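(* Let $p>1$. For each integer $n\ge0$ let $(F^n,\xi^n)$, with decomposition $F^n=F^n_1+F^n_2$, satisfy Assumption (B) of the context with this $p$ and with the data $(\alpha^n,\beta_1,\beta_2,\gamma_1,\gamma_2,\varphi,f)$, where $\beta_1,\beta_2,\gamma_1,\gamma_2,\varphi,f$ do not depend on $n$; and let $(Y^n,Z^n)$ be the unique solution of the BSDE $(F^n,\xi^n)$ in $\mathcal S^p\times\mathcal M^p$. If, as $n\to\infty$, \[ \xi^n-\xi^0\longrightarrow0\quad\text{and}\quad\int_0^T|F^n-F^0|(s,Y^0_s,Z^0_s)\,ds\longrightarrow0\qquad\text{in }\mathbb L^p, \] then $(Y^n,Z^n)$ converges to $(Y^0,Z^0)$ in $\mathcal S^p\times\mathcal M^p$, i.e. $\mathbb E[((Y^n-Y^0)^* )^p]\to0$ and $\mathbb E[(\int_0^T|Z^n_s-Z^0_s|^2ds)^{p/2}]\to0$.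
   Context: Fix $0<T<\infty$ and a $d$-dimensional Brownian motion $W$ on a complete probability space $(\Omega,\mathcal F,\mathbb P)$, with $(\mathcal F_t)_{0\le t\le T}$ the filtration generated by $W$ and augmented by the $\mathbb P$-null sets. $\mathrm{Prog}$ is the progressive $\sigma$-algebra on $\Omega\times[0,T]$. $\operatorname{sgn}(x)=x/|x|$ for $x\ne0$ and $\operatorname{sgn}(0)=0$. A generator is a $\mathrm{Prog}\otimes\mathcal B(\mathbb R)\otimes\mathcal B(\mathbb R^d)$-measurable function $F:\Omega\times[0,T]\times\mathbb R\times\mathbb R^d\to\mathbb R$; a terminal value is an $\mathcal F_T$-measurable real random variable $\xi$. A solution of the BSDE $(F,\xi)$ is a pair $(Y,Z)$ valued in $\mathbb R\times\mathbb R^d$, with $Y$ continuous adapted and $Z$ $\mathrm{Prog}$-measurable, such that $\mathbb P$-a.s. $\int_0^T|Z_s|^2ds<\infty$, $\int_0^T|F(s,Y_s,Z_s)|ds<\infty$ and, for all $t\in[0,T]$, \[Y_t=\xi+\int_t^TF(s,Y_s,Z_s)ds-\int_t^TZ_sdW_s.\] Under Assumption (B) below, the BSDE $(F,\xi)$ has a unique solution in $\mathcal S^p\times\mathcal M^p$ (up to indistinguishability for $Y$ and $dt\otimes d\mathbb P$-a.e. for $Z$). Notation: $Y^*=\sup_{t\in[0,T]}|Y_t|$; for a $\mathrm{Prog}$-measurable real process $H$, $|H|_t=\int_0^tH_udu$. $\mathcal S^p$ ($p\ge1$): continuous adapted processes $Y$ with $Y^*\in\mathbb L^p$. $\mathcal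 M^p$ ($p>0$): $\mathbb R^d$-valued $\mathrm{Prog}$-measurable $Z$ with $\mathbb E[(\int_0^T|Z_s|^2ds)^{p/2}]<\infty$. $\mathcal I$: the set of integrable functions from $\mathbb R$ to $\mathbb R$ that are bounded on every compact subset of $\mathbb R$. $f(|\cdot|)$ denotes the function $x\mapsto f(|x|)$ on $\mathbb R$. Assumption (B) on $(F,\xi)$ with decomposition $F=F_1+F_2$ and data $(\alpha,\beta_1,\beta_2,\gamma_1,\gamma_2,\varphi,f)$, for a given $p>1$: $\beta_1,\beta_2\in\mathbb R$, $\gamma_1,\gamma_2\ge0$, $\alpha$ is an $\mathbb R^+$-valued $\mathrm{Prog}$-measurable process, $\varphi:\mathbb R^+\to\mathbb R^+$ is continuous nondecreasing with $\varphi(0)=0$, $f(|\cdot|)\in\mathcal I$, $F_1,F_2:\Omega\times[0,T]\times\mathbb R\times\mathbb R^d\to\mathbb R$ are $\mathrm{Prog}\otimes\mathcal B(\mathbb R)\otimes\mathcal B(\mathbb R^d)$-measurable with $F=F_1+F_2$, $|\xi|+|\alpha|_T\in\mathbb L^p$ and $\mathbb P$-a.s.: (i) for any $t\in[0,T]$, $(y,z)\mapsto F(t,y,z)$ is continuous; (ii) for any $t\in[0,T]$, $y,y'\in\mathbb R$, $z,z'\in\mathbb R^d$: $\operatorname{sgn}(y-y')\big(F_1(t,y,z)-F_1(t,y',z)\big)\le\beta_1|y-y'|$, $\ |F_1(t,y,z)-F_1(t,y,z')|\le\gamma_1|z-z'|$, and $\operatorname{sgn}(y)F_2(t,y,z)\le\beta_2|y|+\gamma_2|z|+f(|y|)|z|^2$;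 (iii) for any $t\in[0,T]$, $(y,z)\mapsto F_2(t,y,z)$ is convex; (iv) for any $(t,y,z)\in[0,T]\times\mathbb R\times\mathbb R^d$, $|F(t,y,z)|\le\alpha_t+\varphi(|y|)+(\gamma_1+\gamma_2)|z|+f(|y|)|z|^2$. *)

(* Defs.v *)
From mathcomp Require Export all_boot all_order all_algebra.
From mathcomp Require Export all_classical all_reals all_analysis.
Export Order.TTheory GRing.Theory Num.Theory.
Export numFieldNormedType.Exports.

Set Implicit Arguments.
Unset Strict Implicit.
Unset Printing Implicit Defensive.

Local Open Scope classical_set_scope.
Local Open Scope ring_scope.

(* The library norm on matrices is the sup-norm, hence [euclid]. *)
Definition dotp (R : realType) (m : nat) (u v : 'rV[R]_m) : R :=
  \sum_(i < m) u 0 i * v 0 i.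

Definition euclid (R : realType) (m : nat) (z : 'rV[R]_m) : R :=
  Num.sqrt (dotp z z).

Notation borel_rV R m := (g_sigma_algebraType (@open 'rV[R]_m)).

Section Bsde.
Context (R : realType) (d : measure_display) (Omega : measurableType d)
  (P : probability Omega R).
(* Random functions of time take the sample point first, so that [X w] is the
   path of [X]; only times in [0, T] matter. *)
Context (T : R) (m : nat) (W : Omega -> R -> 'rV[R]_m).

Local Notation mu := (@lebesgue_measure R).

(* [natural_gen t] generates sigma(W_s, s <= t), and adding
   the P-null sets yields the augmented Brownian filtration. *)
Definition natural_gen (t : R) : set (set Omega) :=
  [set A | exists s (B : set (borel_rV R m)),
    [/\ 0 <= s <= t, measurable B & A = [set w | B (W w s)]]].

Definition filtration_gen (t : R) : set (set Omega) :=
  natural_gen t `|` P.-negligible.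

Definition filtered (t : R) := g_sigma_algebraType (filtration_gen t).

Record brownian_motion : Prop := BrownianMotion {
  bm_measurable : forall t, 0 <= t <= T ->
    @measurable_fun _ _ Omega (borel_rV R m) setT (fun w => W w t) ;
  bm_start : \forall w \ae P, W w 0 = 0 ;
  bm_continuous : \forall w \ae P, {within `[0, T], continuous (W w)} ;
  bm_independent : forall s t, 0 <= s -> s < t -> t <= T ->
    forall (A : set Omega) (B : set (borel_rV R m)),
      <<s natural_gen s >> A -> measurable B ->
      P (A `&` [set w | B (W w t - W w s)]) =
      (P A * P [set w | B (W w t - W w s)%R])%E ;
  bm_gaussian : forall s t, 0 <= s -> s < t -> t <= T ->
    forall B : 'I_m -> set R, (forall i, measurable (B i)) ->
      P [set w | forall i, B i ((W w t - W w s) 0 i)] =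
      (\prod_(i < m) normal_prob 0 (Num.sqrt (t - s)) (B i))%E }.

(* The trace of this sigma-algebra on Omega x [0, T] is the progressive one. *)
Definition prog_sets : set (set (Omega * R)) :=
  [set A | forall t, 0 <= t <= T ->
    @measurable _ (filtered t * R)%type ((setT `*` `[0, t]) `&` A)].

Lemma sigma_algebra_prog_sets : sigma_algebra setT prog_sets.
Proof.
split=> [t _|A PA t tT|A PA t tT].
- by rewrite setI0; exact: measurable0.
- rewrite setTD (_ : _ `&` _ =
      (setT `*` `[0, t]) `\` ((setT `*` `[0, t]) `&` A)); last first.
    by rewrite setDIr setDv set0U setDE.
  apply: measurableD; last exact: PA.
  by apply: measurableX; [exact: measurableT|exact: measurable_itv].
- by rewrite setI_bigcupr; apply: bigcupT_measurable => k; exact: PA.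
Qed.

Definition prog := g_sigma_algebraType prog_sets.

Definition prog_measurable d' (E : measurableType d') (X : Omega -> R -> E) :=
  @measurable_fun _ _ prog E (setT `*` `[0, T]) (fun x => X x.1 x.2).

Definition continuous_adapted (Y : Omega -> R -> R) :=
  (forall w, {within `[0, T], continuous (Y w)}) /\
  (forall t, 0 <= t <= T ->
    @measurable_fun _ _ (filtered t) R setT (fun w => Y w t)).

Definition sup_path (Y : Omega -> R -> R) (w : Omega) : \bar R :=
  ereal_sup [set `|Y w t|%:E | t in `[0, T]].

Definition energy (Z : Omega -> R -> 'rV[R]_m) (w : Omega) : \bar R :=
  (\int[mu]_(s in `[0%R, T]) (euclid (Z w s) ^+ 2)%:E)%E.

(* E[X^p] for X >= 0; it may be +oo. *)
Definition moment (p : R) (X : Omega -> \bar R) : \bar R :=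
  (\int[P]_w (X w `^ p))%E.

Definition in_Sp (p : R) (Y : Omega -> R -> R) :=
  continuous_adapted Y /\ (moment p (sup_path Y) < +oo)%E.

Definition in_Mp (p : R) (Z : Omega -> R -> 'rV[R]_m) :=
  prog_measurable (Z : Omega -> R -> borel_rV R m) /\
  (moment (p / 2) (energy Z) < +oo)%E.

Definition cvg_in_probability (X : nat -> Omega -> \bar R) :=
  forall e : R, 0 < e ->
    P [set w | (e%:E <= X k w)%E] @[k --> \oo] --> 0%E.

(* The process
   H_s = \sum_(i < el_size) el_coef i * 1_{ el_time i < s <= el_time i.+1}. *)
Record elementary := Elementary {
  el_size : nat ;
  el_time : nat -> R ;
  el_coef : nat -> Omega -> 'rV[R]_m }.

Definition is_elementary (H : elementary) :=
  [/\ el_time H 0 = 0, el_time H (el_size H) = T,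
      (forall i, (i < el_size H)%N -> el_time H i < el_time H i.+1) &
      forall i, (i < el_size H)%N ->
        @measurable_fun _ _ (filtered (el_time H i)) (borel_rV R m) setT
          (el_coef H i) /\
        exists M : R, forall w, euclid (el_coef H i w) <= M].

Definition el_value (H : elementary) (w : Omega) (s : R) : 'rV[R]_m :=
  \sum_(i < el_size H)
    (if el_time H i < s <= el_time H i.+1 then el_coef H i w else 0).

Definition el_integral (H : elementary) (w : Omega) (t : R) : R :=
  \sum_(i < el_size H)
    dotp (el_coef H i w)
      (W w (Num.min t (el_time H i.+1)) - W w (Num.min t (el_time H i))).

(* [J] is (a version of) the Ito integral process of [Z], for progressive [Z]
   with [energy Z] a.s. finite: [J] is the limit, uniformly on [0, T] in
   probability, of the integrals of elementary processes which approximate [Z]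
   in L^2([0, T]) in probability.  This determines [J] up to
   indistinguishability. *)
Definition ito_integral (Z : Omega -> R -> 'rV[R]_m) (J : Omega -> R -> R) :=
  continuous_adapted J /\
  exists H : nat -> elementary,
    [/\ forall k, is_elementary (H k),
        cvg_in_probability
          (fun k => energy (fun w s => el_value (H k) w s - Z w s)) &
        cvg_in_probability
          (fun k => sup_path (fun w t => el_integral (H k) w t - J w t))].

Definition generator_type := Omega -> R -> R -> 'rV[R]_m -> R.

Definition is_generator (F : generator_type) :=
  @measurable_fun _ _ (prog * R * borel_rV R m)%type R
    ((setT `*` `[0, T]) `*` setT `*` setT)
    (fun x => F x.1.1.1 x.1.1.2 x.1.2 x.2).

Definition is_terminal (xi : Omega -> R) :=
  @measurable_fun _ _ (filtered T) R setT xi.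

Definition bsde_solution (F : generator_type) (xi : Omega -> R)
    (Y : Omega -> R -> R) (Z : Omega -> R -> 'rV[R]_m) :=
  [/\ continuous_adapted Y,
      prog_measurable (Z : Omega -> R -> borel_rV R m),
      \forall w \ae P, (energy Z w < +oo)%E,
      \forall w \ae P,
        (\int[mu]_(s in `[0%R, T]) `|F w s (Y w s) (Z w s)|%:E < +oo)%E &
      exists2 J, ito_integral Z J &
        \forall w \ae P, forall t, 0 <= t <= T ->
          Y w t = xi w + \int[mu]_(s in `[t, T]) F w s (Y w s) (Z w s)
                  - (J w T - J w t)].

Definition in_calI (g : R -> R) :=
  mu.-integrable setT (EFin \o g) /\
  forall K : set R, compact K -> [bounded g x | x in K].

(* Half-line functions phi and f are represented by functions on R, of which
   only the values on [0, +oo[ are used. *)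
Record assumption_B (p beta1 beta2 gamma1 gamma2 : R) (phi f : R -> R)
    (alpha : Omega -> R -> R) (F F1 F2 : generator_type) (xi : Omega -> R)
    : Prop := AssumptionB {
  B_gamma1 : 0 <= gamma1 ;
  B_gamma2 : 0 <= gamma2 ;
  B_alpha_prog : prog_measurable alpha ;
  B_alpha_ge0 : forall w t, 0 <= t <= T -> 0 <= alpha w t ;
  B_phi_ge0 : forall x, 0 <= x -> 0 <= phi x ;
  B_phi_continuous : {within `[0, +oo[, continuous phi} ;
  B_phi_nondecreasing : forall x y, 0 <= x -> x <= y -> phi x <= phi y ;
  B_phi0 : phi 0 = 0 ;
  B_f : in_calI (fun x => f `|x|) ;
  B_generator : is_generator F ;
  B_generator1 : is_generator F1 ;
  B_generator2 : is_generator F2 ;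
  B_decomposition : forall w t y z, 0 <= t <= T ->
    F w t y z = F1 w t y z + F2 w t y z ;
  B_terminal : is_terminal xi ;
  B_Lp : (moment p (fun w =>
    `|xi w|%:E + \int[mu]_(s in `[0%R, T]) (alpha w s)%:E) < +oo)%E ;
  B_continuous : \forall w \ae P, forall t, 0 <= t <= T ->
    continuous (fun yz : R * 'rV[R]_m => F w t yz.1 yz.2) ;
  B_monotone : \forall w \ae P, forall t y y' z, 0 <= t <= T ->
    Num.sg (y - y') * (F1 w t y z - F1 w t y' z) <= beta1 * `|y - y'| ;
  B_lipschitz : \forall w \ae P, forall t y z z', 0 <= t <= T ->
    `|F1 w t y z - F1 w t y z'| <= gamma1 * euclid (z - z') ;
  B_onesided : \forall w \ae P, forall t y z, 0 <= t <= T ->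
    Num.sg y * F2 w t y z <=
    beta2 * `|y| + gamma2 * euclid z + f `|y| * euclid z ^+ 2 ;
  B_convex : \forall w \ae P, forall t, 0 <= t <= T ->
    convex_function (E := (R^o * 'rV[R]_m)%type) setT
      (fun yz => F2 w t yz.1 yz.2) ;
  B_growth : \forall w \ae P, forall t y z, 0 <= t <= T ->
    `|F w t y z| <= alpha w t + phi `|y| + (gamma1 + gamma2) * euclid z
                    + f `|y| * euclid z ^+ 2 }.

End Bsde.

(* Main.v *)
(* Let U = Y^n - Y^0, V = Z^n - Z^0, and let G be the time integral of
   g = |F^n - F^0|(Y^0, Z^0).  A convex function of (y, z) with the one-sided
   growth bound imposed on F_2 satisfies the same bound without its quadratic
   term, for differences: F_2 is Lipschitz in z and monotone in y (points far
   away on a ray give the bound, since f is integrable).  Hence the drift h of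
   U satisfies sgn(U) h <= beta |U| + gamma |V| + g.

   Ito's formula for (e^2 + U^2)^(r/2), 1 < r <= 2, then yields, for bounded
   weights measurable at time s, an inequality between its values at s and T in
   which the energy of V appears with a good sign and g with a factor
   |U|^(r - 1).  Doob's maximal inequality with exponent p/r > 1 bounds the
   p-th moment of U^*; the energy is bounded by taking r = p if p <= 2, and by
   Garsia's inequality, with r = 2, if p > 2.  The constants depend neither on n
   nor on e, and the right-hand sides are the moments of xi^n - xi^0 and G.

   Ito's formula is only needed in conditional expectation.  For elementary
   integrands and bounded drift the error over a step of length h is
   O(h^(3/2)), hence vanishes by subdivision; a discount factor
   exp(- lam int (|h| + |V|^2)) makes all terms bounded when passing to the limit
   in the approximation of Z by elementary processes. *)

(* The condition r > 1 makes phi'^2 at most r / (r - 1) phi phi'' for phi(U) = (e^2 + U^2)^(r/2).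
   Hence gamma |V| |phi'(U)| costs half of the energy term and a multiple of phi(U); the weight
   exp(theta t) with theta = 2 beta + gamma^2 r / (r - 1) absorbs that multiple together with the
   term in beta. In the maximal inequality the p-th moment of U^* returns on the right, through the
   product of G and a power of U^* of exponent r - 1. Young's inequality gives it a small
   coefficient, and it may be subtracted because it is finite, both solutions being in S^p. The
   discount works for any path: if K' = - lam (|h| + |V|^2) K and K(0) = 1, then lam int K (|h| +
   |V|^2) <= 1. Errors are thus dominated by constants although h and |V|^2 are merely integrable in
   time. Conditional expectations appear as integrals against bounded weights known at the earlier
   time; Doob's and Garsia's inequalities are summations by parts with such weights. For p > 2 the
   case r = 2 bounds the conditional mean of the energy still to come, which is what Garsia's
   inequality asks for. *)
Require Import Defs.
From mathcomp Require Import ring lra measurable_realfun.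

Set Implicit Arguments.
Unset Strict Implicit.
Unset Printing Implicit Defensive.

Local Open Scope classical_set_scope.
Local Open Scope ring_scope.

(** * Real-valued integrable and measurable functions *)

Section IntegrableReal.
Context d (X : measurableType d) (R : realType) (mu : {measure set X -> \bar R})
  (D : set X) (mD : measurable D).
Implicit Types f g : X -> R.
Local Notation int f := (mu.-integrable D (fun x => (f x)%:E)).

Lemma integrable_measR f : int f -> measurable_fun D f.
Proof. by move=> /measurable_int /measurable_EFinP. Qed.

Lemma integrableDR f g : int f -> int g -> int (fun x => f x + g x).
Proof. by move=> fi gi; exact: integrableD fi gi. Qed.

Lemma integrableNR f : int f -> int (fun x => - f x).
Proof. by move=> fi; exact: integrableN fi. Qed.

Lemma integrableBR f g : int f -> int g -> int (fun x => f x - g x).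
Proof. by move=> fi gi; apply: integrableDR => //; exact: integrableNR. Qed.

Lemma integrableZR k f : int f -> int (fun x => k * f x).
Proof. by move=> fi; exact: integrableZl fi. Qed.

Lemma integrable_leR f g : measurable_fun D f -> (forall x, D x -> `|f x| <= g x) ->
  int g -> int f.
Proof.
move=> mf fg; apply: le_integrable => //; first exact/measurable_EFinP.
by move=> x Dx /=; rewrite lee_fin (le_trans (fg x Dx)) // ler_norm.
Qed.

Lemma integrable_normR f : int f -> int (fun x => `|f x|).
Proof. by move=> fi; exact: integrable_norm fi. Qed.

Lemma integrable_cstR k : (mu D < +oo)%E -> int (fun=> k).
Proof.
move=> muD; apply: measurable_bounded_integrable => //.
by exists `|k|; split => // M kM x _; rewrite /= ltW.
Qed.

Lemma integrable_boundR f M : (mu D < +oo)%E -> measurable_fun D f ->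
  (forall x, D x -> `|f x| <= M) -> int f.
Proof.
by move=> muD mf fM; apply: (integrable_leR mf fM); exact: integrable_cstR.
Qed.

Lemma le_Rintegral_norm f g : int f -> int g -> (forall x, D x -> `|f x| <= g x) ->
  `|\int[mu]_(x in D) f x| <= \int[mu]_(x in D) g x.
Proof.
move=> fi gi fg; rewrite (le_trans (le_normr_Rintegral mD fi)) //.
by apply: le_Rintegral => //; exact: integrable_normR.
Qed.

Lemma integral_EFinR f : int f -> (\int[mu]_(x in D) (f x)%:E)%E = (\int[mu]_(x in D) f x)%:E.
Proof. by move=> fi; rewrite fineK // integrable_fin_num. Qed.

Lemma integrableMbR f g M : int f -> measurable_fun D g ->
  (forall x, D x -> `|g x| <= M) -> int (fun x => g x * f x).
Proof.
move=> fi mg gM; apply: (@integrable_leR _ (fun x => M * `|f x|)).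
- by apply: measurable_funM => //; exact: integrable_measR.
- by move=> x Dx; rewrite normrM ler_wpM2r // gM.
- by apply: integrableZR; exact: integrable_normR.
Qed.

Lemma integrable_sumR (I : finType) (f : I -> X -> R) : (forall i, int (f i)) ->
  int (fun x => \sum_i f i x).
Proof.
move=> fi; rewrite (_ : (fun x => _) = (fun x => (\sum_i (f i x)%:E)%E)).
  by apply: integrable_sum.
by apply/funext => x; rewrite sumEFin.
Qed.

Lemma Rintegral_sumR (I : finType) (f : I -> X -> R) : (forall i, int (f i)) ->
  \int[mu]_(x in D) (\sum_i f i x) = \sum_i \int[mu]_(x in D) f i x.
Proof.
move=> fi; rewrite {1}/Rintegral; under eq_integral do rewrite -sumEFin.
rewrite integral_sum //.
by rewrite (eq_bigr (fun i => (\int[mu]_(x in D) f i x)%:E)) ?sumEFin // => i _; exact: integral_EFinR.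
Qed.

End IntegrableReal.

Section MeasurableFun.
Context d (X : measurableType d) (R : realType) (D : set X).
Implicit Types f g : X -> R.

Lemma measurable_expRf f : measurable_fun D f -> measurable_fun D (fun x => expR (f x)).
Proof. by move=> mf; apply: measurableT_comp. Qed.

Lemma measurable_normf f : measurable_fun D f -> measurable_fun D (fun x => `|f x|).
Proof. by move=> mf; apply: measurableT_comp. Qed.

Lemma measurable_oppf f : measurable_fun D f -> measurable_fun D (fun x => - f x).
Proof. by move=> mf; apply: measurableT_comp. Qed.

Lemma measurable_addf f g : measurable_fun D f -> measurable_fun D g ->
  measurable_fun D (fun x => f x + g x).
Proof. by move=> mf mg; exact: measurable_funD. Qed.

Lemma measurable_mulf f g : measurable_fun D f -> measurable_fun D g ->
  measurable_fun D (fun x => f x * g x).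
Proof. by move=> mf mg; exact: measurable_funM. Qed.

Lemma measurable_exprf f n : measurable_fun D f -> measurable_fun D (fun x => f x ^+ n).
Proof. by move=> mf; exact: measurable_funX. Qed.

Lemma measurable_maxf f g : measurable_fun D f -> measurable_fun D g ->
  measurable_fun D (fun x => Num.max (f x) (g x)).
Proof. by move=> mf mg; exact: measurable_maxr. Qed.

Lemma measurable_minf f g : measurable_fun D f -> measurable_fun D g ->
  measurable_fun D (fun x => Num.min (f x) (g x)).
Proof. by move=> mf mg; exact: measurable_minr. Qed.

Lemma measurable_powRf f p : measurable_fun D f -> measurable_fun D (fun x => f x `^ p).
Proof. by move=> mf; apply: (measurableT_comp (measurable_powR p)). Qed.

Lemma measurable_EFinf f : measurable_fun D f -> measurable_fun D (fun x => (f x)%:E).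
Proof. by move=> /measurable_EFinP. Qed.

End MeasurableFun.

Ltac meas := repeat first
  [ assumption | exact: measurable_id | exact: measurable_cst
  | apply: measurable_addf | apply: measurable_oppf | apply: measurable_mulf
  | apply: measurable_exprf | apply: measurable_expRf | apply: measurable_normf
  | apply: measurable_maxf | apply: measurable_minf | apply: measurable_powRf
  | apply: measurable_EFinf ].

(** * Convex functions with one-sided growth *)

Section Euclid.
Context (R : realType) (m : nat).
Implicit Types (u v w : 'rV[R]_m) (a : R).

Lemma dotpC u v : dotp u v = dotp v u.
Proof. by apply: eq_bigr => i _; rewrite mulrC. Qed.

Lemma dotpDl u v w : dotp (u + v) w = dotp u w + dotp v w.
Proof. by rewrite -big_split; apply: eq_bigr => i _; rewrite !mxE mulrDl. Qed.

Lemma dotpZl a u w : dotp (a *: u) w = a * dotp u w.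
Proof. by rewrite /dotp mulr_sumr; apply: eq_bigr => i _; rewrite !mxE mulrA. Qed.

Lemma dotpNl u w : dotp (- u) w = - dotp u w.
Proof. by rewrite -scaleN1r dotpZl mulN1r. Qed.

Lemma dotpBl u v w : dotp (u - v) w = dotp u w - dotp v w.
Proof. by rewrite dotpDl dotpNl. Qed.

Lemma dotpBr u v w : dotp w (u - v) = dotp w u - dotp w v.
Proof. by rewrite dotpC dotpBl !(dotpC w). Qed.

Lemma dotp0l u : dotp 0 u = 0.
Proof. by rewrite /dotp big1 // => i _; rewrite mxE mul0r. Qed.

Lemma dotp_ge0 u : 0 <= dotp u u.
Proof. by apply: sumr_ge0 => i _; rewrite -expr2 sqr_ge0. Qed.

Lemma euclid_ge0 u : 0 <= euclid u.
Proof. exact: sqrtr_ge0. Qed.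

Lemma sqr_euclid u : euclid u ^+ 2 = dotp u u.
Proof. by rewrite sqr_sqrtr // dotp_ge0. Qed.

Lemma euclid0 : euclid (0 : 'rV[R]_m) = 0.
Proof. by rewrite /euclid dotp0l sqrtr0. Qed.

Lemma euclidZ a u : euclid (a *: u) = `|a| * euclid u.
Proof.
rewrite /euclid dotpZl dotpC dotpZl mulrA -expr2 sqrtrM ?sqr_ge0 //.
by rewrite sqrtr_sqr.
Qed.

Lemma euclidN u : euclid (- u) = euclid u.
Proof. by rewrite -scaleN1r euclidZ normrN1 mul1r. Qed.

Lemma dotp_le u v : dotp u v <= euclid u * euclid v.
Proof.
(* The squared length of [x *: u + v] as a polynomial in [x]. It is evaluated at its minimum if
   [dotp u u] is positive, and otherwise, being affine, at a point where a nonzero slope would give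
   the value -1. *)
have q x : 0 <= dotp u u * x ^+ 2 + 2 * dotp u v * x + dotp v v.
  have := dotp_ge0 (x *: u + v).
  rewrite dotpDl dotpZl (dotpC _ (x *: u + v)) (dotpC v) !dotpDl !dotpZl.
  rewrite (dotpC v u) => h; apply: le_trans h _; rewrite le_eqVlt; apply/orP; left.
  by apply/eqP; ring.
have [u0|u0] := eqVneq (dotp u u) 0.
  have uv0 : dotp u v = 0.
    apply/eqP; apply: contraT => uv0; have := q (- (dotp v v + 1) / (2 * dotp u v)).
    rewrite u0 mul0r add0r (_ : 2 * _ * _ = - (dotp v v + 1)); last by field.
    by move=> h; exfalso; lra.
  by rewrite uv0 mulr_ge0 // euclid_ge0.
have u1 : 0 < dotp u u by rewrite lt_neqAle eq_sym u0 dotp_ge0.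
have h : dotp u v ^+ 2 <= dotp u u * dotp v v.
  have := q (- dotp u v / dotp u u).
  rewrite -(pmulr_rge0 _ u1).
  rewrite (_ : _ * (_ + _) = dotp u u * dotp v v - dotp u v ^+ 2); last by field.
  by rewrite subr_ge0.
have [uv|uv] := leP (dotp u v) 0.
  by rewrite (le_trans uv) // mulr_ge0 ?euclid_ge0.
rewrite -(@ler_pXn2r _ 2) ?nnegrE ?mulr_ge0 ?euclid_ge0 ?(ltW uv) //.
by rewrite exprMn !sqr_euclid.
Qed.

Lemma euclidD u v : euclid (u + v) <= euclid u + euclid v.
Proof.
rewrite -(@ler_pXn2r _ 2) ?nnegrE ?addr_ge0 ?euclid_ge0 // sqr_euclid.
rewrite dotpDl (dotpC u) (dotpC v) !dotpDl sqrrD !sqr_euclid (dotpC v u).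
have := dotp_le u v; rewrite -mulr_natl; lra.
Qed.

Lemma normr_dotp u v : `|dotp u v| <= euclid u * euclid v.
Proof. by rewrite ler_norml dotp_le lerNl -dotpNl -(euclidN u) dotp_le. Qed.

Lemma normr_coord u i : `|u 0 i| <= euclid u.
Proof.
rewrite -(@ler_pXn2r _ 2) ?nnegrE ?euclid_ge0 // sqr_euclid /dotp (bigD1 i) //=.
by rewrite real_normK ?num_real // expr2 lerDl sumr_ge0 // => j _; rewrite -expr2 sqr_ge0.
Qed.

End Euclid.

(** Stands for a passage to the limit as e decreases to 0; [D] may have any sign. *)
Lemma le0_of_small (R : realType) (c D : R) :
  (forall e, 0 < e -> e < 1 -> c <= e * D) -> c <= 0.
Proof.
move=> h; rewrite leNgt; apply/negP => c0.
have h1 : (0 : R) < 1 / 2 by lra.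
have h2 : (1 : R) / 2 < 1 by lra.
have D0 : 0 < D by have := h _ h1 h2; lra.
have k1 : 0 < Num.min (1/2) (c / (2 * D)).
  by rewrite lt_min h1 divr_gt0 // mulr_gt0.
have k2 : Num.min (1/2) (c / (2 * D)) < 1 by rewrite gt_min h2.
have k := h _ k1 k2.
have : Num.min (1/2) (c / (2 * D)) * D <= c / 2.
  rewrite (le_trans (y := c / (2 * D) * D)) //.
    by rewrite ler_pM2r // ge_min lexx orbT.
  by rewrite le_eqVlt; apply/orP; left; apply/eqP; field; lra.
lra.
Qed.

(** Otherwise f(y) >= c / y on [A, +oo[, and the logarithmic divergence of the integral of 1 / y
    contradicts integrability. The point found makes a term of order f(y) |z|^2 negligible when z
    grows like y and the result is divided by y. *)
Lemma integrable_small_tail (R : realType) (f : R -> R) (A c : R) :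
  in_calI (fun x => f `|x|) -> 0 < A -> 0 < c ->
  exists2 y, A <= y & f y * y < c.
Proof.
move=> [/integrableP[mf fI] _] A0 c0.
apply: contrapT => /forall2NP h.
have {}h y : A <= y -> c * y^-1 <= f `|y|.
  move=> Ay; have [//|/negP] := h y; rewrite -leNgt => k.
  have y0 : 0 < y by lra.
  by rewrite ger0_norm ?(ltW y0) // ler_pdivrMr.
set I := (\int[_]_(x in _) _)%E in fI.
have key B : A < B -> ((c * ln B - c * ln A)%:E <= I)%E.
  move=> AB; have B0 : 0 < B by lra.
  have p1 : {within `[A, B], continuous (fun x : R => c * x^-1)}.
    apply: continuous_in_subspaceT => x; rewrite inE /= in_itv /= => /andP[Ax _].
    apply: cvgM; first exact: cvg_cst.
    by apply: cvgV => //; rewrite gt_eqF //; lra.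
  have dl (x : R) : 0 < x -> is_derive x 1 (fun x => c * ln x) (c * x^-1).
    by move=> x0; have := is_derive1_ln x0 => d; apply: is_deriveZ.
  have -> : (c * ln B - c * ln A)%:E = (\int[lebesgue_measure]_(x in `[A, B]) (c * x^-1)%:E)%E.
    rewrite (continuous_FTC2 AB p1 (F := fun x => c * ln x)) //.
    - split.
      + by move=> x; rewrite in_itv /= => /andP[Ax _]; have [] := dl x (lt_trans A0 Ax).
      + have [/derivable1_diffP/differentiable_continuous dA _] := dl A A0.
        exact: cvg_at_right_filter.
      + have [/derivable1_diffP/differentiable_continuous dB _] := dl B B0.
        exact: cvg_at_left_filter.
    - move=> x; rewrite in_itv /= => /andP[Ax _].
      by rewrite derive1E; have [_ ->] := dl x (lt_trans A0 Ax).
  rewrite /I; apply: (@le_trans _ _ (\int[lebesgue_measure]_(x in `[A, B]) `|(f `|x|)%:E|)%E).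
    apply: ge0_le_integral => //=.
    - move=> x; rewrite in_itv /= => /andP[Ax _]; rewrite lee_fin mulr_ge0 ?invr_ge0 //; lra.
    - apply/measurable_EFinP; apply: subspace_continuous_measurable_fun => //.
    - apply/measurable_EFinP; apply: measurableT_comp => //.
      by apply: measurable_funTS; apply/measurable_EFinP.
    - move=> x; rewrite in_itv /= => /andP[Ax _]; rewrite lee_fin.
      by rewrite (le_trans (h x Ax)) ?ler_norm.
  apply: ge0_subset_integral => //=; apply/measurable_EFinP.
  by apply: measurableT_comp => //; exact/measurable_EFinP.
have I0 : (0 <= I)%E by apply: integral_ge0 => x _; exact: abse_ge0.
pose r := fine I.
have rI : I = r%:E by rewrite fineK // ge0_fin_numE.
have r0 : 0 <= r by rewrite fine_ge0.
(* With this right end, c (ln B - ln A) equals r + c, which exceeds the value r of the integral. *)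
have AB : A < A * expR (r / c + 1).
  rewrite -[ltLHS]mulr1 ltr_pM2l // -expR0 ltr_expR.
  by rewrite ltr_wpDl // divr_ge0 // ltW.
have := key _ AB; rewrite rI lee_fin lnM ?posrE ?expR_gt0 // expRK.
rewrite (_ : _ - _ = r + c); first lra.
by field; lra.
Qed.

(* A convex F with F(0, 0) <= 0 growing at most like [b y + g |z| + o(1 / y) |z|^2]
   along some y -> +oo has no quadratic growth at all: every point of the
   half-space y > 0 lies on a segment from the origin to a far point. *)
Lemma convex_onesided (R : realType) (m : nat) (F : R -> 'rV[R]_m -> R)
    (f : R -> R) (b g : R) :
  0 <= g ->
  convex_function (E := (R^o * 'rV[R]_m)%type) setT (fun yz => F yz.1 yz.2) ->
  in_calI (fun x => f `|x|) ->
  (forall y z, Num.sg y * F y z <=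
     b * `|y| + g * euclid z + f `|y| * euclid z ^+ 2) ->
  (forall y y' z, y' < y -> F y z - F y' z <= b * (y - y')) /\
  (forall y z z', F y z - F y z' <= g * euclid (z - z')).
Proof.
move=> g0 Fc fI F1.
have cvx t y y' z z' : 0 <= t -> t <= 1 ->
    F ((1 - t) * y + t * y') ((1 - t) *: z + t *: z') <=
    (1 - t) * F y z + t * F y' z'.
  move=> t0 t1.
  have ti : 0 <= 1 - t <= 1 by apply/andP; split; lra.
  pose t' : {i01 R} := Itv01 (proj1 (andP ti)) (proj2 (andP ti)).
  have := Fc t' (y, z) (y', z') (in_setT _) (in_setT _).
  rewrite convRE /= /unstable.onem.
  rewrite (_ : 1 - (1 - t) = t); last by ring.
  by [].
have Fp y z : 0 < y -> F y z <= b * y + g * euclid z + f y * euclid z ^+ 2.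
  by move=> y0; have := F1 y z; rewrite gtr0_sg // mul1r gtr0_norm.
(* The origin lies between (-1, 0) and (h, 0) with weight h / (1 + h) on the former, so the value at
   -1, on which there is no bound from above, enters with a factor h only. *)
have F00 : F 0 0 <= 0.
  apply: (@le0_of_small _ _ (F (-1) 0 + b - F 0 0)) => h h0 h1.
  have h0' : 0 <= (1 + h)^-1 by rewrite invr_ge0; lra.
  have h1' : (1 + h)^-1 <= 1 by rewrite invf_le1; lra.
  have := cvx _ (-1) h 0 0 h0' h1'.
  rewrite !scaler0 addr0 (_ : _ * -1 + _ = 0); last by field; lra.
  have := Fp h 0 h0; rewrite euclid0 mulr0 expr0n /= mulr0 !addr0 => k1 k2.
  have : F 0 0 * (1 + h) <= h * F (-1) 0 + F h 0.
    have h2 : 0 < 1 + h by lra.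
    rewrite -ler_pdivlMr //; apply: le_trans k2 _.
    rewrite le_eqVlt; apply/orP; left; apply/eqP; field; lra.
  move=> k3; lra.
(* The far point is (Y, (Y / y) z). Multiplied by the weight y / Y, its quadratic term becomes f(Y)
   Y |z|^2 / y, which the choice of Y makes small, while the other two terms are homogeneous of
   degree 1. *)
have lin y z : 0 < y -> F y z <= b * y + g * euclid z.
  move=> y0; rewrite -subr_le0; apply: (@le0_of_small _ _ (euclid z ^+ 2 / y)) => e e0 e1.
  have [Y yY fY] := integrable_small_tail fI y0 e0.
  have Y0 : 0 < Y by lra.
  have t0 : 0 <= y / Y by rewrite divr_ge0 // ltW.
  have t1 : y / Y <= 1 by rewrite ler_pdivrMr // mul1r.
  have := cvx _ 0 Y 0 ((Y / y) *: z) t0 t1.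
  rewrite mulr0 scaler0 !add0r scalerA.
  rewrite (_ : y / Y * Y = y); last by field; lra.
  rewrite (_ : y / Y * (Y / y) = 1) ?scale1r; last by field; lra.
  have := Fp Y ((Y / y) *: z) Y0; rewrite euclidZ.
  rewrite (ger0_norm (divr_ge0 (ltW Y0) (ltW y0))) => k1 k2.
  have k3 : (1 - y / Y) * F 0 0 <= 0 by rewrite mulr_ge0_le0 // subr_ge0.
  have k4 := ler_wpM2l t0 k1.
  have k5 : y / Y * (b * Y + g * (Y / y * euclid z) + f Y * (Y / y * euclid z) ^+ 2) =
            b * y + g * euclid z + (f Y * Y) * (euclid z ^+ 2 / y) by field; lra.
  have k6 : (f Y * Y) * (euclid z ^+ 2 / y) <= e * (euclid z ^+ 2 / y).
    by rewrite ler_wpM2r ?divr_ge0 ?sqr_ge0 ?ltW.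
  lra.
split.
  move=> y y' z yy'; rewrite -subr_le0.
  pose D := `|F y' z| + `|b * y'| + `|g * euclid z| .
  (* The point (y, z) sits at parameter k on the segment from (y', z) to (y' + (y - y') / k, z). For
     k <= e1 the far end has a positive first coordinate, so that [lin] applies to it. *)
  pose e1 := (y - y') / (`|y'| + 1 + (y - y')).
  have d0 : 0 < `|y'| + 1 + (y - y') by have := normr_ge0 y'; lra.
  have e10 : 0 < e1 by rewrite divr_gt0 //; lra.
  apply: (@le0_of_small _ _ D) => e e0 e2.
  pose k := e * e1.
  have k0 : 0 < k by rewrite mulr_gt0.
  have e11 : e1 <= 1 by rewrite ler_pdivrMr // mul1r; have := normr_ge0 y'; lra.
  have ke : k <= e by rewrite /k -[leRHS]mulr1 ler_wpM2l // ltW.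
  have ke1 : k <= e1 by rewrite /k -[leRHS]mul1r ler_wpM2r // ltW.
  have k1 : k <= 1 by lra.
  have := cvx k y' (y' + (y - y') / k) z z (ltW k0) k1.
  rewrite -scalerDl (_ : 1 - k + k = 1) ?scale1r; last by ring.
  rewrite (_ : (1 - k) * y' + k * _ = y); last by field; lra.
  have pos : 0 < y' + (y - y') / k.
    have : (y - y') / e1 <= (y - y') / k.
      by rewrite ler_wpM2l ?subr_ge0 ?(ltW yy') // lef_pV2 ?posrE.
    have -> : (y - y') / e1 = `|y'| + 1 + (y - y') by rewrite /e1; field; apply/andP; split; lra.
    have := ler_norm (- y'); rewrite normrN; lra.
  have := lin _ z pos => h1 h2.
  have h3 := ler_wpM2l (ltW k0) h1.
  have h4 : k * (b * (y' + (y - y') / k) + g * euclid z) =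
    k * (b * y') + b * (y - y') + k * (g * euclid z) by field; lra.
  have h5 : k * (b * y') <= k * `|b * y'| by rewrite ler_wpM2l ?ler_norm // ltW.
  have h6 : k * (g * euclid z) <= k * `|g * euclid z| by rewrite ler_wpM2l ?ler_norm // ltW.
  have h7 : k * - F y' z <= k * `|F y' z|.
    by rewrite ler_wpM2l ?(ltW k0) // -normrN ler_norm.
  have h8 : k * D <= e * D by rewrite ler_wpM2r // !addr_ge0.
  rewrite /D in h8 *; lra.
move=> y z z'; rewrite -subr_le0.
pose D := `|F (2 * y - 1) z| + `|F y z| + `|F y z'| + `|b| + `|g * euclid z'|.
apply: (@le0_of_small _ _ D) => k k0 k1.
have k2 : 0 <= k <= 1 by apply/andP; split; lra.
(* The segment from (y, z') to a far point over 1 passes through z at the first coordinate (1 - k) y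
   + k. A second combination, with (2 y - 1, z) and weights k / (1 + k), 1 / (1 + k), brings this
   coordinate back to y. *)
have := cvx k y 1 z' (z' + k^-1 *: (z - z')) (ltW k0) (ltW k1).
rewrite scalerDr scalerA divff ?scale1r; last by rewrite gt_eqF.
rewrite addrA -scalerDl (_ : 1 - k + k = 1) ?scale1r; last by ring.
rewrite addrC subrK.
have c0 : 0 <= (1 + k)^-1 by rewrite invr_ge0; lra.
have c1 : (1 + k)^-1 <= 1 by rewrite invf_le1; lra.
have := cvx _ (2 * y - 1) ((1 - k) * y + k * 1) z z c0 c1.
rewrite -scalerDl subrK scale1r (_ : (1 - _) * _ + _ = y); last by field; lra.
move=> h1 h2.
have h1' : (1 + k) * F y z <= k * F (2 * y - 1) z + F ((1 - k) * y + k * 1) z.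
  have h3 : 0 < 1 + k by lra.
  rewrite mulrC -ler_pdivlMr //; apply: le_trans h1 _.
  rewrite le_eqVlt; apply/orP; left; apply/eqP; field; lra.
have h3 := lin 1 (z' + k^-1 *: (z - z')) ltr01.
have h4 := ler_wpM2l (ltW k0) h3.
have h5 : k * (b * 1 + g * euclid (z' + k^-1 *: (z - z'))) <=
    k * b + k * (g * euclid z') + g * euclid (z - z').
  have h6 : euclid (z' + k^-1 *: (z - z')) <= euclid z' + k^-1 * euclid (z - z').
    by rewrite (le_trans (euclidD _ _)) // euclidZ ger0_norm // invr_ge0 ltW.
  have h7 := ler_wpM2l g0 h6.
  have -> : k * b + k * (g * euclid z') + g * euclid (z - z') =
    k * (b * 1 + g * (euclid z' + k^-1 * euclid (z - z'))) by field; lra.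
  by rewrite ler_wpM2l ?(ltW k0) // lerD2l.
have h8 : k * F (2 * y - 1) z <= k * `|F (2 * y - 1) z|.
  by rewrite ler_wpM2l ?ler_norm // ltW.
have h9 : k * - F y z <= k * `|F y z|.
  by rewrite ler_wpM2l ?(ltW k0) // -normrN ler_norm.
have h10 : k * - F y z' <= k * `|F y z'|.
  by rewrite ler_wpM2l ?(ltW k0) // -normrN ler_norm.
have h11 : k * b <= k * `|b| by rewrite ler_wpM2l ?ler_norm // ltW.
have h12 : k * (g * euclid z') <= k * `|g * euclid z'| by rewrite ler_wpM2l ?ler_norm // ltW.
rewrite /D; lra.
Qed.

(** * Gaussian moments and independence *)

Import HBNNSimple.

(** The usual ascent from indicators through simple functions to monotone limits. It turns
    expectations under a Gaussian law into Lebesgue integrals. *)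
Lemma integral_density d (X : measurableType d) (R : realType)
    (mu nu : {measure set X -> \bar R}) (g : X -> R) :
  measurable_fun setT g -> (forall x, 0 <= g x) ->
  (forall A, measurable A -> nu A = \int[mu]_(x in A) (g x)%:E)%E ->
  forall f : X -> \bar R, measurable_fun setT f -> (forall x, 0 <= f x)%E ->
  (\int[nu]_x f x = \int[mu]_x (f x * (g x)%:E))%E.
Proof.
move=> /measurable_EFinP mg g0 nuE f mf f0.
have ind E : measurable E ->
    (\int[nu]_x (\1_E x)%:E = \int[mu]_x ((\1_E x)%:E * (g x)%:E))%E.
  move=> mE; rewrite integral_indic // setIT nuE // integral_mkcond.
  apply: eq_integral => x _; rewrite patchE indicE.
  by case: ifPn => _; rewrite ?mul1e ?mul0e.
have simp (h : {nnsfun X >-> R}) :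
    (\int[nu]_x (h x)%:E = \int[mu]_x ((h x)%:E * (g x)%:E))%E.
  under [LHS]eq_integral do rewrite fimfunE -fsumEFin//.
  rewrite [LHS]ge0_integral_fsum//; last 2 first.
    - by move=> r; exact/measurable_EFinP/measurableT_comp.
    - by move=> n x _; rewrite EFinM nnfun_muleindic_ge0.
  under [RHS]eq_integral.
    move=> x xD; rewrite fimfunE -fsumEFin// ge0_mule_fsuml; last first.
      by move=> r; rewrite EFinM nnfun_muleindic_ge0.
    over.
  rewrite [RHS]ge0_integral_fsum//; last 2 first.
    - move=> r; apply: emeasurable_funM => //.
      by apply/measurable_EFinP; apply/measurableT_comp.
    - move=> n x _; apply: mule_ge0; last by rewrite lee_fin.
      by rewrite EFinM nnfun_muleindic_ge0.
  apply: eq_fsbigr => r _.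
  rewrite integralZl_indic_nnsfun//= ind//.
  have [r0|r0] := ltP r 0%R.
    have e0 : h @^-1` [set r] = set0.
      by rewrite preimage_nnfun0.
    rewrite e0 indic0 !integral0_eq ?mule0 //.
      by move=> x _; rewrite mulr0 mul0e.
    by move=> x _; rewrite mul0e.
  rewrite -ge0_integralZl//.
  - by apply: eq_integral => x _; rewrite EFinM muleA.
  - by apply: emeasurable_funM => //; exact/measurable_EFinP.
  - by move=> x _; rewrite mule_ge0 // lee_fin.
pose f_ := nnsfun_approx measurableT mf.
have mf_ n : measurable_fun setT (fun x => (f_ n x)%:E) by exact/measurable_EFinP.
transitivity (lim (\int[nu]_x (f_ n x)%:E @[n --> \oo])%E).
  rewrite -monotone_convergence//=.
  - apply: eq_integral => ? /[!inE] xD; apply/esym/cvg_lim => //=.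
    exact: cvg_nnsfun_approx.
  - by move=> n ? _; rewrite lee_fin.
  - by move=> ? _ ? ? mn; rewrite lee_fin; exact/lefP/nd_nnsfun_approx.
rewrite [RHS](_ : _ = lim (\int[mu]_x ((f_ n x)%:E * (g x)%:E) @[n --> \oo])%E); last first.
  rewrite -monotone_convergence//=.
  - apply: eq_integral => x _; apply/esym/cvg_lim => //.
    have c : (f_ n x)%:E @[n --> \oo] --> f x by apply: cvg_nnsfun_approx.
    exact: cvgeZr.
  - by move=> n; apply: emeasurable_funM.
  - by move=> n ? _; rewrite mule_ge0 ?lee_fin.
  - by move=> ? _ ? ? ?; apply: lee_wpmul2r; rewrite lee_fin ?g0 //; exact/lefP/nd_nnsfun_approx.
by apply: congr_lim; apply/funext => n /=; exact: simp.
Qed.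

(** The mean value theorem without an order between x and y, which spares the Taylor estimates a
    case distinction. *)
Lemma mvt_abs (R : realType) (f f' : R -> R) (x y : R) :
  (forall x : R, is_derive x 1 f (f' x)) ->
  exists2 c, `|c - x| <= `|y - x| & f y - f x = f' c * (y - x).
Proof.
move=> df.
have cf a b : {within `[a, b], continuous f}.
  apply: continuous_in_subspaceT => z _; have [d _] := df z.
  by apply: differentiable_continuous; apply/derivable1_diffP.
have [xy|yx] := leP x y.
  have [c] := MVT_segment xy (fun x _ => df x) (cf _ _).
  rewrite in_itv /= => /andP[xc cy] ->; exists c => //.
  by rewrite !ger0_norm ?subr_ge0 //; lra.
have [c] := MVT_segment (ltW yx) (fun x _ => df x) (cf _ _).
rewrite in_itv /= => /andP[yc cx] e; exists c.
  by rewrite !ler0_norm ?subr_le0 //; lra.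
by rewrite -[LHS]opprB e -mulrN opprB.
Qed.

Lemma expR_taylor0 (R : realType) (z : R) : `|expR z - 1| <= `|z| * expR `|z|.
Proof.
have [c] := mvt_abs 0 z (@is_derive_expR R); rewrite !subr0 expR0 => cz ->.
rewrite normrM mulrC ler_wpM2l // ger0_norm ?expR_ge0 // ler_expR.
by rewrite (le_trans (ler_norm _)).
Qed.

Lemma expR_taylor1 (R : realType) (z : R) :
  `|expR z - 1 - z| <= `|z| ^+ 2 * expR `|z|.
Proof.
have d (x : R) : is_derive x 1 (fun x : R => expR x - 1 - x) (expR x - 1).
  by apply: is_derive_eq; rewrite subr0.
have [c] := mvt_abs 0 z d; rewrite !subr0 expR0 subrr subr0 => cz ->.
rewrite normrM mulrC expr2 -mulrA ler_wpM2l // (le_trans (expR_taylor0 c)) //.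
by rewrite ler_pM ?expR_ge0 // ler_expR.
Qed.

Lemma expR_taylor2 (R : realType) (y : R) :
  `|expR y - 1 - y - y ^+ 2 / 2| <= `|y| ^+ 3 * expR `|y|.
Proof.
have d (x : R) : is_derive x 1 (fun x : R => expR x - 1 - x - x ^+ 2 / 2) (expR x - 1 - x).
  by apply: is_derive_eq; rewrite /GRing.scale /= ?expr1; field.
have [c] := mvt_abs 0 y d; rewrite expR0 expr0n /= mul0r !subr0 subrr subr0 => cz ->.
rewrite normrM mulrC exprS -mulrA ler_wpM2l // (le_trans (expR_taylor1 c)) //.
by rewrite ler_pM ?expR_ge0 ?ler_expR // ?exprn_ge0 // ler_pXn2r ?nnegrE.
Qed.

Lemma expRn_ge (R : realType) (n : nat) (x : R) :
  `|x| ^+ n <= n`!%:R * (expR x + expR (- x)).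
Proof.
have h (y : R) : 0 <= y -> y ^+ n <= n`!%:R * expR y.
  move=> y0; case: n => [|n]; first by rewrite expr0 fact0 mul1r -expR0 ler_expR.
  rewrite mulrC -ler_pdivrMr ?ltr0n ?fact_gt0 // (le_trans _ (expR_ge1Dxn n y0)) //.
  by rewrite lerDr.
have n0 : 0 <= n`!%:R :> R by [].
have [x0|x0] := leP 0 x.
  by rewrite ger0_norm // (le_trans (h _ x0)) // ler_wpM2l // lerDl expR_ge0.
by rewrite ltr0_norm // (le_trans (h _ _)) ?oppr_ge0 ?(ltW x0) // ler_wpM2l // lerDr expR_ge0.
Qed.

Section NormalMoments.
Context (R : realType) (s : R).
Hypothesis s0 : s != 0.
Local Notation N := (normal_prob 0 s).

(** Completing the square turns exp(t x) times the centred density into the density of mean t s^2,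
    up to the constant factor exp(t^2 s^2 / 2). *)
Lemma normal_mgf t :
  (\int[N]_x (expR (t * x))%:E = (expR (t ^+ 2 * s ^+ 2 / 2))%:E)%E.
Proof.
rewrite (@integral_density _ _ _ lebesgue_measure N (normal_pdf 0 s)) //; last 3 first.
- exact: measurable_normal_pdf.
- by move=> x; exact: normal_pdf_ge0.
- apply/measurable_EFinP; apply: measurableT_comp => //; exact: measurable_funM.
transitivity (\int[lebesgue_measure]_x ((expR (t ^+ 2 * s ^+ 2 / 2))%:E * (normal_pdf (t * s ^+ 2) s x)%:E))%E.
  apply: eq_integral => x _; rewrite -!EFinM; congr EFin.
  rewrite /normal_pdf (negbTE s0) /normal_fun !(mulrCA _ (normal_peak s)).
  congr (_ * _); rewrite -!expRD; congr expR; field.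
  by rewrite s0.
rewrite ge0_integralZl_EFin //.
- by rewrite integral_normal_pdf mule1.
- by move=> x _; rewrite lee_fin normal_pdf_ge0.
- by apply/measurable_EFinP; exact: measurable_normal_pdf.
Qed.

Lemma normal_integrable (f : R -> R) (C b : R) : measurable_fun setT f ->
  (forall x, `|f x| <= C * (expR (b * x) + expR (- b * x))) ->
  N.-integrable setT (EFin \o f).
Proof.
have i t : N.-integrable setT (fun x => (expR (t * x))%:E).
  apply/integrableP; split; first by apply/measurable_EFinP; meas.
  by under eq_integral do rewrite gee0_abs ?lee_fin ?expR_ge0 //; rewrite normal_mgf ltry.
move=> mf fb; apply: (@integrable_leR _ _ _ N setT measurableT f (fun x => C * (expR (b * x) + expR (- b * x)))) => //.
by apply: integrableZR => //; apply: integrableDR.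
Qed.

Lemma normal_integrable_exprn n : N.-integrable setT (fun x => (x ^+ n)%:E).
Proof.
apply: (@normal_integrable (fun x => x ^+ n) n`!%:R 1); first by meas.
by move=> x; rewrite normrX mul1r mulN1r expRn_ge.
Qed.

(** From x^4 <= 24 s^4 (exp(x / s) + exp(- x / s)), both exponentials having expectation exp(1/2).
    The constant is far from the exact value 3; only the order s^4 matters below. *)
Lemma normal_moment4 : \int[N]_x (x ^+ 4) <= 48 * expR 1 * s ^+ 4.
Proof.
have ie t : N.-integrable setT (EFin \o (fun x => expR (t * x))).
  apply: (@normal_integrable _ 1 t); first by meas.
  by move=> x; rewrite ger0_norm ?expR_ge0 // mul1r lerDl expR_ge0.
have h x : x ^+ 4 <= 24 * s ^+ 4 * (expR (s^-1 * x) + expR (- s^-1 * x)).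
  have := expRn_ge 4 (s^-1 * x); rewrite -normrX ger0_norm ?exprn_even_ge0 //.
  have s4 : 0 < s ^+ 4 by rewrite exprn_even_gt0.
  move=> h; rewrite (_ : x ^+ 4 = s ^+ 4 * (s^-1 * x) ^+ 4); last by field.
  rewrite (_ : 24 * _ * _ = s ^+ 4 * (4`!%:R * (expR (s^-1 * x) + expR (- (s^-1 * x))))).
    by rewrite ler_pM2l.
  by rewrite (_ : 4`!%:R = 24) // mulNr; ring.
apply: (@le_trans _ _ (\int[N]_x (24 * s ^+ 4 * (expR (s^-1 * x) + expR (- s^-1 * x))))).
  apply: le_Rintegral => //; first exact: normal_integrable_exprn.
  by apply: integrableZR => //; apply: integrableDR => //; exact: ie.
have e t : \int[N]_x expR (t * x) = expR (t ^+ 2 * s ^+ 2 / 2) by rewrite /Rintegral normal_mgf.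
rewrite RintegralZl //; last by apply: integrableDR => //; exact: ie.
rewrite RintegralD ?e //; try exact: ie.
rewrite sqrrN -exprMn mulVf // expr1n.
have : expR (1 / 2) <= expR 1 :> R by rewrite ler_expR; lra.
have s4 : 0 <= s ^+ 4 by rewrite exprn_even_ge0.
nra.
Qed.

(** Both moments are read off [normal_mgf]: the two sides are expanded at t = 0 with a remainder
    O(|t|^3), and the coefficients of t and t^2 are compared. *)
Lemma normal_mean_var : \int[N]_x x = 0 /\ \int[N]_x (x ^+ 2) = s ^+ 2.
Proof.
set a := \int[N]_x x; set v := \int[N]_x (x ^+ 2).
have ie t : N.-integrable setT (EFin \o (fun x => expR (t * x))).
  apply: (@normal_integrable _ 1 t); first by meas.
  by move=> x; rewrite ger0_norm ?expR_ge0 // mul1r lerDl expR_ge0.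
have i1 : N.-integrable setT (EFin \o (fun x : R => x)).
  exact: (normal_integrable_exprn 1).
have i0 : N.-integrable setT (EFin \o (fun x : R => 1)).
  exact: (normal_integrable_exprn 0).
have i2 : N.-integrable setT (EFin \o (fun x : R => x ^+ 2)).
  exact: (normal_integrable_exprn 2).
(* Dominates the third-order remainder of exp(t x) divided by |t|^3, simultaneously for all |t| <=
   1. *)
pose g (x : R) := `|x| ^+ 3 * expR `|x|.
have ig : N.-integrable setT (EFin \o g).
  apply: (@normal_integrable _ 12 2); first by rewrite /g; meas.
  move=> x; rewrite ger0_norm ?mulr_ge0 ?expR_ge0 ?exprn_ge0 //.
  have : g x <= 12 * expR (2 * `|x|).
    rewrite /g (_ : 2 * `|x| = `|x| + `|x|) ?expRD ?mulrA; last by ring.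
    rewrite ler_wpM2r ?expR_ge0 //.
    have := expRn_ge 3 `|x|; rewrite normr_id (_ : 3`!%:R = 6) // => h.
    have : expR (- `|x|) <= expR `|x| by rewrite ler_expR; have := normr_ge0 x; lra.
    lra.
  have [x0|x0] := leP 0 x.
    rewrite ger0_norm // => h; rewrite (le_trans h) // ler_wpM2l // lerDl expR_ge0 //.
  rewrite ltr0_norm // mulrN mulNr => h; rewrite (le_trans h) // ler_wpM2l // lerDr expR_ge0 //.
set c := \int[N]_x g x.
have c0 : 0 <= c by apply: Rintegral_ge0 => x _; rewrite mulr_ge0 ?expR_ge0 ?exprn_ge0.
have e t : \int[N]_x expR (t * x) = expR (t ^+ 2 * s ^+ 2 / 2) by rewrite /Rintegral normal_mgf.
have key t : `|t| <= 1 ->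
    `|expR (t ^+ 2 * s ^+ 2 / 2) - 1 - t * a - t ^+ 2 / 2 * v| <= `|t| ^+ 3 * c.
  move=> t1.
  have j1 : N.-integrable setT (EFin \o (fun x : R => expR (t * x) - 1)).
    by apply: integrableBR => //; exact: ie.
  have j2 : N.-integrable setT (EFin \o (fun x : R => t * x)) by apply: integrableZR.
  have j3 : N.-integrable setT (EFin \o (fun x : R => expR (t * x) - 1 - t * x)).
    by apply: integrableBR.
  have j4 : N.-integrable setT (EFin \o (fun x : R => t ^+ 2 / 2 * x ^+ 2)).
    by apply: integrableZR.
  have -> : expR (t ^+ 2 * s ^+ 2 / 2) - 1 - t * a - t ^+ 2 / 2 * v =
    \int[N]_x (expR (t * x) - 1 - t * x - t ^+ 2 / 2 * x ^+ 2).
    have j0 := ie t; rewrite RintegralB // RintegralB // RintegralB ?e //.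
    rewrite RintegralZl // RintegralZl // Rintegral_cst //.
    have -> : fine (N setT) = 1 by rewrite probability_setT.
    by rewrite mulr1.
  rewrite /c -RintegralZl //; apply: le_Rintegral_norm => //.
  - by apply: integrableBR.
  - by apply: integrableZR.
  - move=> x _; have := expR_taylor2 (t * x).
    rewrite (_ : (t * x) ^+ 2 / 2 = t ^+ 2 / 2 * x ^+ 2); last by ring.
    move=> /le_trans; apply; rewrite normrM exprMn -mulrA /g ler_wpM2l ?exprn_ge0 //.
    by rewrite ler_wpM2l ?exprn_ge0 // ler_expR ler_piMl.
pose c' := c + s ^+ 4 / 4 * expR (s ^+ 2 / 2).
have s2 : 0 <= s ^+ 2 by rewrite sqr_ge0.
have key2 t : `|t| <= 1 -> `|t * a + t ^+ 2 / 2 * (v - s ^+ 2)| <= `|t| ^+ 3 * c'.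
  move=> t1; have k1 := key t t1.
  have := expR_taylor1 (t ^+ 2 * s ^+ 2 / 2).
  have t2 : t ^+ 2 <= 1 by rewrite -real_normK ?num_real // exprn_ile1.
  have p0 : 0 <= t ^+ 2 * s ^+ 2 / 2 by rewrite divr_ge0 // mulr_ge0 // sqr_ge0.
  rewrite (ger0_norm p0) => k2.
  have k3 : (t ^+ 2 * s ^+ 2 / 2) ^+ 2 * expR (t ^+ 2 * s ^+ 2 / 2) <=
      `|t| ^+ 3 * (s ^+ 4 / 4 * expR (s ^+ 2 / 2)).
    rewrite (_ : (_ / 2) ^+ 2 = t ^+ 4 * (s ^+ 4 / 4)); last by field.
    have t4 : 0 <= t ^+ 4 by rewrite exprn_even_ge0.
    have s4 : 0 <= s ^+ 4 / 4 by rewrite divr_ge0 // exprn_even_ge0.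
    have t3 : t ^+ 4 <= `|t| ^+ 3.
      rewrite -(ger0_norm t4) normrX exprS ler_piMl ?exprn_ge0 //.
    have e0 : expR (t ^+ 2 * s ^+ 2 / 2) <= expR (s ^+ 2 / 2) by rewrite ler_expR; nra.
    rewrite -mulrA; apply: ler_pM => //; first by rewrite mulr_ge0 ?expR_ge0.
    by rewrite ler_wpM2l.
  have k4 := le_trans k2 k3.
  rewrite /c' [leRHS]mulrDr.
  apply: le_trans (lerD k1 k4).
  rewrite -[leLHS]normrN; apply: le_trans (ler_normB _ _).
  by rewrite le_eqVlt; apply/orP; left; apply/eqP; congr `|_|; field.
have c'0 : 0 <= c' by rewrite addr_ge0 // mulr_ge0 ?expR_ge0 // divr_ge0 // exprn_even_ge0.
have a0 : a = 0.
  apply/eqP; rewrite -normr_le0; apply: (@le0_of_small _ _ (`|v - s ^+ 2| + c')) => t t0 t1.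
  have t01 : `|t| <= 1 by rewrite gtr0_norm // ltW.
  have := key2 t t01; rewrite (gtr0_norm t0) => k.
  rewrite -(ler_pM2l t0) -{1}(gtr0_norm t0) -normrM.
  have -> : t * a = (t * a + t ^+ 2 / 2 * (v - s ^+ 2)) - t ^+ 2 / 2 * (v - s ^+ 2) by ring.
  rewrite (le_trans (ler_normB _ _)) //; rewrite normrM ger0_norm ?divr_ge0 ?sqr_ge0 //.
  have : 0 <= t * t * (`|v - s ^+ 2|) by rewrite !mulr_ge0 // ltW.
  have : t ^+ 3 * c' <= t * t * c' by rewrite ler_wpM2r // exprS expr2; have := ltW t0; nra.
  lra.
split=> //; apply/eqP; rewrite -subr_eq0 -normr_le0.
apply: (@le0_of_small _ _ (2 * c')) => t t0 t1.
have t01 : `|t| <= 1 by rewrite gtr0_norm // ltW.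
have := key2 t t01; rewrite a0 mulr0 add0r (gtr0_norm t0) normrM ger0_norm ?divr_ge0 ?sqr_ge0 // => k.
have t2 : 0 < t ^+ 2 / 2 by rewrite divr_gt0 // exprn_gt0.
rewrite -(ler_pM2l t2) (le_trans k) // le_eqVlt; apply/orP; left; apply/eqP; by field.
Qed.

End NormalMoments.

Section Independence.
Context d (X : measurableType d) (R : realType) (P : probability X R).

Definition indep_pair (f g : X -> R) := forall A B : set R, measurable A -> measurable B ->
  P (f @^-1` A `&` g @^-1` B) = (P (f @^-1` A) * P (g @^-1` B))%E.

(** Independence says that the law of the pair is the product of the two laws, since both agree on
    rectangles; Fubini's theorem does the rest. *)
Lemma indep_integrable_mul (f g : X -> R) : indep_pair f g ->
  P.-integrable setT (EFin \o f) -> P.-integrable setT (EFin \o g) ->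
  P.-integrable setT (fun x => (f x * g x)%:E) /\
  \int[P]_x (f x * g x) = \int[P]_x f x * \int[P]_x g x.
Proof.
move=> fg fi gi.
have mf : measurable_fun setT f by exact: integrable_measR fi.
have mg : measurable_fun setT g by exact: integrable_measR gi.
have mfg : measurable_fun setT (fun x => (f x, g x)) by exact: measurable_fun_pair.
pose f' := mfun_Sub (mem_set mf); pose g' := mfun_Sub (mem_set mg).
have mfg' : measurable_fun setT (fun x => (f x, g x)) by exact: measurable_fun_pair.
pose mu1 : probability _ R := distribution P f'.
pose mu2 : probability _ R := distribution P g'.
pose nu : probability _ R := distribution P (mfun_Sub (mem_set mfg')).
have prodE A : measurable A -> (mu1 \x mu2)%E A = nu A.
  apply: product_measure_unique => A1 A2 mA1 mA2.
  by rewrite /nu /mu1 /mu2 /= /distribution /pushforward /= -fg.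
have mxy : measurable_fun setT (fun z : R * R => (z.1 * z.2)%:E).
  by apply/measurable_EFinP; apply: measurable_funM.
have i1 : (\int[mu1]_x `|x|%:E < +oo)%E.
  rewrite ge0_integral_distribution //; last exact/measurable_EFinP/measurable_normf.
  by case/integrableP: fi.
have i2 : (\int[mu2]_x `|x|%:E < +oo)%E.
  rewrite ge0_integral_distribution //; last exact/measurable_EFinP/measurable_normf.
  by case/integrableP: gi.
have ixy : (mu1 \x mu2)%E.-integrable setT (fun z => (z.1 * z.2)%:E).
  have inner x : (\int[mu2]_y `|(x * y)%:E| = `|x|%:E * \int[mu2]_y `|y|%:E)%E.
    under eq_integral do rewrite /= normrM EFinM.
    by rewrite ge0_integralZl //; exact/measurable_EFinP/measurable_normf.
  apply/integrable12ltyP => //=; under eq_integral do rewrite inner.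
  rewrite ge0_integralZr //; last 2 first.
    exact/measurable_EFinP/measurable_normf.
    exact: integral_ge0.
  by rewrite lte_mul_pinfty // ?integral_ge0 // ge0_fin_numE // integral_ge0.
have e2 : (\int[P]_x `|(f x * g x)%:E| < +oo)%E.
  have := ixy; move/integrableP => [_]; rewrite (@eq_measure_integral _ _ _ _ nu); last by move=> A mA _; exact: prodE.
  by rewrite ge0_integral_distribution //; apply: measurableT_comp.
have ifg : P.-integrable setT (fun x => (f x * g x)%:E).
  by apply/integrableP; split => //; apply/measurable_EFinP; exact: measurable_funM.
split => //.
have q1 : (\int[P]_x (f x * g x)%:E = \int[mu1 \x mu2]_z (z.1 * z.2)%:E)%E.
  rewrite (@eq_measure_integral _ _ _ _ nu); last by move=> A mA _; exact: prodE.
  by rewrite integral_distribution.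
have i2' : mu2.-integrable setT (fun x => x%:E).
  by apply/integrableP; split => //; exact/measurable_EFinP.
have i1' : mu1.-integrable setT (fun x => x%:E).
  by apply/integrableP; split => //; exact/measurable_EFinP.
have q2 : (\int[mu2]_x x%:E = (\int[P]_x g x)%:E)%E.
  by rewrite integral_distribution // -integral_EFinR.
have q3 : (\int[mu1]_x x%:E = (\int[P]_x f x)%:E)%E.
  by rewrite integral_distribution // -integral_EFinR.
rewrite /Rintegral q1 -integral12_prod_meas1 // /fubini_F /=.
have inner x : (\int[mu2]_y (x * y)%:E = x%:E * (\int[P]_x g x)%:E)%E.
  by under eq_integral do rewrite EFinM; rewrite integralZl // q2.
under eq_integral do rewrite inner.
rewrite integralZr // q3 /=.
by rewrite !integral_EFinR.
Qed.

Lemma normal_law_integral (f : X -> R) s (h : R -> R) : s != 0 ->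
  measurable_fun setT f ->
  (forall A, measurable A -> P (f @^-1` A) = normal_prob 0 s A) ->
  measurable_fun setT h ->
  (normal_prob 0 s).-integrable setT (EFin \o h) ->
  P.-integrable setT (fun x => (h (f x))%:E) /\
  \int[P]_x h (f x) = \int[normal_prob 0 s]_x h x.
Proof.
move=> s0 mf fN mh hi.
have mf' : @measurable_fun _ _ X (measurableTypeR R) setT f by [].
pose f' : {mfun X >-> measurableTypeR R} := @mfun_Sub _ _ X (measurableTypeR R) f (mem_set mf').
pose mu1 : probability (measurableTypeR R) R := @distribution _ _ X (measurableTypeR R) R P f'.
have e (A : set (measurableTypeR R)) : measurable A -> A `<=` setT -> mu1 A = normal_prob 0 s A by move=> mA _; exact: fN.
have i1 : mu1.-integrable setT (EFin \o h).
  case/integrableP: hi => hm hi; apply/integrableP; split => //.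
  by rewrite (eq_measure_integral (normal_prob 0 s) e).
have i2 : P.-integrable setT (fun x => (h (f x))%:E).
  apply/integrableP; split; first exact/measurable_EFinP/measurableT_comp.
  case/integrableP: i1 => hm; rewrite ge0_integral_distribution //.
  by apply: measurableT_comp.
split => //.
rewrite /Rintegral -(eq_measure_integral (normal_prob 0 s) e).
rewrite integral_distribution //; exact/measurable_EFinP.
Qed.

End Independence.

(** * Brownian increments *)

Lemma continuous_borel_rV (R : realType) (m : nat) (g : 'rV[R]_m -> R) :
  continuous g -> @measurable_fun _ _ (borel_rV R m) R setT g.
Proof.
move=> cg.
suff : @measurable_fun _ _ (borel_rV R m) (measurableTypeR R) setT g by [].
apply: (@measurability _ _ _ (measurableTypeR R) _ _ _ (RGenOpens.measurableE R)) => _ [_ [a [b ->] <-]].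
rewrite setTI; apply: sub_sigma_algebra.
by apply: open_comp; [move=> x _; exact: cg|exact: interval_open].
Qed.

Lemma measurable_coord_rV (R : realType) (m : nat) (i : 'I_m) :
  @measurable_fun _ _ (borel_rV R m) R setT (fun v : 'rV[R]_m => v 0 i).
Proof. by apply: continuous_borel_rV => v; exact: coord_continuous. Qed.

Section Filtration.
Context (R : realType) (d : measure_display) (Omega : measurableType d)
  (P : probability Omega R).
Hypothesis P_complete : measure_is_complete P.
Context (T : R) (m : nat) (W : Omega -> R -> 'rV[R]_m).
Hypothesis W_bm : brownian_motion P T W.
Local Notation Ft t := (filtered P W t).

Lemma natural_gen_measurable t (A : set Omega) : t <= T ->
  <<s natural_gen W t >> A -> @measurable _ Omega A.
Proof.
move=> tT; apply: smallest_sub; first exact: sigma_algebra_measurable.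
move=> _ [s [B [/andP[s0 st] mB ->]]].
have := bm_measurable W_bm (t := s) _ measurableT mB.
by rewrite setTI; apply; rewrite s0 (le_trans st).
Qed.

Lemma filtered_measurable t (A : set Omega) : t <= T ->
  @measurable _ (Ft t) A -> @measurable _ Omega A.
Proof.
move=> tT; apply: smallest_sub; first exact: sigma_algebra_measurable.
move=> B [|]; last exact: P_complete.
by move=> nB; apply: (natural_gen_measurable tT); exact: sub_sigma_algebra.
Qed.

Lemma filtered_le s t (A : set Omega) : s <= t -> @measurable _ (Ft s) A -> @measurable _ (Ft t) A.
Proof.
move=> st; apply: sub_sigma_algebra2 => B [[r [C [/andP[r0 rs] mC ->]]]|]; last by right.
by left; exists r, C; split => //; rewrite r0 (le_trans rs).
Qed.

Lemma filtered_negligible t (A : set Omega) : P.-negligible A -> @measurable _ (Ft t) A.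
Proof. by move=> nA; apply: sub_sigma_algebra; right. Qed.

Lemma adapted_measurable d' (E : measurableType d') t (f : Omega -> E) : t <= T ->
  @measurable_fun _ _ (Ft t) E setT f -> @measurable_fun _ _ Omega E setT f.
Proof.
by move=> tT mf _ B mB; apply: (filtered_measurable tT); exact: mf.
Qed.

Lemma adapted_le d' (E : measurableType d') s t (f : Omega -> E) : s <= t ->
  @measurable_fun _ _ (Ft s) E setT f -> @measurable_fun _ _ (Ft t) E setT f.
Proof. by move=> st mf _ B mB; apply: (filtered_le st); exact: mf. Qed.

(** The sets equal to a natural one up to a null set form a sigma-algebra. Independence of the
    increments is assumed for the natural filtration, and this carries it over to the augmented
    one. *)
Lemma filtered_approx t (A : set Omega) : @measurable _ (Ft t) A ->
  exists2 A', <<s natural_gen W t >> A' & P.-negligible ((A `\` A') `|` (A' `\` A)).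
Proof.
pose M : set (set Omega) := [set A | exists2 A', <<s natural_gen W t >> A' &
  P.-negligible ((A `\` A') `|` (A' `\` A))].
apply: (@smallest_sub _ _ _ M).
  have sN : sigma_algebra setT <<s natural_gen W t >> by exact: smallest_sigma_algebra.
  have [N0 NC NU] := sN.
  split.
  - by exists set0 => //; rewrite !setD0 setU0; exact: negligible_set0.
  - move=> B [B' nB' nB]; exists (setT `\` B'); first exact: NC.
    apply: negligibleS nB => w /= [] [[_ a] b]; [right|left]; split => //.
      by apply: contrapT => c; apply: b.
    by apply: contrapT => c; apply: b.
  - move=> F FM.
    have /choice[F' F'P] : forall n, exists A', <<s natural_gen W t >> A' /\
        P.-negligible ((F n `\` A') `|` (A' `\` F n)).
      by move=> n; have [A' ? ?] := FM n; exists A'.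
    exists (\bigcup_n F' n); first by apply: NU => n; have [] := F'P n.
    apply: (@negligibleS _ _ _ _ (\bigcup_n ((F n `\` F' n) `|` (F' n `\` F n)))).
      move=> w /= [] [[n _ a] b]; exists n => //; [left|right]; split => // c; apply: b; exists n => //.
    by apply: negligible_bigcup => n; have [] := F'P n.
move=> B [|] nB.
  by exists B; [exact: sub_sigma_algebra|rewrite setDv setU0; exact: negligible_set0].
exists set0; first by have [] := smallest_sigma_algebra setT (natural_gen W t).
by rewrite setD0 set0D setU0.
Qed.

Lemma measure_ae_eq (A B : set Omega) : measurable A -> measurable B ->
  P.-negligible ((A `\` B) `|` (B `\` A)) -> P A = P B.
Proof.
have le A' B' : measurable A' -> measurable B' ->
    P.-negligible ((A' `\` B') `|` (B' `\` A')) -> (P A' <= P B')%E.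
  move=> mA mB [N [mN N0 sN]].
  apply: (@le_trans _ _ (P (B' `|` N))).
    apply: le_measure; rewrite ?inE //; first exact: measurableU.
    move=> w Aw; have [Bw|nBw] := pselect (B' w); first by left.
    by right; apply: sN; left.
  by rewrite (le_trans (measureU2 _ _ _)) // [X in (_ + X)%E]N0 adde0.
by move=> mA mB nAB; apply/eqP; rewrite eq_le !le // setUC.
Qed.

Definition good : set Omega :=
  [set w | {within `[0, T], continuous (W w)} /\ W w 0 = 0].

(* A modification of [W] all of whose paths are continuous. *)
Definition bm_cont (w : Omega) (t : R) : 'rV[R]_m := if pselect (good w) then W w t else 0.

Lemma good_negligible : P.-negligible (~` good).
Proof.
have := bm_continuous W_bm; have := bm_start W_bm.
move=> h1 h2; apply: negligibleS (negligibleU h1 h2) => w /= ng.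
apply: contrapT => /not_orP[/contrapT a /contrapT b]; exact: ng.
Qed.

Lemma bm_contE w t : good w -> bm_cont w t = W w t.
Proof. by rewrite /bm_cont; case: pselect. Qed.

Lemma bm_cont_continuous w : {within `[0, T], continuous (bm_cont w)}.
Proof.
have [gw|gw] := pselect (good w).
  rewrite (_ : bm_cont w = W w); first by case: gw.
  by apply/funext => t; exact: bm_contE.
have -> : bm_cont w = cst 0 by apply/funext => t; rewrite /bm_cont; case: pselect.
by apply: continuous_subspaceT => x; exact: cvg_cst.
Qed.

Lemma bm_cont_adapted t i : 0 <= t <= T ->
  @measurable_fun _ _ (Ft t) R setT (fun w => bm_cont w t 0 i).
Proof.
move=> /andP[t0 tT] _ B mB; rewrite setTI.
have mWB : @measurable _ (Ft t) [set w | B (W w t 0 i)].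
  apply: sub_sigma_algebra; left; exists t, [set v : 'rV[R]_m | B (v 0 i)]; split => //.
    by rewrite t0 lexx.
  by have := measurable_coord_rV i measurableT mB; rewrite setTI.
have mg : @measurable _ (Ft t) good.
  by rewrite -[good]setCK; apply: measurableC; apply: filtered_negligible; exact: good_negligible.
have -> : (fun w => bm_cont w t 0 i) @^-1` B =
    (good `&` [set w | B (W w t 0 i)]) `|` (~` good `&` [set w | B 0]).
  apply/seteqP; split => w /=; rewrite /bm_cont; case: pselect => g; rewrite ?mxE.
  - by left.
  - by right.
  - by move=> [[]//|[]].
  - by move=> [[]//|[]].
apply: measurableU; first exact: measurableI.
apply: measurableI; first exact: measurableC.
have [b|nb] := pselect (B 0).
  by rewrite (_ : [set w | B 0] = setT) //; apply/seteqP; split.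
by rewrite (_ : [set w | B 0] = set0) //; apply/seteqP; split.
Qed.

(** Both events are changed on null sets: the past one into an event of the natural filtration, the
    increment of the modification into that of [W]. *)
Lemma bm_cont_indep s t (f : Omega -> R) (g : 'rV[R]_m -> R) :
  0 <= s -> s < t -> t <= T ->
  @measurable_fun _ _ (Ft s) R setT f ->
  @measurable_fun _ _ (borel_rV R m) R setT g ->
  @measurable_fun _ _ Omega R setT (fun w => g (bm_cont w t - bm_cont w s)) ->
  indep_pair P f (fun w => g (bm_cont w t - bm_cont w s)).
Proof.
move=> s0 st tT mf mg mgD A B mA mB.
have mfA : @measurable _ (Ft s) (f @^-1` A) by rewrite -[X in measurable X]setTI; exact: mf.
have [A' nA' negA] := filtered_approx mfA.
have sT : s <= T by rewrite ltW // (lt_le_trans st).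
have mA' := natural_gen_measurable sT nA'.
have mgB : @measurable _ (borel_rV R m) (g @^-1` B) by rewrite -[X in measurable X]setTI; exact: mg.
have mE : measurable ((fun w => g (bm_cont w t - bm_cont w s)) @^-1` B).
  by rewrite -[X in measurable X]setTI; exact: mgD.
have ng := good_negligible.
(* This set agrees with a measurable one on [good]; the rest is a subset of a null set, measurable
   by completeness. *)
have mE' : measurable [set w | (g @^-1` B) (W w t - W w s)].
  have -> : [set w | (g @^-1` B) (W w t - W w s)] =
    ((fun w => g (bm_cont w t - bm_cont w s)) @^-1` B `&` good) `|`
    ([set w | (g @^-1` B) (W w t - W w s)] `&` ~` good).
    apply/seteqP; split => w /=.
      move=> h; have [gw|gw] := pselect (good w); [left|by right].
      by rewrite !bm_contE.
    by move=> [[h gw]|[]//]; move: h; rewrite !bm_contE.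
  apply: measurableU; last by apply: P_complete; apply: negligibleS ng => w [].
  by apply: measurableI => //; rewrite -[good]setCK; apply: measurableC; exact: P_complete.
have e1 : P ((fun w => g (bm_cont w t - bm_cont w s)) @^-1` B) =
    P [set w | (g @^-1` B) (W w t - W w s)].
  apply: measure_ae_eq => //; apply: negligibleS ng => w /= [] [a b] gw; apply: b; move: a; by rewrite !bm_contE.
have e2 : P (f @^-1` A) = P A' by apply: measure_ae_eq => //; exact: filtered_measurable mfA.
rewrite e1 e2 -(bm_independent W_bm s0 st tT nA' mgB).
apply: measure_ae_eq.
- by apply: measurableI => //; exact: filtered_measurable mfA.
- exact: measurableI.
- apply: negligibleS (negligibleU negA ng) => w /=.
  have [gw|gw] := pselect (good w); last by right.
  rewrite !bm_contE // => -[] [[a b] c]; left; [left|right]; split => // e; exact: c.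
Qed.

Lemma bm_contB_measurable s t i : 0 <= s -> s <= t -> t <= T ->
  @measurable_fun _ _ (Ft t) R setT (fun w => (bm_cont w t - bm_cont w s) 0 i).
Proof.
move=> s0 st tT; rewrite (_ : (fun _ => _) = (fun w => bm_cont w t 0 i - bm_cont w s 0 i)); last first.
  by apply/funext => w; rewrite !mxE.
apply: measurable_addf; first by apply: bm_cont_adapted; rewrite tT (le_trans s0).
apply: measurable_oppf; apply: (adapted_le st); apply: bm_cont_adapted.
by rewrite s0 (le_trans st).
Qed.

Lemma bm_cont_law s t (B : 'I_m -> set R) : 0 <= s -> s < t -> t <= T ->
  (forall i, measurable (B i)) ->
  P [set w | forall i, B i ((bm_cont w t - bm_cont w s) 0 i)] =
  (\prod_(i < m) normal_prob 0 (Num.sqrt (t - s)) (B i))%E.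
Proof.
move=> s0 st tT mB; rewrite -(bm_gaussian W_bm s0 st tT mB).
have mE (V : Omega -> 'rV[R]_m) : (forall i, @measurable_fun _ _ Omega R setT (fun w => V w 0 i)) ->
    measurable [set w | forall i, B i (V w 0 i)].
  move=> mV; rewrite (_ : [set w | _] = \bigcap_(i in setT) ((fun w => V w 0 i) @^-1` B i)).
    apply: fin_bigcap_measurable; first exact: finite_finset.
    by move=> i _; rewrite -[X in measurable X]setTI; exact: mV.
  by apply/seteqP; split => w /= h i => [_|]; exact: h.
have sT : s <= T by rewrite ltW // (lt_le_trans st).
have t0 : 0 <= t by rewrite ltW // (le_lt_trans s0).
have mW r i : 0 <= r <= T -> @measurable_fun _ _ Omega R setT (fun w => W w r 0 i).
  move=> rT; have mr := bm_measurable W_bm rT.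
  by apply: (measurableT_comp (measurable_coord_rV i) mr).
apply: measure_ae_eq.
- apply: mE => i; apply: (adapted_measurable tT); apply: bm_contB_measurable => //; exact: ltW.
- apply: mE => i; rewrite (_ : (fun _ => _) = (fun w => W w t 0 i - W w s 0 i)); last first.
    by apply/funext => w; rewrite !mxE.
  by apply: measurable_addf; [|apply: measurable_oppf]; apply: mW; apply/andP; split.
- apply: negligibleS good_negligible => w /= h gw; move: h.
  by rewrite !bm_contE // => -[] [a b]; exact: b.
Qed.

Lemma bm_cont_law1 s t i (A : set R) : 0 <= s -> s < t -> t <= T -> measurable A ->
  P ((fun w => (bm_cont w t - bm_cont w s) 0 i) @^-1` A) =
  normal_prob 0 (Num.sqrt (t - s)) A.
Proof.
move=> s0 st tT mA.
pose B k := if k == i then A else setT.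
have mB k : measurable (B k) by rewrite /B; case: ifP.
have := bm_cont_law s0 st tT mB; rewrite (bigD1 i) //= [X in (_ * X)%E]big1 => [|k ki].
  rewrite /B eqxx mule1 => <-; congr (P _); apply/seteqP; split => w /=.
    by move=> h k; case: eqP => // ->.
  by move=> /(_ i); rewrite eqxx.
by rewrite /B (negbTE ki); exact: probability_setT.
Qed.

Lemma bm_cont_coord_indep s t i j : 0 <= s -> s < t -> t <= T -> i != j ->
  indep_pair P (fun w => (bm_cont w t - bm_cont w s) 0 i)
    (fun w => (bm_cont w t - bm_cont w s) 0 j).
Proof.
move=> s0 st tT ij A1 A2 mA1 mA2; rewrite !bm_cont_law1 //.
pose B k := if k == i then A1 else if k == j then A2 else setT.
have mB k : measurable (B k) by rewrite /B; do 2 case: ifP => //.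
have := bm_cont_law s0 st tT mB; rewrite (bigD1 i) //= (bigD1 j) 1?eq_sym //=.
rewrite [X in (_ * (_ * X))%E]big1 => [|k /andP[ki kj]].
  rewrite /B eqxx eq_sym (negbTE ij) eqxx mule1 => <-; congr (P _); apply/seteqP; split => w /=.
    move=> [h1 h2] k; case: eqP => [->//|_]; case: eqP => [->//|_] //.
  by move=> h; have := h i; have := h j; rewrite eqxx eq_sym (negbTE ij) eqxx; split.
by rewrite /B (negbTE ki) (negbTE kj); exact: probability_setT.
Qed.

Section Increment.
Context (s t : R) (s0 : 0 <= s) (st : s < t) (tT : t <= T).
Let D w := bm_cont w t - bm_cont w s.

Let sg0 : Num.sqrt (t - s) != 0.
Proof. by rewrite sqrtr_eq0 -ltNge subr_gt0. Qed.

Let mD i : @measurable_fun _ _ Omega R setT (fun w => D w 0 i).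
Proof. by apply: (adapted_measurable tT); apply: bm_contB_measurable => //; exact: ltW. Qed.

Lemma increment_integrable i n : P.-integrable setT (fun w => (D w 0 i ^+ n)%:E).
Proof.
have [] // := @normal_law_integral _ _ _ P (fun w => D w 0 i) _ (fun x => x ^+ n) sg0 (mD i).
- by move=> A mA; exact: bm_cont_law1.
- exact: normal_integrable_exprn.
Qed.

Lemma increment_moment i n : \int[P]_w (D w 0 i ^+ n) =
  \int[normal_prob 0 (Num.sqrt (t - s))]_x (x ^+ n).
Proof.
have [] // := @normal_law_integral _ _ _ P (fun w => D w 0 i) _ (fun x => x ^+ n) sg0 (mD i).
- by move=> A mA; exact: bm_cont_law1.
- exact: normal_integrable_exprn.
Qed.

Lemma increment_mul i j : P.-integrable setT (fun w => (D w 0 i * D w 0 j)%:E) /\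
  \int[P]_w (D w 0 i * D w 0 j) = (i == j)%:R * (t - s).
Proof.
have h1 i' : P.-integrable setT (EFin \o (fun w => D w 0 i')) by exact: (increment_integrable i' 1).
have h0 i' : \int[P]_w D w 0 i' = 0.
  rewrite -(normal_mean_var sg0).1; exact: (increment_moment i' 1).
have [<-|ij] := eqVneq i j.
  split; first exact: (increment_integrable i 2).
  rewrite mul1r -[RHS]sqr_sqrtr ?subr_ge0 ?ltW // -(normal_mean_var sg0).2.
  exact: (increment_moment i 2).
have [k1 k2] := indep_integrable_mul (bm_cont_coord_indep s0 st tT ij) (h1 i) (h1 j).
by split => //; rewrite k2 !h0 !mul0r.
Qed.

Lemma increment_indep_mul (z : Omega -> R) M i j :
  @measurable_fun _ _ (Ft s) R setT z -> (forall w, `|z w| <= M) ->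
  P.-integrable setT (fun w => (z w * (D w 0 i * D w 0 j))%:E) /\
  \int[P]_w (z w * (D w 0 i * D w 0 j)) = (\int[P]_w z w) * ((i == j)%:R * (t - s)).
Proof.
move=> mz zM; have [k1 k2] := increment_mul i j; rewrite -k2.
have zi : P.-integrable setT (EFin \o z).
  apply: (@integrable_boundR _ _ _ _ _ _ z M) => //; first by rewrite (le_lt_trans (probability_le1 _ _)) ?ltry.
  by apply: (adapted_measurable _ mz); rewrite ltW // (lt_le_trans st).
apply: (indep_integrable_mul _ zi k1).
apply: (@bm_cont_indep s t z (fun v => v 0 i * v 0 j)) => //.
  by apply: measurable_mulf; exact: measurable_coord_rV.
by apply: measurable_mulf; exact: mD.
Qed.

Lemma increment_indep (z : Omega -> R) M i :
  @measurable_fun _ _ (Ft s) R setT z -> (forall w, `|z w| <= M) ->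
  P.-integrable setT (fun w => (z w * D w 0 i)%:E) /\
  \int[P]_w (z w * D w 0 i) = 0.
Proof.
move=> mz zM.
have zi : P.-integrable setT (EFin \o z).
  apply: (@integrable_boundR _ _ _ _ _ _ z M) => //; first by rewrite (le_lt_trans (probability_le1 _ _)) ?ltry.
  by apply: (adapted_measurable _ mz); rewrite ltW // (lt_le_trans st).
have h1 : P.-integrable setT (EFin \o (fun w => D w 0 i)) by exact: (increment_integrable i 1).
have h0 : \int[P]_w D w 0 i = 0.
  rewrite -(normal_mean_var sg0).1; exact: (increment_moment i 1).
have [] := indep_integrable_mul _ zi h1.
  apply: (@bm_cont_indep s t z (fun v => v 0 i)) => //; exact: measurable_coord_rV.
by rewrite h0 mulr0.
Qed.

Lemma increment_moment4 i : \int[P]_w (D w 0 i ^+ 4) <= 48 * expR 1 * (t - s) ^+ 2.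
Proof.
rewrite increment_moment (le_trans (normal_moment4 sg0)) //.
by rewrite (exprM _ 2 2) sqr_sqrtr // subr_ge0 ltW.
Qed.

(** The isometry of the stochastic integral over one step, conditionally on the past thanks to the
    weight [z]. Each coordinate of the increment is independent of [z] and [c], and distinct
    coordinates are uncorrelated, so that only the diagonal of the square survives. *)
Lemma increment_dotp (c : Omega -> 'rV[R]_m) (z : Omega -> R) (M Mz : R) :
  (forall i, @measurable_fun _ _ (Ft s) R setT (fun w => c w 0 i)) ->
  (forall w, euclid (c w) <= M) ->
  @measurable_fun _ _ (Ft s) R setT z -> (forall w, `|z w| <= Mz) ->
  [/\ P.-integrable setT (fun w => (z w * dotp (c w) (D w))%:E),
      \int[P]_w (z w * dotp (c w) (D w)) = 0,
      P.-integrable setT (fun w => (z w * dotp (c w) (D w) ^+ 2)%:E) &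
      \int[P]_w (z w * dotp (c w) (D w) ^+ 2) =
      (t - s) * \int[P]_w (z w * euclid (c w) ^+ 2)].
Proof.
move=> mc cM mz zM.
have M0 (w : Omega) : 0 <= M by rewrite (le_trans (euclid_ge0 (c w))).
have mzc i : @measurable_fun _ _ (Ft s) R setT (fun w => z w * c w 0 i) by apply: measurable_mulf.
have zcM i w : `|z w * c w 0 i| <= Mz * M.
  by rewrite normrM ler_pM // (le_trans (normr_coord _ _)).
have mzcc i j : @measurable_fun _ _ (Ft s) R setT (fun w => z w * c w 0 i * c w 0 j).
  by do 2 apply: measurable_mulf => //.
have zccM i j w : `|z w * c w 0 i * c w 0 j| <= Mz * M * M.
  by rewrite normrM ler_pM // (le_trans (normr_coord _ _)).
have e1 w : z w * dotp (c w) (D w) = \sum_i (z w * c w 0 i * D w 0 i).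
  rewrite /dotp mulr_sumr; apply: eq_bigr => i _; by rewrite mulrA.
have e2 w : z w * dotp (c w) (D w) ^+ 2 =
    \sum_(ij : 'I_m * 'I_m) (z w * c w 0 ij.1 * c w 0 ij.2 * (D w 0 ij.1 * D w 0 ij.2)).
  rewrite /dotp expr2 mulr_suml mulr_sumr -(pair_bigA _ (fun i j => z w * c w 0 i * c w 0 j * (D w 0 i * D w 0 j))) /=.
  apply: eq_bigr => i _; rewrite mulr_sumr mulr_sumr; apply: eq_bigr => j _; ring.
have j1 i := (increment_indep i (mzc i) (zcM i)).1.
have j2 (ij : 'I_m * 'I_m) := (increment_indep_mul ij.1 ij.2 (mzcc ij.1 ij.2) (zccM ij.1 ij.2)).1.
have i1 := integrable_sumR measurableT j1; have h1 := Rintegral_sumR measurableT j1.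
have i2 := integrable_sumR measurableT j2; have h2 := Rintegral_sumR measurableT j2.
split.
- by under [X in _.-integrable _ X]eq_fun do rewrite e1.
- under eq_Rintegral do rewrite e1.
  by rewrite h1 big1 // => i _; have [] := increment_indep i (mzc i) (zcM i).
- by under [X in _.-integrable _ X]eq_fun do rewrite e2.
- under eq_Rintegral do rewrite e2.
  rewrite h2 -(pair_bigA _ (fun i j => \int[P]_w (z w * c w 0 i * c w 0 j * (D w 0 i * D w 0 j)))) /=.
  have sT : s <= T by rewrite ltW // (lt_le_trans st).
  have iz i j : P.-integrable setT (fun w => (z w * c w 0 i * c w 0 j)%:E).
    apply: (@integrable_boundR _ _ _ _ _ _ _ (Mz * M * M)) => //; first by rewrite (le_lt_trans (probability_le1 _ _)) ?ltry.
    exact: (adapted_measurable sT).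
  transitivity (\sum_i (t - s) * \int[P]_w (z w * c w 0 i * c w 0 i)).
    apply: eq_bigr => i _; rewrite (bigD1 i) //= big1 ?addr0 => [|j ji].
      have [_ ->] := increment_indep_mul i i (mzcc i i) (zccM i i).
      by rewrite eqxx mul1r mulrC.
    have [_ ->] := increment_indep_mul i j (mzcc i j) (zccM i j).
    by rewrite eq_sym (negbTE ji) mul0r mulr0.
  rewrite -mulr_sumr; congr (_ * _).
  rewrite -(Rintegral_sumR _ (fun i => iz i i)) //.
  apply: eq_Rintegral => w _; rewrite sqr_euclid /dotp mulr_sumr.
  by apply: eq_bigr => i _; rewrite mulrA.
Qed.

(** Cauchy-Schwarz is used twice, for the product with [c] and for the sum of the squared
    coordinates. One factor m comes from the latter, the other from adding m fourth moments. *)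
Lemma increment_dotp4 (c : Omega -> 'rV[R]_m) (M : R) :
  (forall i, @measurable_fun _ _ (Ft s) R setT (fun w => c w 0 i)) ->
  (forall w, euclid (c w) <= M) ->
  P.-integrable setT (fun w => (dotp (c w) (D w) ^+ 4)%:E) /\
  \int[P]_w (dotp (c w) (D w) ^+ 4) <= M ^+ 4 * m%:R ^+ 2 * (48 * expR 1) * (t - s) ^+ 2.
Proof.
move=> mc cM.
have sT : s <= T by rewrite ltW // (lt_le_trans st).
have M0 (w : Omega) : 0 <= M by rewrite (le_trans (euclid_ge0 (c w))).
pose one := \row_(i < m) (1 : R).
have le4 w : dotp (c w) (D w) ^+ 4 <= M ^+ 4 * m%:R * \sum_i D w 0 i ^+ 4.
  have h1 : dotp (c w) (D w) ^+ 2 <= M ^+ 2 * euclid (D w) ^+ 2.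
    rewrite -exprMn -real_normK ?num_real // ler_pXn2r ?nnegrE ?mulr_ge0 ?euclid_ge0 ?(M0 w) //.
    by rewrite (le_trans (normr_dotp _ _)) // ler_wpM2r // euclid_ge0.
  pose v := \row_i (D w 0 i ^+ 2).
  have h2 : (euclid (D w) ^+ 2) ^+ 2 <= m%:R * \sum_i D w 0 i ^+ 4.
    have -> : euclid (D w) ^+ 2 = dotp v one.
      by rewrite sqr_euclid; apply: eq_bigr => i _; rewrite !mxE mulr1 expr2.
    have -> : \sum_i D w 0 i ^+ 4 = euclid v ^+ 2.
      by rewrite sqr_euclid; apply: eq_bigr => i _; rewrite !mxE -exprD.
    have -> : m%:R = euclid one ^+ 2 :> R.
      rewrite sqr_euclid /dotp; under eq_bigr do rewrite !mxE mulr1.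
      by rewrite sumr_const card_ord.
    rewrite mulrC -exprMn -real_normK ?num_real // ler_pXn2r ?nnegrE ?mulr_ge0 ?euclid_ge0 //.
    exact: normr_dotp.
  rewrite (exprM _ 2 2) (exprM M 2 2).
  apply: (@le_trans _ _ ((M ^+ 2 * euclid (D w) ^+ 2) ^+ 2)).
    by rewrite ler_pXn2r ?nnegrE ?sqr_ge0 // mulr_ge0 // sqr_ge0.
  by rewrite exprMn -mulrA ler_wpM2l // sqr_ge0.
have mdot : measurable_fun setT (fun w => dotp (c w) (D w)).
  rewrite /dotp; apply: measurable_sum => i; apply: measurable_mulf => //.
  exact: (adapted_measurable sT).
have i4 : P.-integrable setT (fun w => (M ^+ 4 * m%:R * \sum_i D w 0 i ^+ 4)%:E).
  by apply: integrableZR => //; apply: integrable_sumR => // i; exact: increment_integrable.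
have i5 : P.-integrable setT (fun w => (dotp (c w) (D w) ^+ 4)%:E).
  apply: (integrable_leR _ _ _ i4) => //; first by meas.
  by move=> w _; rewrite ger0_norm // exprn_even_ge0.
split => //; apply: (le_trans (le_Rintegral _ i5 i4 (fun w _ => le4 w))) => //.
have i6 : P.-integrable setT (fun w => (\sum_i D w 0 i ^+ 4)%:E).
  by apply: integrable_sumR => // i; exact: increment_integrable.
have k : \int[P]_w (\sum_i D w 0 i ^+ 4) <= m%:R * (48 * expR 1 * (t - s) ^+ 2).
  rewrite Rintegral_sumR //; last by move=> i; exact: increment_integrable.
  rewrite (le_trans (ler_sum _ (fun i _ => increment_moment4 i))) //.
  by rewrite sumr_const card_ord [leRHS]mulr_natl.
rewrite RintegralZl // (_ : _ * (t - s) ^+ 2 = M ^+ 4 * m%:R * (m%:R * (48 * expR 1 * (t - s) ^+ 2))); last by ring.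
by rewrite ler_wpM2l // mulr_ge0 // exprn_even_ge0.
Qed.

End Increment.
End Filtration.

(** * Integrals along paths *)

Section PathContinuity.
Context (R : realType).
Implicit Types (f g : R -> R) (a b : R).

Lemma within_continuous_dist f a b : {within `[a, b], continuous f} ->
  forall x, a <= x <= b -> forall e, 0 < e -> exists2 d, 0 < d &
  forall r, a <= r <= b -> `|r - x| < d -> `|f r - f x| < e.
Proof.
move=> cf x xab e e0.
have xA : `[a, b]%classic x by rewrite /= in_itv.
move/subspace_continuousP: cf => /(_ x xA) /cvgrPdist_lt /(_ e e0) [d /= d0 h].
exists d => // r rab rx; rewrite distrC; apply: h => //=.
  by rewrite /ball /= distrC.
Qed.

Lemma within_continuous_unif f a b : {within `[a, b], continuous f} ->
  forall e, 0 < e -> exists2 d, 0 < d &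
  forall x y, a <= x <= b -> a <= y <= b -> `|x - y| < d -> `|f x - f y| < e.
Proof.
move=> cf e e0.
have e2 : 0 < e / 2 by rewrite divr_gt0.
pose P (d x : R) := a <= x <= b -> forall y, a <= y <= b -> `|x - y| < d -> `|f x - f y| < e.
have := @segment_compact R a b; rewrite compact_near_coveringP => nc.
have := nc R (0 : R)^'+ P _ _; move=> /(_ _) [].
  move=> x; rewrite /= in_itv /= => xab.
  have [d d0 h] := within_continuous_dist cf xab e2.
  have d2 : 0 < d / 2 by rewrite divr_gt0.
  exists (ball x (d / 2), [set d' | 0 < d' < d / 2]) => /=.
    split; first exact: nbhsx_ballx.
    exists (d / 2) => //= y; rewrite /= sub0r normrN => h1 h2.
    by rewrite h2 /= -(gtr0_norm h2).
  move=> [x' d'] /= [xx' /andP[d'0 d'd]] x'ab y yab xy.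
  rewrite /ball /= in xx'.
  have h1 : `|f x' - f x| < e / 2.
    by apply: h => //; rewrite distrC (lt_trans xx') // ltr_pdivrMr // ltr_pMr // ltr1n.
  have h2 : `|f y - f x| < e / 2.
    apply: h => //; rewrite (_ : y - x = (x' - x) - (x' - y)); last by ring.
    rewrite (le_lt_trans (ler_normB _ _)) // (distrC x'); lra.
  rewrite (_ : f x' - f y = (f x' - f x) - (f y - f x)); last by ring.
  rewrite (le_lt_trans (ler_normB _ _)) //; lra.
move=> d /= d0 h.
exists (d / 2); first by rewrite divr_gt0.
move=> x y xab yab xy; apply: (h (d / 2)) => //=.
- by rewrite sub0r normrN gtr0_norm ?divr_gt0 // ltr_pdivrMr // ltr_pMr // ltr1n.
- by rewrite divr_gt0.
Qed.

Lemma within_continuousP f a b :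
  (forall x, a <= x <= b -> forall e, 0 < e -> exists2 d, 0 < d &
    forall r, a <= r <= b -> `|r - x| < d -> `|f r - f x| < e) ->
  {within `[a, b], continuous f}.
Proof.
move=> h; apply/subspace_continuousP => x /=; rewrite in_itv /= => xab.
apply/cvgrPdist_lt => e e0; have [d d0 hd] := h x xab e e0.
exists d => //= r rx; rewrite /= in_itv /= => rab.
by rewrite distrC; apply: hd => //; rewrite distrC.
Qed.

Lemma within_continuous_bounded f a b : {within `[a, b], continuous f} ->
  exists2 M, 0 <= M & forall x, a <= x <= b -> `|f x| <= M.
Proof.
move=> cf; have [ab|ba] := leP a b; last first.
  by exists 0 => // x /andP[ax xb]; exfalso; lra.
have cn : {within `[a, b], continuous (fun x => `|f x|)}.
  apply: within_continuousP => x xab e e0.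
  have [dl dl0 h] := within_continuous_dist cf xab e0; exists dl => // r rab rx.
  by rewrite (le_lt_trans (ler_dist_dist _ _)) // h.
have [c _ h] := EVT_max ab cn.
by exists `|f c| => // x xab; apply: h; rewrite in_itv.
Qed.

End PathContinuity.

Lemma natSinv_lt (R : realType) (e : R) : 0 < e ->
  \forall n \near \oo, n.+1%:R^-1 < e.
Proof. by move=> e0; exact: (near_infty_natSinv_lt (PosNum e0)). Qed.

Lemma fine_measure_segment (R : realType) (a b : R) : a <= b ->
  fine (@lebesgue_measure R `[a, b]%classic) = b - a.
Proof.
move=> ab; rewrite (lebesgue_measure_itv `[a, b]) /= lte_fin.
by case: ltP => // ba; rewrite (le_anti (introT andP (conj ab ba))) subrr.
Qed.

Lemma measure_segment_lty (R : realType) (a b : R) :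
  (@lebesgue_measure R `[a, b]%classic < +oo)%E.
Proof. by rewrite (lebesgue_measure_itv `[a, b]) /=; case: ifP => _; rewrite ltry. Qed.

Section Grid.
Context (R : realType) (a b : R) (ab : a <= b).

(** There are [n.+1] steps, hence [n.+2] points, so that every [n] gives a true subdivision. *)
Definition grid n i : R := a + (b - a) * (i%:R / n.+1%:R).

Lemma grid0 n : grid n 0 = a.
Proof. by rewrite /grid mul0r mulr0 addr0. Qed.

Lemma gridS n : grid n n.+1 = b.
Proof. by rewrite /grid divff // mulr1 addrC subrK. Qed.

Lemma grid_step n i : grid n i.+1 - grid n i = (b - a) / n.+1%:R.
Proof. by rewrite /grid -natr1; field. Qed.

Lemma grid_le n i j : (i <= j)%N -> grid n i <= grid n j.
Proof.
move=> ij; rewrite lerD2l ler_wpM2l ?subr_ge0 // ler_wpM2r ?invr_ge0 //.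
by rewrite ler_nat.
Qed.

Lemma grid_itv n i : (i <= n.+1)%N -> a <= grid n i <= b.
Proof.
by move=> i_n; rewrite -[X in X <= _ <= _](grid0 n) -[X in _ <= _ <= X](gridS n) !grid_le.
Qed.

(** The index [n.+1] serves x = b: its half-open cell starts at b and lies outside the interval. *)
Lemma grid_find n x : a <= x <= b -> a < b ->
  exists2 i, (i <= n.+1)%N & grid n i <= x < grid n i.+1.
Proof.
move=> /andP[ax xb] altb.
have ba : 0 < b - a by rewrite subr_gt0.
pose u := (x - a) / (b - a) * n.+1%:R.
have u0 : 0 <= u by rewrite mulr_ge0 // divr_ge0 // subr_ge0.
have /andP[h1 h2] := truncn_itv u0.
have un : u <= n.+1%:R by rewrite ler_piMl // ler_pdivrMr // mul1r lerD2r.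
exists (Num.truncn u); first by rewrite -(ler_nat R) (le_trans h1).
have e y : (grid n y <= x) = (y%:R <= u).
  by rewrite /grid -lerBrDl mulrC -ler_pdivlMr // ler_pdivrMr.
by rewrite e h1 ltNge e -ltNge.
Qed.

End Grid.

Section JointMeasurability.
Context d (Om : measurableType d) (R : realType).
Local Notation mu := (@lebesgue_measure R).

Definition jointly_measurable (a b : R) (X : Om -> R -> R) :=
  @measurable_fun _ _ (Om * R)%type R (setT `*` `[a, b]) (fun z => X z.1 z.2).

Lemma measurable_strip (a b : R) : @measurable _ (Om * R)%type (setT `*` `[a, b]).
Proof. by apply: measurableX; [exact: measurableT|exact: measurable_itv]. Qed.

Lemma jointly_measurableS a b a' b' X : a <= a' -> b' <= b ->
  jointly_measurable a b X -> jointly_measurable a' b' X.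
Proof.
move=> aa bb; apply: measurable_funS; first exact: measurable_strip.
move=> [w s] /= [_]; rewrite !in_itv /= => /andP[h1 h2]; split => //.
by rewrite (le_trans aa) // (le_trans h2).
Qed.

Lemma jointly_measurable_path a b X w : jointly_measurable a b X ->
  measurable_fun `[a, b] (X w).
Proof.
move=> mX _ B mB.
have := mX (measurable_strip a b) B mB.
move=> /(measurable_xsection w); congr measurable; apply/seteqP; split => s /=.
  by rewrite /xsection /= inE => -[[]].
by move=> [h1 h2]; rewrite /xsection /= inE; split => //.
Qed.

Lemma jointly_measurable_fst a b f : measurable_fun setT f ->
  jointly_measurable a b (fun w _ => f w).
Proof.
move=> mf; apply: (@measurable_comp _ _ _ _ _ _ setT f) => //.
exact: measurable_funTS.
Qed.

(** The process frozen at the last grid point is a finite sum of products of a random variable and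
    an indicator of time; by continuity of the paths it converges to [X] as the mesh vanishes. *)
Lemma caratheodory a b (X : Om -> R -> R) : a <= b ->
  (forall w, {within `[a, b], continuous (X w)}) ->
  (forall t, a <= t <= b -> measurable_fun setT (fun w => X w t)) ->
  jointly_measurable a b X.
Proof.
rewrite le_eqVlt => /predU1P[<-|altb] cX mX.
  rewrite /jointly_measurable set_itv1.
  apply: (@eq_measurable_fun _ _ _ _ _ (fun z : Om * R => X z.1 a)).
    by move=> z; rewrite inE /= => -[_ ->].
  apply: measurable_funTS; apply: (measurableT_comp (mX a _)) => //.
  by rewrite lexx.
have ab := ltW altb.
pose A n i := `[grid a b n i, grid a b n i.+1[%classic.
pose h n (z : Om * R) := \sum_(i < n.+2) X z.1 (grid a b n i) * \1_(A n i) z.2.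
have mh n : measurable_fun (setT `*` `[a, b]) (h n).
  apply: measurable_funTS; apply: measurable_sum => i; apply: measurable_mulf.
    by apply: (measurableT_comp (mX _ _)) => //; apply: grid_itv => //; rewrite -ltnS.
  have mi : measurable_fun setT (\1_(A n i) : R -> R).
    by apply: measurable_indic; exact: measurable_itv.
  exact: (measurableT_comp mi measurable_snd).
apply: (measurable_fun_cvg mh) => -[w s] [_ /=]; rewrite in_itv /= => sab.
apply/cvgrPdist_lt => e e0.
have [dl dl0 hd] := within_continuous_dist (cX w) sab e0.
near=> n.
have [i i_n /andP[gs sg]] := grid_find ab n sab altb.
have -> : h n (w, s) = X w (grid a b n i).
  have i2 : (i < n.+2)%N by rewrite ltnS.
  rewrite /h (bigD1 (Ordinal i2)) //= big1 ?addr0 => [|j ji].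
    have sA : A n i s by rewrite /A /= in_itv /= gs sg.
    by rewrite indicE mem_set // mulr1.
  rewrite indicE memNset ?mulr0 // /A /= in_itv /= => /andP[h1 h2].
  move: ji; rewrite -val_eqE /= => /eqP; apply.
  apply/eqP; rewrite eqn_leq -ltnS -[X in _ && X]ltnS; apply/andP; split; rewrite ltnNge; apply/negP => /(grid_le ab n) h3; lra.
rewrite distrC; apply: hd; first exact: grid_itv.
rewrite distrC ger0_norm ?subr_ge0 //.
apply: (@lt_trans _ _ (grid a b n i.+1 - grid a b n i)); first by rewrite ltrD2r.
rewrite grid_step -ltr_pdivlMl ?subr_gt0 //; near: n.
by apply: natSinv_lt; rewrite mulr_gt0 // invr_gt0 subr_gt0.
Unshelve. all: by end_near. Qed.

Lemma measurable_ge0_param_integral a b (X : Om -> R -> R) :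
  jointly_measurable a b X -> (forall w s, a <= s <= b -> 0 <= X w s) ->
  measurable_fun setT (fun w => \int[mu]_(s in `[a, b]) (X w s)%:E)%E.
Proof.
move=> mX X0.
pose f : Om * R -> \bar R := (fun z => (X z.1 z.2)%:E) \_ (setT `*` `[a, b]).
have mf : measurable_fun setT f.
  by apply/(measurable_restrictT _ (measurable_strip a b)); exact/measurable_EFinP.
have f0 z : (0 <= f z)%E.
  rewrite /f patchE; case: ifPn => //; rewrite inE => -[_ /=]; rewrite in_itv /= => h.
  by rewrite lee_fin X0.
have := @measurable_fun_fubini_tonelli_F _ _ Om (measurableTypeR R) R mu f mf f0; congr measurable_fun.
apply/funext => w; rewrite /fubini_F [RHS]integral_mkcond; apply: eq_integral => s _.
rewrite /f !patchE; congr (if _ then _ else _); apply/idP/idP; rewrite !inE; last by split.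
by case.
Qed.

Lemma tonelli_path_integral (P : probability Om R) a b (X : Om -> R -> R) :
  jointly_measurable a b X -> (forall w s, a <= s <= b -> 0 <= X w s) ->
  (\int[P]_w \int[mu]_(s in `[a, b]) (X w s)%:E =
   \int[mu]_(s in `[a, b]) \int[P]_w (X w s)%:E)%E.
Proof.
move=> mX X0.
pose f : Om * R -> \bar R := (fun z => (X z.1 z.2)%:E) \_ (setT `*` `[a, b]).
have mf : measurable_fun setT f.
  by apply/(measurable_restrictT _ (measurable_strip a b)); exact/measurable_EFinP.
have f0 z : (0 <= f z)%E.
  rewrite /f patchE; case: ifPn => //; rewrite inE => -[_ /=]; rewrite in_itv /= => h.
  by rewrite lee_fin X0.
have mem w s : ((w, s) \in setT `*` `[a, b]) = (s \in `[a, b]%classic).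
  by apply/idP/idP; rewrite !inE; last (by split); case.
have := @fubini_tonelli _ _ Om (measurableTypeR R) R P mu f mf f0.
move=> h; transitivity (\int[P]_x \int[mu]_y f (x, y))%E.
  apply: eq_integral => w _; rewrite integral_mkcond; apply: eq_integral => s _.
  by rewrite /f !patchE mem.
rewrite h [RHS]integral_mkcond; apply: eq_integral => s _; rewrite patchE; case: ifPn => sab.
  by apply: eq_integral => w _; rewrite /f patchE mem sab.
by rewrite integral0_eq // => w _; rewrite /f patchE mem (negbTE sab).
Qed.

Lemma tonelli_path_integral_le (P : probability Om R) a b (X : Om -> R -> R) (C : R) :
  a <= b -> jointly_measurable a b X -> (forall w s, a <= s <= b -> 0 <= X w s) ->
  (forall s, a <= s <= b -> (\int[P]_w (X w s)%:E <= C%:E)%E) ->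
  (\int[P]_w \int[mu]_(s in `[a, b]) (X w s)%:E <= (C * (b - a))%:E)%E.
Proof.
move=> ab mX X0 XC; rewrite tonelli_path_integral //.
have C0 : 0 <= C.
  rewrite -lee_fin; apply: le_trans (XC a _); last by rewrite lexx.
  by apply: integral_ge0 => w _; rewrite lee_fin X0 // lexx.
pose f : Om * R -> \bar R := (fun z => (X z.1 z.2)%:E) \_ (setT `*` `[a, b]).
have mf : measurable_fun setT f.
  by apply/(measurable_restrictT _ (measurable_strip a b)); exact/measurable_EFinP.
have f0 z : (0 <= f z)%E.
  rewrite /f patchE; case: ifPn => //; rewrite inE => -[_ /=]; rewrite in_itv /= => h.
  by rewrite lee_fin X0.
have mG := @measurable_fun_fubini_tonelli_G _ _ Om (measurableTypeR R) R P f mf f0.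
have eG s : a <= s <= b -> (\int[P]_w (X w s)%:E = fubini_G P f s)%E.
  move=> sab; apply: eq_integral => w _; rewrite /f patchE ifT //.
  by apply/mem_set; split => //=; rewrite in_itv.
have -> : (C * (b - a))%:E = (\int[mu]_(s in `[a, b]) C%:E)%E.
  rewrite integral_cst //= EFinM; congr (_ * _)%E.
  by rewrite -(fine_measure_segment ab) fineK // ge0_fin_numE // measure_segment_lty.
apply: (@ge0_le_integral _ _ _ mu `[a, b]%classic _ (fun s => \int[P]_w (X w s)%:E)%E (fun=> C%:E)) => //=.
- by move=> s; rewrite in_itv /= => sab; apply: integral_ge0 => w _; rewrite lee_fin X0.
- apply: (eq_measurable_fun (fubini_G P f)); last exact: measurable_funTS.
  by move=> s; rewrite inE /= in_itv /= => sab; rewrite eG.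
Qed.

(** The real integral is [fine] of the difference of two measurable extended integrals, so
    measurability persists across the paths where it is a default value. *)
Lemma measurable_param_integral a b (X : Om -> R -> R) :
  jointly_measurable a b X ->
  measurable_fun setT (fun w => \int[mu]_(s in `[a, b]) X w s).
Proof.
move=> mX.
have m1 : measurable_fun setT (fun w => \int[mu]_(s in `[a, b]) (Num.max (X w s) 0)%:E)%E.
  apply: measurable_ge0_param_integral; first by rewrite /jointly_measurable; meas.
  by move=> w s _; rewrite le_max lexx orbT.
have m2 : measurable_fun setT (fun w => \int[mu]_(s in `[a, b]) (Num.max (- X w s) 0)%:E)%E.
  apply: measurable_ge0_param_integral; first by rewrite /jointly_measurable; meas.
  by move=> w s _; rewrite le_max lexx orbT.
apply: (measurableT_comp (fine_measurable measurableT)).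
rewrite (_ : (fun _ => _) = (fun w => \int[mu]_(s in `[a, b]) (Num.max (X w s) 0)%:E -
    \int[mu]_(s in `[a, b]) (Num.max (- X w s) 0)%:E)%E); first exact: emeasurable_funB.
by apply/funext => w; rewrite integralE; congr (_ - _)%E; apply: eq_integral => s _;
  rewrite ?funeposE ?funenegE -?EFinN EFin_max.
Qed.

End JointMeasurability.

Section Primitive.
Context (R : realType) (T : R) (f : R -> R).
Local Notation mu := (@lebesgue_measure R).
Hypothesis fi : mu.-integrable `[0, T] (EFin \o f).

Lemma integrable_sub a b : 0 <= a -> b <= T -> mu.-integrable `[a, b] (EFin \o f).
Proof.
move=> a0 bT; apply: integrableS fi => //.
move=> x /=; rewrite !in_itv /= => /andP[ax xb].
by rewrite (le_trans a0) // (le_trans xb).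
Qed.

Lemma Rintegral_cat a b c : 0 <= a -> a <= b -> b <= c -> c <= T ->
  \int[mu]_(s in `[a, c]) f s = \int[mu]_(s in `[a, b]) f s + \int[mu]_(s in `[b, c]) f s.
Proof.
move=> a0 ab bc cT.
have iac := integrable_sub a0 cT.
have := Rintegral_itvB iac (x := b); rewrite !bnd_simp => /(_ ab bc) h.
rewrite -[X in _ = _ + X]Rintegral_itv_obnd_cbnd; last first.
  apply: integrableS iac => // x /=; rewrite !in_itv /= => /andP[bx xc].
  by apply/andP; split => //; lra.
by rewrite -h; ring.
Qed.

Lemma Rintegral_continuous : 0 <= T ->
  {within `[0, T], continuous (fun t => \int[mu]_(s in `[0, t]) f s)}.
Proof. by move=> T0; exact: parameterized_integral_continuous. Qed.

Lemma Rintegral_bound a b M : 0 <= a -> a <= b -> b <= T ->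
  (forall s, a <= s <= b -> `|f s| <= M) -> `|\int[mu]_(s in `[a, b]) f s| <= M * (b - a).
Proof.
move=> a0 ab bT fM.
have fin : (mu `[a, b] < +oo)%E by exact: measure_segment_lty.
have ic : mu.-integrable `[a, b] (fun=> M%:E) by apply: integrable_cstR.
have := @le_Rintegral_norm _ _ _ mu `[a, b]%classic (measurable_itv _) f (fun=> M) (integrable_sub a0 bT) ic.
move=> h; rewrite (le_trans (h _)) //.
rewrite Rintegral_cst; last exact: measurable_itv.
by rewrite fine_measure_segment.
Qed.

End Primitive.

(** * Ito's formula over a small step *)

(** The exact ratio is 2^(-1/2), below 3/4: bisecting an interval contracts the sum of the powers
    3/2 of the lengths. *)
Lemma sqrt_cube_half (R : realType) (x : R) : 0 <= x ->
  2 * Num.sqrt (x / 2) ^+ 3 <= 3 / 4 * Num.sqrt x ^+ 3.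
Proof.
move=> x0; set r := Num.sqrt x; set h := Num.sqrt (x / 2).
have r0 : 0 <= r by exact: sqrtr_ge0.
have h0 : 0 <= h by exact: sqrtr_ge0.
have r2 : r ^+ 2 = x by rewrite sqr_sqrtr.
have h2 : h ^+ 2 = x / 2 by rewrite sqr_sqrtr // divr_ge0.
have hr : h <= 3 / 4 * r.
  rewrite -(@ler_pXn2r _ 2) ?nnegrE ?mulr_ge0 //; rewrite exprMn r2 h2; nra.
rewrite !exprS !expr0 !mulr1 (_ : 2 * _ = x * h); last by rewrite mulrA -expr2 in h2 *; nra.
rewrite (_ : 3 / 4 * _ = x * (3 / 4 * r)); last by rewrite -r2; ring.
by rewrite ler_wpM2l.
Qed.

(** After k bisections the bound on an increment has gained a factor (3/4)^k by [sqrt_cube_half].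
    This is how local errors of order 3/2 sum up to zero. *)
Lemma cst_of_sqrt_cube (R : realType) (f : R -> R) (a b C : R) : a <= b -> 0 <= C ->
  (forall s t, a <= s -> s <= t -> t <= b -> `|f t - f s| <= C * Num.sqrt (t - s) ^+ 3) ->
  f b = f a.
Proof.
move=> ab C0 h.
have hk k s t : a <= s -> s <= t -> t <= b ->
    `|f t - f s| <= (3 / 4) ^+ k * (C * Num.sqrt (t - s) ^+ 3).
  elim: k s t => [|k IH] s t as_ st tb; first by rewrite expr0 mul1r; exact: h.
  pose u := s + (t - s) / 2.
  have su : s <= u by rewrite /u; lra.
  have ut : u <= t by rewrite /u; lra.
  have := IH _ _ as_ su (le_trans ut tb); have := IH _ _ (le_trans as_ su) ut tb.
  rewrite (_ : t - u = (t - s) / 2); last by rewrite /u; field.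
  rewrite (_ : u - s = (t - s) / 2); last by rewrite /u; field.
  have st0 : 0 <= t - s by rewrite subr_ge0.
  have := sqrt_cube_half st0.
  set r := Num.sqrt (t - s) ^+ 3; set r2 := Num.sqrt _ ^+ 3 => rr h1 h2.
  have r2p : 0 <= r2 by rewrite exprn_ge0 ?sqrtr_ge0.
  rewrite (_ : f t - f s = (f t - f u) + (f u - f s)); last by ring.
  rewrite (le_trans (ler_normD _ _)) // (le_trans (lerD h1 h2)) //.
  rewrite exprS -mulrDr -mulrA [leRHS]mulrCA ler_wpM2l ?exprn_ge0 //.
  have := ler_wpM2l C0 rr; lra.
apply/eqP; rewrite -subr_eq0 -normr_le0; apply/ler_addgt0Pl => e e0; rewrite addr0.
have [k hke] : exists k, (3 / 4) ^+ k * (C * Num.sqrt (b - a) ^+ 3) <= e.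
  have c0 : (3 / 4) ^+ k * (C * Num.sqrt (b - a) ^+ 3) @[k --> \oo] --> 0 * (C * Num.sqrt (b - a) ^+ 3).
    apply: cvgMl; apply: cvg_expr; rewrite ger0_norm //; lra.
  rewrite mul0r in c0; move/cvgrPdist_le: c0 => /(_ e e0) [k _ /(_ k (leqnn k))].
  rewrite sub0r normrN => h1; exists k; rewrite (le_trans (ler_norm _)) //.
by apply: le_trans (hk k a b _ _ _) hke.
Qed.

(** Extends a relation that is additive over adjacent intervals from the subintervals of the cells
    of a subdivision to all intervals. *)
Lemma interval_chain (R : realType) (Q : R -> R -> Prop) (tau : nat -> R) n :
  (forall i, (i < n)%N -> tau i <= tau i.+1) ->
  (forall s, Q s s) ->
  (forall s u t, tau 0%N <= s -> s <= u -> u <= t -> t <= tau n -> Q s u -> Q u t -> Q s t) ->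
  (forall i s t, (i < n)%N -> tau i <= s -> s <= t -> t <= tau i.+1 -> Q s t) ->
  forall s t, tau 0%N <= s -> s <= t -> t <= tau n -> Q s t.
Proof.
move=> tauS Q0; elim: n tauS => [|n IH] tauS Qcat Qstep s t s0 st tn.
  by rewrite (_ : t = s) //; apply/eqP; rewrite eq_le st (le_trans tn).
have le_n : tau n <= tau n.+1 by exact: tauS.
have {}IH s' t' : tau 0%N <= s' -> s' <= t' -> t' <= tau n -> Q s' t'.
  apply: IH.
  - by move=> i i_n; apply: tauS; rewrite ltnW.
  - by move=> s1 u t1 h1 h2 h3 h4; apply: Qcat => //; exact: le_trans le_n.
  - by move=> i s1 t1 i_n; apply: Qstep; rewrite ltnW.
have [tn'|nt] := leP t (tau n); first exact: IH.
have [sn|ns] := leP s (tau n); last by apply: (Qstep n) => //; exact: ltW.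
apply: (Qcat s (tau n) t) => //; [exact: ltW|exact: IH|].
by apply: (Qstep n) => //; exact: ltW.
Qed.

Lemma taylor2_lipschitz (R : realType) (f f1 f2 : R -> R) (L x y : R) :
  (forall x : R, is_derive x 1 f (f1 x)) -> (forall x : R, is_derive x 1 f1 (f2 x)) ->
  (forall x y, `|f2 x - f2 y| <= L * `|x - y|) ->
  `|f y - f x - f1 x * (y - x) - f2 x / 2 * (y - x) ^+ 2| <= L * `|y - x| ^+ 3.
Proof.
move=> d1 d2 Lip.
have L0 : 0 <= L by have := Lip 1 0; rewrite subr0 normr1 mulr1; apply: le_trans.
have e1 z : `|f1 z - f1 x - f2 x * (z - x)| <= L * `|z - x| ^+ 2.
  have d (u : R) : is_derive u 1 (fun u : R => f1 u - f1 x - f2 x * (u - x)) (f2 u - f2 x).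
    by apply: is_derive_eq; rewrite /GRing.scale /=; ring.
  have [c cz] := mvt_abs x z d; rewrite !subrr mulr0 subr0 subr0 => ->.
  rewrite normrM expr2 mulrA ler_wpM2r // (le_trans (Lip _ _)) //.
  by rewrite ler_wpM2l.
have d (u : R) : is_derive u 1 (fun u : R => f u - f x - f1 x * (u - x) - f2 x / 2 * (u - x) ^+ 2)
    (f1 u - f1 x - f2 x * (u - x)).
  by apply: is_derive_eq; rewrite /GRing.scale /= ?expr1; field.
have [c cz] := mvt_abs x y d; rewrite !subrr !expr0n /= !mulr0 !subr0 => ->.
rewrite normrM exprSr mulrA ler_wpM2r // (le_trans (e1 _)) // ler_wpM2l //.
by rewrite ler_pXn2r ?nnegrE.
Qed.

(** Yields a sample point, from which the nonnegativity of a constant dominating a random variable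
    is deduced. *)
Lemma probability_inhabited (R : realType) d (Om : measurableType d) (P : probability Om R) :
  exists w : Om, True.
Proof.
apply: contrapT => no; have : P setT = 0%E.
  by rewrite (_ : setT = set0) ?measure0 //; apply/seteqP; split => // w _; apply: no; exists w.
by rewrite probability_setT => -[] /eqP; rewrite oner_eq0.
Qed.

(** Here r is the square root of the step, y the size of the Gaussian part, YY and Yi the time
    integrals of its modulus and of its square. The mixed terms are split by r^2 y <= (r^3 + r y^2)
    / 2 and y^3 <= (r y^2 + y^4 / r) / 2, after which only even powers of y, whose moments are
    known, remain. *)
Lemma ito_step_remainder (R : realType) (k L B A D r rT y YY Yi e1 e2 : R) :
  0 <= k -> 0 <= L -> 0 <= B -> 0 <= A -> 0 <= D -> 0 < r -> r <= rT -> 0 <= y ->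
  YY <= (r * r ^+ 2 + Yi / r) / 2 ->
  e2 = k * L * B ^+ 2 + k * A ^+ 2 * k * L + k * A * k * (L * B) + k * A * k * D + k * D * B ->
  e1 = k * L * B + k * A * k * L ->
  k * L * (B ^+ 2 * (r ^+ 2) ^+ 2 + B * r ^+ 2 * y) +
  k * L * (4 * (B ^+ 3 * (r ^+ 2) ^+ 3 + y ^+ 3)) +
  k * A ^+ 2 * k * (r ^+ 2) ^+ 2 * L +
  k * A * k * r ^+ 2 * (L * (B * r ^+ 2 + y)) +
  (k * A * k * D * (r ^+ 2) ^+ 2 + k * D * (B * (r ^+ 2) ^+ 2 + YY)) <=
  (e2 * rT * r ^+ 3 + e1 / 2 * r ^+ 3 + 4 * (k * L) * (B ^+ 3 * rT ^+ 3 * r ^+ 3) + k * D / 2 * r ^+ 3) +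
  (e1 / 2 * r + 2 * (k * L) * r) * y ^+ 2 + 2 * (k * L) / r * y ^+ 4 + k * D / 2 / r * Yi.
Proof.
move=> k0 L0 B0 A0 D0 r0 rrT y0 hY e2E e1E.
have r0' := ltW r0.
have e20 : 0 <= e2 by rewrite e2E !addr_ge0 // !mulr_ge0 // ?sqr_ge0.
have e10 : 0 <= e1 by rewrite e1E !addr_ge0 // !mulr_ge0.
have h1 : 0 <= rT * r ^+ 3 - (r ^+ 2) ^+ 2.
  rewrite (_ : _ - _ = (rT - r) * r ^+ 3); last by ring.
  by rewrite mulr_ge0 ?exprn_ge0 // subr_ge0.
have h2 : 0 <= (r ^+ 3 + r * y ^+ 2) / 2 - r ^+ 2 * y.
  rewrite (_ : _ - _ = r * (r - y) ^+ 2 / 2); last by field.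
  by rewrite divr_ge0 // mulr_ge0 // sqr_ge0.
have h3 : 0 <= (r * y ^+ 2 + y ^+ 4 / r) / 2 - y ^+ 3.
  rewrite (_ : _ - _ = y ^+ 2 * (r - y) ^+ 2 / r / 2); last by field; lra.
  by rewrite !divr_ge0 // mulr_ge0 ?sqr_ge0.
have h4 : 0 <= rT ^+ 3 * r ^+ 3 - (r ^+ 2) ^+ 3.
  rewrite (_ : _ - _ = (rT ^+ 3 - r ^+ 3) * r ^+ 3); last by ring.
  by rewrite mulr_ge0 ?exprn_ge0 // subr_ge0 ler_pXn2r // nnegrE // (le_trans r0').
have h5 : 0 <= (r * r ^+ 2 + Yi / r) / 2 - YY by rewrite subr_ge0.
have g1 := mulr_ge0 e20 h1; have g2 := mulr_ge0 e10 h2.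
have kL : 0 <= 4 * (k * L) by rewrite !mulr_ge0.
have g3 := mulr_ge0 kL h3.
have g4 := mulr_ge0 (mulr_ge0 kL (exprn_ge0 3 B0)) h4.
have g5 := mulr_ge0 (mulr_ge0 k0 D0) h5.
rewrite -subr_ge0.
have := addr_ge0 (addr_ge0 (addr_ge0 g1 g2) (addr_ge0 g3 g4)) g5.
move=> /le_trans; apply; rewrite le_eqVlt; apply/orP; left; apply/eqP.
by rewrite e1E e2E; field; lra.
Qed.

(** The expectation of the previous bound: E2, E4 and EY are the expectations of y^2, y^4 and Yi, of
    orders r^2, r^4 and r^4, so every term is O(r^3). *)
Lemma ito_step_constant (R : realType) (k L B D e1 e2 r rT M c4 E2 E4 EY : R) :
  0 <= k -> 0 <= L -> 0 <= B -> 0 <= D -> 0 <= e1 -> 0 <= e2 -> 0 < r -> 0 <= rT -> 0 <= c4 ->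
  E2 <= M ^+ 2 * r ^+ 2 -> E4 <= c4 * r ^+ 4 -> EY <= M ^+ 2 * r ^+ 4 ->
  (e2 * rT * r ^+ 3 + e1 / 2 * r ^+ 3 + 4 * (k * L) * (B ^+ 3 * rT ^+ 3 * r ^+ 3) + k * D / 2 * r ^+ 3) +
  (e1 / 2 * r + 2 * (k * L) * r) * E2 + 2 * (k * L) / r * E4 + k * D / 2 / r * EY <=
  (e2 * rT + e1 * (1 + M ^+ 2) + k * L * 4 * (B ^+ 3 * rT ^+ 3 + M ^+ 2 + c4) + k * D * (1 + M ^+ 2)) * r ^+ 3.
Proof.
move=> k0 L0 B0 D0 e10 e20 r0 rT0 c40 h2 h4 hY.
have r0' := ltW r0.
have p1 : 0 <= e1 / 2 * r + 2 * (k * L) * r.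
  by rewrite addr_ge0 // !mulr_ge0.
have p2 : 0 <= 2 * (k * L) / r by rewrite divr_ge0 // !mulr_ge0.
have p3 : 0 <= k * D / 2 / r by rewrite !divr_ge0 // mulr_ge0.
have g1 := mulr_ge0 p1 (eq_ind _ is_true h2 _ (esym (subr_ge0 _ _))).
have g2 := mulr_ge0 p2 (eq_ind _ is_true h4 _ (esym (subr_ge0 _ _))).
have g3 := mulr_ge0 p3 (eq_ind _ is_true hY _ (esym (subr_ge0 _ _))).
have r30 : 0 <= r ^+ 3 by exact: exprn_ge0.
have g4 : 0 <= (e1 / 2 * (1 + M ^+ 2) + 2 * (k * L) * (M ^+ 2 + c4) + k * D / 2 * (1 + M ^+ 2)) * r ^+ 3.
  by rewrite mulr_ge0 // !addr_ge0 // !mulr_ge0 // addr_ge0 ?sqr_ge0.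
rewrite -subr_ge0.
have := addr_ge0 (addr_ge0 g1 g2) (addr_ge0 g3 g4).
move=> /le_trans; apply; rewrite le_eqVlt; apply/orP; left; apply/eqP.
by field; lra.
Qed.

(** Here [k] and [kt] are the weights at the two ends, [al] and [be] the integrals of the rate and
    of the drift, [y] the Gaussian part of the increment. Apart from the two subtracted terms, which
    have mean zero given the past, the error consists of second-order terms containing [be], the
    Taylor remainders of the function and of the weight, a product of two increments, and the cost
    of freezing the integrand. *)
Lemma ito_step_algebra (R : realType) (k kt F F1 F2 Ft al be y q dt I K1 K2 L B R3 kap : R) :
  0 <= dt -> 0 <= L -> 0 <= B -> 0 <= kap -> 0 <= K1 -> 0 <= K2 ->
  `|k| <= kap -> `|kt - k + k * al| <= K2 * dt ^+ 2 -> `|kt - k| <= K1 * dt ->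
  `|F| <= L -> `|F2| <= L ->
  `|Ft - F - F1 * (be + y) - F2 / 2 * (be + y) ^+ 2| <= L * `|be + y| ^+ 3 ->
  `|Ft - F| <= L * `|be + y| -> `|be| <= B * dt ->
  `|I - k * (F2 / 2 * (q * dt) + F1 * be - al * F)| <= R3 ->
  `|kt * Ft - k * F - I - (k * F1 * y + k * F2 / 2 * (y ^+ 2 - q * dt))| <=
  kap * L * (B ^+ 2 * dt ^+ 2 + B * dt * `|y|) +
  kap * L * (4 * (B ^+ 3 * dt ^+ 3 + `|y| ^+ 3)) + K2 * dt ^+ 2 * L +
  K1 * dt * (L * (B * dt + `|y|)) + R3.
Proof.
move=> dt0 L0 B0 kap0 K10 K20 hk hkt1 hkt hF hF2 hT hFt hbe hI.
pose r2 := Ft - F - F1 * (be + y) - F2 / 2 * (be + y) ^+ 2.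
pose r1 := kt - k + k * al.
pose r3 := I - k * (F2 / 2 * (q * dt) + F1 * be - al * F).
rewrite (_ : _ - _ = k * (F2 / 2) * (be ^+ 2 + 2 * be * y) + k * r2 + r1 * F + (kt - k) * (Ft - F) - r3); last first.
  by rewrite /r1 /r2 /r3; field.
have bdt : 0 <= B * dt by rewrite mulr_ge0.
have y0 := normr_ge0 y.
have dl : `|be + y| <= B * dt + `|y| by rewrite (le_trans (ler_normD _ _)) // lerD2r.
have dl3 : `|be + y| ^+ 3 <= 4 * (B ^+ 3 * dt ^+ 3 + `|y| ^+ 3).
  apply: (@le_trans _ _ ((B * dt + `|y|) ^+ 3)); first by rewrite ler_pXn2r ?nnegrE // addr_ge0.
  rewrite -exprMn; set u := B * dt in bdt *; set v := `|y| in y0 *.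
  rewrite -subr_ge0 (_ : _ - _ = 3 * (u + v) * (u - v) ^+ 2); last by ring.
  by rewrite mulr_ge0 ?sqr_ge0 // mulr_ge0 // addr_ge0.
have t1 : `|k * (F2 / 2) * (be ^+ 2 + 2 * be * y)| <= kap * L * (B ^+ 2 * dt ^+ 2 + B * dt * `|y|).
  rewrite normrM; apply: (@le_trans _ _ (kap * (L / 2) * ((B * dt) ^+ 2 + 2 * (B * dt) * `|y|))).
    apply: ler_pM => //.
      by rewrite normrM ler_pM // normrM (@ger0_norm _ 2^-1) // ler_wpM2r.
    rewrite (le_trans (ler_normD _ _)) // lerD //.
      by rewrite normrX ler_pXn2r ?nnegrE.
    by rewrite !normrM ger0_norm // ler_wpM2r // ler_wpM2l.
  rewrite exprMn; have : 0 <= kap * L * (B ^+ 2 * dt ^+ 2).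
    by rewrite !mulr_ge0 // sqr_ge0.
  nra.
have t2 : `|k * r2| <= kap * L * (4 * (B ^+ 3 * dt ^+ 3 + `|y| ^+ 3)).
  rewrite normrM -mulrA ler_pM // (le_trans hT) // ler_wpM2l //.
have t3 : `|r1 * F| <= K2 * dt ^+ 2 * L by rewrite normrM ler_pM.
have t4 : `|(kt - k) * (Ft - F)| <= K1 * dt * (L * (B * dt + `|y|)).
  by rewrite normrM ler_pM // (le_trans hFt) // ler_wpM2l.
rewrite (le_trans (ler_normB _ _)) // lerD //.
rewrite (le_trans (ler_normD _ _)) // lerD //.
rewrite (le_trans (ler_normD _ _)) // lerD //.
by rewrite (le_trans (ler_normD _ _)) // lerD.
Qed.

(** * Progressive processes *)

Section SigmaAlgebraInclusion.
Context (R : realType) (d : measure_display) (Omega : measurableType d)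
  (P : probability Omega R).
Hypothesis P_complete : measure_is_complete P.
Context (T : R) (m : nat) (W : Omega -> R -> 'rV[R]_m).
Hypothesis W_bm : brownian_motion P T W.
Hypothesis T_ge0 : 0 <= T.
Local Notation Ft t := (filtered P W t).
Local Notation mu := (@lebesgue_measure R).

(** For real processes this is measurability for [prog] on [0, T], as [prog_progressive] and
    [progressive_prog] show. In this form Fubini's theorem over [Ft t] makes integrals up to time t
    adapted. *)
Definition progressive (X : Omega -> R -> R) :=
  forall t, 0 <= t <= T -> @jointly_measurable _ (Ft t) R 0 t X.

Lemma jointly_measurable_filtered t a b X : t <= T ->
  @jointly_measurable _ (Ft t) R a b X -> @jointly_measurable _ Omega R a b X.
Proof.
move=> tT mX; rewrite /jointly_measurable.
have mid : @measurable_fun _ _ (Omega * R)%type (Ft t * R)%type setT id.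
  have m1 : @measurable_fun _ _ (Omega * R)%type (Ft t) setT fst.
    move=> _ B mB; have := @measurable_fst _ _ Omega R measurableT B.
    by apply; exact: (filtered_measurable P_complete W_bm tT).
  have := measurable_fun_pair m1 (@measurable_snd _ _ Omega R).
  by congr measurable_fun; apply/funext => -[].
move=> mS B mB; have := mid measurableT _ (mX (measurable_strip _ _) B mB).
by rewrite setTI.
Qed.

Lemma progressive_joint X : progressive X -> @jointly_measurable _ Omega R 0 T X.
Proof.
move=> pX; apply: (jointly_measurable_filtered (lexx T)); apply: pX.
by rewrite T_ge0 lexx.
Qed.

Lemma progressive_integral X s t : progressive X -> 0 <= s -> s <= t -> t <= T ->
  @measurable_fun _ _ (Ft t) R setT (fun w => \int[mu]_(u in `[s, t]) X w u).
Proof.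
move=> pX s0 st tT; apply: measurable_param_integral.
apply: (jointly_measurableS s0 (lexx t)); apply: pX.
by rewrite tT (le_trans s0).
Qed.

Lemma continuous_adapted_progressive (X : Omega -> R -> R) :
  continuous_adapted P T W X -> progressive X.
Proof.
move=> [cX mX] t /andP[t0 tT]; apply: caratheodory => //.
  move=> w; apply: continuous_subspaceW (cX w) => r /=; rewrite !in_itv /= => /andP[-> /=].
  by move/le_trans; exact.
move=> s /andP[s0 st]; apply: (adapted_le st); apply: mX.
by rewrite s0 (le_trans st).
Qed.

Lemma progressive_path_measurable X w : progressive X -> measurable_fun `[0, T] (X w).
Proof. by move=> /progressive_joint /jointly_measurable_path; exact. Qed.

Lemma progressive_integrable X w M : progressive X ->
  (forall s, 0 <= s <= T -> `|X w s| <= M) -> mu.-integrable `[0, T] (EFin \o X w).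
Proof.
move=> pX XM; apply: (@integrable_boundR _ _ _ mu _ _ (X w) M) => //.
- exact: measure_segment_lty.
- exact: progressive_path_measurable.
Qed.

Lemma progressiveM X Y : progressive X -> progressive Y -> progressive (fun w s => X w s * Y w s).
Proof. by move=> pX pY t tT; apply: measurable_mulf; [exact: pX|exact: pY]. Qed.

Lemma progressiveD X Y : progressive X -> progressive Y -> progressive (fun w s => X w s + Y w s).
Proof. by move=> pX pY t tT; apply: measurable_addf; [exact: pX|exact: pY]. Qed.

Lemma progressiveN X : progressive X -> progressive (fun w s => - X w s).
Proof. by move=> pX t tT; apply: measurable_oppf; exact: pX. Qed.

Lemma progressive_comp X (f : R -> R) : measurable_fun setT f -> progressive X ->
  progressive (fun w s => f (X w s)).
Proof. by move=> mf pX t tT; apply: (measurableT_comp mf (pX t tT)). Qed.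

Lemma progressive_cst (k : R) : progressive (fun _ _ => k).
Proof. by move=> t tT; exact: measurable_cst. Qed.

Lemma progressive_primitive X M : progressive X ->
  (forall w s, 0 <= s <= T -> `|X w s| <= M) ->
  continuous_adapted P T W (fun w t => \int[mu]_(u in `[0, t]) X w u).
Proof.
move=> pX XM; split.
  by move=> w; apply: Rintegral_continuous => //; exact: (progressive_integrable pX (XM w)).
by move=> t /andP[t0 tT]; exact: progressive_integral.
Qed.

End SigmaAlgebraInclusion.

Opaque expR Rintegral.

Section OneStep.
Context (R : realType) (d : measure_display) (Omega : measurableType d)
  (P : probability Omega R).
Hypothesis P_complete : measure_is_complete P.
Context (T : R) (m : nat) (W : Omega -> R -> 'rV[R]_m).
Hypothesis W_bm : brownian_motion P T W.
Hypothesis T_ge0 : 0 <= T.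
Local Notation Ft t := (filtered P W t).
Local Notation mu := (@lebesgue_measure R).
Local Notation Wc := (bm_cont T W).

Record smooth_bounded (f f1 f2 : R -> R) (L : R) : Prop := SmoothBounded {
  sb_d1 : forall x : R, is_derive x 1 f (f1 x) ;
  sb_d2 : forall x : R, is_derive x 1 f1 (f2 x) ;
  sb_f : forall x, `|f x| <= L ;
  sb_f1 : forall x, `|f1 x| <= L ;
  sb_f2 : forall x, `|f2 x| <= L ;
  sb_lip : forall x y, `|f2 x - f2 y| <= L * `|x - y| }.

Definition weight (a : Omega -> R -> R) w t := expR (- \int[mu]_(u in `[0, t]) a w u).

(** The drift that Ito's formula gives to the product of the weight and of f(x), when x has drift
    [b] and quadratic variation density [q]. *)
Definition ito_drift (f f1 f2 : R -> R) (a b q x : Omega -> R -> R) w u :=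
  weight a w u * (f2 (x w u) / 2 * q w u + f1 (x w u) * b w u - a w u * f (x w u)).

(** The stochastic integral of Ito's formula, defined as what is left after the drift. It is
    additive in the interval, and the formula to be proved is that its mean given the past
    vanishes. *)
Definition ito_error (f f1 f2 : R -> R) (a b q x : Omega -> R -> R) s t w :=
  weight a w t * f (x w t) - weight a w s * f (x w s) -
  \int[mu]_(u in `[s, t]) ito_drift f f1 f2 a b q x w u.

(* On ]s, t] the process [x] has drift [b] and a diffusion coefficient
   frozen at time [s], with square [q]. *)
Definition ito_step (M : R) (b q x : Omega -> R -> R) s t :=
  exists c : Omega -> 'rV[R]_m, [/\
    forall i, @measurable_fun _ _ (Ft s) R setT (fun w => c w 0 i),
    forall w, euclid (c w) <= M,
    forall w u, s <= u -> u <= t ->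
      x w u - x w s = \int[mu]_(r in `[s, u]) b w r + dotp (c w) (Wc w u - Wc w s) &
    forall w u, s < u -> u <= t -> q w u = euclid (c w) ^+ 2].

Context (f f1 f2 : R -> R) (L M A B : R) (a b q x : Omega -> R -> R).
Hypothesis fS : smooth_bounded f f1 f2 L.
Hypothesis M0 : 0 <= M.
Hypothesis pa : progressive P T W a.
Hypothesis pb : progressive P T W b.
Hypothesis pq : progressive P T W q.
Hypothesis xc : continuous_adapted P T W x.
Hypothesis aA : forall w s, 0 <= s <= T -> `|a w s| <= A.
Hypothesis bB : forall w s, 0 <= s <= T -> `|b w s| <= B.
Hypothesis qM : forall w s, 0 <= s <= T -> `|q w s| <= M ^+ 2.
Local Notation K := (weight a).
Local Notation I := (ito_drift f f1 f2 a b q x).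

Let L0 : 0 <= L. Proof. exact: le_trans (sb_f fS 0). Qed.

Lemma weight_cat w s t : 0 <= s -> s <= t -> t <= T ->
  K w t = K w s * expR (- \int[mu]_(u in `[s, t]) a w u).
Proof.
move=> s0 st tT; rewrite /weight -expRD; congr expR.
rewrite (@Rintegral_cat _ T _ _ 0 s t) //; first by ring.
exact: (progressive_integrable P_complete W_bm T_ge0 pa (aA w)).
Qed.

Lemma weight_gt0 w t : 0 < K w t. Proof. exact: expR_gt0. Qed.

Lemma weight_le w t : 0 <= t <= T -> K w t <= expR (A * T).
Proof.
move=> /andP[t0 tT]; rewrite ler_expR.
have ai := progressive_integrable P_complete W_bm T_ge0 pa (aA w).
have A0' : 0 <= A by apply: le_trans (aA w (s := 0) _); rewrite ?lexx.
have := Rintegral_bound ai (lexx 0) t0 tT (M := A).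
rewrite subr0 => h; apply: (@le_trans _ _ (A * t)); last by rewrite ler_wpM2l.
rewrite -normrN in h; apply: le_trans (ler_norm _) (h _).
by move=> s /andP[s0 st]; apply: aA; rewrite s0 (le_trans st).
Qed.

Lemma weight_continuous_adapted : continuous_adapted P T W K.
Proof.
have [c1 c2] := progressive_primitive P_complete W_bm T_ge0 pa aA.
split.
  move=> w; apply: within_continuousP => s sT e e0.
  have cexp : {for (- \int[mu]_(u in `[0, s]) a w u), continuous (@expR R)}.
    exact: continuous_expR.
  move/cvgrPdist_lt : cexp => /(_ e e0) [dl /= dl0 h].
  have [r r0 hr] := within_continuous_dist (c1 w) sT dl0.
  exists r => // v vT vs; rewrite distrC; apply: h => /=.
  by rewrite opprK addrC distrC -[X in `|X|]opprB normrN distrC; have := hr v vT vs; rewrite distrC.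
by move=> t tT; apply: measurable_expRf; apply: measurable_oppf; exact: c2.
Qed.

Opaque weight.

Lemma smooth_bounded_lip x1 x2 : `|f x1 - f x2| <= L * `|x1 - x2|.
Proof.
have [c _ ->] := mvt_abs x2 x1 (sb_d1 fS).
by rewrite normrM ler_wpM2r // (sb_f1 fS).
Qed.

Lemma smooth_bounded_lip1 x1 x2 : `|f1 x1 - f1 x2| <= L * `|x1 - x2|.
Proof.
have [c _ ->] := mvt_abs x2 x1 (sb_d2 fS).
by rewrite normrM ler_wpM2r // (sb_f2 fS).
Qed.

Let mf (g g1 : R -> R) : (forall x : R, is_derive x 1 g (g1 x)) -> measurable_fun setT g.
Proof.
move=> dg; apply: continuous_measurable_fun => y; have [dy _] := dg y.
by apply: differentiable_continuous; apply/derivable1_diffP.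
Qed.

Lemma measurable_smooth : [/\ measurable_fun setT f, measurable_fun setT f1 & measurable_fun setT f2].
Proof.
split; [exact: mf (sb_d1 fS)|exact: mf (sb_d2 fS)|].
apply: continuous_measurable_fun => y; apply/cvgrPdist_lt => e e0.
exists (e / (L + 1)) => /=; first by rewrite divr_gt0 // ltr_pwDr.
move=> z /= yz; rewrite (le_lt_trans (sb_lip fS _ _)) //.
apply: (@le_lt_trans _ _ ((L + 1) * `|y - z|)); first by rewrite ler_wpM2r // lerDl.
by rewrite mulrC -ltr_pdivlMr // ltr_pwDr.
Qed.

Lemma ito_drift_progressive : progressive P T W I.
Proof.
have [m0 m1 m2] := measurable_smooth.
have px := continuous_adapted_progressive xc.
have pK := continuous_adapted_progressive weight_continuous_adapted.
apply: progressiveM => //; apply: progressiveD; last first.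
  by apply: progressiveN; apply: progressiveM => //; exact: progressive_comp.
apply: progressiveD; last by apply: progressiveM => //; exact: progressive_comp.
apply: progressiveM => //; apply: progressiveM; first exact: progressive_comp.
exact: progressive_cst.
Qed.

Lemma ito_drift_bound w u : 0 <= u <= T ->
  `|I w u| <= expR (A * T) * (L / 2 * M ^+ 2 + L * B + A * L).
Proof.
move=> uT; rewrite normrM ger0_norm ?(ltW (weight_gt0 _ _)) //.
apply: ler_pM => //; first exact: ltW (weight_gt0 _ _).
  exact: weight_le.
rewrite (le_trans (ler_normB _ _)) // lerD //; last first.
  by rewrite normrM ler_pM // ?aA // (sb_f fS).
rewrite (le_trans (ler_normD _ _)) // lerD //; last first.
  by rewrite normrM ler_pM // ?bB // (sb_f1 fS).
rewrite normrM ler_pM // ?qM // normrM (@ger0_norm _ 2^-1) // ler_wpM2r //.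
exact: (sb_f2 fS).
Qed.

Lemma ito_error_cat w s r t : 0 <= s -> s <= r -> r <= t -> t <= T ->
  ito_error f f1 f2 a b q x s t w =
  ito_error f f1 f2 a b q x s r w + ito_error f f1 f2 a b q x r t w.
Proof.
move=> s0 sr rt tT.
have ii := progressive_integrable P_complete W_bm T_ge0 ito_drift_progressive (@ito_drift_bound w).
rewrite /ito_error (Rintegral_cat ii s0 sr rt tT).
have e (k1 k2 k3 i1 i2 : R) : k1 - k2 - (i1 + i2) = k3 - k2 - i1 + (k1 - k3 - i2) by ring.
exact: e.
Qed.

Lemma ito_error_measurable s t : 0 <= s -> s <= t -> t <= T ->
  @measurable_fun _ _ Omega R setT (ito_error f f1 f2 a b q x s t).
Proof.
move=> s0 st tT; have [m0 m1 m2] := measurable_smooth.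
have aK := (weight_continuous_adapted).2; have ax := xc.2.
apply: (adapted_measurable P_complete W_bm tT); apply: measurable_addf.
  have tt : 0 <= t <= T by rewrite tT (le_trans s0).
  have ss : 0 <= s <= T by rewrite s0 (le_trans st).
  apply: measurable_addf; last apply: measurable_oppf; apply: measurable_mulf.
  - exact: aK.
  - exact: (measurableT_comp m0 (ax _ tt)).
  - exact: (adapted_le st (aK _ ss)).
  - exact: (adapted_le st (measurableT_comp m0 (ax _ ss))).
have pI := ito_drift_progressive.
by apply: measurable_oppf; exact: (progressive_integral pI s0 st tT).
Qed.

Lemma ito_error_bound s t w : 0 <= s -> s <= t -> t <= T ->
  `|ito_error f f1 f2 a b q x s t w| <=
  2 * expR (A * T) * L + expR (A * T) * (L / 2 * M ^+ 2 + L * B + A * L) * T.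
Proof.
move=> s0 st tT.
have tt : 0 <= t <= T by rewrite tT (le_trans s0).
have ss : 0 <= s <= T by rewrite s0 (le_trans st).
have h r : 0 <= r <= T -> `|K w r * f (x w r)| <= expR (A * T) * L.
  move=> rT; rewrite normrM ler_pM // ?(sb_f fS) //.
  by rewrite ger0_norm ?(ltW (weight_gt0 _ _)) // weight_le.
rewrite (le_trans (ler_normB _ _)) // lerD //.
  rewrite (le_trans (ler_normB _ _)) // -mulrA mulr_natl mulr2n lerD // h //.
have ii := progressive_integrable P_complete W_bm T_ge0 ito_drift_progressive (@ito_drift_bound w).
have hb : forall r, s <= r <= t -> `|I w r| <= expR (A * T) * (L / 2 * M ^+ 2 + L * B + A * L).
  move=> r /andP[sr rt]; apply: ito_drift_bound.
  by rewrite (le_trans s0 sr) (le_trans rt).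
have := Rintegral_bound ii s0 st tT hb.
move=> /le_trans; apply; apply: ler_wpM2l; last by lra.
by apply: le_trans (hb s _); rewrite ?lexx.
Qed.

Lemma expR_taylor_neg (y Y : R) : `|y| <= Y -> `|expR (- y) - 1 + y| <= y ^+ 2 * expR Y /\
  `|expR (- y) - 1| <= `|y| * expR Y.
Proof.
move=> yY; have eY : expR `|y| <= expR Y by rewrite ler_expR.
split.
  have := expR_taylor1 (- y); rewrite opprK normrN => /le_trans; apply.
  by rewrite real_normK ?num_real // ler_wpM2l // sqr_ge0.
by have := expR_taylor0 (- y); rewrite normrN => /le_trans; apply; rewrite ler_wpM2l.
Qed.

Let y_ w s u := x w u - x w s - \int[mu]_(r in `[s, u]) b w r.

(** A statement on one path, in which [y_] is the increment of x without its drift. As soon as [y_]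
    has the size of the square root of t - s, every term on the right is of order 3/2 at least. *)
Lemma ito_step_pathwise w s t (c : 'rV[R]_m) : 0 <= s -> s < t -> t <= T ->
  0 <= A -> 0 <= B ->
  (forall u, s < u -> u <= t -> q w u = euclid c ^+ 2) ->
  {within `[s, t], continuous (y_ w s)} ->
  `|ito_error f f1 f2 a b q x s t w -
    (K w s * f1 (x w s) * y_ w s t +
     K w s * f2 (x w s) / 2 * (y_ w s t ^+ 2 - euclid c ^+ 2 * (t - s)))| <=
  let kap := expR (A * T) in
  kap * L * (B ^+ 2 * (t - s) ^+ 2 + B * (t - s) * `|y_ w s t|) +
  kap * L * (4 * (B ^+ 3 * (t - s) ^+ 3 + `|y_ w s t| ^+ 3)) +
  kap * A ^+ 2 * kap * (t - s) ^+ 2 * L +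
  kap * A * kap * (t - s) * (L * (B * (t - s) + `|y_ w s t|)) +
  (kap * A * kap * (L / 2 * M ^+ 2 + L * B + A * L) * (t - s) ^+ 2 +
   kap * (L / 2 * M ^+ 2 + L * B + A * L) *
     (B * (t - s) ^+ 2 + \int[mu]_(u in `[s, t]) `|y_ w s u|)).
Proof.
move=> s0 st tT A0 B0 qc yc.
have st' := ltW st; have sT : s <= T by exact: le_trans tT.
have ss : 0 <= s <= T by rewrite s0.
have inT u : s <= u <= t -> 0 <= u <= T.
  by move=> /andP[su ut]; rewrite (le_trans s0 su) (le_trans ut).
set kap := expR (A * T).
have kap1 : 1 <= kap by rewrite -expR0 ler_expR mulr_ge0.
have kap0 : 0 <= kap by rewrite expR_ge0.
have T0 : 0 <= T by [].
have ai := progressive_integrable P_complete W_bm T_ge0 pa (aA w).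
have bi := progressive_integrable P_complete W_bm T_ge0 pb (bB w).
have alb u : s <= u <= t -> `|\int[mu]_(r in `[s, u]) a w r| <= A * (u - s).
  move=> /andP[su ut]; apply: (Rintegral_bound ai s0 su (le_trans ut tT)) => r /andP[sr ru].
  by apply: aA; rewrite (le_trans s0 sr) (le_trans ru) // (le_trans ut).
have beb u : s <= u <= t -> `|\int[mu]_(r in `[s, u]) b w r| <= B * (u - s).
  move=> /andP[su ut]; apply: (Rintegral_bound bi s0 su (le_trans ut tT)) => r /andP[sr ru].
  by apply: bB; rewrite (le_trans s0 sr) (le_trans ru) // (le_trans ut).
have kK : `|K w s| <= kap by rewrite ger0_norm ?(ltW (weight_gt0 _ _)) //; exact: weight_le.
have Ku u : s <= u <= t -> `|K w u - K w s| <= kap * A * kap * (u - s) /\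
    `|K w u - K w s + K w s * \int[mu]_(r in `[s, u]) a w r| <= kap * A ^+ 2 * kap * (u - s) ^+ 2.
  move=> su; have /andP[h1 h2] := su; rewrite (weight_cat w s0 h1 (le_trans h2 tT)).
  set al := \int[mu]_(r in `[s, u]) _.
  have alA : `|al| <= A * (u - s) by exact: alb.
  have us : 0 <= u - s by rewrite subr_ge0.
  have alAT : `|al| <= A * T by rewrite (le_trans alA) // ler_wpM2l //; lra.
  have [e1 e2] := expR_taylor_neg alAT.
  split.
    rewrite (_ : _ - _ = K w s * (expR (- al) - 1)); last by ring.
    rewrite normrM -!mulrA ler_pM // (le_trans e2) // -/kap.
    by rewrite (mulrC kap) mulrA ler_wpM2r.
  rewrite (_ : _ + _ = K w s * (expR (- al) - 1 + al)); last by ring.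
  rewrite (_ : _ * (u - s) ^+ 2 = kap * (A ^+ 2 * (u - s) ^+ 2 * kap)); last by ring.
  rewrite normrM ler_pM // (le_trans e1) // -/kap ler_wpM2r //.
  by rewrite -exprMn -real_normK ?num_real // ler_pXn2r ?nnegrE ?mulr_ge0.
have xs u : s <= u <= t -> x w u - x w s = \int[mu]_(r in `[s, u]) b w r + y_ w s u.
  by move=> _; rewrite /y_; ring.
have st2 : s <= t <= t by rewrite st' lexx.
(* The integrand with weight, state and diffusion frozen at time s; rate and drift keep their time
   dependence and integrate to the quantities of [ito_step_algebra]. *)
pose I0 u := K w s * (f2 (x w s) / 2 * euclid c ^+ 2 + f1 (x w s) * b w u - a w u * f (x w s)).
have qcM : euclid c ^+ 2 <= M ^+ 2.
  by rewrite -(qc t st (lexx _)) (le_trans (ler_norm _)) // qM // (le_trans s0 st').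
have Ibd u : s < u -> u <= t -> `|I w u - I0 u| <= kap * A * kap * (L / 2 * M ^+ 2 + L * B + A * L) * (t - s) +
    kap * (L / 2 * M ^+ 2 + L * B + A * L) * (B * (t - s) + `|y_ w s u|).
  move=> su ut; have su' := ltW su; have sut : s <= u <= t by rewrite su'.
  rewrite /ito_drift /I0 (qc u su ut).
  set Q := euclid c ^+ 2 in qcM *.
  have Q0 : 0 <= Q by rewrite sqr_ge0.
  pose D := L / 2 * M ^+ 2 + L * B + A * L.
  have bu := bB w (inT u sut); have au := aA w (inT u sut).
  set bb := b w u in bu *; set aa := a w u in au *.
  set x1 := x w u; set x0 := x w s.
  pose G z := f2 z / 2 * Q + f1 z * bb - aa * f z.
  rewrite -/(G x1) -/(G x0).
  have GD z : `|G z| <= D.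
    rewrite (le_trans (ler_normB _ _)) // lerD //; last by rewrite normrM ler_pM // (sb_f fS).
    rewrite (le_trans (ler_normD _ _)) // lerD //; last by rewrite normrM ler_pM // (sb_f1 fS).
    rewrite (normrM _ Q) (normrM (f2 z)) (@ger0_norm _ 2^-1) // (ger0_norm Q0) ler_pM // ?mulr_ge0 // ler_wpM2r //.
    exact: (sb_f2 fS).
  have GL : `|G x1 - G x0| <= D * `|x1 - x0|.
    rewrite (_ : _ - _ = (f2 x1 - f2 x0) / 2 * Q + (f1 x1 - f1 x0) * bb - aa * (f x1 - f x0)); last by rewrite /G; ring.
    rewrite /D [leRHS]mulrDl [X in _ <= X + _]mulrDl (le_trans (ler_normB _ _)) // lerD //; last first.
      rewrite normrM -mulrA ler_pM //; exact: smooth_bounded_lip.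
    rewrite (le_trans (ler_normD _ _)) // lerD //; last first.
      rewrite normrM mulrAC ler_pM //; exact: smooth_bounded_lip1.
    rewrite (normrM _ Q) (normrM (f2 x1 - f2 x0)) (@ger0_norm _ 2^-1) // (ger0_norm Q0) (mulrAC _ (M ^+ 2)) ler_pM // ?mulr_ge0 //.
    by rewrite mulrAC ler_wpM2r //; exact: (sb_lip fS).
  have D0 : 0 <= D by exact: le_trans (GD 0).
  have [Ku1 _] := Ku u sut.
  have e (k1 k2 g1 g2 : R) : k1 * g1 - k2 * g2 = (k1 - k2) * g1 + k2 * (g1 - g2) by ring.
  rewrite e.
  rewrite (le_trans (ler_normD _ _)) // lerD //.
    rewrite normrM -/D mulrAC ler_pM // (le_trans Ku1) // ler_wpM2l ?mulr_ge0 //; lra.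
  rewrite normrM -/D -mulrA ler_pM // (le_trans GL) // ler_wpM2l //.
  rewrite xs // (le_trans (ler_normD _ _)) // lerD2r (le_trans (beb u sut)) // ler_wpM2l //; lra.
have Ifr : `|\int[mu]_(u in `[s, t]) I w u - K w s * (f2 (x w s) / 2 * (euclid c ^+ 2 * (t - s)) +
     f1 (x w s) * \int[mu]_(u in `[s, t]) b w u - (\int[mu]_(u in `[s, t]) a w u) * f (x w s))| <=
   kap * A * kap * (L / 2 * M ^+ 2 + L * B + A * L) * (t - s) ^+ 2 +
   kap * (L / 2 * M ^+ 2 + L * B + A * L) *
     (B * (t - s) ^+ 2 + \int[mu]_(u in `[s, t]) `|y_ w s u|).
  have mst : measurable (`[s, t]%classic : set R) by exact: measurable_itv.
  have Ii := progressive_integrable P_complete W_bm T_ge0 ito_drift_progressive (@ito_drift_bound w).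
  have Ii' := integrable_sub Ii s0 tT.
  have ai' := integrable_sub ai s0 tT; have bi' := integrable_sub bi s0 tT.
  have muf : (mu `[s, t] < +oo)%E by exact: measure_segment_lty.
  have yi : mu.-integrable `[s, t] (fun u => `|y_ w s u|%:E).
    have [Y Y0 hY] := within_continuous_bounded yc.
    apply: (@integrable_boundR _ _ _ mu _ mst _ Y) => //.
      by apply: measurable_normf; exact: subspace_continuous_measurable_fun.
    by move=> u /=; rewrite in_itv /= normr_id; exact: hY.
  have ci k : mu.-integrable `[s, t] (fun=> k%:E) by exact: integrable_cstR.
  have e0 : K w s * (f2 (x w s) / 2 * (euclid c ^+ 2 * (t - s)) +
     f1 (x w s) * \int[mu]_(u in `[s, t]) b w u - (\int[mu]_(u in `[s, t]) a w u) * f (x w s)) =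
     \int[mu]_(u in `[s, t]) I0 u.
    have j2 : mu.-integrable `[s, t] (fun u => (f1 (x w s) * b w u)%:E) by exact: integrableZR.
    have j3 : mu.-integrable `[s, t] (fun u => (a w u * f (x w s))%:E).
      rewrite (_ : (fun u => _) = (fun u => (f (x w s) * a w u)%:E)); first exact: integrableZR.
      by apply/funext => u; rewrite mulrC.
    have j1 : mu.-integrable `[s, t] (fun u => (f2 (x w s) / 2 * euclid c ^+ 2)%:E) by exact: ci.
    have j4 : mu.-integrable `[s, t] (fun u => (f2 (x w s) / 2 * euclid c ^+ 2 + f1 (x w s) * b w u)%:E).
      exact: integrableDR.
    rewrite /I0 RintegralZl //; last exact: integrableBR.
    rewrite RintegralB // RintegralD // Rintegral_cst // RintegralZl // RintegralZr //.
    by rewrite fine_measure_segment // mulrA.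
  have I0i : mu.-integrable `[s, t] (fun u => (I0 u)%:E).
    apply: integrableZR => //; apply: integrableBR => //.
      by apply: integrableDR => //; exact: integrableZR.
    rewrite (_ : (fun u => _) = (fun u => (f (x w s) * a w u)%:E)); first exact: integrableZR.
    by apply/funext => u; rewrite mulrC.
  rewrite e0 -RintegralB //.
  pose c1 := kap * A * kap * (L / 2 * M ^+ 2 + L * B + A * L) * (t - s).
  pose c2 := kap * (L / 2 * M ^+ 2 + L * B + A * L).
  have ni : mu.-integrable `[s, t] (fun u => (c1 + c2 * (B * (t - s) + `|y_ w s u|))%:E).
    by apply: integrableDR => //; apply: integrableZR => //; exact: integrableDR.
  have IIi : mu.-integrable `[s, t] (fun u => (I w u - I0 u)%:E) by exact: integrableBR.
  have sub : (`]s, t] `<=` `[s, t])%classic.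
    by move=> u /=; rewrite !in_itv /= => /andP[/ltW -> ->].
  have ni' : mu.-integrable `]s, t] (fun u => (c1 + c2 * (B * (t - s) + `|y_ w s u|))%:E).
    by apply: integrableS ni => //; exact: measurable_itv.
  have IIi' : mu.-integrable `]s, t] (fun u => (I w u - I0 u)%:E).
    by apply: integrableS IIi => //; exact: measurable_itv.
  rewrite -(Rintegral_itv_obnd_cbnd IIi').
  have le1 : forall u, (`]s, t]%classic : set R) u -> `|I w u - I0 u| <= c1 + c2 * (B * (t - s) + `|y_ w s u|).
    by move=> u /=; rewrite in_itv /= => /andP[su ut]; exact: Ibd.
  rewrite (le_trans (le_Rintegral_norm _ IIi' ni' le1)) //.
  have ic1 := ci c1; have ic3 := ci (B * (t - s)).
  have ic4 : mu.-integrable `[s, t] (fun u => (B * (t - s) + `|y_ w s u|)%:E) by exact: integrableDR.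
  have ic5 : mu.-integrable `[s, t] (fun u => (c2 * (B * (t - s) + `|y_ w s u|))%:E) by exact: integrableZR.
  rewrite (Rintegral_itv_obnd_cbnd ni') RintegralD // RintegralZl //.
  rewrite RintegralD // !Rintegral_cst // !fine_measure_segment //.
  rewrite /c1 /c2 le_eqVlt; apply/orP; left; apply/eqP.
  by move: (\int[mu]_(_ in _) _) => Y; ring.
have [Ku1 Ku2] := Ku t st2.
have ts0 : 0 <= t - s by rewrite subr_ge0.
have dl : x w t - x w s = \int[mu]_(r in `[s, t]) b w r + y_ w s t by exact: xs.
have := @ito_step_algebra R (K w s) (K w t) (f (x w s)) (f1 (x w s)) (f2 (x w s)) (f (x w t))
  (\int[mu]_(u in `[s, t]) a w u) (\int[mu]_(u in `[s, t]) b w u) (y_ w s t) (euclid c ^+ 2) (t - s)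
  (\int[mu]_(u in `[s, t]) I w u) (kap * A * kap) (kap * A ^+ 2 * kap) L B _ kap ts0 L0 B0 kap0.
apply => //.
- by rewrite !mulr_ge0.
- by rewrite !mulr_ge0 // sqr_ge0.
- exact: (sb_f fS).
- exact: (sb_f2 fS).
- rewrite -dl; exact: (taylor2_lipschitz _ _ (sb_d1 fS) (sb_d2 fS) (sb_lip fS)).
- rewrite -dl; exact: smooth_bounded_lip.
- exact: beb.
Qed.

Let y_path w s : 0 <= s -> s <= T -> continuous_adapted P T W x ->
  {within `[s, T], continuous (y_ w s)}.
Proof.
move=> s0 sT [cx _].
have bi := progressive_integrable P_complete W_bm T_ge0 pb (bB w).
have cb := parameterized_integral_continuous sT (integrable_sub bi s0 (lexx T)).
have cx' : {within `[s, T], continuous (x w)}.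
  apply: continuous_subspaceW (cx w) => r /=; rewrite !in_itv /= => /andP[sr ->].
  by rewrite (le_trans s0 sr).
apply: within_continuousP => u usT e e0.
have e2 : 0 < e / 2 by rewrite divr_gt0.
have [d1 d10 h1] := within_continuous_dist cx' usT e2.
have [d2 d20 h2] := within_continuous_dist cb usT e2.
exists (Num.min d1 d2); first by rewrite lt_min d10.
move=> r rsT; rewrite lt_min => /andP[/(h1 _ rsT) k1 /(h2 _ rsT)].
rewrite /parameterized_integral => k2.
rewrite /y_ (_ : _ - _ = (x w r - x w u) - (\int[mu]_(t in `[s, r]) b w t - \int[mu]_(t in `[s, u]) b w t)); last by ring.
by rewrite (le_lt_trans (ler_normB _ _)) //; lra.
Qed.

(* The one-step error is of order 3/2: conditionally on the past the increment
   of [x] is Gaussian up to the drift, and the second order term of Taylor's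
   formula has the right mean. *)
Lemma ito_error_step : 0 <= A -> 0 <= B -> exists2 C, 0 <= C &
  forall s t (z : Omega -> R) Mz, 0 <= s -> s < t -> t <= T ->
    ito_step M b q x s t ->
    @measurable_fun _ _ (Ft s) R setT z -> (forall w, `|z w| <= Mz) ->
    `|\int[P]_w (z w * ito_error f f1 f2 a b q x s t w)| <=
    Mz * C * Num.sqrt (t - s) ^+ 3.
Proof.
move=> A0 B0.
pose kap := expR (A * T); pose D := L / 2 * M ^+ 2 + L * B + A * L.
pose c4 := M ^+ 4 * m%:R ^+ 2 * (48 * expR 1).
pose rT := Num.sqrt T.
pose e2 := kap * L * B ^+ 2 + kap * A ^+ 2 * kap * L + kap * A * kap * (L * B) + kap * A * kap * D + kap * D * B.
pose e1 := kap * L * B + kap * A * kap * L.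
pose C := e2 * rT + e1 * (1 + M ^+ 2) + kap * L * 4 * (B ^+ 3 * rT ^+ 3 + M ^+ 2 + c4) + kap * D * (1 + M ^+ 2).
have kap0 : 0 <= kap by rewrite expR_ge0.
have D0 : 0 <= D by rewrite /D !addr_ge0 // !mulr_ge0 // sqr_ge0.
have c40 : 0 <= c4 by rewrite /c4 !mulr_ge0 // ?expR_ge0 ?sqr_ge0 ?exprn_even_ge0.
have rT0 : 0 <= rT by exact: sqrtr_ge0.
have e20 : 0 <= e2 by rewrite /e2 !addr_ge0 // !mulr_ge0 // ?sqr_ge0.
have e10 : 0 <= e1 by rewrite /e1 !addr_ge0 // !mulr_ge0.
have C0 : 0 <= C by rewrite /C !addr_ge0 // !mulr_ge0 // ?addr_ge0 ?mulr_ge0 ?exprn_ge0.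
exists C => // s t z Mz s0 st tT [c [mc cM xE qE]] mz zM.
have st' := ltW st; have sT : s <= T by exact: le_trans tT.
have ss : 0 <= s <= T by rewrite s0.
pose ry := Num.sqrt (t - s).
have dt0 : 0 < t - s by rewrite subr_gt0.
have r0 : 0 < ry by rewrite sqrtr_gt0.
have r2 : t - s = ry ^+ 2 by rewrite sqr_sqrtr // ltW.
have rrT : ry <= rT by rewrite ler_sqrt // (le_trans _ tT) // gerBl.
pose G w u := Wc w u - Wc w s.
have yE w u : s <= u -> u <= t -> y_ w s u = dotp (c w) (G w u).
  by move=> su ut; rewrite /y_ xE // addrC addKr.
have zM0 (w : Omega) : 0 <= Mz by exact: le_trans (zM w).
have m012 := measurable_smooth; have [m0 m1 m2] := m012.
have aK := weight_continuous_adapted.2; have ax := xc.2.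
have kK w : `|K w s| <= kap by rewrite ger0_norm ?(ltW (weight_gt0 _ _)) //; exact: weight_le.
pose z1 w := z w * (K w s * f1 (x w s)).
pose z2 w := z w * (K w s * f2 (x w s) / 2).
have mz1 : @measurable_fun _ _ (Ft s) R setT z1.
  apply: measurable_mulf => //; apply: measurable_mulf; first exact: aK.
  exact: (measurableT_comp m1 (ax _ ss)).
have mz2 : @measurable_fun _ _ (Ft s) R setT z2.
  apply: measurable_mulf => //; apply: measurable_mulf; last exact: measurable_cst.
  apply: measurable_mulf; first exact: aK.
  exact: (measurableT_comp m2 (ax _ ss)).
have z1M w : `|z1 w| <= Mz * (kap * L).
  by rewrite normrM ler_pM // normrM ler_pM // (sb_f1 fS).
have z2M w : `|z2 w| <= Mz * (kap * L / 2).
  rewrite normrM ler_pM // normrM (@ger0_norm _ 2^-1) // ler_wpM2r // normrM ler_pM //.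
  exact: (sb_f2 fS).
have [i1 E1 _ _] := increment_dotp P_complete W_bm s0 st tT mc cM mz1 z1M.
have [_ _ i2 E2] := increment_dotp P_complete W_bm s0 st tT mc cM mz2 z2M.
have [_ _ i3 E3] := increment_dotp P_complete W_bm s0 st tT mc cM (@measurable_cst _ _ _ _ setT (1 : R)) (Mz := 1) (fun w => ltac:(by rewrite /= normr1)).
have [i4 E4] := increment_dotp4 P_complete W_bm s0 st tT mc cM.
have sig := @measurable_itv R `[s, t].
pose Yi w := \int[mu]_(u in `[s, t]) (y_ w s u ^+ 2).
have ycont w : {within `[s, t], continuous (y_ w s)}.
  apply: continuous_subspaceW (y_path (w := w) s0 sT xc) => r /=; rewrite !in_itv /= => /andP[-> rt].
  exact: le_trans tT.
have jy : @jointly_measurable _ Omega R s t (fun w u => y_ w s u).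
  apply: caratheodory => // u /andP[su ut].
  have uT := le_trans ut tT.
  apply: (adapted_measurable P_complete W_bm uT); apply: measurable_addf; last first.
    by apply: measurable_oppf; exact: (progressive_integral pb s0 su uT).
  apply: measurable_addf; first by apply: ax; rewrite uT (le_trans s0).
  by apply: measurable_oppf; apply: (adapted_le su); exact: ax.
have jy2 : @jointly_measurable _ Omega R s t (fun w u => y_ w s u ^+ 2) by exact: measurable_exprf.
have y2i w : mu.-integrable `[s, t] (fun u => (y_ w s u ^+ 2)%:E).
  have [Y Y0 hY] := within_continuous_bounded (ycont w).
  apply: (@integrable_boundR _ _ _ mu _ _ _ (Y ^+ 2)) => //; first exact: measure_segment_lty.
    exact: (jointly_measurable_path w jy2).
  by move=> u /=; rewrite in_itv /= => su; rewrite normrX ler_pXn2r ?nnegrE // hY.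
have cM2 w : euclid (c w) ^+ 2 <= M ^+ 2 by rewrite ler_pXn2r ?nnegrE ?euclid_ge0.
have Ey2 u : s < u -> u <= t -> P.-integrable setT (fun w => (y_ w s u ^+ 2)%:E) /\
    \int[P]_w (y_ w s u ^+ 2) <= M ^+ 2 * ry ^+ 2.
  move=> su ut; have uT := le_trans ut tT.
  have := increment_dotp P_complete W_bm s0 su uT mc cM (@measurable_cst _ _ _ _ setT (1 : R)) (Mz := 1).
  move=> [|_ _ j3 F3]; first by move=> w; rewrite /= normr1.
  have e w : y_ w s u ^+ 2 = cst 1 w * dotp (c w) (Wc w u - Wc w s) ^+ 2.
    by rewrite mul1r yE // ltW.
  split; first by under [X in _.-integrable _ X]eq_fun do rewrite e.
  under eq_Rintegral do rewrite e.
  have ci : P.-integrable setT (fun w => (cst 1 w * euclid (c w) ^+ 2)%:E).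
    apply: (@integrable_boundR _ _ _ P _ _ _ (M ^+ 2)) => //; first by rewrite (le_lt_trans (probability_le1 _ _)) ?ltry.
      apply: measurable_mulf; first exact: measurable_cst.
      rewrite (_ : (fun _ => _) = (fun w => \sum_i c w 0 i * c w 0 i)); last by apply/funext => w; rewrite sqr_euclid.
      by apply: measurable_sum => i; apply: measurable_mulf; exact: (adapted_measurable P_complete W_bm sT).
    by move=> w _; rewrite mul1r ger0_norm ?sqr_ge0.
  rewrite F3 mulrC ler_pM ?subr_ge0 ?(ltW su) //.
  - by apply: Rintegral_ge0 => w _; rewrite mul1r sqr_ge0.
  - apply: (@le_trans _ _ (\int[P]_w (M ^+ 2))).
      apply: le_Rintegral => //; last by move=> w _; rewrite mul1r.
      by apply: integrable_cstR => //; rewrite (le_lt_trans (probability_le1 _ _)) ?ltry.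
    by rewrite Rintegral_cst // (_ : fine (P setT) = 1) ?mulr1 // probability_setT.
  - by rewrite -r2 lerD2r.
have Yi0 w : 0 <= Yi w by apply: Rintegral_ge0 => u _; exact: sqr_ge0.
have mYi : @measurable_fun _ _ Omega R setT Yi by exact: measurable_param_integral.
have EYi : (\int[P]_w (Yi w)%:E <= (M ^+ 2 * ry ^+ 4)%:E)%E.
  have -> : (\int[P]_w (Yi w)%:E = \int[P]_w \int[mu]_(u in `[s, t]) (y_ w s u ^+ 2)%:E)%E.
    by apply: eq_integral => w _; rewrite /Yi -integral_EFinR.
  rewrite (_ : M ^+ 2 * ry ^+ 4 = M ^+ 2 * ry ^+ 2 * (t - s)); last by rewrite r2; ring.
  apply: tonelli_path_integral_le => //; first by move=> w u _; exact: sqr_ge0.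
  move=> u /andP[su ut]; have [su'|us] := ltP s u.
    by have [j1 j2] := Ey2 u su' ut; rewrite integral_EFinR // lee_fin.
  have -> : u = s by apply/eqP; rewrite eq_le us su.
  rewrite integral0_eq ?lee_fin ?mulr_ge0 ?sqr_ge0 ?(ltW r0) // => w _.
  by rewrite /y_ set_itv1 Rintegral_set1 subrr subr0 expr0n.
have Yint : P.-integrable setT (fun w => (Yi w)%:E).
  apply/integrableP; split; first exact/measurable_EFinP.
  under eq_integral do rewrite gee0_abs ?lee_fin //.
  by rewrite (le_lt_trans EYi) // ltry.
have EYiR : \int[P]_w Yi w <= M ^+ 2 * ry ^+ 4 by rewrite -lee_fin -integral_EFinR.
have [iy2 Ey2t] := Ey2 t st (lexx t).
have iy4 : P.-integrable setT (fun w => (y_ w s t ^+ 4)%:E).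
  by under [X in _.-integrable _ X]eq_fun do rewrite yE //.
have Ey4 : \int[P]_w (y_ w s t ^+ 4) <= c4 * ry ^+ 4.
  under eq_Rintegral do rewrite yE //.
  by rewrite (le_trans E4) // r2 -exprM.
pose Err := ito_error f f1 f2 a b q x s t.
(* The part of the weighted error that is not small but has mean zero: its first term by [E1], its
   second because [E2] identifies the compensator of the square. *)
pose Lin w := z1 w * y_ w s t + (z2 w * y_ w s t ^+ 2 - (t - s) * (z2 w * euclid (c w) ^+ 2)).
have PT : (P setT < +oo)%E by rewrite (le_lt_trans (probability_le1 _ _)) ?ltry.
have ic2 : P.-integrable setT (fun w => (z2 w * euclid (c w) ^+ 2)%:E).
  apply: (@integrable_boundR _ _ _ P _ _ _ (Mz * (kap * L / 2) * M ^+ 2)) => //.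
    apply: measurable_mulf; first exact: (adapted_measurable P_complete W_bm sT).
    rewrite (_ : (fun _ => _) = (fun w => \sum_i c w 0 i * c w 0 i)); last by apply/funext => w; rewrite sqr_euclid.
    by apply: measurable_sum => i; apply: measurable_mulf; exact: (adapted_measurable P_complete W_bm sT).
  by move=> w _; rewrite normrM ler_pM // ger0_norm ?sqr_ge0.
have i1' : P.-integrable setT (fun w => (z1 w * y_ w s t)%:E).
  by under [X in _.-integrable _ X]eq_fun do rewrite yE //.
have i2' : P.-integrable setT (fun w => (z2 w * y_ w s t ^+ 2)%:E).
  by under [X in _.-integrable _ X]eq_fun do rewrite yE //.
have ic2' : P.-integrable setT (fun w => ((t - s) * (z2 w * euclid (c w) ^+ 2))%:E) by exact: integrableZR.
have i3' : P.-integrable setT (fun w => (z2 w * y_ w s t ^+ 2 - (t - s) * (z2 w * euclid (c w) ^+ 2))%:E) by exact: integrableBR.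
have iLin : P.-integrable setT (fun w => (Lin w)%:E) by exact: integrableDR.
have ELin : \int[P]_w Lin w = 0.
  rewrite /Lin RintegralD // RintegralB // RintegralZl //.
  rewrite -E2 (_ : \int[P]_w (z1 w * y_ w s t) = \int[P]_w (z1 w * dotp (c w) (Wc w t - Wc w s))); last first.
    by apply: eq_Rintegral => w _; rewrite yE.
  rewrite E1 add0r (_ : \int[P]_w (z2 w * y_ w s t ^+ 2) = \int[P]_w (z2 w * dotp (c w) (Wc w t - Wc w s) ^+ 2)) ?subrr //.
  by apply: eq_Rintegral => w _; rewrite yE.
have mErr : @measurable_fun _ _ Omega R setT Err by exact: ito_error_measurable.
have iErr : P.-integrable setT (fun w => (z w * Err w)%:E).
  apply: (@integrable_boundR _ _ _ P _ _ _ (Mz * (2 * expR (A * T) * L + expR (A * T) * (L / 2 * M ^+ 2 + L * B + A * L) * T))) => //.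
    by apply: measurable_mulf => //; exact: (adapted_measurable P_complete W_bm sT).
  by move=> w _; rewrite normrM ler_pM //; exact: ito_error_bound.
pose k0 := e2 * rT * ry ^+ 3 + e1 / 2 * ry ^+ 3 + 4 * (kap * L) * (B ^+ 3 * rT ^+ 3 * ry ^+ 3) + kap * D / 2 * ry ^+ 3.
pose k1 := e1 / 2 * ry + 2 * (kap * L) * ry.
pose k2 := 2 * (kap * L) / ry.
pose k3 := kap * D / 2 / ry.
pose Bd w := k0 + k1 * y_ w s t ^+ 2 + k2 * y_ w s t ^+ 4 + k3 * Yi w.
have young u : 0 <= u -> u <= (ry + u ^+ 2 / ry) / 2.
  move=> u0; rewrite -subr_ge0 (_ : _ - _ = (ry - u) ^+ 2 / (2 * ry)); last by field; rewrite lt0r_neq0.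
  by rewrite divr_ge0 ?sqr_ge0 // mulr_ge0 // ltW.
have rem w : `|z w * Err w - Lin w| <= Mz * Bd w.
  rewrite (_ : z w * Err w - Lin w = z w * (Err w - (K w s * f1 (x w s) * y_ w s t +
     K w s * f2 (x w s) / 2 * (y_ w s t ^+ 2 - euclid (c w) ^+ 2 * (t - s))))); last first.
    rewrite /Lin /z1 /z2; move: (Err w) (K w s) (f1 _) (f2 _) => g1 g2 g3 g4.
    move: (y_ w s t) (z w) (euclid _ ^+ 2) => g5 g6 g7; by field.
  rewrite normrM ler_pM //.
  have := @ito_step_pathwise w s t (c w) s0 st tT A0 B0 (fun u h1 h2 => qE w u h1 h2) (ycont w).
  rewrite -/Err => /le_trans; apply; rewrite /= -/kap -/D.
  have Yabs : \int[mu]_(u in `[s, t]) `|y_ w s u| <= (ry * (t - s) + Yi w / ry) / 2.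
    have j1 : mu.-integrable `[s, t] (fun u => `|y_ w s u|%:E).
      have [Y Y0 hY] := within_continuous_bounded (ycont w).
      apply: (@integrable_boundR _ _ _ mu _ _ _ Y) => //; first exact: measure_segment_lty.
        by apply: measurable_normf; exact: (jointly_measurable_path w jy).
      by move=> u /=; rewrite in_itv /= normr_id; exact: hY.
    have j2 : mu.-integrable `[s, t] (fun u => (ry / 2)%:E).
      by apply: integrable_cstR => //; exact: measure_segment_lty.
    have j3 : mu.-integrable `[s, t] (fun u => ((2 * ry)^-1 * y_ w s u ^+ 2)%:E) by exact: integrableZR.
    have j4 : mu.-integrable `[s, t] (fun u => (ry / 2 + (2 * ry)^-1 * y_ w s u ^+ 2)%:E) by exact: integrableDR.
    apply: (@le_trans _ _ (\int[mu]_(u in `[s, t]) (ry / 2 + (2 * ry)^-1 * y_ w s u ^+ 2))).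
      apply: le_Rintegral => // u _; rewrite (le_trans (young _ (normr_ge0 _))) //.
      rewrite real_normK ?num_real // le_eqVlt; apply/orP; left; apply/eqP; by field; rewrite lt0r_neq0.
    have e1' : \int[mu]_(u in `[s, t]) (ry / 2) = ry / 2 * (t - s).
      by rewrite Rintegral_cst // fine_measure_segment.
    have e2' : \int[mu]_(u in `[s, t]) ((2 * ry)^-1 * y_ w s u ^+ 2) = (2 * ry)^-1 * Yi w by rewrite RintegralZl //; exact: y2i.
    rewrite RintegralD // e1' e2'.
    rewrite le_eqVlt; apply/orP; left; apply/eqP; move: (Yi w) => g1; by field; rewrite lt0r_neq0.
  have y0 := normr_ge0 (y_ w s t).
  set y := `|y_ w s t| in y0 *.
  have yy2 : y_ w s t ^+ 2 = y ^+ 2 by rewrite real_normK ?num_real.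
  have yy4 : y_ w s t ^+ 4 = y ^+ 4 by rewrite (exprM _ 2 2) yy2 -exprM.
  rewrite /Bd yy2 yy4.
  move: Yabs; set YY := \int[mu]_(u in _) _; rewrite r2 => Yabs.
  by apply: ito_step_remainder => //; exact: ltW.
apply: (@le_trans _ _ `|\int[P]_w (z w * Err w - Lin w)|).
  by rewrite RintegralB // ELin subr0.
have iBd : P.-integrable setT (fun w => (Bd w)%:E).
  apply: integrableDR => //; last exact: integrableZR.
  apply: integrableDR => //; last exact: integrableZR.
  by apply: integrableDR => //; [exact: integrable_cstR|exact: integrableZR].
apply: (@le_trans _ _ (\int[P]_w (Mz * Bd w))).
  apply: le_Rintegral_norm => //; [exact: integrableBR|exact: integrableZR].
have [[w0 _]|no] := pselect (exists w : Omega, True); last first.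
  by exfalso; apply: no; exact: probability_inhabited P.
rewrite RintegralZl // -mulrA ler_wpM2l //; first exact: zM0 w0.
have j1 : P.-integrable setT (fun w => (k1 * y_ w s t ^+ 2)%:E) by exact: integrableZR.
have j2 : P.-integrable setT (fun w => (k2 * y_ w s t ^+ 4)%:E) by exact: integrableZR.
have j3 : P.-integrable setT (fun w => (k3 * Yi w)%:E) by exact: integrableZR.
have j0 : P.-integrable setT (fun=> k0%:E) by exact: integrable_cstR.
have j4 : P.-integrable setT (fun w => (k0 + k1 * y_ w s t ^+ 2)%:E) by exact: integrableDR.
have j5 : P.-integrable setT (fun w => (k0 + k1 * y_ w s t ^+ 2 + k2 * y_ w s t ^+ 4)%:E) by exact: integrableDR.
rewrite /Bd RintegralD // RintegralD // RintegralD // !RintegralZl // Rintegral_cst //.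
have -> : fine (P setT) = 1 by rewrite probability_setT.
rewrite mulr1; exact: ito_step_constant.
Qed.
End OneStep.

(** * Ito's formula for elementary integrands *)

Section Partition.
Context (R : realType) (d : measure_display) (Omega : measurableType d)
  (P : probability Omega R).
Hypothesis P_complete : measure_is_complete P.
Context (T : R) (m : nat) (W : Omega -> R -> 'rV[R]_m).
Hypothesis W_bm : brownian_motion P T W.
Hypothesis T_ge0 : 0 <= T.
Local Notation Ft t := (filtered P W t).
Local Notation mu := (@lebesgue_measure R).
Local Notation Wc := (bm_cont T W).

(* Ito's formula for [f], as the vanishing of the conditional expectation of its
   error given the past. *)
Definition ito_null (f f1 f2 : R -> R) (a b q x : Omega -> R -> R) s t :=
  forall (z : Omega -> R) Mz, @measurable_fun _ _ (Ft s) R setT z ->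
    (forall w, `|z w| <= Mz) ->
    \int[P]_w (z w * ito_error f f1 f2 a b q x s t w) = 0.

Context (f f1 f2 : R -> R) (L M A B : R) (a b q x : Omega -> R -> R).
Hypothesis fS : smooth_bounded f f1 f2 L.
Hypothesis M0 : 0 <= M.
Hypothesis A0 : 0 <= A.
Hypothesis B0 : 0 <= B.
Hypothesis pa : progressive P T W a.
Hypothesis pb : progressive P T W b.
Hypothesis pq : progressive P T W q.
Hypothesis xc : continuous_adapted P T W x.
Hypothesis aA : forall w s, 0 <= s <= T -> `|a w s| <= A.
Hypothesis bB : forall w s, 0 <= s <= T -> `|b w s| <= B.
Hypothesis qM : forall w s, 0 <= s <= T -> `|q w s| <= M ^+ 2.
Local Notation err := (ito_error f f1 f2 a b q x).

Let PT : (P setT < +oo)%E.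
Proof. by rewrite (le_lt_trans (probability_le1 _ _)) ?ltry. Qed.

Let err_refl s w : err s s w = 0.
Proof. by rewrite /ito_error set_itv1 Rintegral_set1 subrr subr0. Qed.

Let err_integrable s t (z : Omega -> R) Mz : 0 <= s -> s <= t -> t <= T ->
  @measurable_fun _ _ (Ft s) R setT z -> (forall w, `|z w| <= Mz) ->
  P.-integrable setT (fun w => (z w * err s t w)%:E).
Proof.
move=> s0 st tT mz zM.
apply: (@integrable_boundR _ _ _ P _ _ _ (Mz * (2 * expR (A * T) * L + expR (A * T) * (L / 2 * M ^+ 2 + L * B + A * L) * T))) => //.
  apply: measurable_mulf; first exact: (adapted_measurable P_complete W_bm (le_trans st tT)).
  exact: (ito_error_measurable P_complete W_bm T_ge0 fS pa pb pq xc aA s0 st tT).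
move=> w _; rewrite normrM ler_pM //.
exact: (ito_error_bound P_complete W_bm T_ge0 fS pa pb pq xc aA bB qM).
Qed.

Lemma ito_null_refl s : ito_null f f1 f2 a b q x s s.
Proof.
move=> z Mz mz zM; under eq_Rintegral do rewrite err_refl mulr0.
by rewrite Rintegral_cst // mul0r.
Qed.

Let EadD s u t z Mz : 0 <= s -> s <= u -> u <= t -> t <= T ->
  @measurable_fun _ _ (Ft s) R setT z -> (forall w, `|z w| <= Mz) ->
  \int[P]_w (z w * err s t w) = \int[P]_w (z w * err s u w) + \int[P]_w (z w * err u t w).
Proof.
move=> s0 su ut tT mz zM; have uT := le_trans ut tT; have u0 := le_trans s0 su.
have e w : z w * err s t w = z w * err s u w + z w * err u t w.
  rewrite -mulrDr; congr (_ * _).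
  exact: (ito_error_cat P_complete W_bm T_ge0 fS pa pb pq xc aA bB qM w s0 su ut tT).
under eq_Rintegral do rewrite e.
rewrite RintegralD //; first exact: (err_integrable s0 su uT mz zM).
exact: (err_integrable u0 ut tT (adapted_le su mz) zM).
Qed.

Lemma ito_null_cat s u t : 0 <= s -> s <= u -> u <= t -> t <= T ->
  ito_null f f1 f2 a b q x s u -> ito_null f f1 f2 a b q x u t ->
  ito_null f f1 f2 a b q x s t.
Proof.
move=> s0 su ut tT n1 n2 z Mz mz zM.
rewrite (EadD s0 su ut tT mz zM) (n1 z Mz) // (n2 z Mz) ?addr0 //.
exact: adapted_le mz.
Qed.

Lemma ito_step_sub s t s' t' : 0 <= s -> t <= T -> s <= s' -> s' <= t' -> t' <= t ->
  ito_step P T W M b q x s t -> ito_step P T W M b q x s' t'.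
Proof.
move=> s0 tT ss' s't' t't [c [mc cM xE qE]]; exists c; split => //.
- by move=> i; exact: adapted_le (mc i).
- move=> w u s'u ut'; have ut := le_trans ut' t't.
  have bi := progressive_integrable P_complete W_bm T_ge0 pb (bB w).
  have e1 := xE w u (le_trans ss' s'u) ut.
  have e2 := xE w s' ss' (le_trans s't' t't).
  rewrite (_ : x w u - x w s' = (x w u - x w s) - (x w s' - x w s)); last by ring.
  rewrite e1 e2 (Rintegral_cat bi s0 ss' s'u (le_trans ut tT)) !dotpBr; ring.
- by move=> w u s'u ut'; apply: qE; [exact: le_lt_trans s'u|exact: le_trans ut' t't].
Qed.

(** As a function of the right end point the weighted mean of the error has increments of order 3/2,
    since [z] remains an admissible weight at later times. Such a function is constant, and it
    starts at 0. *)
Lemma ito_null_step s t : 0 <= s -> s <= t -> t <= T ->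
  ito_step P T W M b q x s t -> ito_null f f1 f2 a b q x s t.
Proof.
move=> s0 st tT stp z Mz mz zM.
have [C C0 hC] := ito_error_step P_complete W_bm T_ge0 fS M0 pa pb pq xc aA bB qM A0 B0.
have [w0 _] := probability_inhabited P.
have Mz0 : 0 <= Mz by exact: le_trans (zM w0).
pose g u := \int[P]_w (z w * err s u w).
suff : g t = g s.
  by rewrite /g => ->; exact: (ito_null_refl mz zM).
apply: (@cst_of_sqrt_cube _ g s t (Mz * C)) => //; first exact: mulr_ge0.
move=> u v su uv vt; have vT := le_trans vt tT.
rewrite /g (EadD s0 su uv vT mz zM) addrC addKr.
have [->|uv'] := eqVneq u v.
  under eq_Rintegral do rewrite err_refl mulr0.
  rewrite Rintegral_cst // mul0r; by rewrite normr0 mulr_ge0 // ?mulr_ge0 // exprn_ge0.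
apply: hC => //; first exact: le_trans su.
- by rewrite lt_neqAle uv'.
- exact: (ito_step_sub s0 tT su uv vt stp).
- exact: adapted_le mz.
Qed.

(** Two subdivisions occur because the difference of two elementary integrands is formed without a
    common one. [interval_chain] is applied along [tau1] and, inside each of its cells, along
    [tau2]. *)
Lemma ito_null_partition (tau1 tau2 : nat -> R) n1 n2 :
  (forall i, (i < n1)%N -> tau1 i <= tau1 i.+1) -> tau1 0%N = 0 -> tau1 n1 = T ->
  (forall i, (i < n2)%N -> tau2 i <= tau2 i.+1) -> tau2 0%N = 0 -> tau2 n2 = T ->
  (forall i j s t, (i < n1)%N -> (j < n2)%N -> 0 <= s -> s <= t -> t <= T ->
    tau1 i <= s -> t <= tau1 i.+1 -> tau2 j <= s -> t <= tau2 j.+1 ->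
    ito_step P T W M b q x s t) ->
  forall s t, 0 <= s -> s <= t -> t <= T -> ito_null f f1 f2 a b q x s t.
Proof.
move=> h1 h10 h1T h2 h20 h2T stp s t s0 st tT.
have mono (tau : nat -> R) n k l : (forall i, (i < n)%N -> tau i <= tau i.+1) ->
    (k <= l)%N -> (l <= n)%N -> tau k <= tau l.
  move=> h kl ln; rewrite -(subnKC kl) in ln *.
  elim: (l - k)%N ln => [|j IH]; first by rewrite addn0.
  by rewrite addnS => kjn; rewrite (le_trans (IH (ltnW kjn))) // h.
have lo (tau : nat -> R) n k r : (forall i, (i < n)%N -> tau i <= tau i.+1) ->
    tau 0%N = 0 -> (k <= n)%N -> tau k <= r -> 0 <= r.
  by move=> h h0 kn kr; rewrite -h0 (le_trans _ kr) // (mono _ n).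
have hi (tau : nat -> R) n k r : (forall i, (i < n)%N -> tau i <= tau i.+1) ->
    tau n = T -> (k <= n)%N -> r <= tau k -> r <= T.
  by move=> h h0 kn kr; rewrite -h0 (le_trans kr) // (mono _ n).
have cat1 r u v : tau1 0%N <= r -> r <= u -> u <= v -> v <= tau1 n1 ->
    ito_null f f1 f2 a b q x r u -> ito_null f f1 f2 a b q x u v -> ito_null f f1 f2 a b q x r v.
  by rewrite h10 h1T; exact: ito_null_cat.
have st1 i r v : (i < n1)%N -> tau1 i <= r -> r <= v -> v <= tau1 i.+1 ->
    ito_null f f1 f2 a b q x r v.
  move=> i1 ir rv vi.
  have r0 := lo _ _ _ _ h1 h10 (ltnW i1) ir; have vT := hi _ _ _ _ h1 h1T i1 vi.
  pose Q s t := tau1 i <= s -> t <= tau1 i.+1 -> ito_null f f1 f2 a b q x s t.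
  have cat2 r' u' v' : tau2 0%N <= r' -> r' <= u' -> u' <= v' -> v' <= tau2 n2 ->
      Q r' u' -> Q u' v' -> Q r' v'.
    rewrite h20 h2T => r'0 r'u u'v v'T q1 q2 h3 h4; apply: (ito_null_cat r'0 r'u u'v v'T).
      by apply: q1 => //; exact: le_trans u'v h4.
    by apply: q2 => //; exact: le_trans h3 r'u.
  have st2 j r' u : (j < n2)%N -> tau2 j <= r' -> r' <= u -> u <= tau2 j.+1 -> Q r' u.
    move=> j2 jr ru uj h3 h4.
    have r'0 := lo _ _ _ _ h2 h20 (ltnW j2) jr; have uT := hi _ _ _ _ h2 h2T j2 uj.
    by apply: (ito_null_step r'0 ru uT); exact: (stp i j).
  have h := @interval_chain _ Q tau2 n2 h2 (fun r _ _ => @ito_null_refl r) cat2 st2.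
  by apply: (h r v) => //; rewrite ?h20 ?h2T.
have s0' : tau1 0%N <= s by rewrite h10.
have tT' : t <= tau1 n1 by rewrite h1T.
exact: (interval_chain h1 (@ito_null_refl) cat1 st1 s0' st tT').
Qed.

End Partition.

Lemma within_continuousB (R : realType) (f g : R -> R) a b :
  {within `[a, b], continuous f} -> {within `[a, b], continuous g} ->
  {within `[a, b], continuous (fun t => f t - g t)}.
Proof. by move=> cf cg x; apply: cvgB; [exact: cf|exact: cg]. Qed.

Lemma within_continuousZ (R : realType) (k : R) (f : R -> R) a b :
  {within `[a, b], continuous f} -> {within `[a, b], continuous (fun t => k * f t)}.
Proof. by move=> cf x; apply: cvgMr; exact: cf. Qed.

Lemma within_continuous_sum (R : realType) (n : nat) (f : 'I_n -> R -> R) a b :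
  (forall i, {within `[a, b], continuous (f i)}) ->
  {within `[a, b], continuous (fun t => \sum_(i < n) f i t)}.
Proof.
move=> cf; elim: n f cf => [|n IH] f cf.
  rewrite (_ : (fun t => _) = cst 0); last by apply/funext => t; rewrite big_ord0.
  by move=> x; exact: cvg_cst.
rewrite (_ : (fun t => _) = (fun t => \sum_(i < n) f (widen_ord (leqnSn n) i) t + f ord_max t)); last first.
  by apply/funext => t; rewrite big_ord_recr.
by move=> x; apply: cvgD; [exact: IH|exact: cf].
Qed.

Section Elementary.
Context (R : realType) (d : measure_display) (Omega : measurableType d)
  (P : probability Omega R).
Hypothesis P_complete : measure_is_complete P.
Context (T : R) (m : nat) (W : Omega -> R -> 'rV[R]_m).
Hypothesis W_bm : brownian_motion P T W.
Hypothesis T_ge0 : 0 <= T.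
Local Notation Ft t := (filtered P W t).
Local Notation mu := (@lebesgue_measure R).
Local Notation Wc := (bm_cont T W).
Implicit Types H : elementary R Omega m.

Lemma el_time_mono H i j : is_elementary P T W H -> (i <= j)%N -> (j <= el_size H)%N ->
  el_time H i <= el_time H j.
Proof.
move=> [_ _ h _] kl ln; rewrite -(subnKC kl) in ln *.
elim: (j - i)%N ln => [|k IH]; first by rewrite addn0.
by rewrite addnS => kjn; rewrite (le_trans (IH (ltnW kjn))) // ltW // h.
Qed.

Lemma el_time_in H i : is_elementary P T W H -> (i <= el_size H)%N -> 0 <= el_time H i <= T.
Proof.
move=> eH iH; have [h0 hT _ _] := eH.
apply/andP; split; first by rewrite -h0 el_time_mono.
by rewrite -[leRHS]hT el_time_mono.
Qed.

Lemma el_valueE H i w s : is_elementary P T W H -> (i < el_size H)%N ->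
  el_time H i < s -> s <= el_time H i.+1 -> el_value H w s = el_coef H i w.
Proof.
move=> eH iH is_ si; rewrite /el_value (bigD1 (Ordinal iH)) //= is_ si /=.
rewrite big1 ?addr0 // => -[j jH] /= ji; case: ifPn => // /andP[js sj].
have : j != i by apply: contraNneq ji => ij; apply/eqP/val_inj.
rewrite neq_ltn => /orP[] ij.
  have := el_time_mono eH ij (ltnW iH).
  by move=> h; move: (le_trans sj h); rewrite leNgt is_.
have := el_time_mono eH ij (ltnW jH) => /(le_trans si).
by rewrite leNgt js.
Qed.

Lemma el_integralE (B : Omega -> R -> 'rV[R]_m) H i w s u : is_elementary P T W H -> (i < el_size H)%N ->
  el_time H i <= s -> s <= u -> u <= el_time H i.+1 ->
  el_integral B H w u - el_integral B H w s = dotp (el_coef H i w) (B w u - B w s).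
Proof.
move=> eH iH is_ su ui; rewrite /el_integral -sumrB (bigD1 (Ordinal iH)) //=.
have iu := le_trans is_ su; have si := le_trans su ui.
rewrite (min_l si) (min_l ui) (min_r is_) (min_r iu).
rewrite big1 ?addr0 => [|[j jH] /= ji].
  rewrite !dotpBr; ring.
have : j != i by apply: contraNneq ji => ij; apply/eqP/val_inj.
rewrite neq_ltn => /orP[] ij.
  have := el_time_mono eH ij (ltnW iH) => j1.
  have j2 := le_trans (el_time_mono eH (leqnSn j) jH) j1.
  by rewrite !min_r ?subrr // ?(le_trans j1) // (le_trans j2).
have := el_time_mono eH ij (ltnW jH) => j1.
have j2 := le_trans j1 (el_time_mono eH (leqnSn j) jH).
by rewrite !min_l ?subrr // ?(le_trans ui) // (le_trans si).
Qed.

Lemma el_bounded H : is_elementary P T W H ->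
  exists2 M, 0 <= M & forall i w, (i < el_size H)%N -> euclid (el_coef H i w) <= M.
Proof.
move=> [_ _ _ h].
have hM i : exists M, (i < el_size H)%N -> forall w, euclid (el_coef H i w) <= M.
  have [iH|//] := boolP (i < el_size H)%N; last by exists 0.
  by have [_ [M hM]] := h i iH; exists M.
have [M hMi] := choice hM.
exists (\sum_(i < el_size H) `|M i|); first by apply: sumr_ge0.
move=> i w iH; apply: (le_trans (hMi i iH w)).
rewrite (bigD1 (Ordinal iH)) //= (le_trans (ler_norm _)) // lerDl.
exact: sumr_ge0.
Qed.

Lemma el_coef_measurable H i c : is_elementary P T W H -> (i < el_size H)%N ->
  @measurable_fun _ _ (Ft (el_time H i)) R setT (fun w => el_coef H i w 0 c).
Proof.
move=> [_ _ _ h] iH; have [mc _] := h i iH.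
exact: (measurableT_comp (measurable_coord_rV c) mc).
Qed.

(** On a horizon t < r the process is identically 0; on a later one [X] is already known at time
    t. *)
Lemma progressive_after (X : Omega -> R) (r : R) (p : R -> bool) :
  @measurable_fun _ _ (Ft r) R setT X -> measurable [set s | p s] ->
  (forall s, p s -> r < s) -> progressive P T W (fun w s => if p s then X w else 0).
Proof.
move=> mX mp ps t /andP[t0 tT].
have [rt|tr] := leP r t; last first.
  rewrite /jointly_measurable; apply: (eq_measurable_fun (fun _ : Ft t * R => 0 : R)); last exact: measurable_cst.
  move=> [w s]; rewrite inE => -[_ /=]; rewrite in_itv /= => /andP[_ st].
  by case: ifPn => // /ps; rewrite ltNge (le_trans st (ltW tr)).
rewrite /jointly_measurable; apply: (eq_measurable_fun (fun z : Ft t * R => X z.1 * \1_[set s | p s] z.2)).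
  move=> [w s] _ /=; rewrite indicE; case: ifPn => h; first by rewrite mem_set ?mulr1.
  by rewrite memNset ?mulr0 //=; exact/negP.
apply: measurable_mulf.
  by have := @jointly_measurable_fst _ (Ft t) R 0 t _ (adapted_le rt mX).
apply: measurable_funTS.
have mi : measurable_fun setT (\1_[set s | p s] : R -> R) by exact: measurable_indic.
exact: (measurableT_comp mi (@measurable_snd _ _ (Ft t) R)).
Qed.

Lemma progressive_sum (I : Type) (r : seq I) (p : pred I) (X : I -> Omega -> R -> R) :
  (forall i, p i -> progressive P T W (X i)) ->
  progressive P T W (fun w s => \sum_(i <- r | p i) X i w s).
Proof.
move=> pX; elim: r => [|i r IH].
  by move=> t tT; under [X in jointly_measurable _ _ X]eq_fun do (under eq_fun do rewrite big_nil); exact: measurable_cst.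
have -> : (fun w s => \sum_(j <- i :: r | p j) X j w s) =
  (fun w s => (if p i then X i w s else 0) + \sum_(j <- r | p j) X j w s).
  by apply/funext => w; apply/funext => s; rewrite big_cons; case: ifP => //; rewrite add0r.
apply: progressiveD => //; have [pi|_] := boolP (p i); last exact: progressive_cst.
exact: pX.
Qed.

Lemma el_value_progressive H c : is_elementary P T W H ->
  progressive P T W (fun w s => el_value H w s 0 c).
Proof.
move=> eH.
rewrite (_ : (fun w s => _) = (fun w s => \sum_(i < el_size H)
    (if el_time H i < s <= el_time H i.+1 then el_coef H i w 0 c else 0))); last first.
  apply/funext => w; apply/funext => s; rewrite /el_value summxE.
  by apply: eq_bigr => i _; case: ifP => // _; rewrite mxE.
apply: progressive_sum => i _.
apply: (progressive_after (r := el_time H i)).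
- exact: el_coef_measurable.
- rewrite (_ : [set s | _] = `]el_time H i, el_time H i.+1]%classic); last first.
    by apply/seteqP; split => s /=; rewrite in_itv.
  exact: measurable_itv.
- by move=> s /andP[].
Qed.

Lemma el_integral_continuous_adapted H : is_elementary P T W H ->
  continuous_adapted P T W (el_integral Wc H).
Proof.
move=> eH; split.
  move=> w; apply: within_continuous_sum => i; apply: within_continuous_sum => c.
  apply: within_continuousZ.
  rewrite (_ : (fun t => _) = (fun t => Wc w (Num.min t (el_time H i.+1)) 0 c -
    Wc w (Num.min t (el_time H i)) 0 c)); last by apply/funext => t; rewrite !mxE.
  have h r : 0 <= r -> {within `[0, T], continuous (fun t => Wc w (Num.min t r) 0 c)}.
    move=> r0; have cW : {within `[0, T], continuous (fun t => Wc w t 0 c)}.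
      move=> t; apply: (@continuous_comp _ _ _ _ (fun v : 'rV[R]_m => v 0 c)).
        exact: bm_cont_continuous.
      exact: coord_continuous.
    apply: within_continuousP => u uT e e0.
    have mT v : 0 <= v <= T -> 0 <= Num.min v r <= T.
      by move=> /andP[v0 vT]; rewrite le_min v0 r0 ge_min vT.
    have [dl dl0 hd] := within_continuous_dist cW (mT u uT) e0.
    exists dl => // v vT vu; apply: hd; first exact: mT.
    apply: le_lt_trans vu; rewrite /Num.min; case: ltP => h1; case: ltP => h2 //.
    - rewrite ler_norml; have := ler_norm (v - u); have := ler_norm (u - v); rewrite distrC; lra.
    - rewrite ler_norml; have := ler_norm (v - u); have := ler_norm (u - v); rewrite distrC; lra.
    - by rewrite subrr normr0.
  have /andP[i0 _] := el_time_in eH (ltnW (ltn_ord i)).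
  have /andP[i1 _] := el_time_in eH (ltn_ord i).
  by apply: within_continuousB; exact: h.
move=> t /andP[t0 tT]; rewrite /el_integral.
apply: measurable_sum => i.
have iH := ltn_ord i.
have := el_time_in eH (ltnW iH) => /andP[i0 iT].
have := el_time_in eH iH => /andP[i1 i1T].
have lei := el_time_mono eH (leqnSn i) iH.
(* A coefficient not yet known at time t multiplies an increment of the stopped path, which is 0. *)
have [it|ti] := leP (el_time H i) t; last first.
  rewrite (min_l (le_trans (ltW ti) lei)).
  under eq_fun do rewrite subrr dotpC dotp0l.
  exact: measurable_cst.
rewrite /dotp; apply: measurable_sum => c; apply: measurable_mulf.
  exact: adapted_le it (el_coef_measurable _ _ _).
rewrite (_ : (fun w => _) = (fun w => Wc w (Num.min t (el_time H i.+1)) 0 c -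
    Wc w (el_time H i) 0 c)); last by apply/funext => w; rewrite !mxE.
have ms r : 0 <= r -> r <= t -> @measurable_fun _ _ (Ft t) R setT (fun w => Wc w r 0 c).
  move=> r0 rt; apply: (adapted_le rt); apply: (bm_cont_adapted W_bm).
  by rewrite r0 (le_trans rt).
apply: measurable_addf; first by apply: ms; rewrite ?le_min ?t0 ?i1 // ge_min lexx.
by apply: measurable_oppf; apply: ms.
Qed.

(** Elementary coefficients and the drift are bounded, hence so is the discount rate, and on the
    intersection of two cells the diffusion coefficient is the difference of two fixed coefficients.
    The bounds [M] and [A] depend on the elementary processes, which is why the limit needs
    estimates free of them. *)
Lemma ito_null_elementary (H1 H2 : elementary R Omega m) (X0 : Omega -> R)
    (f f1 f2 : R -> R) (L B lam theta : R) (b : Omega -> R -> R) :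
  is_elementary P T W H1 -> is_elementary P T W H2 ->
  @measurable_fun _ _ (Ft 0) R setT X0 ->
  smooth_bounded f f1 f2 L -> 0 <= B -> 0 <= lam -> 0 <= theta ->
  progressive P T W b -> (forall w s, 0 <= s <= T -> `|b w s| <= B) ->
  let q w u := euclid (el_value H1 w u - el_value H2 w u) ^+ 2 in
  let x w t := X0 w + \int[mu]_(u in `[0, t]) b w u + (el_integral Wc H1 w t - el_integral Wc H2 w t) in
  let a w u := lam * (`|b w u| + q w u) - theta in
  exists M A, [/\ [/\ 0 <= M, 0 <= A & progressive P T W q], continuous_adapted P T W x,
    forall w s, 0 <= s <= T -> `|q w s| <= M ^+ 2,
    forall w s, 0 <= s <= T -> `|a w s| <= A &
    forall s t, 0 <= s -> s <= t -> t <= T -> ito_null P W f f1 f2 a b q x s t].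
Proof.
move=> e1 e2 mX0 fS B0 lam0 th0 pb bB q x a.
have [M1 M10 hM1] := el_bounded e1; have [M2 M20 hM2] := el_bounded e2.
pose M := M1 + M2; have M0 : 0 <= M by rewrite addr_ge0.
pose A := lam * (B + M ^+ 2) + theta.
have A0 : 0 <= A by rewrite addr_ge0 // mulr_ge0 // addr_ge0 // sqr_ge0.
have vM H Mv w s : is_elementary P T W H -> 0 <= Mv ->
    (forall i w, (i < el_size H)%N -> euclid (el_coef H i w) <= Mv) -> euclid (el_value H w s) <= Mv.
  move=> eH Mv0 hM; have [[i [iH is_ si]]|no] := pselect (exists i, [/\ (i < el_size H)%N, el_time H i < s & s <= el_time H i.+1]).
    by rewrite (el_valueE w eH iH is_ si) hM.
  rewrite /el_value big1 ?euclid0 // => i _; case: ifPn => // /andP[h1 h2].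
  by exfalso; apply: no; exists i; split.
have qM w s : 0 <= s <= T -> `|q w s| <= M ^+ 2.
  move=> sT; rewrite ger0_norm ?sqr_ge0 // ler_pXn2r ?nnegrE ?euclid_ge0 //.
  rewrite (le_trans (euclidD _ _)) // euclidN lerD //; exact: vM.
have pq : progressive P T W q.
  rewrite (_ : q = (fun w u => \sum_(c < m) (el_value H1 w u 0 c - el_value H2 w u 0 c) ^+ 2)); last first.
    apply/funext => w; apply/funext => u; rewrite /q sqr_euclid /dotp.
    by apply: eq_bigr => c _; rewrite !mxE expr2.
  apply: progressive_sum => c _.
  apply: (progressive_comp (f := fun r => r ^+ 2)); first exact: exprn_measurable.
  by apply: progressiveD; [|apply: progressiveN]; exact: el_value_progressive.
have pa : progressive P T W a.
  have pn : progressive P T W (fun w s => `|b w s|) by exact: (progressive_comp (f := Num.norm) _ pb).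
  exact: (@progressiveD _ _ _ _ _ _ _ (fun w s => lam * (`|b w s| + q w s)) (fun _ _ => - theta)
    (progressiveM (@progressive_cst _ _ _ _ _ _ _ lam) (progressiveD pn pq)) (@progressive_cst _ _ _ _ _ _ _ _)).
have xc : continuous_adapted P T W x.
  have [c1 m1] := el_integral_continuous_adapted e1; have [c2 m2] := el_integral_continuous_adapted e2.
  have [c3 m3] := progressive_primitive P_complete W_bm T_ge0 pb bB.
  split => [w|t tT].
    by move=> t; apply: cvgD; [apply: cvgD; [exact: cvg_cst|exact: c3]|apply: cvgB; [exact: c1|exact: c2]].
  apply: measurable_addf; first apply: measurable_addf.
  - by apply: adapted_le mX0; case/andP: tT.
  - exact: m3.
  - by apply: measurable_addf; [exact: m1|apply: measurable_oppf; exact: m2].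
have aA w s : 0 <= s <= T -> `|a w s| <= A.
  move=> sT; rewrite /a /A (le_trans (ler_normB _ _)) // (ger0_norm th0) lerD2r.
  rewrite normrM ger0_norm // ler_wpM2l // ger0_norm ?addr_ge0 ?sqr_ge0 //.
  by rewrite lerD ?bB // (le_trans (ler_norm _)) // qM.
exists M, A; split => //.
have [h10 h1T h1 _] := e1; have [h20 h2T h2 _] := e2.
apply: (ito_null_partition P_complete W_bm T_ge0 fS M0 A0 B0 pa pb pq xc aA bB qM
  (fun i ih => ltW (h1 i ih)) h10 h1T (fun i ih => ltW (h2 i ih)) h20 h2T).
move=> i j s t i1 j2 s0 st tT is_ ti js tj.
exists (fun w => el_coef H1 i w - el_coef H2 j w); split.
- move=> c; rewrite (_ : (fun w => _) = (fun w => el_coef H1 i w 0 c - el_coef H2 j w 0 c)); last first.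
    by apply/funext => w; rewrite !mxE.
  by apply: measurable_addf; [|apply: measurable_oppf];
    [exact: adapted_le is_ (el_coef_measurable c e1 i1)|exact: adapted_le js (el_coef_measurable c e2 j2)].
- by move=> w; rewrite (le_trans (euclidD _ _)) // euclidN lerD ?hM1 ?hM2.
- move=> w u su ut; have bi := progressive_integrable P_complete W_bm T_ge0 pb (bB w).
  have := el_integralE Wc w e1 i1 is_ su (le_trans ut ti).
  have := el_integralE Wc w e2 j2 js su (le_trans ut tj).
  rewrite dotpBl => <- <-.
  rewrite /x (Rintegral_cat bi (lexx 0) s0 su (le_trans ut tT)); ring.
- move=> w u su ut; rewrite /q (el_valueE w e1 i1) ?(el_valueE w e2 j2) //.
  + exact: le_lt_trans js su.
  + exact: le_trans ut tj.
  + exact: le_lt_trans is_ su.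
  + exact: le_trans ut ti.
Qed.

End Elementary.

(** * Stability of the discounted formula *)

Lemma expRN_lip (R : realType) (c x y : R) : - c <= x -> - c <= y ->
  `|expR (- x) - expR (- y)| <= expR c * `|x - y|.
Proof.
wlog xy : x y / x <= y.
  move=> h cx cy; have [xy|/ltW yx] := leP x y; first exact: h.
  by rewrite distrC (distrC x); exact: h.
move=> cx cy.
have exy : expR (- y) <= expR (- x) by rewrite ler_expR lerN2.
rewrite ger0_norm ?subr_ge0 // ler0_norm ?subr_le0 // opprB.
have -> : expR (- x) - expR (- y) = expR (- x) * (1 - expR (- (y - x))).
  by rewrite mulrBr mulr1 -expRD; congr (_ - expR _); ring.
apply: ler_pM; rewrite ?expR_ge0 //.
- by rewrite subr_ge0 -[leRHS]expR0 ler_expR; lra.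
- by rewrite ler_expR; lra.
- by have := expR_ge1Dx (- (y - x)); lra.
Qed.

Section Stability.
Context (R : realType) (T : R).
Hypothesis T_ge0 : 0 <= T.
Local Notation mu := (@lebesgue_measure R).
Local Notation int g := (mu.-integrable `[0, T] (fun u => (g u)%:E)).

Let muT : (mu `[0%R, T] < +oo)%E. Proof. exact: measure_segment_lty. Qed.
Let mT : measurable (`[0, T]%classic : set R). Proof. exact: measurable_itv. Qed.

Lemma Rintegral_sub_le (g : R -> R) s t : int g -> (forall u, 0 <= u <= T -> 0 <= g u) ->
  0 <= s -> s <= t -> t <= T ->
  \int[mu]_(u in `[s, t]) g u <= \int[mu]_(u in `[0, T]) g u.
Proof.
move=> ig g0 s0 st tT.
have t0 := le_trans s0 st.
rewrite (Rintegral_cat ig (lexx 0) t0 tT (lexx T)) (Rintegral_cat ig (lexx 0) s0 st tT).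
have h a b : 0 <= a -> b <= T -> 0 <= \int[mu]_(u in `[a, b]) g u.
  move=> a0 bT; apply: Rintegral_ge0 => u; rewrite /= in_itv /= => /andP[au ub].
  by rewrite g0 // (le_trans a0 au) (le_trans ub).
have := h 0 s (lexx 0) (le_trans st tT); have := h t T t0 (lexx T).
by move: (Rintegral _ _ _) (Rintegral _ _ _) (Rintegral _ _ _) => *; lra.
Qed.

Context (d : measure_display) (Omega : measurableType d) (w : Omega).
Context (f f1 f2 : R -> R) (L lam theta : R).
Hypothesis fS : smooth_bounded f f1 f2 L.
Hypothesis lam0 : 0 <= lam.
Hypothesis th0 : 0 <= theta.

(* Discounting at rate [lam (|b| + q)] bounds the discounted integral of
   [|b| + q] by a constant over [lam]; no localization by stopping times is
   then needed in Ito's formula. *)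
Definition ito_killing (b q : Omega -> R -> R) w u := lam * (`|b w u| + q w u) - theta.

(** What holds for almost every path; the estimates of this section are deterministic, along one
    fixed [w]. *)
Record path_data (b q x : Omega -> R -> R) : Prop := PathData {
  pd_b : int (b w) ;
  pd_q : int (q w) ;
  pd_q0 : forall u, 0 <= u <= T -> 0 <= q w u ;
  pd_x : measurable_fun `[0, T] (x w) }.

Let L0 : 0 <= L. Proof. exact: le_trans (sb_f fS 0). Qed.

Lemma killing_integrable b q x : path_data b q x -> int (ito_killing b q w).
Proof.
move=> [ib iq q0 mx].
apply: integrableBR => //; last exact: integrable_cstR.
by apply: integrableZR => //; apply: integrableDR => //; exact: integrable_normR.
Qed.

Lemma killing_primitive_ge b q x t : path_data b q x -> 0 <= t <= T ->
  - (theta * T) <= \int[mu]_(u in `[0, t]) ito_killing b q w u.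
Proof.
move=> h /andP[t0 tT]; have ia := killing_integrable h; have [ib iq q0 mx] := h.
rewrite (_ : - (theta * T) = - theta * T); last by rewrite mulNr.
apply: (@le_trans _ _ (- theta * t)); first by rewrite !mulNr lerN2 ler_wpM2l.
have -> : - theta * t = \int[mu]_(u in `[0, t]) (- theta).
  by rewrite Rintegral_cst // fine_measure_segment // subr0.
apply: le_Rintegral => //.
- by apply: integrable_cstR => //; exact: measure_segment_lty.
- exact: (integrable_sub ia).
- move=> u; rewrite /= in_itv /= => /andP[u0 ut]; rewrite /ito_killing.
  have q0u := q0 u; have : 0 <= lam * (`|b w u| + q w u).
    by rewrite mulr_ge0 // addr_ge0 // q0u // u0 (le_trans ut).
  by lra.
Qed.

(** The part lam (|b| + q) of the rate only lowers the weight, so the bound is the same for all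
    drifts and densities. *)
Lemma weight_killing_le b q x t : path_data b q x -> 0 <= t <= T ->
  weight (ito_killing b q) w t <= expR (theta * T).
Proof. by move=> h tT; rewrite /weight ler_expR -[leRHS]opprK lerN2 (killing_primitive_ge h tT). Qed.

Lemma weight_killing_measurable b q x : path_data b q x ->
  measurable_fun `[0, T] (weight (ito_killing b q) w).
Proof.
move=> h; apply: measurable_expRf; apply: measurable_oppf.
apply: subspace_continuous_measurable_fun => //.
exact: (Rintegral_continuous (killing_integrable h) T_ge0).
Qed.

Lemma ito_drift_measurable b q x : path_data b q x ->
  measurable_fun `[0, T] (ito_drift f f1 f2 (ito_killing b q) b q x w).
Proof.
move=> h; have ia := killing_integrable h; have [ib iq q0 mx] := h.
have mb : measurable_fun `[0, T] (b w) by exact: (integrable_measR (mu := mu)).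
have mq : measurable_fun `[0, T] (q w) by exact: (integrable_measR (mu := mu)).
have [m0 m1 m2] := measurable_smooth fS.
have mK := weight_killing_measurable h.
have ma : measurable_fun `[0, T] (ito_killing b q w) by exact: (integrable_measR (mu := mu)).
apply: measurable_mulf => //; apply: measurable_addf; first apply: measurable_addf.
- apply: measurable_mulf => //; apply: measurable_mulf; last exact: measurable_cst.
  exact: (measurableT_comp m2).
- by apply: measurable_mulf => //; exact: (measurableT_comp m1).
- by apply: measurable_oppf; apply: measurable_mulf => //; exact: (measurableT_comp m0).
Qed.

Let G (b q : Omega -> R -> R) u := `|b w u| + q w u + lam * (`|b w u| + q w u) + theta.

Let Gint b q x : path_data b q x -> int (G b q).
Proof.
move=> [ib iq q0 mx].
have i1 : int (fun u => `|b w u| + q w u) by apply: integrableDR => //; exact: integrable_normR.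
apply: integrableDR => //; last exact: integrable_cstR.
by apply: integrableDR => //; exact: integrableZR.
Qed.

Let killing_norm b q u : 0 <= q w u ->
  `|ito_killing b q w u| <= lam * (`|b w u| + q w u) + theta.
Proof.
move=> q0; rewrite (le_trans (ler_normB _ _)) // (ger0_norm th0) lerD2r ger0_norm //.
by rewrite mulr_ge0 // addr_ge0.
Qed.

Let core_le (X Q Bb Aa : R) : 0 <= Q ->
  `|f2 X / 2 * Q + f1 X * Bb - Aa * f X| <= L * (Q + `|Bb| + `|Aa|).
Proof.
move=> Q0; rewrite (le_trans (ler_normB _ _)) // mulrDr lerD //; last first.
  by rewrite normrM mulrC ler_wpM2r // (sb_f fS).
rewrite (le_trans (ler_normD _ _)) // mulrDr lerD //; last first.
  by rewrite normrM ler_wpM2r // (sb_f1 fS).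
rewrite normrM (ger0_norm Q0) ler_wpM2r // normrM (@ger0_norm _ 2^-1) //.
have := sb_f2 fS X; have := normr_ge0 (f2 X); lra.
Qed.

Lemma ito_drift_integrable b q x : path_data b q x ->
  int (ito_drift f f1 f2 (ito_killing b q) b q x w).
Proof.
move=> h; have iG := Gint h; have [ib iq q0 mx] := h.
apply: (@integrable_leR _ _ _ mu _ _ _ (fun u => expR (theta * T) * (L * G b q u))) => //.
- exact: ito_drift_measurable.
- move=> u; rewrite /= in_itv /= => uT; rewrite normrM ler_pM //.
    by rewrite ger0_norm ?expR_ge0 //; exact: weight_killing_le h uT.
  rewrite (le_trans (core_le _ _ _ (q0 u uT))) // ler_wpM2l //.
  have := killing_norm b (q0 u uT); rewrite /G; lra.
- by apply: integrableZR => //; exact: integrableZR.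
Qed.

Context (b q x bk qk xk : Omega -> R -> R).
Hypothesis D : path_data b q x.
Hypothesis Dk : path_data bk qk xk.
Context (dl ep : R).
Hypothesis xe : forall u, 0 <= u <= T -> `|xk w u - x w u| <= ep.
Hypothesis de : \int[mu]_(u in `[0, T]) (`|bk w u - b w u| + `|qk w u - q w u|) <= dl.
Local Notation a := (ito_killing b q).
Local Notation ak := (ito_killing bk qk).
Local Notation k := (expR (theta * T)).
Local Notation Z := (\int[mu]_(u in `[0, T]) G b q u).
Let delta u := `|bk w u - b w u| + `|qk w u - q w u|.

Let ep0 : 0 <= ep.
Proof. by apply: le_trans (xe (u := 0) _); rewrite ?lexx. Qed.
Let delta_int : int delta.
Proof.
have [ib iq _ _] := D; have [ibk iqk _ _] := Dk.
by apply: integrableDR => //; apply: integrable_normR => //; exact: integrableBR.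
Qed.
Let delta0 u : 0 <= delta u. Proof. by rewrite addr_ge0. Qed.
Let dl0 : 0 <= dl.
Proof. by apply: le_trans de; apply: Rintegral_ge0 => u _; exact: delta0. Qed.

Let a_diff u : `|ak w u - a w u| <= lam * delta u.
Proof.
rewrite /ito_killing (_ : _ - _ = lam * ((`|bk w u| - `|b w u|) + (qk w u - q w u))); last by ring.
rewrite normrM ger0_norm // ler_wpM2l // (le_trans (ler_normD _ _)) // lerD //.
exact: ler_dist_dist.
Qed.

Let K_diff t : 0 <= t <= T -> `|weight ak w t - weight a w t| <= k * (lam * dl).
Proof.
move=> tT; have /andP[t0 tT'] := tT.
rewrite /weight (le_trans (expRN_lip (killing_primitive_ge Dk tT) (killing_primitive_ge D tT))) //.
rewrite ler_wpM2l ?expR_ge0 //.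
have i1 := integrable_sub (killing_integrable Dk) (lexx 0) tT'.
have i2 := integrable_sub (killing_integrable D) (lexx 0) tT'.
have mt : measurable (`[0, t]%classic : set R) by exact: measurable_itv.
rewrite -RintegralB //.
have i3 : mu.-integrable `[0, t] (fun u => (lam * delta u)%:E).
  by apply: integrableZR => //; exact: (integrable_sub delta_int).
have i4 : mu.-integrable `[0, t] (fun u => (ak w u - a w u)%:E) by exact: integrableBR.
have hd : forall u, (`[0, t]%classic : set R) u -> `|ak w u - a w u| <= lam * delta u by move=> u _; exact: a_diff.
rewrite (le_trans (le_Rintegral_norm _ i4 i3 hd)) //.
have i5 : mu.-integrable `[0, t] (fun u => (delta u)%:E) by exact: (integrable_sub delta_int).
rewrite RintegralZl // ler_wpM2l // (le_trans _ de) //.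
exact: (Rintegral_sub_le delta_int).
Qed.

Let F_diff t : 0 <= t <= T ->
  `|weight ak w t * f (xk w t) - weight a w t * f (x w t)| <= k * (lam * dl) * L + k * (L * ep).
Proof.
move=> tT.
rewrite (_ : _ - _ = (weight ak w t - weight a w t) * f (xk w t) + weight a w t * (f (xk w t) - f (x w t))); last by ring.
rewrite (le_trans (ler_normD _ _)) // lerD // normrM ler_pM //.
- exact: K_diff.
- exact: (sb_f fS).
- by rewrite ger0_norm ?expR_ge0 // (weight_killing_le D).
- by rewrite (le_trans (smooth_bounded_lip fS _ _)) // ler_wpM2l // xe.
Qed.

Let drift_diff u : 0 <= u <= T ->
  `|ito_drift f f1 f2 ak bk qk xk w u - ito_drift f f1 f2 a b q x w u| <=
  k * (lam * dl) * (L * G b q u) + k * (L * ep * G b q u) +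
  k * (L * (1 + lam) * delta u) + k * (lam * dl) * (L * (1 + lam) * delta u).
Proof.
move=> uT; have [_ _ q0 _] := D; have q0u := q0 u uT.
rewrite /ito_drift; set X := xk w u; set Y := x w u.
set gk := f2 X / 2 * qk w u + f1 X * bk w u - ak w u * f X.
set g := f2 Y / 2 * q w u + f1 Y * b w u - a w u * f Y.
(* Perturbed state with unperturbed coefficients: the changes of the state and of the coefficients
   are estimated separately. *)
pose g' := f2 X / 2 * q w u + f1 X * b w u - a w u * f X.
have hg' : `|g'| <= L * G b q u.
  rewrite (le_trans (core_le _ _ _ q0u)) // ler_wpM2l //.
  have := killing_norm b q0u; rewrite /G; lra.
have XY := xe uT; rewrite -/X -/Y in XY.
have h1 : `|g' - g| <= L * ep * G b q u.
  rewrite (_ : g' - g = (f2 X - f2 Y) / 2 * q w u + (f1 X - f1 Y) * b w u - a w u * (f X - f Y)); last by rewrite /g' /g; ring.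
  have l2 : `|f2 X - f2 Y| <= L * ep by rewrite (le_trans (sb_lip fS _ _)) // ler_wpM2l.
  have l1 : `|f1 X - f1 Y| <= L * ep by rewrite (le_trans (smooth_bounded_lip1 fS _ _)) // ler_wpM2l.
  have l0 : `|f X - f Y| <= L * ep by rewrite (le_trans (smooth_bounded_lip fS _ _)) // ler_wpM2l.
  apply: (@le_trans _ _ (L * ep * (q w u) + L * ep * `|b w u| + L * ep * `|a w u|)).
    rewrite (le_trans (ler_normB _ _)) // lerD //; last by rewrite normrM mulrC ler_wpM2r.
    rewrite (le_trans (ler_normD _ _)) // lerD //; last by rewrite normrM ler_wpM2r.
    rewrite (normrM _ (q w u)) (ger0_norm q0u) ler_wpM2r // normrM (@ger0_norm _ 2^-1) //.
    have := normr_ge0 (f2 X - f2 Y); lra.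
  rewrite -!mulrDr ler_wpM2l ?mulr_ge0 //.
  have := killing_norm b q0u; rewrite /G; lra.
have h2 : `|gk - g'| <= L * (1 + lam) * delta u.
  rewrite (_ : gk - g' = f2 X / 2 * (qk w u - q w u) + f1 X * (bk w u - b w u) - (ak w u - a w u) * f X); last by rewrite /gk /g'; ring.
  apply: (@le_trans _ _ (L * `|qk w u - q w u| + L * `|bk w u - b w u| + lam * delta u * L)).
    rewrite (le_trans (ler_normB _ _)) // lerD //; last first.
      by rewrite normrM ler_pM // (sb_f fS).
    rewrite (le_trans (ler_normD _ _)) // lerD //; last by rewrite normrM ler_wpM2r // (sb_f1 fS).
    rewrite (normrM _ (qk w u - q w u)) ler_wpM2r // normrM (@ger0_norm _ 2^-1) //.
    have := sb_f2 fS X; have := normr_ge0 (f2 X); lra.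
  rewrite /delta le_eqVlt; apply/orP; left; apply/eqP; ring.
have Kd := K_diff uT.
have Kk : `|weight a w u| <= k by rewrite ger0_norm ?expR_ge0 // (weight_killing_le D).
move: Kd Kk; set K1 := weight ak w u; set K0 := weight a w u => Kd Kk.
rewrite (_ : K1 * gk - K0 * g = (K1 - K0) * g' + K0 * (g' - g) + K0 * (gk - g') + (K1 - K0) * (gk - g')); last by ring.
rewrite (le_trans (ler_normD _ _)) // lerD //; last by rewrite normrM ler_pM.
rewrite (le_trans (ler_normD _ _)) // lerD //; last by rewrite normrM ler_pM.
by rewrite (le_trans (ler_normD _ _)) // lerD // normrM ler_pM.
Qed.

(** The path is perturbed uniformly by [ep], drift and density in L^1 by [dl]. The constant Z
    belongs to the unperturbed path alone, so the bound tends to 0 with [ep] and [dl]. *)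
Lemma ito_error_diff s t : 0 <= s -> s <= t -> t <= T ->
  `|ito_error f f1 f2 ak bk qk xk s t w - ito_error f f1 f2 a b q x s t w| <=
  2 * (k * (lam * dl) * L + k * (L * ep)) +
  (k * (lam * dl) * (L * Z) + k * (L * ep * Z) +
   k * (L * (1 + lam) * dl) + k * (lam * dl) * (L * (1 + lam) * dl)).
Proof.
move=> s0 st tT; have t0 := le_trans s0 st; have sT := le_trans st tT.
have sI : 0 <= s <= T by rewrite s0. have tI : 0 <= t <= T by rewrite t0.
rewrite /ito_error.
set I1 := \int[mu]_(u in _) _; set I0 := \int[mu]_(u in `[s, t]) ito_drift _ _ _ a _ _ _ _ _.
have e (p1 p2 p3 p4 i1 i2 : R) : p1 - p2 - i1 - (p3 - p4 - i2) = (p1 - p3) - (p2 - p4) - (i1 - i2) by ring.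
rewrite e (le_trans (ler_normB _ _)) // lerD //.
  rewrite (le_trans (ler_normB _ _)) // (mulr_natl _ 2) mulr2n lerD //; exact: F_diff.
have j1 := integrable_sub (ito_drift_integrable Dk) s0 tT.
have j2 := integrable_sub (ito_drift_integrable D) s0 tT.
have mt : measurable (`[s, t]%classic : set R) by exact: measurable_itv.
rewrite /I1 /I0 -RintegralB //.
have iG := Gint D.
have k1 : int (fun u => k * (lam * dl) * (L * G b q u)) by apply: integrableZR => //; exact: integrableZR.
have k2 : int (fun u => k * (L * ep * G b q u)) by apply: integrableZR => //; exact: integrableZR.
have k3 : int (fun u => k * (L * (1 + lam) * delta u)) by apply: integrableZR => //; exact: integrableZR.
have k4 : int (fun u => k * (lam * dl) * (L * (1 + lam) * delta u)) by apply: integrableZR => //; exact: integrableZR.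
have k12 : int (fun u => k * (lam * dl) * (L * G b q u) + k * (L * ep * G b q u)) by exact: integrableDR.
have k123 : int (fun u => k * (lam * dl) * (L * G b q u) + k * (L * ep * G b q u) + k * (L * (1 + lam) * delta u)) by exact: integrableDR.
have kk : int (fun u => k * (lam * dl) * (L * G b q u) + k * (L * ep * G b q u) + k * (L * (1 + lam) * delta u) + k * (lam * dl) * (L * (1 + lam) * delta u)) by exact: integrableDR.
have kk' := integrable_sub kk s0 tT.
have jj : mu.-integrable `[s, t] (fun u => (ito_drift f f1 f2 ak bk qk xk w u - ito_drift f f1 f2 a b q x w u)%:E).
  exact: integrableBR.
apply: le_trans.
  apply: (le_Rintegral_norm _ jj kk') => // => u; rewrite /= in_itv /= => /andP[su ut].
  by apply: drift_diff; rewrite (le_trans s0 su) (le_trans ut).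
have kp : 0 <= k by exact: expR_ge0.
have G0 u : 0 <= u <= T -> 0 <= G b q u.
  by move=> uT; have [_ _ q0 _] := D; rewrite /G !addr_ge0 ?mulr_ge0 ?addr_ge0 // q0.
apply: (@le_trans _ _ (\int[mu]_(u in `[0, T]) (k * (lam * dl) * (L * G b q u) + k * (L * ep * G b q u) + k * (L * (1 + lam) * delta u) + k * (lam * dl) * (L * (1 + lam) * delta u)))).
  apply: (Rintegral_sub_le kk) => // u uT; have := G0 u uT => gu; have := delta0 u => du.
  by rewrite !addr_ge0 // !mulr_ge0 // ?addr_ge0.
have iLG : int (fun u => L * G b q u) by exact: integrableZR.
have iLeG : int (fun u => L * ep * G b q u) by exact: integrableZR.
have iLd : int (fun u => L * (1 + lam) * delta u) by exact: integrableZR.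
rewrite RintegralD // RintegralD // RintegralD //.
have RZ c (g : R -> R) : int g -> \int[mu]_(u in `[0, T]) (c * g u) = c * \int[mu]_(u in `[0, T]) g u.
  by move=> ig; rewrite RintegralZl.
rewrite (RZ _ _ iLG) (RZ _ _ iLeG) !(RZ _ _ iLd) !(RZ _ _ iG) !(RZ _ _ delta_int).
rewrite !lerD // ler_wpM2l ?mulr_ge0 // ?addr_ge0 // ler_wpM2l ?mulr_ge0 // addr_ge0 //.
Qed.

End Stability.

(** * Suprema of paths, convergence in probability *)

Lemma measurable_bigmax (R : realType) d (Om : measurableType d) k (g : 'I_k -> Om -> R) :
  (forall i, measurable_fun setT (g i)) ->
  measurable_fun setT (fun w => \big[Num.max/0]_(i < k) g i w).
Proof.
elim: k g => [|k IH] g mg.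
  rewrite (_ : (fun w => _) = cst 0); last by apply/funext => w; rewrite big_ord0.
  exact: measurable_cst.
rewrite (_ : (fun w => _) = (fun w => Num.max (g ord0 w) (\big[Num.max/0]_(i < k) g (lift ord0 i) w))); last first.
  by apply/funext => w; rewrite big_ord_recl.
by apply: measurable_maxf; [exact: mg|apply: IH].
Qed.

Section PathSup.
Context (R : realType) (T : R).
Hypothesis T_gt0 : 0 < T.

Definition grid_max (h : R -> R) (n : nat) : R :=
  \big[Num.max/0]_(i < n.+2) `|h (grid 0 T n i)|.

Lemma grid_max_ge h n i : (i <= n.+1)%N -> `|h (grid 0 T n i)| <= grid_max h n.
Proof. by move=> hi; rewrite /grid_max (le_bigmax _ (fun i : 'I_n.+2 => `|h (grid 0 T n i)|) (Ordinal (hi : (i < n.+2)%N))). Qed.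

Lemma grid_max_le h n M : 0 <= M -> (forall t, 0 <= t <= T -> `|h t| <= M) -> grid_max h n <= M.
Proof.
move=> M0 hM; apply: bigmax_le => // i _; apply: hM.
by apply: (grid_itv (ltW T_gt0)); rewrite -ltnS.
Qed.

Lemma grid_max_ge0 h n : 0 <= grid_max h n.
Proof. exact: le_trans (normr_ge0 _) (grid_max_ge h (leq0n _)). Qed.

Lemma sup_path_attained d (Om : measurableType d) (X : Om -> R -> R) w :
  {within `[0, T], continuous (X w)} -> exists2 t0, 0 <= t0 <= T &
  sup_path T X w = `|X w t0|%:E /\ forall t, 0 <= t <= T -> `|X w t| <= `|X w t0|.
Proof.
move=> cX.
have cN : {within `[0, T], continuous (fun t => `|X w t|)}.
  by move=> t; apply: cvg_norm; exact: cX.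
have [t0 t0T ht0] := EVT_max (ltW T_gt0) cN.
exists t0; first by move: t0T; rewrite in_itv.
have h t : 0 <= t <= T -> `|X w t| <= `|X w t0| by move=> tT; apply: ht0; rewrite in_itv.
split => //; apply/eqP; rewrite eq_le; apply/andP; split.
  by apply: ge_ereal_sup => y [t] /=; rewrite in_itv /= => tT <-; rewrite lee_fin h.
by apply: ereal_sup_ubound; exists t0 => //=; rewrite in_itv; move: t0T; rewrite in_itv.
Qed.

(** The grid point just before a maximizer is within one mesh of it. In this way a supremum over
    time becomes a limit of finite maxima, hence measurable. *)
Lemma grid_max_cvg (h : R -> R) t0 : {within `[0, T], continuous h} -> 0 <= t0 <= T ->
  (forall t, 0 <= t <= T -> `|h t| <= `|h t0|) -> grid_max h n @[n --> \oo] --> `|h t0|.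
Proof.
move=> ch t0T ht0; apply/cvgrPdist_lt => e e0.
have [dl dl0 hd] := within_continuous_dist ch t0T e0.
have := natSinv_lt (divr_gt0 dl0 T_gt0) => -[N _ hN].
exists N => // n /= Nn.
have [i i_n /andP[it ti]] := grid_find (ltW T_gt0) n t0T T_gt0.
have gT := grid_itv (ltW T_gt0) i_n.
have gt0 : `|grid 0 T n i - t0| < dl.
  rewrite distrC ger0_norm ?subr_ge0 //; have := grid_step 0 T n i; rewrite subr0 => st.
  have := hN n Nn; rewrite ltr_pdivlMr // mulrC => h1.
  by apply: lt_trans h1; rewrite -st ltrD2r.
have h1 := hd _ gT gt0.
have h2 := grid_max_ge h i_n; have h3 := grid_max_le n (normr_ge0 (h t0)) ht0.
rewrite ger0_norm ?subr_ge0 //.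
have h4 := lerB_dist (h t0) (h (grid 0 T n i)); rewrite distrC in h4.
by rewrite (le_lt_trans _ h1) // (le_trans _ h4) // lerD2l lerN2.
Qed.

Lemma measurable_grid_max d (Om : measurableType d) (X : Om -> R -> R) n :
  (forall t, 0 <= t <= T -> measurable_fun setT (fun w => X w t)) ->
  measurable_fun setT (fun w => grid_max (X w) n).
Proof.
move=> mX; rewrite /grid_max.
apply: measurable_bigmax => i; apply: measurable_normf; apply: mX.
by apply: (grid_itv (ltW T_gt0)); rewrite -ltnS.
Qed.

Lemma sup_path_measurable d (Om : measurableType d) (X : Om -> R -> R) :
  (forall w, {within `[0, T], continuous (X w)}) ->
  (forall t, 0 <= t <= T -> measurable_fun setT (fun w => X w t)) ->
  measurable_fun setT (fun w => fine (sup_path T X w)) /\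
  forall w, sup_path T X w = (fine (sup_path T X w))%:E.
Proof.
move=> cX mX; split; last first.
  by move=> w; have [t0 _ [-> _]] := sup_path_attained (cX w).
apply: (measurable_fun_cvg (h := fun n w => grid_max (X w) n)).
  by move=> n; exact: measurable_grid_max.
move=> w _; have [t0 t0T [-> ht0]] := sup_path_attained (cX w).
exact: grid_max_cvg.
Qed.

End PathSup.

Section CvgInProbability.
Context d (Om : measurableType d) (R : realType) (P : probability Om R).
Implicit Types X Y : nat -> Om -> \bar R.

(** Serves to replace [W] by its continuous modification in the approximation of the stochastic
    integral; level sets of [X] differ from measurable ones by null sets. *)
Lemma cvg_in_probability_ae X Y : measure_is_complete P ->
  (forall k, measurable_fun setT (Y k)) -> (forall k, \forall w \ae P, X k w = Y k w) ->
  cvg_in_probability P X -> cvg_in_probability P Y.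
Proof.
move=> cP mY XY hX e e0; apply: cvg_trans (hX e e0); apply: near_eq_cvg.
near=> k; have mB : measurable [set w | (e%:E <= Y k w)%E].
  rewrite -[X in measurable X]setTI.
  by have := mY k measurableT `[e%:E, +oo[%classic (emeasurable_itv _); congr measurable; apply/seteqP; split => w /=; rewrite in_itv /= andbT.
set A := [set w | (e%:E <= X k w)%E]; set B := [set w | _] in mB *.
have nAB : P.-negligible (A `\` B `|` B `\` A).
  apply: negligibleS (XY k) => w /=; rewrite /A /B /= => h e1; move: h; rewrite e1; tauto.
have n1 : P.-negligible (A `\` B) by apply: negligibleS nAB => w; left.
have n2 : P.-negligible (B `\` A) by apply: negligibleS nAB => w; right.
apply: measure_ae_eq => //.
have -> : A = (B `\` (B `\` A)) `|` (A `\` B).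
  apply/seteqP; split => w; last by case=> [[Bw /not_andP[//|/contrapT]]|[]].
  by move=> Aw; have [Bw|nB] := pselect (B w); [left; split => // -[]|right].
by apply: measurableU; [apply: measurableD => //; exact: cP|exact: cP].
Unshelve. all: by end_near. Qed.

Lemma measurable_ge_set (Y : Om -> \bar R) e : measurable_fun setT Y ->
  measurable [set w | (e%:E <= Y w)%E].
Proof.
move=> mY; rewrite -[X in measurable X]setTI.
have := mY measurableT `[e%:E, +oo[%classic (emeasurable_itv _).
by congr measurable; apply/seteqP; split => w /=; rewrite in_itv /= andbT.
Qed.

Lemma cvg_in_probabilityD X Y : (forall k, measurable_fun setT (X k)) ->
  (forall k, measurable_fun setT (Y k)) ->
  cvg_in_probability P X -> cvg_in_probability P Y ->
  cvg_in_probability P (fun k w => X k w + Y k w)%E.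
Proof.
move=> mX mY hX hY e e0; have e2 : 0 < e / 2 by rewrite divr_gt0.
apply: (@squeeze_cvge _ _ _ _ (fun=> 0%E) _
  (fun k => P [set w | ((e / 2)%:E <= X k w)%E] + P [set w | ((e / 2)%:E <= Y k w)%E])%E).
- apply: nearW => k; rewrite measure_ge0 /=.
  have m1 := measurable_ge_set (e / 2) (mX k); have m2 := measurable_ge_set (e / 2) (mY k).
  apply: le_trans (measureU2 _ m1 m2); apply: le_measure; rewrite ?inE.
  + by apply: measurable_ge_set; exact: emeasurable_funD.
  + exact: measurableU.
  + move=> w /= h; apply: contrapT => /not_orP[/negP]; rewrite -ltNge => h1 /negP; rewrite -ltNge => h2.
    by have := lteD h1 h2; rewrite -EFinD -splitr ltNge h.
- exact: cvg_cst.
- by rewrite -[X in _ --> X]adde0; apply: cvgeD => //; [exact: hX|exact: hY].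
Qed.

(** Borel-Cantelli, along indices at which the value 1 / (n + 1) is reached with probability at most
    2^-(n + 1). *)
Lemma cvg_in_probability_subseq X : (forall k, measurable_fun setT (X k)) ->
  cvg_in_probability P X -> exists phi : nat -> nat,
  \forall w \ae P, forall e, 0 < e -> exists N, forall n, (N <= n)%N -> (X (phi n) w < e%:E)%E.
Proof.
move=> mX hX.
have hk n : exists k, (P [set w | ((n.+1%:R^-1)%:E <= X k w)%E] <= (1 / (2 ^ n.+1)%:R)%:E)%E.
  have n0 : 0 < n.+1%:R^-1 :> R by rewrite invr_gt0.
  have p0 : 0 < 1 / (2 ^ n.+1)%:R :> R by rewrite divr_gt0 // ltr0n expn_gt0.
  have /fine_cvgP[hfin /cvgrPdist_lt/(_ (1 / (2 ^ n.+1)%:R) p0) hlt] := hX _ n0.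
  have [k [hf hl]] := filter_ex (filterI hfin hlt); exists k.
  rewrite -(fineK hf) lee_fin ltW //; move: hl; rewrite sub0r normrN.
  exact: le_lt_trans (ler_norm _).
have [phi hphi] := choice hk; exists phi.
pose F n := [set w | ((n.+1%:R^-1)%:E <= X (phi n) w)%E].
have mF n : measurable (F n) by exact: measurable_ge_set.
have sF : (\sum_(n <oo) P (F n) < +oo)%E.
  apply: (@le_lt_trans _ _ (\sum_(n <oo) (1 / (2 ^ n.+1)%:R)%:E)%E).
    by apply: lee_nneseries => n _ *; [exact: measure_ge0|exact: hphi].
  by apply: le_lt_trans (epsilon_trick0 xpredT ler01) _; rewrite ltry.
have := lim_sup_set_cvg0 mF sF.
move=> h0; exists (lim_sup_set F); split => //.
  by apply: bigcap_measurable => // n _; apply: bigcup_measurable => j _; exact: mF.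
move=> w /= hw; apply: contrapT => nlim; apply: hw => e e0.
have [n0 hn0] : exists n0, forall j, (n0 <= j)%N -> ~ F j w.
  apply: contrapT => no; apply: nlim => n _; apply: contrapT => nex; apply: no; exists n => j nj Fj.
  by apply: nex; exists j.
have [n1 _ hn1] := natSinv_lt e0.
exists (maxn n0 n1) => n; rewrite geq_max => /andP[n0n n1n].
have := hn0 n n0n; rewrite /F /= => /negP; rewrite -ltNge => /lt_trans; apply.
by rewrite lte_fin; exact: hn1.
Qed.

End CvgInProbability.

(** * Measurability for the progressive sigma-algebra *)

Lemma measurable_fun_pair_on d1 d2 d3 (T1 : measurableType d1) (T2 : measurableType d2)
    (T3 : measurableType d3) (D : set T1) (f : T1 -> T2) (g : T1 -> T3) :
  measurable D -> measurable_fun D f -> measurable_fun D g ->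
  measurable_fun D (fun x => (f x, g x)).
Proof.
move=> mD mf mg; have [->|/set0P[x0 Dx0]] := eqVneq D set0; first exact: measurable_fun_set0.
(* Off [D] the functions are given their value at [x0], which makes them measurable on the whole
   space, where pairs of measurable functions are measurable. *)
have ext d4 (T4 : measurableType d4) (h : T1 -> T4) : measurable_fun D h ->
    measurable_fun setT (fun x => if x \in D then h x else h x0).
  move=> mh; apply: measurable_fun_if => //.
  - by apply: (measurable_fun_bool true); rewrite setTI (_ : _ @^-1` _ = D) //; apply/seteqP; split => x /=; [move/set_mem|move/mem_set].
  - rewrite setTI (_ : _ @^-1` _ = D) //; apply/seteqP; split => x /=; first by move/set_mem.
    by move/mem_set ->.
apply: (eq_measurable_fun (fun x => (if x \in D then f x else f x0, if x \in D then g x else g x0))).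
  by move=> x ->.
by apply: measurable_funTS; apply: measurable_fun_pair; exact: ext.
Qed.

Section Prog.
Context (R : realType) (d : measure_display) (Omega : measurableType d)
  (P : probability Omega R).
Context (T : R) (m : nat) (W : Omega -> R -> 'rV[R]_m).
Hypothesis T_ge0 : 0 <= T.
Local Notation Ft t := (filtered P W t).
Local Notation PG := (prog P T W).
Local Notation D := ([set: Omega] `*` `[0, T]%classic).

Lemma prog_measurableE (A : set PG) : measurable A -> prog_sets P T W A.
Proof. by rewrite /measurable /= sigma_algebra_id //; exact: sigma_algebra_prog_sets. Qed.

Lemma prog_domain : @measurable _ PG D.
Proof.
apply: sub_sigma_algebra => t /andP[t0 tT].
rewrite (_ : _ `&` _ = [set: Ft t] `*` `[0, t]%classic).
  by apply: measurableX; [exact: measurableT|exact: measurable_itv].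
apply/seteqP; split => -[w s] /=; first by case.
by rewrite !in_itv /= => -[_ /andP[-> st]]; rewrite st (le_trans st).
Qed.

Lemma prog_progressive d' (E : measurableType d') (X : Omega -> R -> E) (g : E -> R) :
  prog_measurable P T W X -> measurable_fun setT g ->
  progressive P T W (fun w s => g (X w s)).
Proof.
move=> mX mg t tT mD B mB; have /andP[t0 tT'] := tT.
have := mg measurableT B mB; rewrite setTI => mB'.
have := prog_measurableE (mX prog_domain _ mB') tT.
congr measurable; apply/seteqP; split => -[w s] /=; first by case=> ? [].
by rewrite !in_itv /= => -[[_ /andP[-> st]] ?]; do !split => //; rewrite /= ?st // (le_trans st).
Qed.

Lemma progressive_prog (X : Omega -> R -> R) : progressive P T W X -> prog_measurable P T W X.
Proof.
move=> pX _ B mB; apply: sub_sigma_algebra => t tT; have /andP[t0 tT'] := tT.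
have mD : @measurable _ (Ft t * R)%type ([set: Ft t] `*` `[0, t]%classic).
  by apply: measurableX; [exact: measurableT|exact: measurable_itv].
have := pX t tT mD B mB.
congr measurable; apply/seteqP; split => -[w s] /=; last by case=> ? [].
by rewrite !in_itv /= => -[[_ /andP[-> st]] ?]; do !split => //; rewrite /= ?st // (le_trans st).
Qed.

Lemma generator_progressive (F : generator_type R Omega m) (Y : Omega -> R -> R)
    (Z : Omega -> R -> 'rV[R]_m) :
  is_generator P T W F -> progressive P T W Y ->
  prog_measurable P T W (Z : Omega -> R -> borel_rV R m) ->
  progressive P T W (fun w s => F w s (Y w s) (Z w s)).
Proof.
move=> mF pY mZ; apply: (prog_progressive (E := R) (g := id)); last exact: measurable_id.
have mY := progressive_prog pY.
have mD := prog_domain.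
have mid : @measurable_fun _ _ PG PG D id by exact: measurable_id.
have mp := measurable_fun_pair_on mD (measurable_fun_pair_on mD mid mY) mZ.
apply: (@measurable_comp _ _ _ PG (PG * R * borel_rV R m)%type R
  ((D `*` setT) `*` setT) (fun x => F x.1.1.1 x.1.1.2 x.1.2 x.2) D
  (fun x => (x, Y x.1 x.2, Z x.1 x.2))) => //.
- by apply: measurableX => //; exact: measurableX.
- by move=> _ [x Dx <-]; do !split => //=; case: Dx.
Qed.

End Prog.

(** * Ito's formula for general integrands *)

Lemma norm_sub3_le (R : realType) (p1 p2 p3 c1 c2 : R) :
  `|p1| <= c1 -> `|p2| <= c1 -> `|p3| <= c2 -> `|p1 - p2 - p3| <= 2 * c1 + c2.
Proof. by move=> a1 a2 a3; have := ler_normB (p1 - p2) p3; have := ler_normB p1 p2; lra. Qed.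

Lemma budget_algebra (R : realType) (Kt Ks th I lG k T : R) :
  0 <= th -> 0 <= Kt -> Ks <= k -> I <= k * T -> Kt - Ks - (th * I - lG) = 0 ->
  lG <= k * (1 + th * T).
Proof.
move=> th0 Kt0 Ksk Ik h; have : th * I <= th * (k * T) by exact: ler_wpM2l.
rewrite (_ : k * (1 + th * T) = k + th * (k * T)); last by ring.
lra.
Qed.

Lemma killing_sum_le (R : realType) (lam th b q a : R) :
  a <= lam * (b + q) + th -> q + b + a <= (1 + lam) * (b + q) + th.
Proof. by rewrite mulrDl mul1r; lra. Qed.

Lemma ftc_algebra (R : realType) (k A r rT : R) : 0 <= k -> 0 <= A -> 0 <= r -> r <= rT ->
  k * A ^+ 2 * k * (r ^+ 2) ^+ 2 + k * A * k * A * (r ^+ 2) ^+ 2 <=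
  (k * A ^+ 2 * k + k * A * k * A) * rT * r ^+ 3.
Proof.
move=> k0 A0 r0 rrT; rewrite -subr_ge0.
rewrite (_ : _ - _ = (k * A ^+ 2 * k + k * A * k * A) * ((rT - r) * r ^+ 3)); last by ring.
rewrite mulr_ge0 //; first by rewrite addr_ge0 // !mulr_ge0 // sqr_ge0.
by rewrite mulr_ge0 ?exprn_ge0 // subr_ge0.
Qed.

Lemma budget_bound (R : realType) (lam L th IG IK Bu kT : R) : 0 < lam -> 0 <= L -> 0 <= th ->
  lam * IG <= Bu -> IK <= kT ->
  L * (1 + lam) * IG + L * th * IK <= L * ((1 + lam) / lam * Bu + th * kT).
Proof.
move=> l0 L0 th0 h1 h2; rewrite [leRHS]mulrDr -!mulrA lerD // ler_wpM2l //; last exact: ler_wpM2l.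
by rewrite ler_wpM2l ?addr_ge0 ?(ltW l0) // ler_pdivlMl.
Qed.

Lemma half_le (R : realType) (x L : R) : `|x| <= L -> `|x| / 2 <= L.
Proof. by have := normr_ge0 x; lra. Qed.

Lemma sqr_euclidB_le (R : realType) m (u v : 'rV[R]_m) :
  euclid (u - v) ^+ 2 <= 2 * euclid u ^+ 2 + 2 * euclid v ^+ 2.
Proof.
rewrite !sqr_euclid /dotp !mulr_sumr -big_split /=; apply: ler_sum => i _; rewrite !mxE.
have : 0 <= (u 0 i + v 0 i) ^+ 2 by exact: sqr_ge0.
by move: (u 0 i) (v 0 i) => x y h; nra.
Qed.

(** The cross term of |v + (u - v)|^2 is split by Young's inequality with parameter e. Closeness of
    integrands in L^2 thus gives closeness of their squares in L^1. *)
Lemma sqr_euclid_diff_le (R : realType) m (u v : 'rV[R]_m) (e : R) : 0 < e ->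
  `|euclid u ^+ 2 - euclid v ^+ 2| <= (1 + e^-1) * euclid (u - v) ^+ 2 + e * euclid v ^+ 2.
Proof.
move=> e0; rewrite !sqr_euclid /dotp -sumrB !mulr_sumr -big_split /=.
rewrite (le_trans (ler_norm_sum _ _ _)) //; apply: ler_sum => i _; rewrite !mxE.
move: (u 0 i) (v 0 i) => x y.
have e0' := ltW e0.
rewrite (_ : (1 + e^-1) * _ = (x - y) ^+ 2 + ((x - y) / e) ^+ 2 * e); last by field; rewrite lt0r_neq0.
set t := (x - y) / e.
have xy : x - y = t * e by rewrite /t divfK // lt0r_neq0.
have h1 : 0 <= e * (t - y) ^+ 2 by rewrite mulr_ge0 // sqr_ge0.
have h2 : 0 <= e * (t + y) ^+ 2 by rewrite mulr_ge0 // sqr_ge0.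
have h3 : 0 <= (x - y) ^+ 2 by exact: sqr_ge0.
rewrite ler_norml; apply/andP; split.
  rewrite -subr_ge0 (_ : _ - _ = 2 * (x - y) ^+ 2 + (x * x - y * y - (x - y) ^+ 2 + t ^+ 2 * e + e * (y * y))); last by ring.
  rewrite (_ : x * x - y * y - _ = 2 * y * (x - y)); last by ring.
  rewrite xy; have : 2 * y * (t * e) + t ^+ 2 * e + e * (y * y) = e * (t + y) ^+ 2 by ring.
  by move=> ->; rewrite -xy addr_ge0 // mulr_ge0.
rewrite -subr_ge0 (_ : _ - _ = - (x * x - y * y - (x - y) ^+ 2) + t ^+ 2 * e + e * (y * y)); last by ring.
rewrite (_ : x * x - y * y - _ = 2 * y * (x - y)); last by ring.
rewrite xy; have : - (2 * y * (t * e)) + t ^+ 2 * e + e * (y * y) = e * (t - y) ^+ 2 by ring.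
by move=> ->.
Qed.

(** For the constant function 1 the Ito error vanishes exactly when the weight K satisfies K' = - a
    K in integrated form. *)
Lemma smooth_bounded_one (R : realType) : smooth_bounded (cst 1) (cst 0) (cst 0) (1 : R).
Proof.
by split => [x|x|x|x|x|x y] /=; rewrite ?normr1 ?normr0 ?subrr ?normr0 ?mulr_ge0 //;
  exact: is_derive_cst.
Qed.

Lemma ito_error_one (R : realType) d (Omega : measurableType d) (a b q x : Omega -> R -> R) s t w :
  ito_error (cst 1) (cst 0) (cst 0) a b q x s t w =
  weight a w t - weight a w s - \int[@lebesgue_measure R]_(u in `[s, t]) (weight a w u * - a w u).
Proof.
rewrite /ito_error; congr (_ - _ - _); [exact: mulr1|exact: mulr1|apply: eq_Rintegral => u _].
by rewrite /ito_drift /= !mul0r mulr1 !add0r.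
Qed.

Section WeightFTC.
Context (R : realType) (d : measure_display) (Omega : measurableType d)
  (P : probability Omega R).
Hypothesis P_complete : measure_is_complete P.
Context (T : R) (m : nat) (W : Omega -> R -> 'rV[R]_m).
Hypothesis W_bm : brownian_motion P T W.
Hypothesis T_ge0 : 0 <= T.
Local Notation mu := (@lebesgue_measure R).

(** The rate is only bounded and measurable, so the weight need not be differentiable everywhere.
    The one-step estimate, free of randomness here, makes the error an additive function with
    increments of order 3/2, hence zero. *)
Lemma weight_ftc (a b q x : Omega -> R -> R) A s t w : progressive P T W a ->
  (forall w s, 0 <= s <= T -> `|a w s| <= A) -> 0 <= s -> s <= t -> t <= T ->
  ito_error (cst 1) (cst 0) (cst 0) a b q x s t w = 0.
Proof.
move=> pa aA s0 st tT.
have A0 : 0 <= A by apply: le_trans (aA w 0 _); rewrite ?lexx.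
(* With a constant test function the error does not see drift, density and state; all three are
   replaced by 0. *)
pose z := fun (_ : Omega) (_ : R) => (0 : R).
have e s' t' : ito_error (cst 1) (cst 0) (cst 0) a b q x s' t' w = ito_error (cst 1) (cst 0) (cst 0) a z z z s' t' w.
  by rewrite !ito_error_one.
have pz : progressive P T W z by exact: progressive_cst.
have zc : continuous_adapted P T W z.
  by split => [w'|r rT]; [move=> r; exact: cvg_cst|exact: measurable_cst].
have z0 w' r : 0 <= r <= T -> `|z w' r| <= 0 by rewrite normr0.
have z0' w' r : 0 <= r <= T -> `|z w' r| <= 0 ^+ 2 by rewrite normr0 expr0n.
have cat := ito_error_cat P_complete W_bm T_ge0 (smooth_bounded_one R) pa pz pz zc aA z0 z0' w.
have step := ito_step_pathwise P_complete W_bm T_ge0 (smooth_bounded_one R) pa pz pz zc aA z0 z0'.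
pose g r := ito_error (cst 1) (cst 0) (cst 0) a z z z s r w.
have g0 : g s = 0 by rewrite /g ito_error_one set_itv1 Rintegral_set1 subrr subr0.
rewrite e -/(g t) -g0.
pose k := expR (A * T); have k0 : 0 <= k by exact: expR_ge0.
pose C := (k * A ^+ 2 * k + k * A * k * A) * Num.sqrt T.
apply: (@cst_of_sqrt_cube _ g s t C) => //.
  by rewrite !mulr_ge0 ?sqrtr_ge0 // addr_ge0 // !mulr_ge0 // sqr_ge0.
move=> u v su uv vt.
have u0 := le_trans s0 su; have vT := le_trans vt tT.
rewrite /g (cat s u v s0 su uv vT) addrC addKr.
have [<-|uv'] := eqVneq u v.
  rewrite ito_error_one set_itv1 Rintegral_set1 subrr subr0 normr0 mulr_ge0 ?exprn_ge0 ?sqrtr_ge0 //.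
  by rewrite !mulr_ge0 ?sqrtr_ge0 // addr_ge0 // !mulr_ge0 // sqr_ge0.
have {uv'} ltuv : u < v by rewrite lt_neqAle uv' uv.
have := step w u v 0 u0 ltuv vT A0 (lexx 0).
have Iz r r' : \int[mu]_(_ in `[r, r']) (0 : R) = 0 by rewrite Rintegral_cst ?mul0r.
have hq : forall y, u < y -> y <= v -> z w y = euclid (0 : 'rV[R]_m) ^+ 2.
  by move=> y _ _; rewrite euclid0 expr0n.
have hy : {within `[u, v], continuous (fun y => z w y - z w u - \int[mu]_(r in `[u, y]) z w r)}.
  apply: within_continuousP => y yT e' e'0; exists 1 => // r rT ry.
  by rewrite !Iz !subrr normr0.
move=> /(_ hq hy); rewrite /= Iz !subrr euclid0 -/k.
under eq_Rintegral do rewrite Iz !subrr normr0.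
rewrite ?(normr0, expr0n, mulr0, mul0r, addr0, add0r, subr0, sub0r, mulr1, mul1r, Iz) /=.
rewrite ?Iz ?mulr0 ?addr0 => /le_trans; apply.
rewrite /C; have d0 : 0 <= v - u by rewrite subr_ge0.
have sq2 : Num.sqrt (v - u) ^+ 2 = v - u by rewrite sqr_sqrtr.
have sT : Num.sqrt (v - u) <= Num.sqrt T by rewrite ler_sqrt // (le_trans _ vT) // gerBl.
have e4 : (v - u) ^+ 2 = (Num.sqrt (v - u) ^+ 2) ^+ 2 by rewrite sq2.
by rewrite e4; apply: ftc_algebra => //; exact: sqrtr_ge0.
Qed.

End WeightFTC.

Section Budget.
Context (R : realType) (T : R).
Hypothesis T_ge0 : 0 <= T.
Local Notation mu := (@lebesgue_measure R).
Context (d : measure_display) (Omega : measurableType d) (w : Omega).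
Context (lam theta : R).
Hypothesis lam0 : 0 < lam.
Hypothesis th0 : 0 <= theta.
Context (b q x : Omega -> R -> R).
Hypothesis D : path_data T w b q x.
Local Notation a := (ito_killing lam theta b q).
Local Notation k := (expR (theta * T)).
Context (s t : R).
Hypothesis s0 : 0 <= s.
Hypothesis st : s <= t.
Hypothesis tT : t <= T.
Hypothesis ftc : ito_error (cst 1) (cst 0) (cst 0) a b q x s t w = 0.

Let Kle u : s <= u <= t -> 0 <= weight a w u <= k.
Proof.
move=> /andP[su ut]; rewrite (ltW (weight_gt0 _ _ _)) /=.
by apply: (weight_killing_le (ltW lam0) th0 D); rewrite (le_trans s0 su) (le_trans ut).
Qed.

Let sst : s <= s <= t. Proof. by rewrite lexx. Qed.

Let int0 (g : R -> R) := mu.-integrable `[0, T] (fun u => (g u)%:E).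
Let mst : measurable (`[s, t]%classic : set R). Proof. exact: measurable_itv. Qed.

Let mK : measurable_fun `[0, T] (weight a w).
Proof. by apply: weight_killing_measurable => //; exact: D. Qed.

Let K0 u : 0 <= weight a w u. Proof. exact: ltW (weight_gt0 _ _ _). Qed.

Let ig : int0 (fun u => `|b w u| + q w u).
Proof. by have [ib iq _ _] := D; apply: integrableDR => //; exact: integrable_normR. Qed.

Let iKg : int0 (fun u => weight a w u * (`|b w u| + q w u)).
Proof.
have [ib iq q0 _] := D.
have mg : measurable_fun `[0, T] (fun u => `|b w u| + q w u) by exact: (integrable_measR (mu := mu)).
apply: (@integrable_leR _ _ _ mu _ _ _ (fun u => k * (`|b w u| + q w u))) => //; first exact: measurable_mulf.
  move=> u; rewrite /= in_itv /= => uT; rewrite normrM ler_pM //.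
    by rewrite ger0_norm ?K0 //; exact: (weight_killing_le (ltW lam0) th0 D).
  by rewrite ger0_norm // addr_ge0 // q0.
exact: integrableZR.
Qed.

Let iK : int0 (weight a w).
Proof.
apply: (@integrable_boundR _ _ _ mu _ _ _ k) => //; first exact: measure_segment_lty.
move=> u; rewrite /= in_itv /= => uT.
by rewrite ger0_norm ?K0 //; exact: (weight_killing_le (ltW lam0) th0 D).
Qed.

Let hK : \int[mu]_(u in `[s, t]) weight a w u <= k * T.
Proof.
have kb u : s <= u <= t -> `|weight a w u| <= k.
  by move=> /Kle /andP[? ?]; rewrite ger0_norm.
apply: le_trans (ler_norm _) (le_trans (Rintegral_bound iK s0 st tT kb) _).
by rewrite ler_wpM2l ?expR_ge0 // (le_trans _ tT) // gerBl.
Qed.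

(** The integrated weight equation says that the integral of K a is K_s - K_t, hence at most k.
    Moving the part with theta to the right leaves a bound that depends on neither [b] nor [q]. *)
Lemma killing_budget :
  lam * \int[mu]_(u in `[s, t]) (weight a w u * (`|b w u| + q w u)) <= k * (1 + theta * T).
Proof.
have sT := le_trans st tT; have t0 := le_trans s0 st.
move: ftc; rewrite ito_error_one => h.
have i1 := integrable_sub iKg s0 tT; have i2 := integrable_sub iK s0 tT.
have e : \int[mu]_(u in `[s, t]) (weight a w u * - a w u) =
    theta * \int[mu]_(u in `[s, t]) weight a w u - lam * \int[mu]_(u in `[s, t]) (weight a w u * (`|b w u| + q w u)).
  rewrite -(RintegralZl _ _ i1) // -(RintegralZl _ _ i2) // -RintegralB //; try exact: integrableZR.
  by apply: eq_Rintegral => u _; rewrite /ito_killing; ring.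
move: h; rewrite e => h.
have hs : weight a w s <= k by have /andP[] := Kle (u := s) sst.
have ht := K0 t.
exact: (budget_algebra th0 ht hs hK h).
Qed.

Context (f f1 f2 : R -> R) (L : R).
Hypothesis fS : smooth_bounded f f1 f2 L.

(** The drift is at most a multiple of K (|b| + q) + K, and [killing_budget] bounds its integral by
    a constant free of the path. This is the domination used in the limit. *)
Lemma ito_error_killing_bound :
  `|ito_error f f1 f2 a b q x s t w| <=
  2 * (k * L) + L * ((1 + lam) / lam * (k * (1 + theta * T)) + theta * (k * T)).
Proof.
have L0 : 0 <= L by exact: le_trans (sb_f fS 0).
have sT := le_trans st tT; have t0 := le_trans s0 st.
have [ib iq q0 _] := D.
have ks : `|weight a w s| <= k by rewrite ger0_norm ?K0 //; have /andP[] := Kle (u := s) sst.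
have kt : `|weight a w t| <= k by rewrite ger0_norm ?K0 //; apply: (weight_killing_le (ltW lam0) th0 D); rewrite t0.
have h1 : `|weight a w t * f (x w t)| <= k * L.
  by rewrite normrM; exact: (ler_pM (normr_ge0 _) (normr_ge0 _) kt (sb_f fS _)).
have h2 : `|weight a w s * f (x w s)| <= k * L.
  by rewrite normrM; exact: (ler_pM (normr_ge0 _) (normr_ge0 _) ks (sb_f fS _)).
apply: (norm_sub3_le h1 h2); clear h1 h2.
have i1 := integrable_sub iKg s0 tT; have i2 := integrable_sub iK s0 tT.
have iI := integrable_sub (ito_drift_integrable T_ge0 fS (ltW lam0) th0 D) s0 tT.
have j1 : mu.-integrable `[s, t] (fun u => (L * (1 + lam) * (weight a w u * (`|b w u| + q w u)))%:E) by exact: integrableZR.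
have j2 : mu.-integrable `[s, t] (fun u => (L * theta * weight a w u)%:E) by exact: integrableZR.
have j3 : mu.-integrable `[s, t] (fun u => (L * (1 + lam) * (weight a w u * (`|b w u| + q w u)) + L * theta * weight a w u)%:E) by exact: integrableDR.
have hd u : (`[s, t]%classic : set R) u -> `|ito_drift f f1 f2 a b q x w u| <=
    L * (1 + lam) * (weight a w u * (`|b w u| + q w u)) + L * theta * weight a w u.
  rewrite /= in_itv /= => /andP[su ut].
  have uT : 0 <= u <= T by rewrite (le_trans s0 su) (le_trans ut).
  rewrite normrM ger0_norm ?K0 //.
  have e1 (k1 l1 l2 g1 : R) : L * l1 * (k1 * g1) + L * l2 * k1 = k1 * (L * l1 * g1 + L * l2) by ring.
  rewrite e1.
  rewrite ler_wpM2l ?K0 //; have q0u := q0 u uT.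
  apply: (@le_trans _ _ (L * (q w u + `|b w u| + `|a w u|))).
    rewrite (le_trans (ler_normB _ _)) // mulrDr lerD //; last by rewrite normrM mulrC ler_wpM2r // (sb_f fS).
    rewrite (le_trans (ler_normD _ _)) // mulrDr lerD //; last by rewrite normrM ler_wpM2r // (sb_f1 fS).
    rewrite normrM (ger0_norm q0u) ler_wpM2r // normrM (@ger0_norm _ 2^-1) //.
    exact: half_le (sb_f2 fS _).
  have : `|a w u| <= lam * (`|b w u| + q w u) + theta.
    rewrite (le_trans (ler_normB _ _)) // (ger0_norm th0) lerD2r ger0_norm //.
    by rewrite mulr_ge0 // ?addr_ge0 // ltW.
  move=> ha; have e2 (g1 : R) : L * (1 + lam) * g1 + L * theta = L * ((1 + lam) * g1 + theta) by ring.
  rewrite e2.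
  by rewrite ler_wpM2l //; exact: killing_sum_le.
apply: (le_trans (le_Rintegral_norm _ iI j3 hd)) => //.
have Z1 c : \int[mu]_(u in `[s, t]) (c * (weight a w u * (`|b w u| + q w u))) = c * \int[mu]_(u in `[s, t]) (weight a w u * (`|b w u| + q w u)) by rewrite (RintegralZl _ _ i1).
have Z2 c : \int[mu]_(u in `[s, t]) (c * weight a w u) = c * \int[mu]_(u in `[s, t]) weight a w u by rewrite (RintegralZl _ _ i2).
rewrite RintegralD // Z1 Z2; apply: (budget_bound lam0 L0 th0 killing_budget).
exact: hK.
Qed.

End Budget.

Lemma stability_small (R : realType) (k lam L Z e : R) : 0 <= k -> 0 <= lam -> 0 <= L -> 0 <= Z ->
  0 <= e -> e <= 1 ->
  2 * (k * (lam * e) * L + k * (L * e)) +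
  (k * (lam * e) * (L * Z) + k * (L * e * Z) +
   k * (L * (1 + lam) * e) + k * (lam * e) * (L * (1 + lam) * e)) <=
  (2 * (k * lam * L + k * L) + k * lam * L * Z + k * L * Z + k * L * (1 + lam) + k * lam * L * (1 + lam)) * e.
Proof.
move=> k0 l0 L0 Z0 e0 e1; rewrite -subr_ge0.
rewrite (_ : _ - _ = k * lam * L * (1 + lam) * (e * (1 - e))); last by ring.
have h1 : 0 <= 1 - e by rewrite subr_ge0.
by rewrite !mulr_ge0 // addr_ge0.
Qed.

Lemma cvg_of_small (R : realType) (u : nat -> R) (l C : R) : 0 <= C ->
  (forall e, 0 < e -> e <= 1 -> exists N, forall n, (N <= n)%N -> `|u n - l| <= C * e) ->
  u n @[n --> \oo] --> l.
Proof.
move=> C0 h; apply/cvgrPdist_le => e e0.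
pose e' := Num.min 1 (e / (C + 1)).
have C1 : 0 < C + 1 by rewrite ltr_wpDl.
have e'0 : 0 < e' by rewrite lt_min ltr01 divr_gt0.
have e'1 : e' <= 1 by rewrite ge_min lexx.
have [N hN] := h e' e'0 e'1; exists N => // n /= Nn.
rewrite distrC (le_trans (hN n Nn)) //.
have : e' <= e / (C + 1) by rewrite ge_min lexx orbT.
rewrite ler_pdivlMr // => he; apply: le_trans he.
by rewrite mulrC ler_wpM2l ?(ltW e'0) // lerDl.
Qed.

Definition truncation (R : realType) n (r : R) : R := Num.max (- n%:R) (Num.min r n%:R).

Lemma truncation_le (R : realType) n (r : R) : `|truncation n r| <= n%:R.
Proof.
have n0 : 0 <= n%:R :> R by exact: ler0n.
rewrite /truncation.
have [h1|h1] := lerP r n%:R.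
  by have [h2|h2] := lerP (- n%:R) r; rewrite ler_norml; lra.
by have [h2|h2] := lerP (- n%:R) (n%:R : R); rewrite ler_norml; lra.
Qed.

Lemma truncation_dist (R : realType) n (r : R) : `|truncation n r - r| <= `|r|.
Proof.
have n0 : 0 <= n%:R :> R by exact: ler0n.
have := ler_norm r; have := ler_norm (- r); rewrite normrN => h3 h4.
rewrite /truncation.
have [h1|h1] := lerP r n%:R.
  by have [h2|h2] := lerP (- n%:R) r; rewrite ler_norml; lra.
by have [h2|h2] := lerP (- n%:R) (n%:R : R); rewrite ler_norml; lra.
Qed.

Lemma truncation_eq (R : realType) n (r : R) : `|r| <= n%:R -> truncation n r = r.
Proof.
by rewrite ler_norml => /andP[h1 h2]; rewrite /truncation (min_l h2) (max_r h1).
Qed.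

Lemma path_dist_algebra (R : realType) (I1 I2 B1 B2 j1 j2 j3 j4 x0 e dl : R) :
  `|I1 - j1| <= e -> `|I2 - j2| <= e -> `|0 - j3| <= e -> `|0 - j4| <= e -> `|B1 - B2| <= dl ->
  `|x0 + B1 + (I1 - I2) - (x0 + B2 + (j1 - j2) - (j3 - j4))| <= dl + 4 * e.
Proof.
rewrite !ler_norml => /andP[? ?] /andP[? ?] /andP[? ?] /andP[? ?] /andP[? ?].
by apply/andP; split; lra.
Qed.

Lemma choice_ratio (R : realType) (e Q : R) : 0 < e -> 0 <= Q -> e / (4 * (Q + 1)) * Q <= e / 4.
Proof.
move=> e0 Q0; have Q1 : 0 < Q + 1 by rewrite ltr_wpDl.
rewrite (_ : _ * Q = e / 4 * (Q / (Q + 1))); last by field; rewrite lt0r_neq0.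
by rewrite ler_piMr ?divr_ge0 ?(ltW e0) // ler_pdivrMr // mul1r lerDl.
Qed.

Lemma four_quarters (R : realType) (e I1 I2 y1 y2 : R) :
  I1 <= e / 2 -> I2 <= y2 + y1 -> y1 <= e / 4 -> y2 <= e / 4 -> I1 + I2 <= e.
Proof. lra. Qed.

Lemma ae_eq_measurable d (Om : measurableType d) (R : realType) (P : probability Om R)
    (f g : Om -> \bar R) : measure_is_complete P -> measurable_fun setT g ->
  (\forall w \ae P, f w = g w) -> measurable_fun setT f.
Proof.
move=> cP mg fg _ B mB; rewrite setTI.
have N0 : P.-negligible [set w | f w <> g w] by exact: fg.
have mN := cP _ N0.
have -> : f @^-1` B = (g @^-1` B `\` [set w | f w <> g w]) `|` (f @^-1` B `&` [set w | f w <> g w]).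
  apply/seteqP; split => w /=.
    move=> fB; have [e|ne] := pselect (f w = g w); last by right.
    by left; rewrite -e; split.
  by case=> [[gB /contrapT ->]|[]].
apply: measurableU.
  by apply: measurableD => //; rewrite -[X in measurable X]setTI; exact: mg.
by apply: cP; apply: negligibleS N0 => w [].
Qed.

Lemma ae_limit_measurable d (Om : measurableType d) (R : realType) (P : probability Om R)
    (f : nat -> Om -> \bar R) (g : Om -> \bar R) : measure_is_complete P ->
  (forall n, measurable_fun setT (f n)) ->
  (\forall w \ae P, f n w @[n --> \oo] --> g w) -> measurable_fun setT g.
Proof.
move=> cP mf fg; have m1 := measurable_fun_limn_esup mf.
apply: (ae_eq_measurable cP m1); apply: filterS fg => w h.
rewrite limn_esup_lim; apply/esym/cvg_lim => //.
exact: cvg_esups h.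
Qed.

Section ItoData.
Context (R : realType) (d : measure_display) (Omega : measurableType d)
  (P : probability Omega R).
Hypothesis P_complete : measure_is_complete P.
Context (T : R) (m : nat) (W : Omega -> R -> 'rV[R]_m).
Hypothesis W_bm : brownian_motion P T W.
Hypothesis T_gt0 : 0 < T.
Local Notation Ft t := (filtered P W t).
Local Notation mu := (@lebesgue_measure R).
Local Notation Wc := (bm_cont T W).
Local Notation int g := (mu.-integrable `[0, T] (fun u => (g u)%:E)).
Let T_ge0 : 0 <= T. Proof. exact: ltW. Qed.
Let mT : measurable (`[0, T]%classic : set R). Proof. exact: measurable_itv. Qed.

Lemma prog_coord_progressive (Z : Omega -> R -> 'rV[R]_m) c :
  prog_measurable P T W (Z : Omega -> R -> borel_rV R m) ->
  progressive P T W (fun w s => Z w s 0 c).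
Proof.
move=> mZ; exact: (prog_progressive (E := borel_rV R m) (g := fun v : 'rV[R]_m => v 0 c) mZ (measurable_coord_rV c)).
Qed.

Lemma progressive_sqr_euclidB (A B : Omega -> R -> 'rV[R]_m) :
  (forall c, progressive P T W (fun w s => A w s 0 c)) ->
  (forall c, progressive P T W (fun w s => B w s 0 c)) ->
  progressive P T W (fun w s => euclid (A w s - B w s) ^+ 2).
Proof.
move=> pA pB.
rewrite (_ : (fun w s => _) = (fun w u => \sum_(c < m) (A w u 0 c - B w u 0 c) ^+ 2)); last first.
  apply/funext => w; apply/funext => u; rewrite sqr_euclid /dotp.
  by apply: eq_bigr => c _; rewrite !mxE expr2.
apply: progressive_sum => c _.
apply: (progressive_comp (f := fun r => r ^+ 2)); first exact: exprn_measurable.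
by apply: progressiveD => //; exact: progressiveN.
Qed.

Lemma progressive_sqr_euclid (A : Omega -> R -> 'rV[R]_m) :
  (forall c, progressive P T W (fun w s => A w s 0 c)) ->
  progressive P T W (fun w s => euclid (A w s) ^+ 2).
Proof.
move=> pA.
have := @progressive_sqr_euclidB A (fun _ _ => 0) pA.
have p0 c : progressive P T W (fun _ _ => (0 : 'rV[R]_m) 0 c) by exact: progressive_cst.
move=> /(_ p0); congr progressive.
by apply/funext => w; apply/funext => s; rewrite subr0.
Qed.

Lemma energy_finite (A : Omega -> R -> 'rV[R]_m) w :
  (forall c, progressive P T W (fun w s => A w s 0 c)) ->
  (energy T A w < +oo)%E -> int (fun s => euclid (A w s) ^+ 2) /\
  energy T A w = (\int[mu]_(s in `[0, T]) (euclid (A w s) ^+ 2))%:E.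
Proof.
move=> pA hE.
have mA := progressive_path_measurable P_complete W_bm T_ge0 w (progressive_sqr_euclid pA).
have iA : int (fun s => euclid (A w s) ^+ 2).
  apply/integrableP; split; first exact/measurable_EFinP.
  apply: le_lt_trans hE; rewrite /energy le_eqVlt; apply/orP; left; apply/eqP.
  by apply: eq_integral => s _; rewrite gee0_abs // lee_fin sqr_ge0.
by split => //; rewrite /energy integral_EFinR.
Qed.

Lemma energy_measurable (A : Omega -> R -> 'rV[R]_m) :
  (forall c, progressive P T W (fun w s => A w s 0 c)) ->
  measurable_fun setT (energy T A).
Proof.
move=> pA; apply: measurable_ge0_param_integral.
  exact: (progressive_joint P_complete W_bm T_ge0 (progressive_sqr_euclid pA)).
by move=> w s _; exact: sqr_ge0.
Qed.

Lemma el_integral_bm_cont (H : elementary R Omega m) w t : good T W w ->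
  el_integral (bm_cont T W) H w t = el_integral W H w t.
Proof. by move=> gw; rewrite /el_integral; apply: eq_bigr => i _; rewrite !bm_contE. Qed.

Definition approximation_gap (Z : Omega -> R -> 'rV[R]_m) (J : Omega -> R -> R)
    (H : elementary R Omega m) (w : Omega) : \bar R :=
  (energy T (fun w s => (el_value H w s - Z w s)%R) w +
   sup_path T (fun w t => (el_integral Wc H w t - J w t)%R) w)%E.

(** The two convergences that define the stochastic integral are merged into one, and [W] becomes
    its continuous modification, for which elementary integrals are continuous on every path. *)
Lemma ito_integral_cont (Z : Omega -> R -> 'rV[R]_m) (J : Omega -> R -> R) :
  prog_measurable P T W (Z : Omega -> R -> borel_rV R m) -> ito_integral P T W Z J ->
  exists H : nat -> elementary R Omega m, [/\ forall k, is_elementary P T W (H k),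
    (forall k, measurable_fun setT (approximation_gap Z J (H k))) &
    cvg_in_probability P (fun k => approximation_gap Z J (H k))].
Proof.
move=> pZ [[cJ mJ] [H [eH hE hS]]]; exists H.
have pE k c : progressive P T W (fun w s => (el_value (H k) w s - Z w s) 0 c).
  rewrite (_ : (fun w s => _) = (fun w s => el_value (H k) w s 0 c - Z w s 0 c)); last first.
    by apply/funext => w; apply/funext => s; rewrite !mxE.
  apply: progressiveD; first exact: el_value_progressive.
  by apply: progressiveN; exact: prog_coord_progressive.
have mE k := energy_measurable (pE k).
have cc k w : {within `[0, T], continuous (fun t => el_integral Wc (H k) w t - J w t)}.
  have [c1 _] := el_integral_continuous_adapted W_bm (eH k).
  exact: within_continuousB.
have ms k : measurable_fun setT (sup_path T (fun w t => el_integral Wc (H k) w t - J w t)).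
  have [_ m1] := el_integral_continuous_adapted W_bm (eH k).
  have [] := @sup_path_measurable R T T_gt0 _ _ (fun w t => el_integral Wc (H k) w t - J w t) (cc k).
    move=> t tT; have tT' : t <= T by case/andP: tT.
    apply: (adapted_measurable P_complete W_bm tT'); apply: measurable_addf; first exact: m1.
    by apply: measurable_oppf; exact: mJ.
  move=> mf ef; apply: (eq_measurable_fun (fun w => (fine (sup_path T (fun w t => el_integral Wc (H k) w t - J w t) w))%:E)).
    by move=> w _; rewrite -ef.
  exact/measurable_EFinP.
have hS' : cvg_in_probability P (fun k => sup_path T (fun w t => el_integral Wc (H k) w t - J w t)).
  apply: (cvg_in_probability_ae P_complete ms) hS => k.
  apply: negligibleS (good_negligible W_bm) => w /= h gw; apply: h.
  rewrite /sup_path; congr ereal_sup; apply/seteqP.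
  by split => y [t tT <-]; exists t => //; rewrite el_integral_bm_cont.
split => //; last exact: cvg_in_probabilityD.
by move=> k; exact: emeasurable_funD.
Qed.

Context (b x J1 J2 : Omega -> R -> R) (Z1 Z2 : Omega -> R -> 'rV[R]_m).
Hypothesis pb : progressive P T W b.
Hypothesis bint : \forall w \ae P, int (b w).
Hypothesis xc : continuous_adapted P T W x.
Hypothesis pZ1 : prog_measurable P T W (Z1 : Omega -> R -> borel_rV R m).
Hypothesis pZ2 : prog_measurable P T W (Z2 : Omega -> R -> borel_rV R m).
Hypothesis eZ1 : \forall w \ae P, (energy T Z1 w < +oo)%E.
Hypothesis eZ2 : \forall w \ae P, (energy T Z2 w < +oo)%E.
Hypothesis iJ1 : ito_integral P T W Z1 J1.
Hypothesis iJ2 : ito_integral P T W Z2 J2.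
Hypothesis xE : \forall w \ae P, forall t, 0 <= t <= T ->
  x w t = x w 0 + \int[mu]_(u in `[0, t]) b w u + (J1 w t - J2 w t) - (J1 w 0 - J2 w 0).

Definition energy_density w u := euclid (Z1 w u - Z2 w u) ^+ 2.
Local Notation q := energy_density.

Lemma energy_density_progressive : progressive P T W q.
Proof. by apply: progressive_sqr_euclidB => c; exact: prog_coord_progressive. Qed.

Lemma energy_density_path : \forall w \ae P, path_data T w b q x.
Proof.
move: bint eZ1 eZ2; apply: filterS3 => w ib e1 e2; split => //.
- have [i1 _] := energy_finite (fun c => prog_coord_progressive c pZ1) e1.
  have [i2 _] := energy_finite (fun c => prog_coord_progressive c pZ2) e2.
  apply: (@integrable_leR _ _ _ mu _ _ _ (fun u => 2 * euclid (Z1 w u) ^+ 2 + 2 * euclid (Z2 w u) ^+ 2)) => //.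
  + exact: (progressive_path_measurable P_complete W_bm T_ge0 w energy_density_progressive).
  + by move=> u _; rewrite ger0_norm ?sqr_ge0 //; exact: sqr_euclidB_le.
  + by apply: integrableDR => //; exact: integrableZR.
- by move=> u _; exact: sqr_ge0.
- exact: (progressive_path_measurable P_complete W_bm T_ge0 w (continuous_adapted_progressive xc)).
Qed.

Lemma truncation_L1 w : int (b w) -> forall e, 0 < e -> exists N, forall n, (N <= n)%N ->
  \int[mu]_(u in `[0, T]) `|truncation n (b w u) - b w u| <= e.
Proof.
move=> ib e e0.
have mb : measurable_fun `[0, T] (b w) by exact: (integrable_measR (mu := mu)).
pose f_ n u := (truncation n (b w u))%:E.
have mf n : measurable_fun `[0, T] (f_ n).
  by apply/measurable_EFinP; apply: measurable_maxf => //; apply: measurable_minf.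
have mf' : measurable_fun `[0, T] (fun u => (b w u)%:E) by exact/measurable_EFinP.
have cf : {ae mu, forall u, `[0, T]%classic u -> f_ ^~ u @ \oo --> (b w u)%:E}.
  apply: aeW => u _; apply: cvg_near_cst.
  exists (Num.truncn `|b w u|).+1 => // n /= hn; rewrite /f_ truncation_eq //.
  by rewrite (le_trans (ltW (truncnS_gt _))) // ler_nat.
have ig : mu.-integrable `[0, T] (fun u => (`|b w u| + `|b w u|)%:E).
  by apply: integrableDR => //; exact: integrable_normR.
have fg : {ae mu, forall u n, `[0, T]%classic u -> (`|f_ n u| <= (`|b w u| + `|b w u|)%:E)%E}.
  apply: aeW => u n _; rewrite lee_fin.
  have := truncation_dist n (b w u); have := ler_dist_dist (truncation n (b w u)) (b w u).
  by have := ler_norm (`|truncation n (b w u)| - `|b w u|); lra.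
have : [/\ mu.-integrable `[0, T] (fun u => (b w u)%:E),
    [sequence (\int[mu]_(u in `[0%R, T]) `|f_ n u - (b w u)%:E|)%E]_n @ \oo --> 0%E &
    [sequence (\int[mu]_(u in `[0%R, T]) (f_ n u))%E]_n @ \oo --> (\int[mu]_(u in `[0%R, T]) (b w u)%:E)%E].
  by apply: dominated_convergence fg.
case=> _ /fine_cvgP[hf hc] _.
have {hc} /cvgrPdist_le/(_ e e0)[N _ hN] := hc.
exists N => n /hN /=; rewrite sub0r normrN.
apply: le_trans; rewrite (le_trans _ (ler_norm _)) // /Rintegral /comp.
Qed.

Context (f f1 f2 : R -> R) (L lam theta : R).
Hypothesis fS : smooth_bounded f f1 f2 L.
Hypothesis lam0 : 0 < lam.
Hypothesis th0 : 0 <= theta.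
Local Notation a := (ito_killing lam theta b q).

Let L0 : 0 <= L. Proof. exact: le_trans (sb_f fS 0). Qed.

(* Stage [n] of the approximation: the drift is truncated at level [n] and the
   diffusion coefficients are elementary. *)
Definition approx_drift n w u := truncation n (b w u).
Definition approx_density (H1 H2 : elementary R Omega m) w u :=
  euclid (el_value H1 w u - el_value H2 w u) ^+ 2.
Definition approx_path n (H1 H2 : elementary R Omega m) w t :=
  x w 0 + \int[mu]_(u in `[0, t]) approx_drift n w u +
  (el_integral Wc H1 w t - el_integral Wc H2 w t).

Lemma approx_drift_progressive n : progressive P T W (approx_drift n).
Proof.
apply: (progressive_comp (f := truncation n) _ pb).
by apply: measurable_maxf => //; apply: measurable_minf.
Qed.

(** [r] is the free parameter of [sqr_euclid_diff_le], to be chosen before e. The quantity 4 e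
    bounds the energy between the two differences, twice the sum of two energies below e. *)
Lemma approx_density_dist H1 H2 w (e : R) : 0 < e -> path_data T w b q x ->
  is_elementary P T W H1 -> is_elementary P T W H2 ->
  (approximation_gap Z1 J1 H1 w < e%:E)%E -> (approximation_gap Z2 J2 H2 w < e%:E)%E ->
  forall r, 0 < r ->
  \int[mu]_(u in `[0, T]) `|approx_density H1 H2 w u - q w u| <=
  (1 + r^-1) * (4 * e) + r * \int[mu]_(u in `[0, T]) q w u.
Proof.
move=> e0 [_ iq _ _] e1 e2 g1 g2 r r0.
have pE H Z : is_elementary P T W H -> prog_measurable P T W (Z : Omega -> R -> borel_rV R m) ->
    forall c, progressive P T W (fun w s => (el_value H w s - Z w s) 0 c).
  move=> eH pZ c; rewrite (_ : (fun w s => _) = (fun w s => el_value H w s 0 c - Z w s 0 c)); last first.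
    by apply/funext => w'; apply/funext => s; rewrite !mxE.
  apply: progressiveD; first exact: el_value_progressive.
  by apply: progressiveN; exact: prog_coord_progressive.
have gE H Z J : is_elementary P T W H -> prog_measurable P T W (Z : Omega -> R -> borel_rV R m) ->
    (approximation_gap Z J H w < e%:E)%E ->
    int (fun s => euclid (el_value H w s - Z w s) ^+ 2) /\
    \int[mu]_(s in `[0, T]) (euclid (el_value H w s - Z w s) ^+ 2) <= e.
  move=> eH pZ hg.
  have s0 : (0 <= sup_path T (fun w t => el_integral Wc H w t - J w t)%R w)%E.
    apply: (@le_trans _ _ `|el_integral Wc H w 0 - J w 0|%:E); first by rewrite lee_fin.
    by apply: ereal_sup_ubound; exists 0 => //=; rewrite in_itv /= lexx T_ge0.
  have hE : (energy T (fun w s => el_value H w s - Z w s)%R w < e%:E)%E.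
    by apply: le_lt_trans hg; rewrite leeDl.
  have [i1 h1] := energy_finite (pE H Z eH pZ) (lt_le_trans hE (leey _)).
  by split => //; rewrite h1 lte_fin in hE; exact: ltW.
have [i1 l1] := gE _ _ _ e1 pZ1 g1; have [i2 l2] := gE _ _ _ e2 pZ2 g2.
have iv : int (fun s => euclid (el_value H1 w s - el_value H2 w s - (Z1 w s - Z2 w s)) ^+ 2) /\
  \int[mu]_(s in `[0, T]) (euclid (el_value H1 w s - el_value H2 w s - (Z1 w s - Z2 w s)) ^+ 2) <= 4 * e.
  have e3 s : el_value H1 w s - el_value H2 w s - (Z1 w s - Z2 w s) =
      (el_value H1 w s - Z1 w s) - (el_value H2 w s - Z2 w s).
    by apply/matrixP => i j; rewrite !mxE; ring.
  have j1 : int (fun s => 2 * euclid (el_value H1 w s - Z1 w s) ^+ 2) by exact: integrableZR.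
  have j2 : int (fun s => 2 * euclid (el_value H2 w s - Z2 w s) ^+ 2) by exact: integrableZR.
  have j3 : int (fun s => 2 * euclid (el_value H1 w s - Z1 w s) ^+ 2 + 2 * euclid (el_value H2 w s - Z2 w s) ^+ 2) by exact: integrableDR.
  have le3 s : euclid (el_value H1 w s - el_value H2 w s - (Z1 w s - Z2 w s)) ^+ 2 <=
      2 * euclid (el_value H1 w s - Z1 w s) ^+ 2 + 2 * euclid (el_value H2 w s - Z2 w s) ^+ 2.
    by rewrite e3; exact: sqr_euclidB_le.
  have j4 : int (fun s => euclid (el_value H1 w s - el_value H2 w s - (Z1 w s - Z2 w s)) ^+ 2).
    apply: (@integrable_leR _ _ _ mu _ _ _ _ _ _ j3) => //.
      apply: (progressive_path_measurable P_complete W_bm T_ge0 w (X := fun w s => euclid (el_value H1 w s - el_value H2 w s - (Z1 w s - Z2 w s)) ^+ 2)).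
      apply: progressive_sqr_euclid => c.
      rewrite (_ : (fun w s => _) = (fun w s => (el_value H1 w s - Z1 w s) 0 c - (el_value H2 w s - Z2 w s) 0 c)); last first.
        by apply/funext => w'; apply/funext => s; rewrite !mxE; ring.
      by apply: progressiveD; [|apply: progressiveN]; exact: pE.
    by move=> s _; rewrite ger0_norm ?sqr_ge0.
  split => //.
  apply: (@le_trans _ _ (\int[mu]_(s in `[0, T]) (2 * euclid (el_value H1 w s - Z1 w s) ^+ 2 + 2 * euclid (el_value H2 w s - Z2 w s) ^+ 2))).
    exact: le_Rintegral.
  rewrite RintegralD // !RintegralZl //.
  move: l1 l2; move: (Rintegral _ _ _) (Rintegral _ _ _) => I1 I2; lra.
have [iv1 lv1] := iv.
have k1 : int (fun s => (1 + r^-1) * euclid (el_value H1 w s - el_value H2 w s - (Z1 w s - Z2 w s)) ^+ 2) by exact: integrableZR.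
have k2 : int (fun s => r * q w s) by exact: integrableZR.
have k3 : int (fun s => (1 + r^-1) * euclid (el_value H1 w s - el_value H2 w s - (Z1 w s - Z2 w s)) ^+ 2 + r * q w s) by exact: integrableDR.
have lek u : `|approx_density H1 H2 w u - q w u| <=
    (1 + r^-1) * euclid (el_value H1 w u - el_value H2 w u - (Z1 w u - Z2 w u)) ^+ 2 + r * q w u.
  exact: sqr_euclid_diff_le.
have pa : progressive P T W (approx_density H1 H2).
  by apply: progressive_sqr_euclidB => c; exact: el_value_progressive.
have iad : int (fun u => `|approx_density H1 H2 w u - q w u|).
  apply: (@integrable_leR _ _ _ mu _ _ _ _ _ _ k3) => //; last by move=> u _; rewrite normr_id.
  apply: measurable_normf.
  apply: (progressive_path_measurable P_complete W_bm T_ge0 w (X := fun w u => approx_density H1 H2 w u - q w u)).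
  by apply: progressiveD => //; apply: progressiveN; exact: energy_density_progressive.
apply: (@le_trans _ _ (\int[mu]_(u in `[0, T]) ((1 + r^-1) * euclid (el_value H1 w u - el_value H2 w u - (Z1 w u - Z2 w u)) ^+ 2 + r * q w u))).
  exact: le_Rintegral.
rewrite RintegralD // !RintegralZl // lerD2r ler_wpM2l // addr_ge0 // invr_ge0; exact: ltW.
Qed.

Lemma approx_path_dist n H1 H2 w (e dl : R) : 0 < e -> is_elementary P T W H1 -> is_elementary P T W H2 -> int (b w) ->
  (forall t, 0 <= t <= T ->
    x w t = x w 0 + \int[mu]_(u in `[0, t]) b w u + (J1 w t - J2 w t) - (J1 w 0 - J2 w 0)) ->
  (approximation_gap Z1 J1 H1 w < e%:E)%E -> (approximation_gap Z2 J2 H2 w < e%:E)%E ->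
  \int[mu]_(u in `[0, T]) `|approx_drift n w u - b w u| <= dl ->
  forall t, 0 <= t <= T -> `|approx_path n H1 H2 w t - x w t| <= dl + 4 * e.
Proof.
move=> e0 eH1 eH2 ib xw g1 g2 bd t tT; have /andP[t0 tT'] := tT.
have gS H Z J t' : 0 <= t' <= T -> (approximation_gap Z J H w < e%:E)%E ->
    `|el_integral Wc H w t' - J w t'| <= e.
  move=> t'T hg; rewrite -lee_fin; apply: le_trans (ltW hg).
  have s1 : (`|el_integral Wc H w t' - J w t'|%:E <= sup_path T (fun w t => el_integral Wc H w t - J w t)%R w)%E.
    by apply: ereal_sup_ubound; exists t' => //=; rewrite in_itv.
  apply: le_trans s1 _; rewrite /approximation_gap leeDr //.
  by apply: integral_ge0 => s _; rewrite lee_fin sqr_ge0.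
have T0 : (0 : R) <= 0 <= T by rewrite lexx T_ge0.
(* The initial values of [J1] and [J2] are not known to be 0; the uniform distance to elementary
   integrals, which start at 0, makes them small. Hence four errors in all, two at time t and two at
   time 0. *)
have z0 H : is_elementary P T W H -> el_integral Wc H w 0 = 0.
  move=> eH; rewrite /el_integral big1 // => i _.
  have /andP[i0 _] := el_time_in eH (ltnW (ltn_ord i)).
  have /andP[i1 _] := el_time_in eH (ltn_ord i).
  by rewrite (min_l i0) (min_l i1) subrr dotpC dotp0l.
have a1 := gS _ _ _ _ tT g1; have a2 := gS _ _ _ _ tT g2.
have a3 := gS _ _ _ _ T0 g1; have a4 := gS _ _ _ _ T0 g2.
rewrite (xw t tT) /approx_path.
have ibn : int (approx_drift n w).
  exact: (progressive_integrable P_complete W_bm T_ge0 (approx_drift_progressive n) (fun s _ => truncation_le n (b w s))).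
have ibd : int (fun u => approx_drift n w u - b w u) by exact: integrableBR.
have nbd : int (fun u => `|approx_drift n w u - b w u|) by exact: integrable_normR.
have hB : `|\int[mu]_(u in `[0, t]) approx_drift n w u - \int[mu]_(u in `[0, t]) b w u| <= dl.
  have i1 := integrable_sub ibn (lexx 0) tT'; have i2 := integrable_sub ib (lexx 0) tT'.
  have i3 := integrable_sub ibd (lexx 0) tT'; have i4 := integrable_sub nbd (lexx 0) tT'.
  rewrite -RintegralB //.
  apply: le_trans (le_Rintegral_norm _ i3 i4 (fun u _ => lexx _)) _ => //.
  by apply: le_trans bd; apply: (Rintegral_sub_le nbd).
move: a1 a2 a3 a4 hB; rewrite (z0 _ eH1) (z0 _ eH2).
move: (el_integral _ _ _ _) (el_integral _ _ _ _) (Rintegral _ _ _) (Rintegral _ _ _) => I1 I2 B1 B2.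
move: (J1 w t) (J2 w t) (J1 w 0) (J2 w 0) (x w 0) => j1 j2 j3 j4 x0.
exact: path_dist_algebra.
Qed.

Lemma approx_path_data n H1 H2 w : is_elementary P T W H1 -> is_elementary P T W H2 ->
  path_data T w (approx_drift n) (approx_density H1 H2) (approx_path n H1 H2).
Proof.
move=> e1 e2.
have x0m : @measurable_fun _ _ (Ft 0) R setT (fun w => x w 0) by apply: xc.2; rewrite lexx T_ge0.
have := ito_null_elementary P_complete W_bm T_ge0 e1 e2 x0m fS (ler0n R n) (ltW lam0) th0
  (approx_drift_progressive n) (fun w s _ => truncation_le n (b w s)).
move=> [M [A [[M0 A0 pqn] xcn qM aA _]]]; split.
- exact: (progressive_integrable P_complete W_bm T_ge0 (approx_drift_progressive n) (fun s _ => truncation_le n (b w s))).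
- exact: (progressive_integrable P_complete W_bm T_ge0 pqn (qM w)).
- by move=> u _; exact: sqr_ge0.
- exact: (progressive_path_measurable P_complete W_bm T_ge0 w (continuous_adapted_progressive xcn)).
Qed.

Lemma approx_ftc n H1 H2 s t w : is_elementary P T W H1 -> is_elementary P T W H2 ->
  0 <= s -> s <= t -> t <= T ->
  ito_error (cst 1) (cst 0) (cst 0) (ito_killing lam theta (approx_drift n) (approx_density H1 H2))
    (approx_drift n) (approx_density H1 H2) (approx_path n H1 H2) s t w = 0.
Proof.
move=> e1 e2 s0 st tT.
have x0m : @measurable_fun _ _ (Ft 0) R setT (fun w => x w 0) by apply: xc.2; rewrite lexx T_ge0.
have := ito_null_elementary P_complete W_bm T_ge0 e1 e2 x0m fS (ler0n R n) (ltW lam0) th0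
  (approx_drift_progressive n) (fun w s _ => truncation_le n (b w s)).
move=> [M [A [[M0 A0 pqn] xcn qM aA _]]].
apply: (weight_ftc P_complete W_bm T_ge0 _ _ _ _ _ aA) => //.
have pn : progressive P T W (fun w s => `|approx_drift n w s|).
  exact: (progressive_comp (f := Num.norm) _ (approx_drift_progressive n)).
exact: (@progressiveD _ _ _ _ _ _ _ (fun w s => lam * (`|approx_drift n w s| + approx_density H1 H2 w s)) (fun _ _ => - theta)
  (progressiveM (@progressive_cst _ _ _ _ _ _ _ lam) (progressiveD pn pqn)) (@progressive_cst _ _ _ _ _ _ _ _)).
Qed.

Lemma approx_null n H1 H2 s t : is_elementary P T W H1 -> is_elementary P T W H2 ->
  0 <= s -> s <= t -> t <= T ->
  ito_null P W f f1 f2 (ito_killing lam theta (approx_drift n) (approx_density H1 H2))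
    (approx_drift n) (approx_density H1 H2) (approx_path n H1 H2) s t.
Proof.
move=> e1 e2 s0 st tT.
have x0m : @measurable_fun _ _ (Ft 0) R setT (fun w => x w 0) by apply: xc.2; rewrite lexx T_ge0.
have := ito_null_elementary P_complete W_bm T_ge0 e1 e2 x0m fS (ler0n R n) (ltW lam0) th0
  (approx_drift_progressive n) (fun w s _ => truncation_le n (b w s)).
by move=> [M [A [_ _ _ _ h]]]; exact: h.
Qed.

Lemma approx_error_measurable n H1 H2 s t : is_elementary P T W H1 -> is_elementary P T W H2 ->
  0 <= s -> s <= t -> t <= T ->
  measurable_fun setT (ito_error f f1 f2 (ito_killing lam theta (approx_drift n) (approx_density H1 H2))
    (approx_drift n) (approx_density H1 H2) (approx_path n H1 H2) s t).
Proof.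
move=> e1 e2 s0 st tT.
have x0m : @measurable_fun _ _ (Ft 0) R setT (fun w => x w 0) by apply: xc.2; rewrite lexx T_ge0.
have := ito_null_elementary P_complete W_bm T_ge0 e1 e2 x0m fS (ler0n R n) (ltW lam0) th0
  (approx_drift_progressive n) (fun w s _ => truncation_le n (b w s)).
move=> [M [A [[M0 A0 pqn] xcn qM aA _]]].
apply: (ito_error_measurable P_complete W_bm T_ge0 fS _ (approx_drift_progressive n) pqn xcn aA s0 st tT).
have pn : progressive P T W (fun w s => `|approx_drift n w s|).
  exact: (progressive_comp (f := Num.norm) _ (approx_drift_progressive n)).
exact: (@progressiveD _ _ _ _ _ _ _ (fun w s => lam * (`|approx_drift n w s| + approx_density H1 H2 w s)) (fun _ _ => - theta)
  (progressiveM (@progressive_cst _ _ _ _ _ _ _ lam) (progressiveD pn pqn)) (@progressive_cst _ _ _ _ _ _ _ _)).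
Qed.

(** A subsequence makes both gaps vanish almost surely, and [ito_error_diff] then applies path by
    path. The exceptional null set is the same for all test functions and all times. *)
Lemma approx_error_cvg : exists H1 H2 : nat -> elementary R Omega m,
  [/\ forall n, is_elementary P T W (H1 n), forall n, is_elementary P T W (H2 n) &
  \forall w \ae P, path_data T w b q x /\
    forall (g g1 g2 : R -> R) Lg s t, smooth_bounded g g1 g2 Lg -> 0 <= s -> s <= t -> t <= T ->
    ito_error g g1 g2 (ito_killing lam theta (approx_drift n) (approx_density (H1 n) (H2 n)))
      (approx_drift n) (approx_density (H1 n) (H2 n)) (approx_path n (H1 n) (H2 n)) s t w
      @[n --> \oo] --> ito_error g g1 g2 a b q x s t w].
Proof.
have [H1 [eH1 mG1 cG1]] := ito_integral_cont pZ1 iJ1.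
have [H2 [eH2 mG2 cG2]] := ito_integral_cont pZ2 iJ2.
have gap0 Z J H w : (0 <= approximation_gap Z J H w)%E.
  rewrite adde_ge0 //; first by apply: integral_ge0 => s _; rewrite lee_fin sqr_ge0.
  apply: (@le_trans _ _ `|el_integral Wc H w 0 - J w 0|%:E); first by rewrite lee_fin.
  by apply: ereal_sup_ubound; exists 0 => //=; rewrite in_itv /= lexx T_ge0.
have cG := cvg_in_probabilityD mG1 mG2 cG1 cG2.
have [|phi hphi] := cvg_in_probability_subseq _ cG.
  by move=> k; exact: emeasurable_funD.
exists (H1 \o phi), (H2 \o phi); split => [n|n|]; [exact: eH1|exact: eH2|].
have hp := energy_density_path.
have hbx : \forall w \ae P, int (b w) /\ forall t, 0 <= t <= T ->
    x w t = x w 0 + \int[mu]_(u in `[0, t]) b w u + (J1 w t - J2 w t) - (J1 w 0 - J2 w 0).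
  by move: bint xE; apply: filterS2.
move: hbx hphi hp; apply: filterS3 => w [ib xw] hgap D; split => // g g1 g2 Lg s t gS s0 st tT.
have Lg0 : 0 <= Lg by exact: le_trans (sb_f gS 0).
have [_ _ q0 _] := D.
pose k := expR (theta * T); have k0 : 0 <= k by exact: expR_ge0.
pose Q := \int[mu]_(u in `[0, T]) q w u.
have Q0 : 0 <= Q by apply: Rintegral_ge0 => u _; exact: sqr_ge0.
have l0 := ltW lam0.
pose Z := \int[mu]_(u in `[0, T]) (`|b w u| + q w u + lam * (`|b w u| + q w u) + theta).
have Z0 : 0 <= Z.
  apply: Rintegral_ge0 => u _; have qu : 0 <= q w u by exact: sqr_ge0.
  by rewrite !addr_ge0 // mulr_ge0 // addr_ge0.
pose C := 2 * (k * lam * Lg + k * Lg) + k * lam * Lg * Z + k * Lg * Z + k * Lg * (1 + lam) + k * lam * Lg * (1 + lam).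
apply: (@cvg_of_small _ _ _ C).
  by rewrite /C !addr_ge0 // ?mulr_ge0 // ?addr_ge0 // !mulr_ge0.
move=> e e0 e1.
(* The choices of [r] and [e'] make both terms of [approx_density_dist] at most e / 4; with the
   truncated drift within e / 2 the coefficients are e-close. As e' <= e / 8, the paths are within e
   / 2 + 4 e' <= e. *)
pose r := e / (4 * (Q + 1)).
have r0 : 0 < r by rewrite divr_gt0 // mulr_gt0 // ltr_wpDl.
have rQ : r * Q <= e / 4 by exact: choice_ratio.
pose e' := Num.min (e / 8) (e / (16 * (1 + r^-1))).
have ri0 : 0 < 1 + r^-1 by rewrite addr_gt0 // invr_gt0.
have e'0 : 0 < e' by rewrite lt_min !divr_gt0 // mulr_gt0.
have e'8 : e' <= e / 8 by rewrite ge_min lexx.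
have e'16 : (1 + r^-1) * (4 * e') <= e / 4.
  have : e' <= e / (16 * (1 + r^-1)) by rewrite ge_min lexx orbT.
  by rewrite ler_pdivlMr ?mulr_gt0 //; move: (1 + r^-1) => y; lra.
have [N1 hN1] := hgap e' e'0.
have e20 : 0 < e / 2 by rewrite divr_gt0.
have [N2 hN2] := truncation_L1 ib e20.
exists (maxn N1 N2) => n; rewrite geq_max => /andP[n1 n2].
have gA : (approximation_gap Z1 J1 (H1 (phi n)) w < e'%:E)%E.
  by apply: le_lt_trans (hN1 n n1); rewrite leeDl.
have gB : (approximation_gap Z2 J2 (H2 (phi n)) w < e'%:E)%E.
  by apply: le_lt_trans (hN1 n n1); rewrite leeDr.
have bd := hN2 n n2.
have dD := approx_density_dist e'0 D (eH1 _) (eH2 _) gA gB r0.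
have pD := approx_path_dist e'0 (eH1 _) (eH2 _) ib xw gA gB bd.
have Dk := approx_path_data n w (eH1 (phi n)) (eH2 (phi n)).
have pD' u : 0 <= u <= T -> `|approx_path n (H1 (phi n)) (H2 (phi n)) w u - x w u| <= e.
  by move=> uT; apply: le_trans (pD u uT) _; lra.
have dD' : \int[mu]_(u in `[0, T]) (`|approx_drift n w u - b w u| + `|approx_density (H1 (phi n)) (H2 (phi n)) w u - q w u|) <= e.
  have [ibk iqk _ _] := Dk; have [_ iq _ _] := D.
  have j1 : int (fun u => approx_drift n w u - b w u) by exact: integrableBR.
  have j2 : int (fun u => approx_density (H1 (phi n)) (H2 (phi n)) w u - q w u) by exact: integrableBR.
  rewrite RintegralD //; try exact: integrable_normR.
  move: bd dD rQ e'16; rewrite -/Q /approx_drift.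
  move: (Rintegral _ _ _) (Rintegral _ _ _) (r * Q) ((1 + r^-1) * (4 * e')) => I1 I2 y1 y2.
  exact: four_quarters.
have := ito_error_diff T_ge0 gS l0 th0 D Dk pD' dD' s0 st tT.
move=> /le_trans; apply; rewrite -/k /C; apply: stability_small => //; exact: ltW.
Qed.

(** The weight equation holds exactly at every stage of the approximation, and its limit reaches a
    rate that is merely integrable in time. *)
Lemma energy_density_budget : \forall w \ae P, forall s t, 0 <= s -> s <= t -> t <= T ->
  ito_error (cst 1) (cst 0) (cst 0) a b q x s t w = 0.
Proof.
have [H1 [H2 [e1 e2]]] := approx_error_cvg.
apply: filterS => w [_ h] s t s0 st tT.
have := h _ _ _ _ _ _ (smooth_bounded_one R) s0 st tT.
under eq_fun do rewrite approx_ftc //.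
move=> hc; have := cvg_unique _ hc (@cvg_cst _ _ _ _ _); exact.
Qed.

Lemma ito_error_measurable_limit s t : 0 <= s -> s <= t -> t <= T ->
  measurable_fun setT (ito_error f f1 f2 a b q x s t).
Proof.
move=> s0 st tT; have [H1 [H2 [e1 e2 hcv]]] := approx_error_cvg.
apply/measurable_EFinP.
pose errn n w := ito_error f f1 f2 (ito_killing lam theta (approx_drift n) (approx_density (H1 n) (H2 n)))
      (approx_drift n) (approx_density (H1 n) (H2 n)) (approx_path n (H1 n) (H2 n)) s t w.
apply: (@ae_limit_measurable _ _ _ P (fun n w => (errn n w)%:E)) => //.
  by move=> n; apply/measurable_EFinP; exact: approx_error_measurable.
apply: filterS hcv => w [_ h]; apply: cvg_EFin; first by apply: nearW.
exact: (h _ _ _ _ _ _ fS s0 st tT).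
Qed.

(** Dominated convergence: thanks to the discount, one constant bounds the errors of all stages. *)
Lemma ito_null_limit s t : 0 <= s -> s <= t -> t <= T -> ito_null P W f f1 f2 a b q x s t.
Proof.
move=> s0 st tT z Mz mz zM.
have [w0 _] := probability_inhabited P.
have Mz0 : 0 <= Mz by exact: le_trans (zM w0).
have [H1 [H2 [e1 e2 hcv]]] := approx_error_cvg.
pose errn n w := ito_error f f1 f2 (ito_killing lam theta (approx_drift n) (approx_density (H1 n) (H2 n)))
      (approx_drift n) (approx_density (H1 n) (H2 n)) (approx_path n (H1 n) (H2 n)) s t w.
pose C := 2 * (expR (theta * T) * L) + L * ((1 + lam) / lam * (expR (theta * T) * (1 + theta * T)) + theta * (expR (theta * T) * T)).
have mz' : measurable_fun setT z by exact: (adapted_measurable P_complete W_bm (le_trans st tT)).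
have mf n : measurable_fun setT (fun w => (z w * errn n w)%:E).
  apply/measurable_EFinP; apply: measurable_mulf => //; exact: approx_error_measurable.
have cf : {ae P, forall w, setT w -> (z w * errn n w)%:E @[n --> \oo] --> (z w * ito_error f f1 f2 a b q x s t w)%:E}.
  apply: filterS hcv => w [_ h] _; apply: cvg_EFin; first by apply: nearW.
  apply: cvgMr; exact: (h _ _ _ _ _ _ fS s0 st tT).
have fg : {ae P, forall w n, setT w -> (`|(z w * errn n w)%:E| <= (Mz * C)%:E)%E}.
  apply: aeW => w n _; rewrite lee_fin normrM ler_pM //.
  apply: (ito_error_killing_bound T_ge0 lam0 th0 (approx_path_data n w (e1 n) (e2 n)) s0 st tT _ fS).
  exact: approx_ftc.
have mlim : measurable_fun setT (fun w => (z w * ito_error f f1 f2 a b q x s t w)%:E).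
  apply: (ae_limit_measurable P_complete mf); apply: filterS cf => w; exact.
have PT : (P setT < +oo)%E by rewrite (le_lt_trans (probability_le1 _ _)) ?ltry.
have ig : P.-integrable setT (fun _ => (Mz * C)%:E) by exact: integrable_cstR.
have [ilim _ hlim] := dominated_convergence measurableT mf mlim cf ig fg.
apply: EFin_inj; rewrite -integral_EFinR //.
have e0 n : (\int[P]_w (z w * errn n w)%:E = 0)%E.
  have iz : P.-integrable setT (fun w => (z w * errn n w)%:E).
    apply: (@integrable_boundR _ _ _ P _ _ _ (Mz * C)) => //; first by have /measurable_EFinP := mf n.
    move=> w _; rewrite normrM ler_pM //.
    apply: (ito_error_killing_bound T_ge0 lam0 th0 (approx_path_data n w (e1 n) (e2 n)) s0 st tT _ fS).
    exact: approx_ftc.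
  rewrite integral_EFinR //; congr EFin.
  exact: (approx_null n (e1 n) (e2 n) s0 st tT mz zM).
have c0 : [sequence (\int[P]_x (z x * errn n x)%:E)%E]_n @ \oo --> (0 : \bar R)%E.
  by apply: cvg_near_cst; apply: nearW => n; exact: e0.
exact: (cvg_unique _ hlim c0).
Qed.

End ItoData.

(** * Regularized powers *)

Lemma mulr_powRB1' (R : realType) (k x : R) : 0 < x -> x * x `^ (k - 1) = x `^ k.
Proof.
move=> x0; rewrite -{1}(powRr1 (ltW x0)) -powRD; first by congr powR; ring.
by apply/implyP => _; exact: lt0r_neq0.
Qed.

Section DerivativeRules.
Context (R : realType) (f g : R -> R) (x a b : R).
Hypothesis df : is_derive x 1 f a.
Hypothesis dg : is_derive x 1 g b.

Lemma derive_fun_eq (c : R) : a = c -> is_derive x 1 f c. Proof. by move=> <-. Qed.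

Lemma derive_funD : is_derive x 1 (fun u => f u + g u) (a + b).
Proof. exact: is_deriveD. Qed.

Lemma derive_funN : is_derive x 1 (fun u => - f u) (- a).
Proof. exact: is_deriveN. Qed.

Lemma derive_funM : is_derive x 1 (fun u => f u * g u) (a * g x + f x * b).
Proof. by apply: is_derive_eq (is_deriveM df dg) _; rewrite /GRing.scale /= addrC mulrC. Qed.

Lemma derive_funV : f x != 0 -> is_derive x 1 (fun u => (f u)^-1) (- a / f x ^+ 2).
Proof. by move=> fx; apply: is_derive_eq (is_deriveV fx df) _; rewrite /GRing.scale /= mulrC mulrN mulNr. Qed.

Lemma derive_funX n : is_derive x 1 (fun u => f u ^+ n) (n%:R * f x ^+ n.-1 * a).
Proof.
have := @is_deriveX R R f n x 1 a df; rewrite /GRing.scale /=.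
by rewrite (_ : f ^+ n = (fun u => f u ^+ n)) //; apply/funext => u; rewrite fctE.
Qed.

Lemma derive_fun_exp : is_derive x 1 (fun u => expR (f u)) (a * expR (f x)).
Proof. by have := @is_derive1_comp R expR f x _ _ (is_derive_expR _) df; rewrite mulrC. Qed.

Lemma derive_fun_pow k : 0 < f x -> is_derive x 1 (fun u => f u `^ k) (k * a / f x * f x `^ k).
Proof.
move=> fx; have := @is_derive1_comp R (fun u => u `^ k) f x _ _ (is_derive1_powR k fx) df.
move=> h; apply: is_derive_eq h _.
rewrite -(mulr_powRB1' k fx); field; exact: lt0r_neq0.
Qed.

End DerivativeRules.

Lemma expR_ge_exp4 (R : realType) (x : R) : 0 <= x -> x ^+ 4 <= 24 * expR x.
Proof.
move=> x0; have := expR_ge1Dxn 3 x0; rewrite -[4`!%:R]/(24%:R : R) => h.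
by rewrite mulrC -ler_pdivrMr // (le_trans _ h) // lerDr.
Qed.

(** In these bounds [i] is 1 / e2, [a] is r / w, and the long factor is the common constant [c] of
    [test_fun_smooth], large enough for all the functions estimated there. *)
Lemma test_bound1 (R : realType) (a u S eta i e : R) : 0 <= a -> a <= 2 * i -> u <= S -> 0 <= u ->
  0 <= i -> 0 <= eta -> 0 <= e ->
  a * u + 2 * eta * u <= (1 + 2 * i + 14 * i ^+ 2 + 6 * i + 2 * eta + (2 + e)) * S.
Proof.
move=> a0 ai uS u0 i0 n0 e0; rewrite -mulrDl ler_pM ?addr_ge0 ?mulr_ge0 //.
by have := sqr_ge0 i; lra.
Qed.

Lemma test_bound2 (R : realType) (a v i eta e : R) : 0 <= a -> a <= 2 * i -> 0 <= v -> v <= 1 ->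
  0 <= i -> 0 <= eta -> 0 <= e ->
  `|a - 2 * a * v - 2 * eta| <= 1 + 2 * i + 14 * i ^+ 2 + 6 * i + 2 * eta + (2 + e).
Proof.
move=> a0 ai v0 v1 i0 n0 e0; have := sqr_ge0 i => i2.
have h1 : 0 <= a * v by exact: mulr_ge0.
have h2 : a * v <= a by rewrite ler_piMr.
by rewrite ler_norml -mulrA; apply/andP; split; lra.
Qed.

Lemma test_bound3 (R : realType) (a b v i eta e : R) : 0 <= a -> a <= 2 * i -> 0 <= b -> b <= i ->
  0 <= v -> v <= 1 -> 0 <= i -> 0 <= eta -> 0 <= e ->
  `|a * b * (8 * v - 6)| <= 1 + 2 * i + 14 * i ^+ 2 + 6 * i + 2 * eta + (2 + e).
Proof.
move=> a0 ai b0 bi v0 v1 i0 n0 e0; rewrite normrM (ger0_norm (mulr_ge0 a0 b0)).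
have h1 : `|8 * v - 6| <= 6 by rewrite ler_norml; lra.
have h2 : a * b * `|8 * v - 6| <= 2 * i * i * 6.
  by rewrite ler_pM ?mulr_ge0 // ler_pM.
by apply: le_trans h2 _; have := sqr_ge0 i; rewrite expr2; lra.
Qed.

Lemma test_bound4 (R : realType) (c S x y : R) : 1 <= c -> 1 <= S -> `|x| <= c * S -> `|y| <= c ->
  `|y + x ^+ 2| <= 5 * c ^+ 3 * S ^+ 3.
Proof.
move=> c1 S1 hx hy; have c0 : 0 <= c by lra. have S0 : 0 <= S by lra.
have p1 : 1 <= c * S by rewrite mulr_ege1.
have p3 : c * S <= (c * S) ^+ 3 by rewrite ler_eXnr.
have p2 : (c * S) ^+ 2 <= (c * S) ^+ 3 by rewrite ler_weXn2l.
have hc : c <= c * S by rewrite ler_peMr.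
have hx2 : `|x| ^+ 2 <= (c * S) ^+ 2 by rewrite ler_pXn2r ?nnegrE ?mulr_ge0.
rewrite (le_trans (ler_normD _ _)) // normrX -mulrA -exprMn; lra.
Qed.

Lemma test_bound5 (R : realType) (c S x y z : R) : 1 <= c -> 1 <= S -> `|x| <= c * S -> `|y| <= c ->
  `|z| <= c * S -> `|z + 3 * x * y + x ^+ 3| <= 5 * c ^+ 3 * S ^+ 3.
Proof.
move=> c1 S1 hx hy hz; have c0 : 0 <= c by lra. have S0 : 0 <= S by lra.
have p1 : 1 <= c * S by rewrite mulr_ege1.
have p3 : c * S <= (c * S) ^+ 3 by rewrite ler_eXnr.
have p2 : (c * S) ^+ 2 <= (c * S) ^+ 3 by rewrite ler_weXn2l.
have hc : c <= c * S by rewrite ler_peMr.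
have hx3 : `|x| ^+ 3 <= (c * S) ^+ 3 by rewrite ler_pXn2r ?nnegrE ?mulr_ge0.
have hxy : `|x| * `|y| <= (c * S) ^+ 2.
  by rewrite expr2 ler_pM // (le_trans hy).
have n1 := ler_normD (z + 3 * x * y) (x ^+ 3); have n2 := ler_normD z (3 * x * y).
move: n1 n2; rewrite !normrX !normrM (@ger0_norm _ 3) // -mulrA => n1 n2.
by rewrite -[leRHS]mulrA -exprMn; lra.
Qed.

Section TestFunction.
Context (R : realType) (e2 r eta : R).
Hypothesis e20 : 0 < e2.
Hypothesis r1 : 1 < r.
Hypothesis r2 : r <= 2.
Hypothesis eta0 : 0 < eta.

(** The parameter [e2] is the square e^2 of the regularization. [smooth_pow1] and [smooth_pow2] are
    the first two derivatives of [smooth_pow], written as multiples of it. *)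
Definition smooth_sqr u : R := e2 + u ^+ 2.
Definition smooth_pow u : R := smooth_sqr u `^ (r / 2).
Local Notation w := smooth_sqr.
Local Notation phi := smooth_pow.
Definition smooth_pow1 u : R := r * u / w u * phi u.
Definition smooth_pow2 u : R := r * (e2 + (r - 1) * u ^+ 2) / w u ^+ 2 * phi u.

Lemma smooth_sqr_gt0 u : 0 < w u.
Proof. by rewrite /w ltr_pwDl // sqr_ge0. Qed.

Lemma smooth_pow_gt0 u : 0 < phi u.
Proof. exact/powR_gt0/smooth_sqr_gt0. Qed.

(* The Gaussian factor makes [phi] and its derivatives bounded; it is removed by
   letting [eta] tend to 0. *)
Definition test_fun u : R := phi u * expR (- (eta * u ^+ 2)).
(** The logarithmic derivative of [test_fun]; [g2] and [g3] are its first two derivatives.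
    Derivatives of [test_fun] are thus polynomials in these times [test_fun] itself. *)
Let g1 u := r * u / w u - 2 * eta * u.
Let g2 u := r / w u - 2 * r * u ^+ 2 / w u ^+ 2 - 2 * eta.
Let g3 u := - 6 * r * u / w u ^+ 2 + 8 * r * u ^+ 3 / w u ^+ 3.
Definition test_fun1 u : R := g1 u * test_fun u.
Definition test_fun2 u : R := (g2 u + g1 u ^+ 2) * test_fun u.
Let test_fun3 u : R := (g3 u + 3 * g1 u * g2 u + g1 u ^+ 3) * test_fun u.

Let w0 u : w u != 0. Proof. exact: lt0r_neq0 (smooth_sqr_gt0 u). Qed.

Let did (u : R) : is_derive u 1 (fun u : R => u) 1. Proof. exact: is_derive_id. Qed.
Let dc (k u : R) : is_derive u 1 (fun _ : R => k) 0. Proof. exact: is_derive_cst. Qed.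

Let dw (u : R) : is_derive u 1 w (2 * u).
Proof.
apply: (derive_fun_eq (derive_funD (dc e2 u) (derive_funX (did u) 2))); ring.
Qed.

Let dexp (u : R) : is_derive u 1 (fun u => expR (- (eta * u ^+ 2))) (- 2 * eta * u * expR (- (eta * u ^+ 2))).
Proof.
apply: (derive_fun_eq (derive_fun_exp (derive_funN (derive_funM (dc eta u) (derive_funX (did u) 2))))).
by move: (expR _) => E; ring.
Qed.

Let dpow (u : R) : is_derive u 1 phi (smooth_pow1 u).
Proof.
apply: (derive_fun_eq (derive_fun_pow (dw u) (r / 2) (smooth_sqr_gt0 u))).
by rewrite /smooth_pow1 /phi; move: (_ `^ _) => E; field; exact: w0.
Qed.

Let dtest (u : R) : is_derive u 1 test_fun (test_fun1 u).
Proof.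
apply: (derive_fun_eq (derive_funM (dpow u) (dexp u))).
by rewrite /test_fun1 /g1 /test_fun /smooth_pow1; move: (expR _) (phi u) => E F; field; exact: w0.
Qed.

Let dg1 (u : R) : is_derive u 1 g1 (g2 u).
Proof.
have d1 := derive_funM (derive_funM (dc r u) (did u)) (derive_funV (dw u) (w0 u)).
have d2 := derive_funN (derive_funM (derive_funM (dc 2 u) (dc eta u)) (did u)).
apply: (derive_fun_eq (derive_funD d1 d2)).
by rewrite /g2; have := w0 u; move: (w u) => E E0; field.
Qed.

Let dg2 (u : R) : is_derive u 1 g2 (g3 u).
Proof.
have d1 := derive_funM (dc r u) (derive_funV (dw u) (w0 u)).
have w20 : w u ^+ 2 != 0 by rewrite expf_neq0.
have d2 := derive_funN (derive_funM (derive_funM (dc (2 * r) u) (derive_funX (did u) 2)) (derive_funV (derive_funX (dw u) 2) w20)).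
have d3 := dc (- (2 * eta)) u.
apply: (derive_fun_eq (derive_funD (derive_funD d1 d2) d3)).
by rewrite /g3 /=; have := w0 u; move: (w u) => E E0; field.
Qed.

Let dtest1 (u : R) : is_derive u 1 test_fun1 (test_fun2 u).
Proof.
apply: (derive_fun_eq (derive_funM (dg1 u) (dtest u))).
by rewrite /test_fun2 /test_fun1; ring.
Qed.

Let dtest2 (u : R) : is_derive u 1 test_fun2 (test_fun3 u).
Proof.
apply: (derive_fun_eq (derive_funM (derive_funD (dg2 u) (derive_funX (dg1 u) 2)) (dtest u))).
by rewrite /test_fun3 /test_fun1 /=; ring.
Qed.

Lemma test_fun_smooth : exists L, smooth_bounded test_fun test_fun1 test_fun2 L.
Proof.
pose S u : R := 1 + u ^+ 2.
have S1 u : 1 <= S u by rewrite lerDl sqr_ge0.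
have S0 u : 0 <= S u by exact: le_trans (S1 u).
have uS (u : R) : `|u| <= S u.
  rewrite /S -(real_normK (num_real u)); have := sqr_ge0 (`|u| - 2^-1); move: `|u| => y; nra.
have e0 := ltW e20.
have we u : e2 <= w u by rewrite lerDl sqr_ge0.
have ei0 : 0 <= e2^-1 by rewrite invr_ge0.
have wi u : 0 <= (w u)^-1 <= e2^-1.
  by rewrite invr_ge0 (ltW (smooth_sqr_gt0 u)) /= lef_pV2 // posrE ?smooth_sqr_gt0.
pose c := 1 + 2 * e2^-1 + 14 * e2^-1 ^+ 2 + 6 * e2^-1 + 2 * eta + (2 + e2).
have c1 : 1 <= c by rewrite /c; have := sqr_ge0 e2^-1; have := ltW eta0; lra.
have c0 : 0 <= c by exact: le_trans c1.
have uw u : u ^+ 2 / w u <= 1.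
  by rewrite ler_pdivrMr ?smooth_sqr_gt0 // mul1r lerDr.
have uw0 u : 0 <= u ^+ 2 / w u by rewrite divr_ge0 ?sqr_ge0 ?(ltW (smooth_sqr_gt0 u)).
have r0 : 0 <= r by exact: ltW (lt_trans ltr01 r1).
have rw u : 0 <= r / w u <= 2 * e2^-1.
  have /andP[h1 h2] := wi u; rewrite mulr_ge0 //=.
  by rewrite ler_pM.
have b1 u : `|g1 u| <= c * S u.
  rewrite /g1 (mulrAC r u) (le_trans (ler_normB _ _)) // !normrM.
  have /andP[h1 h2] := rw u; have h3 := uS u.
  rewrite -(normrM r) (ger0_norm h1) (@ger0_norm _ 2) // (ger0_norm (ltW eta0)).
  exact: (test_bound1 h1 h2 h3 (normr_ge0 _) ei0 (ltW eta0) e0).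
have b2 u : `|g2 u| <= c.
  rewrite /g2; have -> : 2 * r * u ^+ 2 / w u ^+ 2 = 2 * (r / w u) * (u ^+ 2 / w u).
    by have := w0 u; move: (w u) => E E0; field.
  have /andP[h1 h2] := rw u; exact: (test_bound2 h1 h2 (uw0 u) (uw u) ei0 (ltW eta0) e0).
have b3 u : `|g3 u| <= c * S u.
  have /andP[h1 h2] := rw u; have /andP[h3 h4] := wi u.
  have -> : g3 u = (r / w u) * (w u)^-1 * (8 * (u ^+ 2 / w u) - 6) * u.
    by rewrite /g3; have := w0 u; move: (w u) => E E0; field.
  rewrite normrM ler_pM //.
  exact: (test_bound3 h1 h2 h3 h4 (uw0 u) (uw u) ei0 (ltW eta0) e0).
have bphi u : 0 <= phi u <= c * S u.
  rewrite ltW ?smooth_pow_gt0 //=; have wS : 1 + w u <= c * S u.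
    have h1 : 1 + w u <= (1 + (2 + e2)) * S u by rewrite /w /S; have := sqr_ge0 u; nra.
    apply: le_trans h1 _; rewrite ler_wpM2r // /c.
    have : 0 <= e2^-1 ^+ 2 by exact: sqr_ge0.
    have := ltW eta0; move: e2^-1 (e2^-1 ^+ 2) ei0 => y y2 y0; lra.
  apply: le_trans wS; have := smooth_sqr_gt0 u; rewrite /phi; move: (w u) => y y0.
  have [y1|y1] := leP 1 y.
    apply: le_trans (_ : y <= _); last by rewrite lerDr.
    by rewrite -[leRHS](powRr1 (ltW y0)) ler_powR // ler_pdivrMr // mul1r.
  apply: le_trans (_ : 1 <= _); last by rewrite lerDl ltW.
  rewrite -[leRHS](powRr0 y) ger_powR ?y0 ?(ltW y1) //.
  by rewrite divr_ge0.
(* From x^4 <= 24 exp(x) at x = eta (1 + u^2). Three powers of [S] pay for the derivatives, the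
   fourth for the growth of [phi]. *)
have [M M0 hM] : exists2 M, 0 <= M & forall u, S u ^+ 4 * expR (- (eta * u ^+ 2)) <= M.
  exists (24 * expR eta / eta ^+ 4).
    by rewrite divr_ge0 ?mulr_ge0 ?expR_ge0 ?exprn_ge0 // ltW.
  move=> u; rewrite ler_pdivlMr ?exprn_gt0 //.
  have h := expR_ge_exp4 (mulr_ge0 (ltW eta0) (S0 u)).
  have e1 : expR (- (eta * u ^+ 2)) * expR (eta * S u) = expR eta.
    by rewrite -expRD; congr expR; rewrite /S; ring.
  have := ler_wpM2l (expR_ge0 (- (eta * u ^+ 2))) h.
  have e3 (E F : R) : E * (24 * F) = 24 * (E * F) by ring.
  have e4 (E s : R) : E * (eta * s) ^+ 4 = s ^+ 4 * E * eta ^+ 4 by ring.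
  by rewrite e3 e1 e4.
have bound (G : R -> R) k : (forall u, `|G u| <= k * S u ^+ 3) -> 0 <= k ->
    forall u, `|G u * test_fun u| <= k * c * M.
  move=> hG k0 u; rewrite normrM /test_fun normrM (ger0_norm (expR_ge0 _)).
  have /andP[p0 p1] := bphi u; rewrite (ger0_norm p0).
  apply: (@le_trans _ _ (k * S u ^+ 3 * (c * S u * expR (- (eta * u ^+ 2))))).
    by rewrite ler_pM ?mulr_ge0 ?expR_ge0 // ler_wpM2r ?expR_ge0.
  have e3 (s E : R) : k * s ^+ 3 * (c * s * E) = k * c * (s ^+ 4 * E) by ring.
  rewrite e3.
  by rewrite ler_wpM2l ?mulr_ge0.
have S3 u : 1 <= S u ^+ 3 by rewrite exprn_ege1.
have SS3 u : S u <= S u ^+ 3 by rewrite ler_eXnr.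
have S23 u : S u ^+ 2 <= S u ^+ 3 by rewrite ler_weXn2l.
pose L := 5 * c ^+ 3 * c * M.
have c3 : 1 <= c ^+ 3 by rewrite exprn_ege1.
have k5 : 0 <= 5 * c ^+ 3 by rewrite mulr_ge0 // exprn_ge0.
have B0 u : `|test_fun u| <= L.
  rewrite -[test_fun u]mul1r; apply: bound => // v; rewrite normr1.
  by rewrite -[leLHS]mulr1 ler_pM //; lra.
have B1 u : `|test_fun1 u| <= L.
  apply: bound => // v; apply: le_trans (b1 v) _; rewrite ler_pM //.
  by apply: (@le_trans _ _ (c ^+ 3)); [rewrite ler_eXnr|lra].
have B2 u : `|test_fun2 u| <= L.
  exact: (bound (fun u => g2 u + g1 u ^+ 2) _ (fun v => test_bound4 c1 (S1 v) (b1 v) (b2 v)) k5).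
have B3 u : `|test_fun3 u| <= L.
  exact: (bound (fun u => g3 u + 3 * g1 u * g2 u + g1 u ^+ 3) _ (fun v => test_bound5 c1 (S1 v) (b1 v) (b2 v) (b3 v)) k5).
exists L; split => // x y.
have [z _ ->] := mvt_abs y x dtest2.
by rewrite normrM ler_wpM2r.
Qed.

End TestFunction.

Opaque powR.

(** The algebra of [test_drift_ge], with [E] the damping factor, [y] = u^2 / w, and [p], [p1], [p2]
    the power and its derivatives, [A] the modulus of [p1]. The difference of the sides is the sum
    of three nonnegative terms: [T1] uses the one-sided condition, [T2] and [T3] collect the damping
    and discount errors carrying q and b. *)
Lemma drift_algebra (R : realType) (E s eta u y r p p1 p2 A q g be ga lam th c b v : R) :
  0 < E -> E <= 1 -> 0 < s -> eta = s ^+ 2 -> s * `|u| * E <= 1 -> 0 <= y -> y <= 1 ->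
  0 <= r -> r <= 2 -> 0 <= p -> 0 <= q -> 0 <= be -> 0 <= lam ->
  - (A * (be * `|u| + ga * v + g)) <= p1 * b ->
  A * ga * v <= 4^-1 * p2 * q + c * p -> A * `|u| <= 2 * p -> th = 2 * be + c ->
  E * (4^-1 * p2 * q - A * g) - (5 * eta + 2 * s + lam) * p * (`|b| + q) <=
  E * (p2 - 4 * eta * r * y * p + 4 * eta ^+ 2 * u ^+ 2 * p - 2 * eta * p) / 2 * q +
  E * (p1 - 2 * eta * u * p) * b - (lam * (`|b| + q) - th) * (p * E).
Proof.
move=> E0 E1 s0 etaE Es y0 y1 r0 r2 p0 q0 be0 lam0 h1 hq hu ->.
have E0' := ltW E0; have s0' := ltW s0; have eta0 : 0 <= eta by rewrite etaE sqr_ge0.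
have T1 : 0 <= E * (4^-1 * p2 * q + p1 * b + A * g + (2 * be + c) * p).
  rewrite mulr_ge0 //; have := ler_wpM2l be0 hu; nra.
have T2 : 0 <= ((5 * eta + 2 * s + lam) - E * (2 * eta * r * y + eta) + E * (2 * eta ^+ 2 * u ^+ 2) - lam * E) * (p * q).
  rewrite mulr_ge0 ?mulr_ge0 //.
  have a1 : E * (2 * eta * r * y + eta) <= 5 * eta.
    apply: (@le_trans _ _ (1 * (5 * eta))); last by rewrite mul1r.
    rewrite ler_pM ?addr_ge0 ?mulr_ge0 //.
    have : 2 * eta * r * y <= 2 * eta * 2 * 1 by rewrite ler_pM ?mulr_ge0 // ler_wpM2l // mulr_ge0.
    lra.
  have a2 : lam * E <= lam by rewrite ler_piMr.
  have a3 : 0 <= E * (2 * eta ^+ 2 * u ^+ 2) by rewrite mulr_ge0 // mulr_ge0 ?sqr_ge0 // mulr_ge0 ?sqr_ge0.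
  lra.
have T3 : 0 <= p * ((5 * eta + 2 * s + lam) * `|b| - 2 * eta * E * (u * b) - lam * E * `|b|).
  rewrite mulr_ge0 //.
  have a1 : eta * E * (u * b) <= s * `|b|.
    apply: (@le_trans _ _ (s * (s * `|u| * E) * `|b|)).
      rewrite (_ : s * _ * _ = eta * E * `|u * b|); last by rewrite etaE normrM; ring.
      by rewrite ler_wpM2l ?mulr_ge0 // ler_norm.
    by rewrite ler_wpM2r // ler_piMr.
  have a2 : lam * E * `|b| <= lam * `|b| by rewrite ler_wpM2r // ler_piMr.
  have a3 : 0 <= eta * `|b| by rewrite mulr_ge0.
  by rewrite !mulrDl; lra.
rewrite -subr_ge0; have := addr_ge0 (addr_ge0 T1 T2) T3.
by move=> /le_trans; apply; rewrite le_eqVlt; apply/orP; left; apply/eqP; field.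
Qed.

Section PowerAlgebra.
Context (R : realType) (e2 r : R).
Hypothesis e20 : 0 < e2.
Hypothesis r1 : 1 < r.
Hypothesis r2 : r <= 2.
Local Notation w := (smooth_sqr e2).
Local Notation phi := (smooth_pow e2 r).
Local Notation phi1 := (smooth_pow1 e2 r).
Local Notation phi2 := (smooth_pow2 e2 r).

Let r0 : 0 < r. Proof. exact: lt_trans ltr01 r1. Qed.
Let w0 u : 0 < w u. Proof. exact: smooth_sqr_gt0. Qed.
Let p0 u : 0 < phi u. Proof. exact: smooth_pow_gt0. Qed.

Lemma smooth_pow2_ge0 u : 0 <= phi2 u.
Proof.
rewrite /smooth_pow2 mulr_ge0 ?(ltW (p0 u)) // divr_ge0 ?sqr_ge0 // mulr_ge0 ?(ltW r0) //.
by rewrite addr_ge0 ?(ltW e20) // mulr_ge0 ?sqr_ge0 // subr_ge0 ltW.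
Qed.

Lemma smooth_pow1_sg u : phi1 u = Num.sg u * `|phi1 u|.
Proof.
have c0 : 0 <= r / w u * phi u by rewrite !mulr_ge0 ?(ltW r0) ?invr_ge0 ?(ltW (w0 u)) ?(ltW (p0 u)).
have e : phi1 u = r / w u * phi u * u.
  by rewrite /smooth_pow1; move: (w u)^-1 (phi u) => a b; ring.
by rewrite e normrM (ger0_norm c0) mulrCA -numEsg.
Qed.

Lemma smooth_pow1_mul u : `|phi1 u| * `|u| <= 2 * phi u.
Proof.
rewrite -normrM (_ : phi1 u * u = r * (u ^+ 2 / w u) * phi u); last first.
  by rewrite /smooth_pow1; move: (w u)^-1 (phi u) => a b; ring.
have uw0 : 0 <= u ^+ 2 / w u by rewrite divr_ge0 ?sqr_ge0 ?(ltW (w0 u)).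
have uw : u ^+ 2 / w u <= 1 by rewrite ler_pdivrMr ?w0 // mul1r lerDr ltW.
have h0 : 0 <= r * (u ^+ 2 / w u) * phi u.
  by rewrite mulr_ge0 ?(ltW (p0 u)) // mulr_ge0 // ltW.
rewrite ger0_norm //.
by rewrite ler_wpM2r ?(ltW (p0 u)) // -[leRHS]mulr1 ler_pM // ltW.
Qed.

(** The difference is r^2 e2 (phi / w)^2. The factor r - 1 is the reason for exponents above 1: at r
    = 1 the second derivative would no longer control the first. *)
Lemma smooth_pow1_sqr u : `|phi1 u| ^+ 2 * (r - 1) <= r * phi u * phi2 u.
Proof.
rewrite real_normK ?num_real //.
rewrite -subr_ge0 (_ : _ - _ = r ^+ 2 * e2 * ((w u)^-1 * phi u) ^+ 2); last first.
  rewrite /smooth_pow1 /smooth_pow2; have := lt0r_neq0 (w0 u).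
  by move: (w u) (phi u) => a b a0; field.
by rewrite mulr_ge0 ?sqr_ge0 // mulr_ge0 ?sqr_ge0 // ltW.
Qed.

(** Young's inequality with [smooth_pow1_sqr]. For v = |V| it spends half of the term phi'' |V|^2 /
    2 of Ito's formula and leaves the other half. *)
Lemma smooth_pow_quadratic u v ga : `|phi1 u| * ga * v <= 4^-1 * phi2 u * v ^+ 2 + ga ^+ 2 * (r / (r - 1)) * phi u.
Proof.
have h := smooth_pow1_sqr u; have p20 := smooth_pow2_ge0 u; have pp := p0 u.
move: h p20 pp; move: (phi2 u) `|phi1 u| (phi u) => p2 A p h p20 pp.
have rr : 0 < r - 1 by rewrite subr_gt0.
(* Only [0 <= p2] is retained; if [p2] vanishes, [A] does too by [smooth_pow1_sqr]. *)
have [p2e|p2n] := eqVneq p2 0.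
  have A0 : A = 0.
    apply/eqP; rewrite -sqrf_eq0 eq_le sqr_ge0 andbT.
    by move: h; rewrite p2e mulr0 pmulr_lle0.
  rewrite A0 p2e !mul0r mulr0 mul0r add0r.
  by rewrite mulr_ge0 ?(ltW pp) // mulr_ge0 ?sqr_ge0 // divr_ge0 ?(ltW r0) ?(ltW rr).
have p2p : 0 < p2 by rewrite lt_neqAle eq_sym p2n.
have h' : A ^+ 2 <= r / (r - 1) * p * p2.
  by rewrite (_ : r / (r - 1) * p * p2 = r * p * p2 / (r - 1)) ?ler_pdivlMr //; field; exact: lt0r_neq0.
rewrite -(ler_pM2l p2p) -subr_ge0.
rewrite (_ : _ - _ = (p2 * v / 2 - ga * A) ^+ 2 + ga ^+ 2 * (r / (r - 1) * p * p2 - A ^+ 2)).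
  by rewrite addr_ge0 ?sqr_ge0 // mulr_ge0 ?sqr_ge0 // subr_ge0.
by field; exact: lt0r_neq0.
Qed.

Context (eta s : R).
Hypothesis s0 : 0 < s.
Hypothesis etaE : eta = s ^+ 2.

(** The last bound is s |u| <= 1 + s^2 u^2 <= exp(eta u^2). It lets the derivative of the Gaussian
    factor cost only s, the square root of eta. *)
Lemma damping u : let E := expR (- (eta * u ^+ 2)) in [/\ 0 < E, E <= 1 & s * `|u| * E <= 1].
Proof.
have eu : 0 <= eta * u ^+ 2 by rewrite etaE mulr_ge0 ?sqr_ge0.
split; [exact: expR_gt0|by rewrite -[leRHS]expR0 ler_expR oppr_le0|].
rewrite expRN ler_pdivrMr ?expR_gt0 // mul1r.
apply: le_trans (expR_ge1Dx _); rewrite etaE -(real_normK (num_real u)) -exprMn.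
by move: (s * `|u|) => y; have := sqr_ge0 (y - 2^-1); nra.
Qed.

(** The rate [th] cancels what the one-sided condition produces in [be] and [ga]. The errors due to
    damping and discount are small multiples of phi (|b| + q), whose discounted time integral is
    under control. *)
Lemma test_drift_ge (u b q g be ga lam th : R) : 0 <= q -> 0 <= g -> 0 <= be -> 0 <= ga -> 0 <= lam ->
  - (Num.sg u * b) <= be * `|u| + ga * Num.sqrt q + g ->
  th = 2 * be + ga ^+ 2 * (r / (r - 1)) ->
  expR (- (eta * u ^+ 2)) * (4^-1 * phi2 u * q - `|phi1 u| * g) -
    (5 * eta + 2 * s + lam) * phi u * (`|b| + q) <=
  test_fun2 e2 r eta u / 2 * q + test_fun1 e2 r eta u * b - (lam * (`|b| + q) - th) * test_fun e2 r eta u.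
Proof.
move=> q0 g0 be0 ga0 lam0 hb thE.
have [E0 E1 Es] := damping u.
have hq := smooth_pow_quadratic u (Num.sqrt q) ga; rewrite sqr_sqrtr // in hq.
have hu := smooth_pow1_mul u.
have h1 : - (`|phi1 u| * (be * `|u| + ga * Num.sqrt q + g)) <= phi1 u * b.
  have e : - (phi1 u * b) = `|phi1 u| * (- (Num.sg u * b)).
    by rewrite {1}smooth_pow1_sg mulrN (mulrC (Num.sg u)) mulrA.
  by rewrite lerNl e; exact: ler_wpM2l.
have uw0 : 0 <= u ^+ 2 / w u by rewrite divr_ge0 ?sqr_ge0 ?(ltW (w0 u)).
have uw : u ^+ 2 / w u <= 1 by rewrite ler_pdivrMr ?w0 // mul1r lerDr ltW.
have t2 : test_fun2 e2 r eta u = expR (- (eta * u ^+ 2)) *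
    (phi2 u - 4 * eta * r * (u ^+ 2 / w u) * phi u + 4 * eta ^+ 2 * u ^+ 2 * phi u - 2 * eta * phi u).
  rewrite /test_fun2 /test_fun /smooth_pow2 /smooth_sqr; have := lt0r_neq0 (w0 u).
  by rewrite /smooth_sqr; move: (expR _) (phi u) => E p a0; field.
have t1 : test_fun1 e2 r eta u = expR (- (eta * u ^+ 2)) * (phi1 u - 2 * eta * u * phi u).
  rewrite /test_fun1 /test_fun /smooth_pow1; move: (expR _) (w u)^-1 (phi u) => E a p; ring.
rewrite t2 t1 {t2 t1} /test_fun.
have pp := ltW (p0 u); have e0 : 0 <= eta by rewrite etaE sqr_ge0.
exact: (drift_algebra E0 E1 s0 etaE Es uw0 uw (ltW r0) r2 pp q0 be0 lam0 h1 hq hu thE).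
Qed.

End PowerAlgebra.

(** * Almost sure inequalities and Fatou's lemma *)

Section AeReal.
Context d (Om : measurableType d) (R : realType) (P : probability Om R).
Local Notation int f := (P.-integrable setT (fun w => (f w)%:E)).

Lemma ae_le_Rintegral (f g : Om -> R) : int f -> int g -> (\forall w \ae P, f w <= g w) ->
  \int[P]_w f w <= \int[P]_w g w.
Proof.
move=> fi gi fg; rewrite -subr_ge0 -RintegralB //.
have hi := integrableBR measurableT gi fi; have hn := integrable_normR hi.
apply: (@le_trans _ _ (\int[P]_w `|g w - f w|)).
  by apply: Rintegral_ge0 => w _.
rewrite le_eqVlt; apply/orP; left; apply/eqP; apply: EFin_inj.
rewrite -!integral_EFinR //; apply: ae_eq_integral => //.
- exact: measurable_int hn.
- exact: measurable_int hi.
- by apply: filterS fg => w h _; rewrite ger0_norm ?subr_ge0.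
Qed.

Lemma ae_integrable_le (f g : Om -> R) : measurable_fun setT f -> (\forall w \ae P, `|f w| <= g w) ->
  int g -> int f.
Proof.
move=> mf fg gi; apply/integrableP; split; first exact/measurable_EFinP.
have /integrableP [_] := gi; apply: le_lt_trans; apply: ae_ge0_le_integral => //.
- by apply/measurableT_comp => //; exact/measurable_EFinP.
- by apply/measurableT_comp => //; exact: measurable_int gi.
- by apply: filterS fg => w h _; rewrite /= lee_fin (le_trans h) ?ler_norm.
Qed.

(** The integrability of the limit is a conclusion. The majorants [H] may take both signs, which
    accommodates a centred error in them; only their means enter. *)
Lemma fatou_le (Y H : nat -> Om -> R) (X : Om -> R) (c : nat -> R) (l : R) :
  (forall n, measurable_fun setT (Y n)) -> (forall n w, 0 <= Y n w) ->
  (forall n, int (H n)) ->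
  (forall n, \forall w \ae P, Y n w <= H n w) ->
  (forall n, \int[P]_w H n w <= c n) -> c n @[n --> \oo] --> l ->
  measurable_fun setT X ->
  (\forall w \ae P, Y n w @[n --> \oo] --> X w) ->
  int X /\ \int[P]_w X w <= l.
Proof.
move=> mY Y0 iH YH Hc cl mX YX.
have mYe n : measurable_fun setT (fun w => (Y n w)%:E) by exact/measurable_EFinP.
have Y0e n w : setT w -> (0 <= (Y n w)%:E)%E by rewrite lee_fin.
have iY n : int (Y n).
  apply: (ae_integrable_le (mY n) _ (iH n)).
  by apply: filterS (YH n) => w h; rewrite ger0_norm.
have hY n : (\int[P]_w (Y n w)%:E <= (c n)%:E)%E.
  rewrite integral_EFinR // lee_fin (le_trans _ (Hc n)) //.
  exact: ae_le_Rintegral.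
have X0 : \forall w \ae P, 0 <= X w.
  apply: filterS YX => w h; rewrite -(cvg_lim _ h) //.
  by apply: limr_ge; [exact: cvgP h|exact: nearW].
have hX : (\int[P]_w `|X w|%:E <= l%:E)%E.
  have := fatou P measurableT mYe Y0e.
  have e1 : (\int[P]_w `|X w|%:E = \int[P]_w (limn_einf (fun n => (Y n w)%:E)))%E.
    apply: ge0_ae_eq_integral => //.
    - by apply/measurable_EFinP; exact: measurable_normf.
    - apply: (emeasurable_fun_cvg (fun n w => einfs (fun k => (Y k w)%:E) n)).
        by move=> n; exact: measurable_fun_einfs.
      by move=> w _; rewrite limn_einf_lim; exact: is_cvg_einfs.
    - move=> w _; rewrite limn_einf_lim; apply: lime_ge; first exact: is_cvg_einfs.
      by apply: nearW => n; apply: le_ereal_inf_tmp => _ [k _ <-]; rewrite lee_fin.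
    - apply: filterS2 X0 YX => w h0 h _; rewrite ger0_norm //.
      rewrite limn_einf_lim; apply/esym/cvg_lim => //; apply: cvg_einfs.
      by apply: cvg_EFin => //; apply: nearW.
  rewrite -e1 => /le_trans; apply.
  rewrite limn_einf_lim.
  have cle : (c n)%:E @[n --> \oo] --> l%:E by apply: cvg_EFin => //; apply: nearW.
  have -> : l%:E = limn (einfs (fun n => (c n)%:E)).
    by apply/esym/cvg_lim => //; apply: cvg_einfs; exact: cle.
  apply: lee_lim; [exact: is_cvg_einfs|exact: is_cvg_einfs|].
  apply: nearW => n; apply: le_ereal_inf_tmp => _ [k nk <-].
  by apply: le_trans (hY k); apply: ereal_inf_lbound; exists k.
have iX : int X.
  apply/integrableP; split; first exact/measurable_EFinP.
  by apply: (le_lt_trans _ (ltry l)); exact: hX.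
split => //; move: hX; rewrite (integral_EFinR measurableT (integrable_normR iX)) lee_fin; apply: le_trans.
by apply: le_Rintegral => // [|w _]; [exact: integrable_normR|exact: ler_norm].
Qed.

End AeReal.

(** * Growth of the regularized powers *)

Section PowerBounds.
Context (R : realType) (e2 r : R).
Hypothesis e20 : 0 < e2.
Hypothesis r1 : 1 < r.
Hypothesis r2 : r <= 2.

Lemma smooth_pow_le u v : `|u| <= `|v| -> smooth_pow e2 r u <= smooth_pow e2 r v.
Proof.
move=> uv; rewrite /smooth_pow; apply: ge0_ler_powR.
- by rewrite divr_ge0 // (le_trans ler01) // ltW.
- by rewrite nnegrE ltW // smooth_sqr_gt0.
- by rewrite nnegrE ltW // smooth_sqr_gt0.
- by rewrite /smooth_sqr lerD2l -[leLHS]real_normK ?num_real // -[leRHS]real_normK ?num_real // lerXn2r ?nnegrE.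
Qed.

Lemma smooth_pow2_le u v : `|u| <= `|v| -> smooth_pow2 e2 r u <= 2 * smooth_pow e2 r v / e2.
Proof.
move=> uv; have hp := smooth_pow_le uv; have w0 := smooth_sqr_gt0 e20 u.
have p0 := ltW (smooth_pow_gt0 r e20 u).
apply: (@le_trans _ _ (2 * smooth_pow e2 r u / e2)); last first.
  by rewrite ler_wpM2r ?invr_ge0 ?(ltW e20) // ler_wpM2l.
rewrite /smooth_pow2 (mulrAC 2) ler_wpM2r //.
rewrite ler_pdivrMr ?exprn_gt0 // mulrAC ler_pdivlMr //.
have we : smooth_sqr e2 u = e2 + u ^+ 2 by [].
rewrite we; have u0 := sqr_ge0 u; move: (u ^+ 2) u0 => y y0 {we hp p0 w0 uv}.
have h1 : r * (e2 + (r - 1) * y) <= 2 * (e2 + y).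
  have a1 : r * (r - 1) <= 2 * 1.
    by apply: ler_pM => //; rewrite ?subr_ge0 ?lerBlDr ?(le_trans ler01) // ltW.
  have a2 : r * (r - 1) * y <= 2 * 1 * y by rewrite ler_wpM2r.
  have a3 : r * e2 <= 2 * e2 by rewrite ler_wpM2r // ltW.
  by clear -a2 a3; lra.
apply: (@le_trans _ _ (2 * (e2 + y) * e2)); first by rewrite ler_wpM2r // ltW.
rewrite expr2 mulrA ler_wpM2l ?mulr_ge0 ?addr_ge0 ?(ltW e20) //.
by rewrite lerDl.
Qed.

Lemma normr_smooth_pow1_le u v : `|u| <= `|v| -> `|smooth_pow1 e2 r u| <= 2 * smooth_pow e2 r v / e2 * `|v|.
Proof.
move=> uv; have hp := smooth_pow_le uv; have w0 := smooth_sqr_gt0 e20 u.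
have p0 := ltW (smooth_pow_gt0 r e20 u).
have r0 : 0 <= r by rewrite (le_trans ler01) // ltW.
have -> : `|smooth_pow1 e2 r u| = r * smooth_pow e2 r u / smooth_sqr e2 u * `|u|.
  rewrite /smooth_pow1 !normrM (ger0_norm r0) (ger0_norm p0) normfV (ger0_norm (ltW w0)).
  by move: (_^-1) (smooth_pow _ _ _) => a b; ring.
apply: ler_pM => //; first by rewrite divr_ge0 ?mulr_ge0 // ltW.
apply: ler_pM; rewrite ?mulr_ge0 ?invr_ge0 ?(ltW w0) //; first exact: ler_pM.
by rewrite lef_pV2 ?posrE // lerDl sqr_ge0.
Qed.

Lemma measurable_smooth_pow : [/\ measurable_fun setT (smooth_pow e2 r),
  measurable_fun setT (smooth_pow1 e2 r) & measurable_fun setT (smooth_pow2 e2 r)].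
Proof.
have mw : measurable_fun setT (smooth_sqr e2).
  by apply: measurable_addf => //; exact: measurable_exprf.
have mp : measurable_fun setT (smooth_pow e2 r) by exact: measurable_powRf.
have mi : measurable_fun setT (fun u => (smooth_sqr e2 u)^-1).
  have := measurable_powRf (-1) mw; apply: eq_measurable_fun => u _.
  by rewrite powR_inv1 // ltW // smooth_sqr_gt0.
split => //.
  by apply: measurable_mulf => //; apply: measurable_mulf => //; exact: measurable_mulf.
apply: measurable_mulf => //; apply: measurable_mulf.
  apply: measurable_mulf => //; apply: measurable_addf => //; apply: measurable_mulf => //; exact: measurable_exprf.
apply: (eq_measurable_fun (fun u => (smooth_sqr e2 u)^-1 ^+ 2)); first by move=> u _; rewrite exprVn.
exact: measurable_exprf.
Qed.

End PowerBounds.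

(** * The drift inequality *)

Lemma drift_combine (R : realType) (p2 p1 ph pM B c l E Em X e K : R) :
  0 <= p2 -> 0 <= p1 -> 0 <= ph -> ph <= pM -> 0 <= B -> 0 <= c -> c <= 8 * l ->
  0 <= Em -> 0 <= X -> 0 <= e -> E <= 1 -> Em <= E -> K <= e -> e * X <= K ->
  X * Em * (e * p2) - e * p1 - 8 * pM * (l * (K * B)) <= K * (E * (p2 - p1) - c * ph * B).
Proof.
move=> p20 p10 h0 hM B0 c0 cl Em0 X0 e0 E1 EE Ke Kx.
have K0 : 0 <= K by rewrite (le_trans _ Kx) ?mulr_ge0.
have E0 : 0 <= E by rewrite (le_trans Em0).
have a1 : e * X * Em * p2 <= K * E * p2 by rewrite ler_wpM2r // ler_pM ?mulr_ge0.
have a2 : K * E * p1 <= e * 1 * p1 by rewrite ler_wpM2r // ler_pM.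
have a3 : c * ph * (K * B) <= 8 * l * pM * (K * B) by rewrite ler_wpM2r ?mulr_ge0 // ler_pM.
by clear -a1 a2 a3; lra.
Qed.

Lemma small_coef (R : realType) (l l2 l4 : R) : l2 <= l -> l4 <= l -> 5 * l4 + 2 * l2 + l <= 8 * l.
Proof. lra. Qed.

Lemma pathwise_combine (R : realType) (X c Ps Kf Pt Kg G Lo I mn J : R) : 0 <= c ->
  X * G - Lo - 8 * c * I <= J -> I <= mn -> X * Ps <= Kf -> Kg <= Pt ->
  X * (Ps + G) <= Pt + Lo + 8 * c * mn - (Kg - Kf - J).
Proof.
move=> c0 h hm h1 h2; have := ler_wpM2l c0 hm; lra.
Qed.

Section DriftInequality.
Context (R : realType) (T : R) (T_gt0 : 0 < T) d (Omega : measurableType d) (w : Omega).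
Local Notation mu := (@lebesgue_measure R).
Local Notation int g := (mu.-integrable `[0, T] (fun u => (g u)%:E)).
Context (e2 r be ga : R).
Hypothesis e20 : 0 < e2.
Hypothesis r1 : 1 < r.
Hypothesis r2 : r <= 2.
Hypothesis be0 : 0 <= be.
Hypothesis ga0 : 0 <= ga.
Context (b q x g : Omega -> R -> R) (M : R).
Local Notation phi := (smooth_pow e2 r).
Local Notation phi1 := (smooth_pow1 e2 r).
Local Notation phi2 := (smooth_pow2 e2 r).

(** The term 2 be comes from [smooth_pow1_mul], the other one from [smooth_pow_quadratic]. With this
    rate, [gain] is the part of the energy that Ito's formula retains and [loss] the cost of the
    difference of generators. *)
Definition growth_rate := 2 * be + ga ^+ 2 * (r / (r - 1)).
Definition gain w u := expR (growth_rate * u) * (4^-1 * phi2 (x w u) * q w u).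
Definition loss w u := expR (growth_rate * u) * (`|phi1 (x w u)| * g w u).
Local Notation th := growth_rate.

Hypothesis D : path_data T w b q x.
Hypothesis gi : int (g w).
Hypothesis g0 : forall u, 0 <= u <= T -> 0 <= g w u.
Hypothesis xM : forall u, 0 <= u <= T -> `|x w u| <= M.
Hypothesis onesided : forall u, 0 <= u <= T ->
  - (Num.sg (x w u) * b w u) <= be * `|x w u| + ga * Num.sqrt (q w u) + g w u.

Let T0 : 0 <= T. Proof. exact: ltW. Qed.

Lemma growth_rate_ge0 : 0 <= th.
Proof.
rewrite /growth_rate addr_ge0 //; first by rewrite mulr_ge0.
by rewrite mulr_ge0 ?sqr_ge0 // divr_ge0 ?subr_ge0 ?(le_trans ler01) // ltW.
Qed.

Let M0 : 0 <= M. Proof. by apply: le_trans (xM (u := 0) _) => //; rewrite lexx. Qed.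

Let xM' u : 0 <= u <= T -> `|x w u| <= `|M|.
Proof. by move=> /xM h; rewrite (le_trans h) ?ler_norm. Qed.

Let mexp : measurable_fun `[0, T] (fun u => expR (th * u)).
Proof. by apply: measurable_expRf; exact: measurable_mulf. Qed.

Let expth u : 0 <= u <= T -> `|expR (th * u)| <= expR (th * T).
Proof.
by move=> /andP[_ uT]; rewrite ger0_norm ?expR_ge0 // ler_expR ler_wpM2l // growth_rate_ge0.
Qed.

Lemma gain_integrable : int (gain w).
Proof.
have [ib iq q0 mx] := D; have [_ _ m2] := measurable_smooth_pow r e20.
have mq : measurable_fun `[0, T] (q w) by exact: (integrable_measR (mu := mu)).
apply: (@integrable_leR _ _ _ mu _ _ _ (fun u => expR (th * T) * (4^-1 * (2 * phi M / e2) * q w u))).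
- by [].
- apply: measurable_mulf => //; apply: measurable_mulf => //; apply: measurable_mulf => //.
  by apply: (measurableT_comp m2).
- move=> u; rewrite /= in_itv /= => uT; rewrite normrM ler_pM ?expth //.
  have p20 := smooth_pow2_ge0 e20 r1 (x w u).
  rewrite ger0_norm; last by rewrite mulr_ge0 ?q0 // mulr_ge0.
  by rewrite ler_wpM2r ?q0 // ler_wpM2l // smooth_pow2_le // xM'.
- by apply: integrableZR => //; exact: integrableZR.
Qed.

Lemma loss_integrable : int (loss w).
Proof.
have [ib iq q0 mx] := D; have [_ m1 _] := measurable_smooth_pow r e20.
have mg : measurable_fun `[0, T] (g w) by exact: (integrable_measR (mu := mu)).
apply: (@integrable_leR _ _ _ mu _ _ _ (fun u => expR (th * T) * (2 * phi M / e2 * `|M| * g w u))).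
- by [].
- apply: measurable_mulf => //; apply: measurable_mulf => //; apply: measurable_normf.
  by apply: (measurableT_comp m1).
- move=> u; rewrite /= in_itv /= => uT; rewrite normrM ler_pM ?expth //.
  rewrite ger0_norm ?mulr_ge0 ?g0 //.
  by rewrite ler_wpM2r ?g0 // normr_smooth_pow1_le // xM'.
- by apply: integrableZR => //; exact: integrableZR.
Qed.

Context (l s t : R).
Hypothesis l0 : 0 < l.
Hypothesis l1 : l <= 1.
Hypothesis s0 : 0 <= s.
Hypothesis st : s <= t.
Hypothesis tT : t <= T.
Local Notation a := (ito_killing l th b q).
Local Notation f := (test_fun e2 r (l ^+ 4)).
Local Notation f1 := (test_fun1 e2 r (l ^+ 4)).
Local Notation f2 := (test_fun2 e2 r (l ^+ 4)).
Hypothesis ftc : ito_error (cst 1) (cst 0) (cst 0) a b q x s t w = 0.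
Let A := \int[mu]_(u in `[0, T]) (`|b w u| + q w u).
(** The parameter [l] is the discount rate and, through eta = l^4, also governs the damping. [X]
    bounds the product of the two factors from below along the whole path, and tends to 1 with l. *)
Let X := expR (- (l * A) - l ^+ 4 * M ^+ 2).
Let K := weight a w.
Let k := expR (th * T).

Let ibq : int (fun u => `|b w u| + q w u).
Proof. by have [ib iq _ _] := D; apply: integrableDR => //; exact: integrable_normR. Qed.

Let bq0 u : 0 <= u <= T -> 0 <= `|b w u| + q w u.
Proof. by move=> uT; rewrite addr_ge0 // (pd_q0 D). Qed.

Transparent weight.
Lemma weight_killingE u : 0 <= u <= T ->
  K u = expR (th * u - l * \int[mu]_(v in `[0, u]) (`|b w v| + q w v)).
Proof.
move=> /andP[u0 uT]; rewrite /K /weight /ito_killing; congr expR.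
have i1 := integrable_sub ibq (lexx 0) uT.
have mu0 : (mu `[0%R, u] < +oo)%E by exact: measure_segment_lty.
rewrite RintegralB //; [|exact: integrableZR|exact: integrable_cstR].
rewrite (RintegralZl _ _ i1) // Rintegral_cst // fine_measure_segment // subr0.
by move: (Rintegral _ _ _) => I; ring.
Qed.

Opaque weight.

Let Ale u : 0 <= u <= T -> \int[mu]_(v in `[0, u]) (`|b w v| + q w v) <= A.
Proof. by move=> /andP[u0 uT]; apply: Rintegral_sub_le. Qed.

Let Kge u : 0 <= u <= T -> expR (th * u) * expR (- (l * A)) <= K u.
Proof.
by move=> uT; rewrite (weight_killingE uT) expRD (ler_pM2l (expR_gt0 _)) ler_expR lerN2 (ler_pM2l l0); exact: Ale.
Qed.

Let Kle u : 0 <= u <= T -> K u <= expR (th * u).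
Proof.
move=> uT; rewrite weight_killingE // ler_expR gerBl mulr_ge0 ?(ltW l0) //.
by apply: Rintegral_ge0 => v; rewrite /= in_itv /= => /andP[v0 vu]; apply: bq0; rewrite v0 (le_trans vu) //; case/andP: uT.
Qed.

Let Ege u : 0 <= u <= T -> expR (- (l ^+ 4 * M ^+ 2)) <= expR (- (l ^+ 4 * x w u ^+ 2)).
Proof.
move=> uT; rewrite ler_expR lerN2 ler_wpM2l ?exprn_ge0 ?(ltW l0) //.
by rewrite -(real_normK (num_real (x w u))) lerXn2r ?nnegrE // xM.
Qed.

Let Ele y : expR (- (l ^+ 4 * y ^+ 2)) <= 1.
Proof. by rewrite -[leRHS]expR0 ler_expR oppr_le0 mulr_ge0 ?sqr_ge0 // exprn_ge0 // ltW. Qed.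

(** [test_drift_ge] with eta = l^4 and s = l^2, whose error coefficient 5 eta + 2 s + l is at most 8
    l. Relative to exp(th u), the weight on the gain is bounded below by [X] and that on the loss
    above by 1. *)
Lemma drift_pathwise u : 0 <= u <= T ->
  X * gain w u - loss w u - 8 * phi M * (l * (K u * (`|b w u| + q w u))) <=
  ito_drift f f1 f2 a b q x w u.
Proof.
move=> uT; have q0 := pd_q0 D uT; have gg0 := g0 uT.
have l2 : 0 < l ^+ 2 by rewrite exprn_gt0.
have le : l ^+ 4 = (l ^+ 2) ^+ 2 by rewrite -exprM.
have h := test_drift_ge e20 r1 r2 l2 le q0 gg0 be0 ga0 (ltW l0) (onesided uT) erefl.
rewrite /ito_drift; apply: (@le_trans _ _ (weight a w u * (expR (- (l ^+ 4 * x w u ^+ 2)) * (4^-1 * phi2 (x w u) * q w u - `|phi1 (x w u)| * g w u) -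
    (5 * l ^+ 4 + 2 * l ^+ 2 + l) * phi (x w u) * (`|b w u| + q w u)))); last first.
  by rewrite ler_wpM2l // ltW // weight_gt0.
have p20 : 0 <= 4^-1 * phi2 (x w u) * q w u by rewrite mulr_ge0 // mulr_ge0 // smooth_pow2_ge0.
have p10 : 0 <= `|phi1 (x w u)| * g w u by rewrite mulr_ge0.
have ph : phi (x w u) <= phi M by apply: smooth_pow_le => //; exact: xM'.
have ph0 : 0 <= phi (x w u) by rewrite ltW // smooth_pow_gt0.
have cl : 5 * l ^+ 4 + 2 * l ^+ 2 + l <= 8 * l.
  have a2 : l ^+ 2 <= l by rewrite expr2 ger_pMr.
  have a4 : l ^+ 4 <= l by rewrite le (le_trans _ a2) // expr2 ger_pMr // (le_trans a2).
  exact: (small_coef a2 a4).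
have XE : X = expR (- (l * A)) * expR (- (l ^+ 4 * M ^+ 2)) by rewrite /X expRD.
rewrite -/K /gain /loss XE.
have := Kge uT; have := Kle uT; have := Ege uT; have := Ele (x w u).
have e1 := expR_ge0 (- (l ^+ 4 * M ^+ 2)); have e2' := expR_ge0 (- (l * A)); have e3 := expR_ge0 (th * u).
have c0 : 0 <= 5 * l ^+ 4 + 2 * l ^+ 2 + l by rewrite !addr_ge0 ?mulr_ge0 ?exprn_ge0 ?(ltW l0).
exact: (drift_combine p20 p10 ph0 ph (bq0 uT) c0 cl e1 e2' e3).
Qed.

Let Bu := k * (1 + th * T).

(** The minimum joins two bounds of the same error: [Bu], from [killing_budget], is free of the
    path, and the other tends to 0 with l. Dominated convergence then works without any moment of
    [A]. *)
Lemma drift_pathwise_integrated :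
  X * (expR (th * s) * phi (x w s) + \int[mu]_(u in `[s, t]) gain w u) <=
  expR (th * t) * phi (x w t) + \int[mu]_(u in `[s, t]) loss w u +
  8 * phi M * Num.min Bu (l * (k * A)) - ito_error f f1 f2 a b q x s t w.
Proof.
have sT := le_trans st tT; have t0 := le_trans s0 st.
have [L fS] : exists L, smooth_bounded f f1 f2 L by apply: test_fun_smooth => //; exact: exprn_gt0.
have sTT : 0 <= s <= T by rewrite s0. have tTT : 0 <= t <= T by rewrite t0.
have mK : measurable_fun `[0, T] K by apply: weight_killing_measurable => //; exact: D.
have Kk u : 0 <= u <= T -> `|K u| <= k.
  move=> uT; rewrite ger0_norm ?(ltW (weight_gt0 _ _ _)) // (le_trans (Kle uT)) //.
  by rewrite (le_trans _ (expth uT)) // ler_norm.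
have iKb : int (fun u => K u * (`|b w u| + q w u)).
  apply: (@integrable_leR _ _ _ mu _ _ _ (fun u => k * (`|b w u| + q w u))) => //.
  - by apply: measurable_mulf => //; exact: (integrable_measR (mu := mu)).
  - by move=> u; rewrite /= in_itv /= => uT; rewrite normrM ler_pM ?Kk // ger0_norm ?bq0.
  - exact: integrableZR.
have iKs := integrable_sub iKb s0 tT.
have ig1 := integrable_sub gain_integrable s0 tT.
have il1 := integrable_sub loss_integrable s0 tT.
have id1 := integrable_sub (ito_drift_integrable T0 fS (ltW l0) growth_rate_ge0 D) s0 tT.
have mst : measurable (`[s, t]%classic : set R) by exact: measurable_itv.
have h : X * \int[mu]_(u in `[s, t]) gain w u - \int[mu]_(u in `[s, t]) loss w u -
    8 * phi M * (l * \int[mu]_(u in `[s, t]) (K u * (`|b w u| + q w u))) <=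
    \int[mu]_(u in `[s, t]) ito_drift f f1 f2 a b q x w u.
  have RZ c (h : R -> R) : mu.-integrable `[s, t] (EFin \o h) ->
      c * \int[mu]_(u in `[s, t]) h u = \int[mu]_(u in `[s, t]) (c * h u).
    by move=> ih; rewrite (RintegralZl _ _ ih).
  rewrite (RZ X _ ig1) (RZ l _ iKs) (RZ (8 * phi M) (fun u => l * (K u * (`|b w u| + q w u)))); last exact: integrableZR.
  rewrite -!RintegralB //; first last.
  - exact: integrableZR.
  - by apply: integrableZR => //; exact: integrableZR.
  - by apply: integrableBR => //; exact: integrableZR.
  apply: le_Rintegral => //.
    apply: integrableBR => //; first by apply: integrableBR => //; exact: integrableZR.
    by apply: integrableZR => //; exact: integrableZR.
  move=> u; rewrite /= in_itv /= => /andP[su ut]; apply: drift_pathwise.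
  by rewrite (le_trans s0) // (le_trans ut).
have hm : l * \int[mu]_(u in `[s, t]) (K u * (`|b w u| + q w u)) <= Num.min Bu (l * (k * A)).
  rewrite le_min (killing_budget T0 l0 growth_rate_ge0 D s0 st tT ftc) /= ler_pM2l //.
  have -> : k * A = \int[mu]_(u in `[0, T]) (k * (`|b w u| + q w u)) by rewrite RintegralZl.
  apply: (@le_trans _ _ (\int[mu]_(u in `[s, t]) (k * (`|b w u| + q w u)))).
    apply: le_Rintegral => //; first by apply: (integrable_sub _ s0 tT); exact: integrableZR.
    move=> u; rewrite /= in_itv /= => /andP[su ut].
    have uT : 0 <= u <= T by rewrite (le_trans s0) // (le_trans ut).
    by rewrite ler_wpM2r ?bq0 // (le_trans (ler_norm _)) ?Kk.
  apply: Rintegral_sub_le => //; first exact: integrableZR.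
  by move=> u uT; rewrite mulr_ge0 ?bq0 // expR_ge0.
have pM0 : 0 <= phi M by rewrite ltW // smooth_pow_gt0.
have hks : X * (expR (th * s) * phi (x w s)) <= K s * f (x w s).
  have -> : X = expR (- (l * A)) * expR (- (l ^+ 4 * M ^+ 2)) by rewrite /X expRD.
  rewrite /test_fun (_ : _ * _ * _ = (expR (th * s) * expR (- (l * A))) * (phi (x w s) * expR (- (l ^+ 4 * M ^+ 2)))); last by ring.
  have p0 := ltW (smooth_pow_gt0 r e20 (x w s)).
  by apply: ler_pM; rewrite ?mulr_ge0 ?expR_ge0 ?Kge // ler_wpM2l // Ege.
have hkt : K t * f (x w t) <= expR (th * t) * phi (x w t).
  have p0 := ltW (smooth_pow_gt0 r e20 (x w t)).
  rewrite /test_fun ler_pM ?mulr_ge0 ?expR_ge0 ?(ltW (weight_gt0 _ _ _)) ?Kle //.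
  by rewrite ler_piMr.
rewrite /ito_error -/K; exact: (pathwise_combine pM0 h hm hks hkt).
Qed.

End DriftInequality.

Lemma weighted_error_le (R : realType) (z Mz X V Q J : R) : 0 <= z -> z <= Mz -> 0 <= Q ->
  X <= V + Q - J -> z * X <= z * V + Mz * Q - z * J.
Proof. by move=> z0 zM Q0 h; have := ler_wpM2l z0 h; have := ler_wpM2r Q0 zM; lra. Qed.

Lemma ae_impl4 (R : realType) d (Om : measurableType d) (P : probability Om R) (A B C D E : Om -> Prop) :
  (\forall w \ae P, A w) -> (\forall w \ae P, B w) -> (\forall w \ae P, C w) -> (\forall w \ae P, D w) ->
  (forall w, A w -> B w -> C w -> D w -> E w) -> \forall w \ae P, E w.
Proof.
move=> a b c e h.
have ab : \forall w \ae P, A w /\ B w by apply: filterS2 a b.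
by apply: filterS3 ab c e => w [? ?] ? ?; exact: h.
Qed.

Section ItoProcess.
Context (R : realType) (d : measure_display) (Omega : measurableType d)
  (P : probability Omega R).
Hypothesis P_complete : measure_is_complete P.
Context (T : R) (m : nat) (W : Omega -> R -> 'rV[R]_m).
Hypothesis W_bm : brownian_motion P T W.
Hypothesis T_gt0 : 0 < T.
Local Notation Ft t := (filtered P W t).
Local Notation mu := (@lebesgue_measure R).
Local Notation int g := (mu.-integrable `[0, T] (fun u => (g u)%:E)).
Local Notation Int X := (P.-integrable setT (fun w => (X w)%:E)).

(* All that is used of a process [x] with drift [b] and quadratic variation
   density [q]. *)
Record ito_process (b q x : Omega -> R -> R) : Prop := ItoProcess {
  ip_b : progressive P T W b ;
  ip_q : progressive P T W q ;
  ip_q0 : forall w u, 0 <= q w u ;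
  ip_x : continuous_adapted P T W x ;
  ip_path : \forall w \ae P, path_data T w b q x ;
  ip_budget : forall lam theta, 0 < lam -> 0 <= theta ->
    \forall w \ae P, forall s t, 0 <= s -> s <= t -> t <= T ->
    ito_error (cst 1) (cst 0) (cst 0) (ito_killing lam theta b q) b q x s t w = 0 ;
  ip_error_measurable : forall lam theta f f1 f2 L s t, 0 < lam -> 0 <= theta ->
    smooth_bounded f f1 f2 L -> 0 <= s -> s <= t -> t <= T ->
    measurable_fun setT (ito_error f f1 f2 (ito_killing lam theta b q) b q x s t) ;
  ip_null : forall lam theta f f1 f2 L s t, 0 < lam -> 0 <= theta ->
    smooth_bounded f f1 f2 L -> 0 <= s -> s <= t -> t <= T ->
    ito_null P W f f1 f2 (ito_killing lam theta b q) b q x s t }.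

Context (b q x g : Omega -> R -> R).
Hypothesis ip : ito_process b q x.
Hypothesis pg : progressive P T W g.
Hypothesis gi : \forall w \ae P, int (g w).
Hypothesis g0 : forall w u, 0 <= g w u.

Definition path_max w := fine (sup_path T x w).
Local Notation M := path_max.

Lemma path_max_measurable : measurable_fun setT M.
Proof.
have [cx mx] := ip_x ip.
apply: (proj1 (sup_path_measurable T_gt0 cx _)) => t tT.
by apply: (adapted_measurable P_complete W_bm _ (mx t tT)); case/andP: tT.
Qed.

Lemma path_max_ge w u : 0 <= u <= T -> `|x w u| <= M w.
Proof.
have [cx _] := ip_x ip.
by move=> uT; rewrite /M; have [t0 _ [-> h]] := sup_path_attained T_gt0 (cx w); exact: h.
Qed.

Lemma path_max_ge0 w : 0 <= M w.
Proof. by apply: le_trans (path_max_ge w (u := 0) _) => //; rewrite lexx ltW. Qed.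

Context (e2 r be ga : R).
Hypothesis e20 : 0 < e2.
Hypothesis r1 : 1 < r.
Hypothesis r2 : r <= 2.
Hypothesis be0 : 0 <= be.
Hypothesis ga0 : 0 <= ga.
Local Notation phi := (smooth_pow e2 r).
Local Notation th := (growth_rate r be ga).
Local Notation gain := (gain e2 r be ga q x).
Local Notation loss := (loss e2 r be ga x g).
Hypothesis onesided : \forall w \ae P, forall u, 0 <= u <= T ->
  - (Num.sg (x w u) * b w u) <= be * `|x w u| + ga * Num.sqrt (q w u) + g w u.

Let th0 : 0 <= th. Proof. exact: growth_rate_ge0. Qed.

Lemma exp_time_progressive (k : R) : progressive P T W (fun _ u => expR (k * u)).
Proof.
apply: continuous_adapted_progressive; split=> [w|t tT]; last exact: measurable_cst.
apply: continuous_subspaceT => u; apply: continuous_comp; last exact: continuous_expR.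
exact: mulrl_continuous.
Qed.

Let px : progressive P T W x. Proof. exact: continuous_adapted_progressive (ip_x ip). Qed.

Lemma gain_progressive : progressive P T W gain.
Proof.
have [_ _ m2] := measurable_smooth_pow r e20.
apply: progressiveM; first exact: exp_time_progressive.
apply: progressiveM; last exact: ip_q ip.
apply: progressiveM; first exact: progressive_cst.
exact: progressive_comp.
Qed.

Lemma loss_progressive : progressive P T W loss.
Proof.
have [_ m1 _] := measurable_smooth_pow r e20.
apply: progressiveM; first exact: exp_time_progressive.
by apply: progressiveM => //; apply: (progressive_comp (measurable_normf m1)).
Qed.

Lemma progressive_integral_measurable X s t : progressive P T W X -> 0 <= s -> s <= t -> t <= T ->
  measurable_fun setT (fun w => \int[mu]_(u in `[s, t]) X w u).
Proof.
move=> pX s0 st tT; apply: (adapted_measurable P_complete W_bm tT).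
exact: (progressive_integral pX s0 st tT).
Qed.

Lemma gain_ge0 w u : 0 <= gain w u.
Proof.
have p20 := smooth_pow2_ge0 e20 r1 (x w u).
by rewrite mulr_ge0 ?expR_ge0 // mulr_ge0 ?(ip_q0 ip) // mulr_ge0.
Qed.

Lemma loss_ge0 w u : 0 <= loss w u.
Proof. by rewrite mulr_ge0 ?expR_ge0 // mulr_ge0. Qed.

Lemma loss_path_integrable : \forall w \ae P, int (loss w).
Proof.
apply: filterS2 (ip_path ip) gi => w D iw.
apply: (loss_integrable ga e20 r1 r2 be0 D iw (M := M w)) => // u uT.
exact: path_max_ge.
Qed.

Hypothesis iPhi : Int (fun w => phi (M w)).
Hypothesis iLoss : Int (fun w => \int[mu]_(u in `[0, T]) loss w u).

Lemma state_integrable t : 0 <= t <= T -> Int (fun w => phi (x w t)).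
Proof.
move=> tT; have [mp _ _] := measurable_smooth_pow r e20; have [_ mx] := ip_x ip.
apply: (integrable_leR _ _ _ iPhi) => //.
  apply: (measurableT_comp mp); apply: (adapted_measurable P_complete W_bm _ (mx t tT)).
  by case/andP: tT.
move=> w _; rewrite ger0_norm ?(ltW (smooth_pow_gt0 _ _ _)) //.
by apply: smooth_pow_le => //; rewrite (ger0_norm (path_max_ge0 w)) path_max_ge.
Qed.

Lemma loss_expectation_integrable s t : 0 <= s -> s <= t -> t <= T ->
  Int (fun w => \int[mu]_(u in `[s, t]) loss w u).
Proof.
move=> s0 st tT; apply: (ae_integrable_le _ _ iLoss).
  by apply: progressive_integral_measurable => //; exact: loss_progressive.
apply: filterS loss_path_integrable => w iw; rewrite ger0_norm.
  by apply: Rintegral_sub_le => // u _; exact: loss_ge0.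
by apply: Rintegral_ge0 => u _; exact: loss_ge0.
Qed.

(* The weights of Ito's formula are removed by Fatou's lemma, as the discount
   rate and the damping tend to 0. *)
Lemma discounted_power_le s t (z : Omega -> R) Mz : 0 <= s -> s <= t -> t <= T -> @measurable_fun _ _ (Ft s) R setT z ->
  (forall w, 0 <= z w) -> (forall w, z w <= Mz) ->
  Int (fun w => z w * (expR (th * s) * phi (x w s) + \int[mu]_(u in `[s, t]) gain w u)) /\
  \int[P]_w (z w * (expR (th * s) * phi (x w s) + \int[mu]_(u in `[s, t]) gain w u)) <=
  \int[P]_w (z w * (expR (th * t) * phi (x w t) + \int[mu]_(u in `[s, t]) loss w u)).
Proof.
move=> s0 st tT mz z0 zM; have sT := le_trans st tT; have t0 := le_trans s0 st.
have [w0 _] := probability_inhabited P.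
have Mz0 : 0 <= Mz := le_trans (z0 w0) (zM w0).
have mz' : measurable_fun setT z by exact: (adapted_measurable P_complete W_bm sT).
have sTT : 0 <= s <= T by rewrite s0. have tTT : 0 <= t <= T by rewrite t0.
pose A w := \int[mu]_(u in `[0, T]) (`|b w u| + q w u).
have A0 w : 0 <= A w.
  by apply: Rintegral_ge0 => u _; rewrite addr_ge0 // (ip_q0 ip).
have mA : measurable_fun setT A.
  apply: progressive_integral_measurable => //; last exact: ltW.
  apply: progressiveD; last exact: ip_q ip.
  by apply: (progressive_comp (f := fun y => `|y|) _ (ip_b ip)); exact: measurable_normf.
pose l (n : nat) : R := n.+1%:R^-1.
have l0 n : 0 < l n by rewrite invr_gt0.
have l1 n : l n <= 1 by rewrite invf_le1 // ler1n.
have lcvg : l n @[n --> \oo] --> (0 : R) by exact: cvg_harmonic.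
pose k := expR (th * T); pose Bu := k * (1 + th * T).
have k0 : 0 <= k by exact: expR_ge0.
have Bu0 : 0 <= Bu by rewrite mulr_ge0 // addr_ge0 // mulr_ge0 // ltW.
pose X n w := expR (- (l n * A w) - l n ^+ 4 * M w ^+ 2).
pose Qn n w := phi (M w) * Num.min Bu (l n * (k * A w)).
pose V w := expR (th * t) * phi (x w t) + \int[mu]_(u in `[s, t]) loss w u.
pose U w := expR (th * s) * phi (x w s) + \int[mu]_(u in `[s, t]) gain w u.
pose J n := ito_error (test_fun e2 r (l n ^+ 4)) (test_fun1 e2 r (l n ^+ 4)) (test_fun2 e2 r (l n ^+ 4))
  (ito_killing (l n) th b q) b q x s t.
have p0 y : 0 <= phi y by rewrite ltW // smooth_pow_gt0.
have Qn0 n w : 0 <= Qn n w by rewrite mulr_ge0 // le_min Bu0 mulr_ge0 ?(ltW (l0 n)) // mulr_ge0.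
have [mp _ _] := measurable_smooth_pow r e20.
have mM := path_max_measurable.
have mQ n : measurable_fun setT (Qn n).
  apply: measurable_mulf; first exact: (measurableT_comp mp).
  by apply: measurable_minf => //; apply: measurable_mulf => //; exact: measurable_mulf.
have QB n w : `|Qn n w| <= phi (M w) * Bu.
  by rewrite ger0_norm // ler_wpM2l // ge_min lexx.
have iB : Int (fun w => phi (M w) * Bu).
  have := integrableZR measurableT Bu iPhi; congr (P.-integrable _ _).
  by apply/funext => w; rewrite mulrC.
have iQ n : Int (Qn n) by apply: (integrable_leR _ (mQ n) _ iB).
have iV : Int V.
  apply: integrableDR => //; first by apply: integrableZR => //; exact: state_integrable.
  exact: loss_expectation_integrable.
have iZ (h : Omega -> R) : Int h -> Int (fun w => z w * h w).
  move=> ih; have := integrableMbR measurableT ih mz' (M := Mz).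
  have zb w : setT w -> `|z w| <= Mz by rewrite ger0_norm.
  by move=> /(_ zb); congr (P.-integrable _ _); apply/funext => w; rewrite mulrC.
have fS n : exists L, smooth_bounded (test_fun e2 r (l n ^+ 4)) (test_fun1 e2 r (l n ^+ 4)) (test_fun2 e2 r (l n ^+ 4)) L.
  by apply: test_fun_smooth => //; exact: exprn_gt0.
have iJ n : Int (J n).
  have [L fL] := fS n.
  have PT : (P setT < +oo)%E by rewrite (le_lt_trans (probability_le1 _ _)) ?ltry.
  apply: (@ae_integrable_le _ _ _ P _ (fun=> 2 * (expR (th * T) * L) + L * ((1 + l n) / l n * (expR (th * T) * (1 + th * T)) + th * (expR (th * T) * T)))).
  - exact: (ip_error_measurable ip (l0 n) th0 fL).
  - apply: filterS2 (ip_path ip) (ip_budget ip (l0 n) th0) => w D ftc.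
    exact: (ito_error_killing_bound (ltW T_gt0) (l0 n) th0 D s0 st tT (ftc s t s0 st tT) fL).
  - exact: integrable_cstR.
have J0 n : \int[P]_w (z w * J n w) = 0.
  have [L fL] := fS n.
  by apply: (ip_null ip (l0 n) th0 fL s0 st tT mz (Mz := Mz)) => w; rewrite ger0_norm.
have iH n : Int (fun w => z w * V w + Mz * (8 * Qn n w) - z w * J n w).
  apply: integrableBR => //; last exact: iZ.
  apply: integrableDR => //; first exact: iZ.
  by apply: integrableZR => //; exact: integrableZR.
have mU : measurable_fun setT U.
  apply: measurable_addf.
    apply: measurable_mulf => //; apply: (measurableT_comp mp).
    by apply: (adapted_measurable P_complete W_bm sT); have [_ mx] := ip_x ip; exact: mx.
  by apply: progressive_integral_measurable => //; exact: gain_progressive.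
have mX n : measurable_fun setT (X n).
  apply: measurable_expRf; apply: measurable_addf.
    by apply: measurable_oppf; exact: measurable_mulf.
  by apply: measurable_oppf; apply: measurable_mulf => //; exact: measurable_exprf.
(* The first entry of the minimum supplies the integrable bound, the second the pointwise limit. *)
have Qcvg : \int[P]_w Qn n w @[n --> \oo] --> (0 : R).
  have mf n : measurable_fun setT (fun w => (Qn n w)%:E) by exact/measurable_EFinP.
  have cf : {ae P, forall w, setT w -> (Qn n w)%:E @[n --> \oo] --> (fun=> 0%E : \bar R) w}.
    apply: aeW => w _; apply: cvg_EFin; first by apply: nearW.
    rewrite /= -(mulr0 (phi (M w))); apply: cvgMr.
    have kA : 0 <= k * A w by rewrite mulr_ge0.
    apply: (squeeze_cvgr (f := fun=> 0) (h := fun n => l n * (k * A w))).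
    - by apply: nearW => n; rewrite le_min Bu0 mulr_ge0 ?(ltW (l0 n)) //= ge_min lexx orbT.
    - exact: cvg_cst.
    - by rewrite -(mul0r (k * A w)); apply: cvgMl.
  have fg : {ae P, forall w n, setT w -> (`|(Qn n w)%:E| <= (phi (M w) * Bu)%:E)%E}.
    by apply: aeW => w n _; rewrite lee_fin.
  have ml : measurable_fun setT (fun _ : Omega => 0%E : \bar R) by [].
  have [_ _ h] : [/\ P.-integrable setT (fun _ : Omega => 0%E : \bar R), _ & _] := dominated_convergence measurableT mf ml cf iB fg.
  rewrite integral0 in h.
  have e n : \int[P]_w Qn n w = fine (\int[P]_w (Qn n w)%:E)%E by rewrite integral_EFinR.
  by under eq_fun do rewrite e; exact: (fine_cvg h).
(* The majorant is the right side of [drift_pathwise_integrated], weighted by [z]: its Ito error has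
   mean 0, the mean of its term [Qn] tends to 0, and on the left the factor [X n] tends to 1. *)
apply: (@fatou_le _ _ _ P (fun n w => z w * (X n w * U w)) (fun n w => z w * V w + Mz * (8 * Qn n w) - z w * J n w)
  (fun w => z w * U w) (fun n => \int[P]_w (z w * V w) + Mz * (8 * \int[P]_w Qn n w))).
- by move=> n; do 2 (apply: measurable_mulf => //).
- move=> n w; rewrite mulr_ge0 // mulr_ge0 ?expR_ge0 // addr_ge0 ?mulr_ge0 ?expR_ge0 //.
  by apply: Rintegral_ge0 => u _; exact: gain_ge0.
- exact: iH.
- move=> n; apply: ae_impl4 (ip_path ip) gi (ip_budget ip (l0 n) th0) onesided _ => w D iw ftc on.
  apply: weighted_error_le => //; first by rewrite mulr_ge0.
  have := drift_pathwise_integrated T_gt0 e20 r1 r2 be0 ga0 D iw (fun u _ => g0 w u) (fun u uT => path_max_ge w uT) on (l0 n) (l1 n) s0 st tT (ftc s t s0 st tT).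
  by rewrite -mulrA.
- move=> n; rewrite RintegralB //; last exact: iZ; last first.
    by apply: integrableDR => //; [exact: iZ|apply: integrableZR => //; exact: integrableZR].
  rewrite J0 subr0 RintegralD //; last first.
  + by apply: integrableZR => //; exact: integrableZR.
  + exact: iZ.
  have RZ c (h : Omega -> R) : Int h -> \int[P]_w (c * h w) = c * \int[P]_w h w.
    by move=> ih; rewrite (RintegralZl _ _ ih).
  by rewrite (RZ Mz (fun w => 8 * Qn n w)) ?(RZ 8) //; exact: integrableZR.
- rewrite -[X in _ --> X]addr0; apply: cvgD; first exact: cvg_cst.
  rewrite -(mulr0 Mz); apply: cvgMr; rewrite -(mulr0 8); exact: cvgMr.
- exact: measurable_mulf.
- apply: aeW => w; apply: cvgMr; rewrite -[X in _ --> X]mul1r; apply: cvgMl.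
  rewrite -expR0; apply: continuous_cvg; first exact: continuous_expR.
  rewrite -[X in _ --> X]subr0; apply: cvgB.
    by rewrite -oppr0; apply: cvgN; rewrite -(mul0r (A w)); exact: cvgMl.
  rewrite -(mul0r (M w ^+ 2)); apply: cvgMl.
  apply: (squeeze_cvgr (f := fun=> 0) (h := l)) => //; last exact: cvg_cst.
  apply: nearW => n; rewrite exprn_ge0 ?(ltW (l0 n)) //= exprS.
  by rewrite ler_piMr ?exprn_ile1 ?(ltW (l0 n)).
Qed.

End ItoProcess.

(** * Moment inequalities *)

Section PowerInequalities.
Context (R : realType).
Implicit Types x y q c : R.

Lemma ler_powRl x y c : 0 <= c -> 0 <= x -> x <= y -> x `^ c <= y `^ c.
Proof. by move=> c0 x0 xy; apply: ge0_ler_powR => //; rewrite nnegrE // (le_trans x0). Qed.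

Lemma young_powR x y q : 1 < q -> 0 <= x -> 0 <= y ->
  q * (x `^ (q - 1) * y) <= (q - 1) * x `^ q + y `^ q.
Proof.
move=> q1 x0 y0; have q0 : 0 < q by exact: lt_trans ltr01 q1.
have q10 : 0 < q - 1 by rewrite subr_gt0.
have qn := lt0r_neq0 q0; have q1n := lt0r_neq0 q10.
have p0 : 0 < q / (q - 1) by rewrite divr_gt0.
have e : (q / (q - 1))^-1 + q^-1 = 1 by field; rewrite qn.
have := conjugate_powR (powR_ge0 x (q - 1)) y0 p0 q0 e.
rewrite -powRrM (_ : (q - 1) * (q / (q - 1)) = q); last by field.
move=> h; have := ler_wpM2l (ltW q0) h; move=> /le_trans; apply.
rewrite le_eqVlt; apply/orP; left; apply/eqP.
by move: (x `^ q) (y `^ q) => X Y; field; rewrite qn.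
Qed.

(** Convexity of the power, with the slope taken at the larger point. *)
Lemma powR_increment_le x y q : 1 < q -> 0 <= y -> y <= x ->
  x `^ q - y `^ q <= q * (x `^ (q - 1) * (x - y)).
Proof.
move=> q1 y0 yx; have x0 := le_trans y0 yx.
have := young_powR q1 x0 y0.
have e : x `^ q = x * x `^ (q - 1) by rewrite mulr_powRB1 // (lt_trans ltr01).
by rewrite e; move: (x `^ (q - 1)) (y `^ q) => X Y; lra.
Qed.

(** The pathwise form of Doob's inequality: summed along a running maximum, it bounds the q-th power
    by increments of the power q - 1 times the current value. *)
Lemma doob_powR x y q : 1 < q -> 0 <= y -> y <= x ->
  x `^ q - y `^ q <= q / (q - 1) * (x * (x `^ (q - 1) - y `^ (q - 1))).
Proof.
move=> q1 y0 yx; have x0 := le_trans y0 yx; have q10 : 0 < q - 1 by rewrite subr_gt0.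
have h := young_powR q1 y0 x0.
have e : x * x `^ (q - 1) = x `^ q by rewrite mulr_powRB1 // (lt_trans ltr01).
rewrite mulrBr e mulrAC ler_pdivlMr // (mulrC x).
by move: h; lra.
Qed.

Lemma powR_mul_absorb x y q c : 1 <= q -> 0 <= x -> 0 <= y -> 0 < c ->
  x `^ (q - 1) * y <= c * x `^ q + c `^ (1 - q) * y `^ q.
Proof.
move=> q1 x0 y0 c0; have q0 : 0 < q by exact: lt_le_trans ltr01 q1.
have q10 : 0 <= q - 1 by rewrite subr_ge0.
have [yx|xy] := leP y (c * x).
  apply: (@le_trans _ _ (c * x `^ q)); last by rewrite lerDl mulr_ge0 ?powR_ge0.
  rewrite -(mulr_powRB1 x0 q0) mulrA mulrC ler_wpM2r ?powR_ge0 //.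
apply: (@le_trans _ _ (c `^ (1 - q) * y `^ q)); last by rewrite lerDr mulr_ge0 ?powR_ge0 // ltW.
have xc : x <= y / c by rewrite ler_pdivlMr // mulrC ltW.
apply: (@le_trans _ _ ((y / c) `^ (q - 1) * y)).
  by rewrite ler_wpM2r //; apply: ler_powRl.
have ci : 0 <= c^-1 by rewrite invr_ge0 ltW.
rewrite powRM // -(powR_inv1 (ltW c0)) -powRrM mulN1r opprB mulrAC.
by rewrite (mulrC _ y) (mulr_powRB1 y0 q0) mulrC.
Qed.

Lemma powRD_le x y q : 0 <= q -> 0 <= x -> 0 <= y ->
  (x + y) `^ q <= 2 `^ q * (x `^ q + y `^ q).
Proof.
move=> q0 x0 y0; wlog xy : x y x0 y0 / x <= y.
  move=> h; have [/h|/ltW/h] := leP x y; first exact.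
  by rewrite addrC (addrC (x `^ q)); exact.
apply: (@le_trans _ _ ((2 * y) `^ q)); first by apply: ler_powRl; rewrite ?addr_ge0 //; lra.
by rewrite powRM // ler_wpM2l ?powR_ge0 // lerDr powR_ge0.
Qed.

(** Either y <= c x, and the first term suffices, or x < y / c, and the second does. A small [c]
    makes the coefficient of x small at the expense of that of y. *)
Lemma powR_mul_split x y r q c : 1 <= r -> 0 <= q -> 0 <= x -> 0 <= y -> 0 < c ->
  (x `^ (r - 1) * y) `^ q <= c `^ q * x `^ (r * q) + c `^ ((1 - r) * q) * y `^ (r * q).
Proof.
move=> r1 q0 x0 y0 c0; have r0 : 0 < r by exact: lt_le_trans ltr01 r1.
have r10 : 0 <= r - 1 by rewrite subr_ge0.
have [yx|xy] := leP y (c * x).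
  apply: (@le_trans _ _ (c `^ q * x `^ (r * q))); last by rewrite lerDl mulr_ge0 ?powR_ge0.
  rewrite powRrM -powRM ?powR_ge0 ?(ltW c0) //; apply: ler_powRl => //.
    by rewrite mulr_ge0 ?powR_ge0.
  by rewrite -(mulr_powRB1 x0 r0) mulrA mulrC ler_wpM2r ?powR_ge0.
apply: (@le_trans _ _ (c `^ ((1 - r) * q) * y `^ (r * q))); last by rewrite lerDr mulr_ge0 ?powR_ge0.
have xc : x <= y / c by rewrite ler_pdivlMr // mulrC ltW.
rewrite (powRrM y) (powRrM c) -powRM ?powR_ge0 //; apply: ler_powRl => //.
  by rewrite mulr_ge0 ?powR_ge0.
apply: (@le_trans _ _ ((y / c) `^ (r - 1) * y)).
  by rewrite ler_wpM2r //; apply: ler_powRl.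
have ci : 0 <= c^-1 by rewrite invr_ge0 ltW.
rewrite powRM // -(powR_inv1 (ltW c0)) -powRrM mulN1r opprB mulrAC.
by rewrite (mulrC _ y) (mulr_powRB1 y0 r0) mulrC.
Qed.

Lemma powR_le1D x r q : 0 <= r -> r <= q -> 0 <= x -> x `^ r <= 1 + x `^ q.
Proof.
move=> r0 rq x0; have [x1|x1] := leP x 1.
  apply: (@le_trans _ _ 1); last by rewrite lerDl powR_ge0.
  by have := ler_powRl r0 x0 x1; rewrite powR1.
by apply: (@le_trans _ _ (x `^ q)); [exact: ler_powR (ltW x1) _ _ rq|rewrite lerDr].
Qed.

Lemma powR_absorb_const q c : 0 < q -> 0 <= c -> exists2 k : R, 0 < k & c * k `^ q <= 2^-1.
Proof.
move=> q0 c0; have h : 0 < (2 * (c + 1))^-1 by rewrite invr_gt0 mulr_gt0 // ltr_wpDl.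
exists ((2 * (c + 1))^-1 `^ q^-1); first exact: powR_gt0.
have -> : ((2 * (c + 1))^-1 `^ q^-1) `^ q = (2 * (c + 1))^-1.
  by rewrite -powRrM mulVf ?lt0r_neq0 // powRr1 // ltW.
rewrite invfM mulrCA ler_piMr // ler_pdivrMr ?ltr_wpDl // mul1r; lra.
Qed.

End PowerInequalities.

Lemma grid_max_attained (R : realType) (T : R) (h : R -> R) n :
  exists2 i, (i <= n.+1)%N & grid_max T h n = `|h (grid 0 T n i)|.
Proof.
have [i _ e] := @eq_bigmax _ _ _ (0 : R) ord0 xpredT (fun i : 'I_n.+2 => `|h (grid 0 T n i)|) isT (fun i _ => normr_ge0 _).
by exists i => //; rewrite -ltnS.
Qed.

Section RunMax.
Context (R : realType) (K : R) (K0 : 0 <= K).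

(** The truncation at [K] makes all powers bounded, so that weights are admissible and moments may
    be subtracted; it is removed by Fatou's lemma. *)
Fixpoint run_max (S : nat -> R) n : R :=
  if n is j.+1 then Num.max (run_max S j) (Num.min (S n) K) else Num.min (S 0%N) K.

Context (S : nat -> R).
Hypothesis S0 : forall i, 0 <= S i.

Lemma run_max_ge0 n : 0 <= run_max S n.
Proof. by elim: n => [|n IH] /=; [rewrite le_min S0|rewrite le_max IH]. Qed.

Lemma run_max_le n : run_max S n <= K.
Proof. by elim: n => [|n IH] /=; rewrite ?ge_max ?IH ge_min lexx orbT. Qed.

Lemma run_max_mono n : run_max S n <= run_max S n.+1.
Proof. by rewrite /= le_max lexx. Qed.

Lemma run_max_ge n i : (i <= n)%N -> Num.min (S i) K <= run_max S n.
Proof.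
elim: n => [|n IH]; first by rewrite leqn0 => /eqP ->.
by rewrite leq_eqVlt => /predU1P[->|/IH h] /=; rewrite le_max ?h ?lexx ?orbT.
Qed.

Lemma run_max_doob0 q : 1 < q ->
  run_max S 0 `^ q <= q / (q - 1) * (run_max S 0 `^ (q - 1) * S 0%N).
Proof.
move=> q1; have h := run_max_ge0 0; have q10 : 0 < q - 1 by rewrite subr_gt0.
have := doob_powR q1 (lexx 0) h; rewrite !powR0 ?subr0 ?lt0r_neq0 ?(lt_trans ltr01 q1) //.
move=> /le_trans; apply; rewrite ler_wpM2l ?divr_ge0 ?(ltW q10) ?(le_trans ler01) ?(ltW q1) // mulrC.
by rewrite ler_wpM2l ?powR_ge0 //= ge_min lexx.
Qed.

(** If the maximum does not move, both sides vanish. Otherwise its new value is the truncated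
    [S n.+1], hence at most [S n.+1], which can replace it as a factor in [doob_powR]. *)
Lemma run_max_doob n q : 1 < q ->
  run_max S n.+1 `^ q - run_max S n `^ q <=
  q / (q - 1) * ((run_max S n.+1 `^ (q - 1) - run_max S n `^ (q - 1)) * S n.+1).
Proof.
move=> q1; have q10 : 0 < q - 1 by rewrite subr_gt0.
have [e|h] := leP (Num.min (S n.+1) K) (run_max S n).
  have -> : run_max S n.+1 = run_max S n by rewrite /=; apply/max_idPl.
  by rewrite !subrr mul0r mulr0.
have hm := run_max_mono n.
have e : run_max S n.+1 = Num.min (S n.+1) K by rewrite /=; apply/max_idPr/ltW.
have := doob_powR q1 (run_max_ge0 n) hm; move=> /le_trans; apply.
rewrite ler_wpM2l ?divr_ge0 ?(ltW q10) ?(le_trans ler01) ?(ltW q1) // mulrC.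
rewrite ler_wpM2l ?subr_ge0 //; last by rewrite e ge_min lexx.
by apply: ler_powRl => //; [exact: ltW|exact: run_max_ge0].
Qed.

End RunMax.

Lemma measurable_run_max (R : realType) d (Om : measurableType d) (K : R) (S : nat -> Om -> R) n :
  (forall i, (i <= n)%N -> measurable_fun setT (S i)) ->
  measurable_fun setT (fun w => run_max K (S^~ w) n).
Proof.
elim: n => [|n IH] mS /=; first by apply: measurable_minf => //; exact: mS.
apply: measurable_maxf; first by apply: IH => i ni; apply: mS; exact: leqW.
by apply: measurable_minf => //; exact: mS.
Qed.

Definition absorb_const (R : realType) (c q : R) := 2 * c * (2 * c)^-1 `^ (1 - q).

(** [powR_mul_absorb] with parameter 1 / (2 c) puts half of the moment of [X] on the right. Being
    finite it can be subtracted, and [absorb_const] is what remains in front of the moment of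
    [L]. *)
Lemma moment_absorb d (Om : measurableType d) (R : realType) (P : probability Om R)
    (X L : Om -> R) (c q : R) : 1 < q -> 0 < c -> (forall w, 0 <= X w) -> (forall w, 0 <= L w) ->
  P.-integrable setT (fun w => (X w `^ q)%:E) -> P.-integrable setT (fun w => (L w `^ q)%:E) ->
  P.-integrable setT (fun w => (X w `^ (q - 1) * L w)%:E) ->
  \int[P]_w (X w `^ q) <= c * \int[P]_w (X w `^ (q - 1) * L w) ->
  \int[P]_w (X w `^ q) <= absorb_const c q * \int[P]_w (L w `^ q).
Proof.
move=> q1 c0 X0 L0 iX iLq iXL h.
pose dl := (2 * c)^-1; have dl0 : 0 < dl by rewrite invr_gt0 mulr_gt0.
have i1 : P.-integrable setT (fun w => (dl * X w `^ q)%:E) by exact: integrableZR.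
have i2 : P.-integrable setT (fun w => (dl `^ (1 - q) * L w `^ q)%:E) by exact: integrableZR.
have h2 : \int[P]_w (X w `^ (q - 1) * L w) <= dl * \int[P]_w (X w `^ q) + dl `^ (1 - q) * \int[P]_w (L w `^ q).
  rewrite -(RintegralZl _ _ iX) // -(RintegralZl _ _ iLq) // -RintegralD //.
  apply: le_Rintegral => //; first exact: integrableDR.
  by move=> w _; apply: powR_mul_absorb => //; exact: ltW.
move: h h2; rewrite /absorb_const -/dl.
have : c * dl = 2^-1 by rewrite /dl; field; exact: lt0r_neq0.
move: (Rintegral _ _ _) (Rintegral _ _ _) (Rintegral _ _ _) (dl `^ (1 - q)) => A B C e a0 h h1.
have := ler_wpM2l (ltW c0) h1; rewrite mulrDr mulrA a0; lra.
Qed.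

Section DiscreteDoob.
Context d (Om : measurableType d) (R : realType) (P : probability Om R).
Local Notation Int f := (P.-integrable setT (fun w => (f w)%:E)).
Context (adapted : nat -> (Om -> R) -> Prop) (N : nat) (S : nat -> Om -> R) (L : Om -> R) (K q : R).
Hypothesis q1 : 1 < q.
Hypothesis K0 : 0 <= K.
Hypothesis S0 : forall i w, 0 <= S i w.
Hypothesis iS : forall i, (i <= N)%N -> Int (S i).
Hypothesis L0 : forall w, 0 <= L w.
Hypothesis iL : Int L.
Hypothesis iLq : Int (fun w => L w `^ q).
Local Notation m i w := (run_max K (S^~ w) i).
Hypothesis submartingale : forall i (z : Om -> R) Mz, (i <= N)%N -> adapted i z ->
  measurable_fun setT z ->
  (forall w, 0 <= z w) -> (forall w, z w <= Mz) ->
  \int[P]_w (z w * S i w) <= \int[P]_w (z w * L w).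
Hypothesis adapted0 : adapted 0 (fun w => m 0 w `^ (q - 1)).
Hypothesis adaptedS : forall i, (i < N)%N -> adapted i.+1 (fun w => m i.+1 w `^ (q - 1) - m i w `^ (q - 1)).

Let q10 : 0 <= q - 1. Proof. by rewrite subr_ge0 ltW. Qed.
Let q0 : 0 <= q. Proof. exact: le_trans ler01 (ltW q1). Qed.
Let qq0 : 0 <= q / (q - 1). Proof. by rewrite divr_ge0. Qed.
Let PT : (P setT < +oo)%E. Proof. by rewrite (le_lt_trans (probability_le1 _ _)) ?ltry. Qed.

Let mm i : (i <= N)%N -> measurable_fun setT (fun w => m i w).
Proof. by move=> iN; apply: measurable_run_max => j ji; apply: integrable_measR (iS _); exact: leq_trans ji iN. Qed.

Let m0 i w : 0 <= m i w. Proof. exact: run_max_ge0. Qed.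

Let mpK i c w : 0 <= c -> m i w `^ c <= K `^ c.
Proof. by move=> c0; apply: ler_powRl => //; exact: run_max_le. Qed.

Let imq i : (i <= N)%N -> Int (fun w => m i w `^ q).
Proof.
move=> iN; apply: (@integrable_boundR _ _ _ P _ _ _ (K `^ q)) => //; first by apply: measurable_powRf; exact: mm.
by move=> w _; rewrite ger0_norm ?powR_ge0 ?mpK.
Qed.

Let iml i : (i <= N)%N -> Int (fun w => m i w `^ (q - 1) * L w).
Proof.
move=> iN; apply: (@integrableMbR _ _ _ P _ _ _ _ (K `^ (q - 1))) => //; first by apply: measurable_powRf; exact: mm.
by move=> w _; rewrite ger0_norm ?powR_ge0 ?mpK.
Qed.

Let step i : (i <= N)%N ->
  \int[P]_w (m i w `^ q) <= q / (q - 1) * \int[P]_w (m i w `^ (q - 1) * L w).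
Proof.
elim: i => [|i IH] iN.
  have mz : measurable_fun setT (fun w => m 0 w `^ (q - 1)) by apply: measurable_powRf; exact: mm.
  have iz : Int (fun w => m 0 w `^ (q - 1) * S 0 w).
    apply: (@integrableMbR _ _ _ P _ _ _ _ (K `^ (q - 1))) => //; first exact: iS.
    by move=> w _; rewrite ger0_norm ?powR_ge0 ?mpK.
  apply: (@le_trans _ _ (\int[P]_w (q / (q - 1) * (m 0 w `^ (q - 1) * S 0 w)))).
    apply: le_Rintegral => //; first exact: imq.
      exact: integrableZR.
    by move=> w _; exact: run_max_doob0.
  rewrite (RintegralZl _ _ iz) // ler_wpM2l //.
  by apply: (submartingale (Mz := K `^ (q - 1))) => // w; rewrite ?powR_ge0 ?mpK.
have iN' : (i <= N)%N by exact: ltnW.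
pose z w := m i.+1 w `^ (q - 1) - m i w `^ (q - 1).
have z0 w : 0 <= z w by rewrite subr_ge0; apply: ler_powRl => //; exact: run_max_mono.
have zK w : z w <= K `^ (q - 1) by rewrite (le_trans _ (mpK i.+1 w q10)) // gerBl powR_ge0.
have mz : measurable_fun setT z.
  by apply: measurable_addf; [|apply: measurable_oppf]; apply: measurable_powRf; exact: mm.
have iz : Int (fun w => z w * S i.+1 w).
  apply: (@integrableMbR _ _ _ P _ _ _ _ (K `^ (q - 1))) => //; first exact: iS.
  by move=> w _; rewrite ger0_norm.
have hz := submartingale iN (adaptedS iN) mz z0 zK.
have h1 : \int[P]_w (m i.+1 w `^ q) <= \int[P]_w (m i w `^ q) + q / (q - 1) * \int[P]_w (z w * S i.+1 w).
  rewrite -(RintegralZl _ _ iz) // -RintegralD //; [|exact: imq|exact: integrableZR].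
  apply: le_Rintegral => //; first exact: imq.
    by apply: integrableDR => //; [exact: imq|exact: integrableZR].
  by move=> w _; rewrite -lerBlDl; exact: run_max_doob.
have h2 : \int[P]_w (m i.+1 w `^ (q - 1) * L w) = \int[P]_w (m i w `^ (q - 1) * L w) + \int[P]_w (z w * L w).
  rewrite -RintegralD //; [|exact: iml|].
    by apply: eq_Rintegral => w _; rewrite /z mulrBl [RHS]addrC subrK.
  apply: (@integrableMbR _ _ _ P _ _ _ _ (K `^ (q - 1))) => // w _; by rewrite ger0_norm.
rewrite h2 mulrDr (le_trans h1) // lerD ?IH // ler_wpM2l //.
Qed.

(** The submartingale property is tested against the increments of the power q - 1 of the running
    maximum, which are nonnegative, bounded and adapted. Their sum telescopes to that power of the
    final maximum times [L], and [moment_absorb] concludes. *)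
Lemma doob_discrete : \int[P]_w (m N w `^ q) <=
  absorb_const (q / (q - 1)) q * \int[P]_w (L w `^ q).
Proof.
apply: moment_absorb => //; first by rewrite divr_gt0 ?subr_gt0 // (lt_trans ltr01).
- exact: imq.
- exact: iml.
- exact: step.
Qed.

End DiscreteDoob.

(** * A priori estimates *)

Section GapPower.
Context (R : realType) (e2 r : R).
Hypothesis e20 : 0 < e2.
Hypothesis r1 : 1 < r.
Definition smooth_abs (u : R) := smooth_sqr e2 u `^ 2^-1.

Lemma smooth_abs_gt0 u : 0 < smooth_abs u.
Proof. exact/powR_gt0/smooth_sqr_gt0. Qed.

Lemma smooth_pow_abs s u : smooth_pow e2 s u = smooth_abs u `^ s.
Proof. by rewrite /smooth_pow /smooth_abs -powRrM mulrC. Qed.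

Lemma smooth_abs_sqr u : smooth_abs u ^+ 2 = smooth_sqr e2 u.
Proof.
have w0 := smooth_sqr_gt0 e20 u.
by rewrite -powR_mulrn ?powR_ge0 // /smooth_abs -powRrM mulVf // powRr1 // ltW.
Qed.

Lemma normr_le_smooth_abs u : `|u| <= smooth_abs u.
Proof.
rewrite -(ler_pXn2r (n := 2)) ?nnegrE ?powR_ge0 //.
by rewrite real_normK ?num_real // smooth_abs_sqr lerDr ltW.
Qed.

Lemma smooth_abs_le u v : `|u| <= `|v| -> smooth_abs u <= smooth_abs v.
Proof.
move=> uv; apply: ler_powRl => //; first exact/ltW/smooth_sqr_gt0.
by rewrite /smooth_sqr lerD2l -[leLHS]real_normK ?num_real // -[leRHS]real_normK ?num_real // lerXn2r ?nnegrE.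
Qed.

Lemma smooth_pow1_abs u v : `|u| <= `|v| -> `|smooth_pow1 e2 r u| <= r * smooth_abs v `^ (r - 1).
Proof.
move=> uv; have s0 := smooth_abs_gt0 u; have r0 : 0 < r by exact: lt_trans ltr01 r1.
have e : `|smooth_pow1 e2 r u| = r * (`|u| / smooth_abs u * smooth_abs u `^ (r - 1)).
  rewrite /smooth_pow1 smooth_pow_abs -smooth_abs_sqr -(mulr_powRB1 (ltW s0) r0).
  rewrite !normrM normfV (ger0_norm (ltW r0)) normrX (ger0_norm (ltW s0)) (ger0_norm (powR_ge0 _ _)).
  by move: (smooth_abs u `^ (r - 1)) (smooth_abs u) s0 => y s s0; field; exact: lt0r_neq0.
rewrite e ler_wpM2l ?(ltW r0) //.
apply: (@le_trans _ _ (1 * smooth_abs u `^ (r - 1))).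
  by rewrite ler_wpM2r ?powR_ge0 // ler_pdivrMr // mul1r normr_le_smooth_abs.
rewrite mul1r; apply: ler_powRl; [by rewrite subr_ge0 ltW|exact: ltW|exact: smooth_abs_le].
Qed.

Lemma smooth_pow_continuous u : {for u, continuous (smooth_pow e2 r)}.
Proof.
have did := is_derive_id (u : R) (1 : R); have dc := @is_derive_cst R R R e2 u 1.
have [h _] := derive_fun_pow (derive_funD dc (derive_funX did 2)) (r / 2) (smooth_sqr_gt0 e20 u).
exact/differentiable_continuous/derivable1_diffP.
Qed.

End GapPower.

Section Gap.
Context (R : realType) (d : measure_display) (Omega : measurableType d)
  (P : probability Omega R).
Hypothesis P_complete : measure_is_complete P.
Context (T : R) (m : nat) (W : Omega -> R -> 'rV[R]_m).
Hypothesis W_bm : brownian_motion P T W.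
Hypothesis T_gt0 : 0 < T.
Local Notation Ft t := (filtered P W t).
Local Notation mu := (@lebesgue_measure R).
Local Notation int g := (mu.-integrable `[0, T] (fun u => (g u)%:E)).
Local Notation Int X := (P.-integrable setT (fun w => (X w)%:E)).

(** All that the estimates use of two solutions: x is the difference of the first components, q the
    squared length of that of the second ones, g the difference of the generators. A backward
    equation has minus the generator as its forward drift, hence the sign in the one-sided
    condition. *)
Record bsde_gap (be ga : R) (b q x g : Omega -> R -> R) : Prop := BsdeGap {
  gap_be0 : 0 <= be ;
  gap_ga0 : 0 <= ga ;
  gap_ito : ito_process P T W b q x ;
  gap_prog : progressive P T W g ;
  gap_int : \forall w \ae P, int (g w) ;
  gap_ge0 : forall w u, 0 <= g w u ;
  gap_onesided : \forall w \ae P, forall u, 0 <= u <= T ->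
    - (Num.sg (x w u) * b w u) <= be * `|x w u| + ga * Num.sqrt (q w u) + g w u }.

Context (be ga : R) (b q x g : Omega -> R -> R).
Hypothesis H : bsde_gap be ga b q x g.
Context (e2 p : R).
Hypothesis e20 : 0 < e2.
Hypothesis p1 : 1 < p.
Local Notation M := (path_max T x).
Definition gap_abs w := smooth_abs e2 (M w).
Definition gap_drift w := \int[mu]_(u in `[0, T]) g w u.
Local Notation a := gap_abs.
Local Notation G := gap_drift.
Hypothesis iA : Int (fun w => a w `^ p).
Hypothesis iG : Int (fun w => G w `^ p).

Let T0 : 0 <= T. Proof. exact: ltW. Qed.
Let p0 : 0 <= p. Proof. exact: le_trans ler01 (ltW p1). Qed.

Lemma gap_abs_gt0 w : 0 < a w. Proof. exact: smooth_abs_gt0. Qed.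

Lemma gap_drift_ge0 w : 0 <= G w.
Proof. by apply: Rintegral_ge0 => u _; exact: (gap_ge0 H). Qed.

Lemma measurable_gap_abs : measurable_fun setT a.
Proof.
apply: measurable_powRf; apply: measurable_addf => //; apply: measurable_exprf.
exact: (path_max_measurable P_complete W_bm T_gt0 (gap_ito H)).
Qed.

Lemma measurable_gap_drift : measurable_fun setT G.
Proof.
exact: (progressive_integral_measurable P_complete W_bm (gap_prog H) (lexx 0) T0 (lexx T)).
Qed.

Let PT : (P setT < +oo)%E. Proof. by rewrite (le_lt_trans (probability_le1 _ _)) ?ltry. Qed.

Let iAG : Int (fun w => a w `^ p + G w `^ p).
Proof. exact: integrableDR. Qed.

Section Exponent.
Context (r : R).
Hypothesis r1 : 1 < r.
Hypothesis r2 : r <= 2.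
Hypothesis rp : r <= p.
Local Notation phi := (smooth_pow e2 r).
Local Notation th := (growth_rate r be ga).
Local Notation gain := (gain e2 r be ga q x).
Local Notation loss := (loss e2 r be ga x g).
Let r0 : 0 <= r. Proof. exact: le_trans ler01 (ltW r1). Qed.
Let th0 : 0 <= th. Proof. by apply: growth_rate_ge0 => //; [exact: gap_be0 H]. Qed.

Lemma gap_state_integrable : Int (fun w => phi (M w)).
Proof.
apply: (@integrable_leR _ _ _ P _ _ _ (fun w => 1 + a w `^ p)) => //.
- have [mp _ _] := measurable_smooth_pow r e20; apply: (measurableT_comp mp).
  exact: (path_max_measurable P_complete W_bm T_gt0 (gap_ito H)).
- move=> w _; rewrite smooth_pow_abs ger0_norm ?powR_ge0 //.
  by apply: powR_le1D => //; exact: ltW (gap_abs_gt0 w).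
- by apply: integrableDR => //; exact: integrable_cstR.
Qed.

Lemma gap_loss_le : \forall w \ae P, \int[mu]_(u in `[0, T]) loss w u <=
  expR (th * T) * (r * (a w `^ (r - 1) * G w)).
Proof.
have lpi := loss_path_integrable T_gt0 (gap_ito H) (gap_int H) (gap_ge0 H) ga e20 r1 r2 (gap_be0 H).
apply: filterS2 (gap_int H) lpi => w iw il.
have -> : expR (th * T) * (r * (a w `^ (r - 1) * G w)) =
    \int[mu]_(u in `[0, T]) (expR (th * T) * (r * a w `^ (r - 1)) * g w u).
  by rewrite (RintegralZl _ _ iw) // !mulrA.
apply: le_Rintegral => //; first exact: integrableZR.
move=> u; rewrite /= in_itv /= => /andP[u0 uT].
have gg := gap_ge0 H w u.
rewrite /loss -mulrA ler_pM ?expR_ge0 ?mulr_ge0 //.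
  by rewrite ler_expR ler_wpM2l.
rewrite ler_wpM2r //; apply: smooth_pow1_abs => //.
rewrite (ger0_norm (path_max_ge0 T_gt0 (gap_ito H) w)).
by apply: (path_max_ge T_gt0 (gap_ito H)); rewrite u0.
Qed.

Lemma gap_mixed_integrable : Int (fun w => a w `^ (r - 1) * G w).
Proof.
have mG := measurable_gap_drift; have ma := measurable_gap_abs.
apply: (@integrable_leR _ _ _ P _ _ _ (fun w => 2 + (a w `^ p + G w `^ p))) => //.
- by apply: measurable_mulf => //; exact: measurable_powRf.
- move=> w _; have a0 := ltW (gap_abs_gt0 w); have G0 := gap_drift_ge0 w.
  rewrite ger0_norm ?mulr_ge0 ?powR_ge0 //.
  have := powR_mul_split (q := 1) (ltW r1) ler01 a0 G0 (ltr01 : (0 : R) < 1).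
  rewrite !powR1 !mul1r !mulr1 powRr1 ?mulr_ge0 ?powR_ge0 //.
  have := powR_le1D r0 rp a0; have := powR_le1D r0 rp G0.
  by move: (_ `^ _) (_ `^ _) (_ `^ _) (_ `^ _) => A B C D; lra.
- by apply: integrableDR => //; exact: integrable_cstR.
Qed.

Lemma gap_loss_integrable : Int (fun w => \int[mu]_(u in `[0, T]) loss w u).
Proof.
apply: (ae_integrable_le (g := fun w => expR (th * T) * (r * (a w `^ (r - 1) * G w)))).
- apply: (progressive_integral_measurable P_complete W_bm _ (lexx 0) T0 (lexx T)).
  exact: (loss_progressive (gap_ito H) (gap_prog H) _ _ _ e20).
- apply: filterS gap_loss_le => w; rewrite ger0_norm //.
  by apply: Rintegral_ge0 => u _; exact: (loss_ge0 _ (gap_ge0 H)).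
- by do 2 apply: integrableZR => //; exact: gap_mixed_integrable.
Qed.

Definition gap_terminal w := expR (th * T) * (phi (x w T) + r * (a w `^ (r - 1) * G w)).
Local Notation L := gap_terminal.

Lemma gap_terminal_ge0 w : 0 <= L w.
Proof.
rewrite mulr_ge0 ?expR_ge0 // addr_ge0 ?(ltW (smooth_pow_gt0 _ _ _)) //.
by rewrite mulr_ge0 // mulr_ge0 ?powR_ge0 // gap_drift_ge0.
Qed.

Lemma gap_terminal_integrable : Int L.
Proof.
apply: integrableZR => //; apply: integrableDR => //; last first.
  by apply: integrableZR => //; exact: gap_mixed_integrable.
apply: (state_integrable P_complete W_bm T_gt0 (gap_ito H) e20 r1 gap_state_integrable).
by rewrite T0 lexx.
Qed.

(** The loss after s is enlarged to the loss over [0, T] and then bounded through the maximum of the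
    path. The dominating variable [L] is thus the same for all s, as Doob's and Garsia's
    inequalities require. *)
Lemma gap_power_le s (z : Omega -> R) Mz : 0 <= s <= T -> @measurable_fun _ _ (Ft s) R setT z ->
  (forall w, 0 <= z w) -> (forall w, z w <= Mz) ->
  Int (fun w => z w * (expR (th * s) * phi (x w s) + \int[mu]_(u in `[s, T]) gain w u)) /\
  \int[P]_w (z w * (expR (th * s) * phi (x w s) + \int[mu]_(u in `[s, T]) gain w u)) <=
  \int[P]_w (z w * L w).
Proof.
move=> /andP[s0 sT] mz z0 zM.
have [i1 h1] := discounted_power_le P_complete W_bm T_gt0 (gap_ito H) (gap_prog H) (gap_int H) (gap_ge0 H)
  e20 r1 r2 (gap_be0 H) (gap_ga0 H) (gap_onesided H) gap_state_integrable gap_loss_integrable s0 sT (lexx T) mz z0 zM.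
split => //; apply: (le_trans h1).
have mz' : measurable_fun setT z by exact: (adapted_measurable P_complete W_bm sT).
have iZ (h : Omega -> R) : Int h -> Int (fun w => z w * h w).
  by move=> ih; apply: (@integrableMbR _ _ _ P _ _ _ _ Mz) => // w _; rewrite ger0_norm.
have lint := loss_expectation_integrable P_complete W_bm T_gt0 (gap_ito H) (gap_prog H) (gap_int H) (gap_ge0 H)
  e20 r1 r2 (gap_be0 H) gap_loss_integrable s0 sT (lexx T).
have lpi := loss_path_integrable T_gt0 (gap_ito H) (gap_int H) (gap_ge0 H) ga e20 r1 r2 (gap_be0 H).
apply: ae_le_Rintegral.
- apply: iZ; apply: integrableDR => //; apply: integrableZR => //.
  apply: (state_integrable P_complete W_bm T_gt0 (gap_ito H) e20 r1 gap_state_integrable).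
  by rewrite T0 lexx.
- by apply: iZ; exact: gap_terminal_integrable.
- apply: filterS2 gap_loss_le lpi => w h il.
  rewrite ler_wpM2l // /gap_terminal mulrDr lerD2l (le_trans _ h) //.
  by apply: Rintegral_sub_le => // u _; exact: (loss_ge0 _ (gap_ge0 H)).
Qed.

Context (qq : R).
Hypothesis qE : qq = p / r.
Hypothesis rp' : r < p.
Let rpos : 0 < r. Proof. exact: lt_trans ltr01 r1. Qed.
Let q1 : 1 < qq. Proof. by rewrite qE ltr_pdivlMr // mul1r. Qed.
Let q0 : 0 <= qq. Proof. exact: le_trans ler01 (ltW q1). Qed.
Let rq : r * qq = p. Proof. by rewrite qE mulrCA divff ?mulr1 // lt0r_neq0. Qed.

(** The free parameter [c] makes the coefficient of the power of [a] as small as the later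
    absorption requires. *)
Lemma gap_terminal_powR c w : 0 < c ->
  L w `^ qq <= expR (th * T) `^ qq * (2 `^ qq * (smooth_abs e2 (x w T) `^ p +
    r `^ qq * (c `^ qq * a w `^ p + c `^ ((1 - r) * qq) * G w `^ p))).
Proof.
move=> c0; have a0 := ltW (gap_abs_gt0 w); have G0 := gap_drift_ge0 w.
have aG : 0 <= a w `^ (r - 1) * G w by rewrite mulr_ge0 ?powR_ge0.
have f0 : 0 <= phi (x w T) by rewrite ltW // smooth_pow_gt0.
rewrite /gap_terminal powRM ?expR_ge0 //; last by rewrite addr_ge0 // mulr_ge0.
rewrite ler_wpM2l ?powR_ge0 //.
have raG : 0 <= r * (a w `^ (r - 1) * G w) by rewrite mulr_ge0.
apply: (le_trans (powRD_le q0 f0 raG)); rewrite ler_wpM2l ?powR_ge0 //.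
rewrite smooth_pow_abs -powRrM rq lerD2l powRM // ler_wpM2l ?powR_ge0 //.
by have := powR_mul_split (ltW r1) q0 a0 G0 c0; rewrite rq.
Qed.

Lemma gap_terminal_powR_integrable : Int (fun w => L w `^ qq).
Proof.
have TT : 0 <= T <= T by rewrite T0 lexx.
have ix : Int (fun w => smooth_abs e2 (x w T) `^ p).
  have [_ mx] := ip_x (gap_ito H).
  apply: (@integrable_leR _ _ _ P _ _ _ (fun w => a w `^ p)) => //.
    apply: measurable_powRf; apply: measurable_powRf; apply: measurable_addf => //.
    by apply: measurable_exprf; exact: (adapted_measurable P_complete W_bm (lexx T) (mx T TT)).
  move=> w _; rewrite (ger0_norm (powR_ge0 _ _)).
  have h : smooth_abs e2 (x w T) <= a w.
    apply: smooth_abs_le => //; rewrite (ger0_norm (path_max_ge0 T_gt0 (gap_ito H) w)).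
    exact: (path_max_ge T_gt0 (gap_ito H)).
  exact: (ler_powRl p0 (powR_ge0 _ _) h).
apply: (@integrable_leR _ _ _ P _ _ _ (fun w => expR (th * T) `^ qq * (2 `^ qq * (smooth_abs e2 (x w T) `^ p +
    r `^ qq * (1 `^ qq * a w `^ p + 1 `^ ((1 - r) * qq) * G w `^ p))))) => //.
- by apply: measurable_powRf; apply: integrable_measR gap_terminal_integrable.
- by move=> w _; rewrite ger0_norm ?powR_ge0 // gap_terminal_powR.
- do 2 (apply: integrableZR => //); apply: integrableDR => //; apply: integrableZR => //.
  exact: (integrableDR measurableT (integrableZR measurableT _ iA) (integrableZR measurableT _ iG)).
Qed.

(** [doob_discrete] with exponent p / r > 1, applied on a grid to the powers of exponent r of the
    regularized path: its hypothesis is [gap_power_le] without the nonnegative gain. *)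
Lemma gap_doob : \int[P]_w (a w `^ p) <= absorb_const (qq / (qq - 1)) qq * \int[P]_w (L w `^ qq).
Proof.
have iL := gap_terminal_integrable; have iLq := gap_terminal_powR_integrable.
pose tau n := grid 0 T n.
have tauT n i : (i <= n.+1)%N -> 0 <= tau n i <= T by move=> hi; exact: grid_itv.
pose S n i w := expR (th * tau n i) * phi (x w (tau n i)).
have S0 n i w : 0 <= S n i w by rewrite mulr_ge0 ?expR_ge0 // ltW // smooth_pow_gt0.
have [cx mx] := ip_x (gap_ito H).
have [mp _ _] := measurable_smooth_pow r e20.
have mS n i j : (i <= j)%N -> (j <= n.+1)%N -> @measurable_fun _ _ (Ft (tau n j)) R setT (S n i).
  move=> ij jn; have tij : tau n i <= tau n j by exact: grid_le.
  apply: (adapted_le tij); apply: measurable_mulf => //.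
  by apply: (measurableT_comp mp); apply: mx; apply: tauT; exact: leq_trans ij jn.
have mm n K i j : (i <= j)%N -> (j <= n.+1)%N ->
    @measurable_fun _ _ (Ft (tau n j)) R setT (fun w => run_max K ((S n)^~ w) i `^ (qq - 1)).
  move=> ij jn; apply: measurable_powRf; apply: measurable_run_max => k ki.
  by apply: mS => //; exact: leq_trans ki ij.
have hD n : \int[P]_w (run_max n%:R ((S n)^~ w) n.+1 `^ qq) <= absorb_const (qq / (qq - 1)) qq * \int[P]_w (L w `^ qq).
  apply: (@doob_discrete _ _ _ P (fun i z => @measurable_fun _ _ (Ft (tau n i)) R setT z) n.+1) => //.
  - move=> i hi; apply: integrableZR => //.
    exact: (state_integrable P_complete W_bm T_gt0 (gap_ito H) e20 r1 gap_state_integrable (tauT _ _ hi)).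
  - exact: gap_terminal_ge0.
  - move=> i z Mz hi mz mz' z0 zM.
    have [i1 h1] := gap_power_le (tauT _ _ hi) mz z0 zM.
    apply: le_trans h1; apply: ae_le_Rintegral => //.
      apply: (@integrableMbR _ _ _ P _ _ _ _ Mz) => //.
        apply: integrableZR => //.
        exact: (state_integrable P_complete W_bm T_gt0 (gap_ito H) e20 r1 gap_state_integrable (tauT _ _ hi)).
      by move=> w _; rewrite ger0_norm.
    apply: aeW => w; rewrite ler_wpM2l // lerDl.
    by apply: Rintegral_ge0 => u _; exact: (gain_ge0 (gap_ito H) _ _ e20 r1).
  - exact: mm.
  - by move=> i hi; apply: measurable_addf; [exact: mm|apply: measurable_oppf; exact: mm].
have mMx : measurable_fun setT (path_max T x) := path_max_measurable P_complete W_bm T_gt0 (gap_ito H).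
(* The index [n] refines the grid and raises the truncation level at the same time, so a single
   limit removes both. *)
apply: (proj2 (@fatou_le _ _ _ P (fun n w => Num.min (phi (grid_max T (x w) n)) n%:R `^ qq)
  (fun n w => run_max n%:R ((S n)^~ w) n.+1 `^ qq) _ (fun=> absorb_const (qq / (qq - 1)) qq * \int[P]_w (L w `^ qq)) _ _ _ _ _ _ _ _ _)).
- move=> n; apply: measurable_powRf; apply: measurable_minf => //; apply: (measurableT_comp mp).
  apply: measurable_grid_max => // t tT; apply: (adapted_measurable P_complete W_bm _ (mx t tT)).
  by case/andP: tT.
- by move=> n w; exact: powR_ge0.
- move=> n; apply: (@integrable_boundR _ _ _ P _ _ _ (n%:R `^ qq)) => //.
    have hm : @measurable_fun _ _ (Ft (tau n n.+1)) R setT (fun w => run_max n%:R ((S n)^~ w) n.+1 `^ qq).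
      by apply: measurable_powRf; apply: measurable_run_max => k ki; exact: mS.
    by apply: (adapted_measurable P_complete W_bm _ hm); rewrite /tau gridS.
  move=> w _; rewrite ger0_norm ?powR_ge0 //; apply: ler_powRl => //; first exact: run_max_ge0.
  exact: run_max_le.
- move=> n; apply: aeW => w; apply: ler_powRl => //; first by rewrite le_min ler0n ltW ?smooth_pow_gt0.
  have [i hi ->] := grid_max_attained T (x w) n.
  apply: le_trans (run_max_ge n%:R _ hi); rewrite le_min !ge_min lexx orbT andbT.
  (* [phi] is even, and the factor exp(th tau) contained in [S] is at least 1. *)
  apply/orP; left; rewrite /S (_ : phi `|_| = phi (x w (tau n i))); last first.
    by rewrite /smooth_pow /smooth_sqr real_normK ?num_real.
  rewrite ler_peMl ?(ltW (smooth_pow_gt0 _ _ _)) //.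
  rewrite -[leLHS]expR0 ler_expR mulr_ge0 //; by case/andP: (tauT _ _ hi).
- exact: hD.
- exact: cvg_cst.
- by apply: measurable_powRf; exact: measurable_gap_abs.
- apply: aeW => w.
  have [t0 t0T [eM ht0]] := sup_path_attained T_gt0 (cx w).
  have MM : path_max T x w = `|x w t0| by rewrite /path_max eM.
  have hg := grid_max_cvg T_gt0 (cx w) t0T ht0.
  have hc : smooth_pow e2 p (grid_max T (x w) n) @[n --> \oo] --> a w `^ p.
    rewrite /gap_abs MM -smooth_pow_abs; apply: continuous_cvg hg.
    exact: smooth_pow_continuous.
  apply: cvg_trans hc; apply: near_eq_cvg.
  near=> n.
  have hn : phi (grid_max T (x w) n) <= n%:R.
    apply: (@le_trans _ _ (phi (path_max T x w))).
      apply: smooth_pow_le => //; rewrite (ger0_norm (grid_max_ge0 _ _ _)) MM normr_id.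
      exact: grid_max_le.
    by near: n; exact: nbhs_infty_ger.
  by rewrite (min_idPl hn) !smooth_pow_abs -powRrM rq.
Unshelve. all: by end_near.
Qed.

End Exponent.
End Gap.

(** * Garsia's inequality for sampled increasing processes *)

Lemma garsia_algebra (R : realType) (al X Y g z z' AN A A' dl mu mu' : R) : 0 <= al ->
  Y <= al * (g - z * (AN - A)) + al * dl * z -> X - Y <= al * (z' * (mu' - mu)) ->
  mu' - mu <= dl -> mu' - mu <= A' - A -> 0 <= z -> 0 <= z' - z ->
  X <= al * (g + (z' - z) * (AN - A') - z' * (AN - A')) + al * dl * z'.
Proof.
move=> al0 hY hX h1 h2 z0 zz.
have a1 := ler_wpM2l z0 h2; have a2 := ler_wpM2l zz h1.
have a3 : al * (z' * (mu' - mu)) <= al * (z * (A' - A) + (z' - z) * dl).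
  by rewrite ler_wpM2l // -[z' in leLHS](subrK z) mulrDl addrC lerD.
by move: hY hX a3; clear; lra.
Qed.

Section DiscreteGarsia.
Context d (Om : measurableType d) (R : realType) (P : probability Om R).
Local Notation Int f := (P.-integrable setT (fun w => (f w)%:E)).
Context (adapted : nat -> (Om -> R) -> Prop) (N : nat) (A : nat -> Om -> R) (L dl : Om -> R) (K al : R).
Hypothesis al1 : 1 < al.
Hypothesis K0 : 0 <= K.
Hypothesis A0 : forall w, A 0 w = 0.
Hypothesis Amono : forall i w, (i < N)%N -> A i w <= A i.+1 w.
Hypothesis mA : forall i, (i <= N)%N -> measurable_fun setT (A i).
Hypothesis iA : Int (A N).
Hypothesis iL : Int L.
Local Notation m i w := (Num.min (A i w) K).
Hypothesis mdl : measurable_fun setT dl.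
Hypothesis dl0 : forall w, 0 <= dl w.
Hypothesis dlK : forall w, dl w <= K.
Hypothesis osc : forall i w, (i < N)%N -> m i.+1 w - m i w <= dl w.
Hypothesis potential : forall i (z : Om -> R) Mz, (i <= N)%N -> adapted i z ->
  measurable_fun setT z -> (forall w, 0 <= z w) -> (forall w, z w <= Mz) ->
  \int[P]_w (z w * (A N w - A i w)) <= \int[P]_w (z w * L w).
Hypothesis adaptedS : forall i, (i < N)%N -> adapted i.+1 (fun w => m i.+1 w `^ (al - 1) - m i w `^ (al - 1)).

Let al10 : 0 <= al - 1. Proof. by rewrite subr_ge0 ltW. Qed.
Let al0 : 0 <= al. Proof. exact: le_trans ler01 (ltW al1). Qed.
Let PT : (P setT < +oo)%E. Proof. by rewrite (le_lt_trans (probability_le1 _ _)) ?ltry. Qed.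

Let Ale i w : (i <= N)%N -> 0 <= A i w <= A N w.
Proof.
move=> iN; apply/andP; split.
  elim: i iN => [|i IH] iN; first by rewrite A0.
  by rewrite (le_trans (IH (ltnW iN))) // Amono.
have h k : (i + k <= N)%N -> A i w <= A (i + k) w.
  elim: k => [|k IH]; first by rewrite addn0.
  by rewrite addnS => hk; rewrite (le_trans (IH (ltnW hk))) // Amono.
by have := h (N - i)%N; rewrite subnKC //; exact.
Qed.

Let m0 i w : (i <= N)%N -> 0 <= m i w.
Proof. by move=> iN; rewrite le_min K0; case/andP: (Ale w iN) => ->. Qed.

Let mS i w : (i < N)%N -> m i w <= m i.+1 w.
Proof. by move=> iN; rewrite le_min !ge_min lexx orbT andbT Amono. Qed.

Let mK i w c : 0 <= c -> (i <= N)%N -> m i w `^ c <= K `^ c.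
Proof. by move=> c0 iN; apply: ler_powRl; rewrite ?m0 // ge_min lexx orbT. Qed.

Let mm i c : (i <= N)%N -> measurable_fun setT (fun w => m i w `^ c).
Proof. by move=> iN; apply: measurable_powRf; apply: measurable_minf => //; exact: mA. Qed.

Let rise i w := m i.+1 w `^ (al - 1) - m i w `^ (al - 1).
Let rise0 i w : (i < N)%N -> 0 <= rise i w.
Proof. by move=> iN; rewrite subr_ge0; apply: ler_powRl => //; [rewrite m0 // ltnW|exact: mS]. Qed.
Let riseK i w : (i < N)%N -> rise i w <= K `^ (al - 1).
Proof. by move=> iN; rewrite (le_trans _ (mK w al10 iN)) // gerBl powR_ge0. Qed.
Let mrise i : (i < N)%N -> measurable_fun setT (rise i).
Proof. by move=> iN; apply: measurable_addf; [exact: mm|apply: measurable_oppf; apply: mm; exact: ltnW]. Qed.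

(** Summation by parts: the increments of the power al - 1 of the truncated process, known at the
    right end of each step, multiply what the process has still to gain. The potential hypothesis
    bounds each term in mean. *)
Fixpoint garsia_sum n w := if n is i.+1 then garsia_sum i w + rise i w * (A N w - A i.+1 w) else 0.

Let iAB i : (i <= N)%N -> Int (fun w => A N w - A i w).
Proof.
move=> iN; apply: (@integrable_leR _ _ _ P _ _ _ (A N)) => //.
  by apply: measurable_addf; [exact: mA|apply: measurable_oppf; exact: mA].
by move=> w _; have /andP[a1 a2] := Ale w iN; rewrite ger0_norm ?subr_ge0 // gerBl.
Qed.

Let irise i (h : Om -> R) : (i < N)%N -> Int h -> Int (fun w => rise i w * h w).
Proof.
move=> iN ih; apply: (@integrableMbR _ _ _ P _ _ _ _ (K `^ (al - 1))) => //; first exact: mrise.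
by move=> w _; rewrite ger0_norm ?rise0 ?riseK.
Qed.

Let iml i (h : Om -> R) : (i <= N)%N -> Int h -> Int (fun w => m i w `^ (al - 1) * h w).
Proof.
move=> iN ih; apply: (@integrableMbR _ _ _ P _ _ _ _ (K `^ (al - 1))) => //; first exact: mm.
by move=> w _; rewrite ger0_norm ?powR_ge0 ?mK.
Qed.

Let sum_le n : (n <= N)%N -> Int (garsia_sum n) /\
  \int[P]_w garsia_sum n w <= \int[P]_w (m n w `^ (al - 1) * L w).
Proof.
elim: n => [|n IH] nN.
  have i0 : Int (garsia_sum 0) by exact: integrable_cstR.
  split=> //; apply: le_Rintegral => // [|w _]; first exact: iml.
  by rewrite A0 (min_idPl K0) powR0 ?mul0r // subr_eq0; apply/eqP => e; move: al1; rewrite e ltxx.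
have [iR hR] := IH (ltnW nN); have iN := irise nN (iAB nN); have iNL := irise nN iL.
split; first exact: integrableDR.
have -> : \int[P]_w (m n.+1 w `^ (al - 1) * L w) = \int[P]_w (m n w `^ (al - 1) * L w + rise n w * L w).
  by apply: eq_Rintegral => w _; rewrite /rise mulrBl [RHS]addrC subrK.
rewrite RintegralD //.
rewrite RintegralD //; last exact: (iml (ltnW nN)).
apply: lerD => //; apply: (potential (Mz := K `^ (al - 1))) => //; first exact: adaptedS.
- exact: mrise.
- by move=> w; exact: rise0.
- by move=> w; exact: riseK.
Qed.

(** The subtracted product is the boundary term of the summation by parts, zero at n = N. The term
    in [dl] pays for slopes taken at the right end of a step, while the summation by parts needs
    them at the left end. *)
Let sum_ge n w : (n <= N)%N ->
  m n w `^ al <= al * (garsia_sum n w - m n w `^ (al - 1) * (A N w - A n w)) + al * dl w * m n w `^ (al - 1).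
Proof.
have aln : al != 0 by rewrite lt0r_neq0 // (lt_trans ltr01).
have al1n : al - 1 != 0 by rewrite lt0r_neq0 // subr_gt0.
elim: n => [|n IH] nN; first by rewrite A0 (min_idPl K0) !powR0 //= mul0r mulr0 subr0 mulr0 addr0.
have h := powR_increment_le al1 (m0 w (ltnW nN)) (mS w nN).
have ho := osc w nN.
have hA : m n.+1 w - m n w <= A n.+1 w - A n w.
  have := Amono w nN; rewrite /Num.min; case: ifP; case: ifP; lra.
have z0 : 0 <= m n w `^ (al - 1) by exact: powR_ge0.
exact: (garsia_algebra al0 (IH (ltnW nN)) h ho hA z0 (rise0 w nN)).
Qed.

(* The oscillation [dl] enters because [A], predictable through its continuity,
   is only sampled on a grid. *)
Lemma garsia_discrete : \int[P]_w (m N w `^ al) <=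
  al * \int[P]_w (m N w `^ (al - 1) * L w) + al * K `^ (al - 1) * \int[P]_w dl w.
Proof.
have [iR hR] := sum_le (leqnn N).
have idl : Int dl.
  by apply: (@integrable_boundR _ _ _ P _ _ _ K) => // w _; rewrite ger0_norm.
apply: (@le_trans _ _ (al * \int[P]_w garsia_sum N w + al * K `^ (al - 1) * \int[P]_w dl w)); last first.
  by rewrite lerD2r ler_wpM2l.
rewrite -(RintegralZl _ _ iR) // -(RintegralZl _ _ idl) // -RintegralD //; try exact: integrableZR.
apply: le_Rintegral => //.
- apply: (@integrable_boundR _ _ _ P _ _ _ (K `^ al)) => //; first exact: mm.
  by move=> w _; rewrite ger0_norm ?powR_ge0 ?mK.
- by apply: integrableDR => //; exact: integrableZR.
move=> w _; have := sum_ge w (leqnn N); rewrite subrr mulr0 subr0 => /le_trans; apply.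
rewrite lerD2l -!mulrA ler_wpM2l // mulrC ler_wpM2r ?mK //.
Qed.

End DiscreteGarsia.

(** * Moments of the maximum and of the energy *)

Lemma powR_npos_le (R : realType) (x y c : R) : 0 < x -> x <= y -> c <= 0 -> y `^ c <= x `^ c.
Proof.
move=> x0 xy c0; have y0 := lt_le_trans x0 xy.
have e (z : R) : z `^ c = (z `^ (- c))^-1 by rewrite -powRN opprK.
rewrite !e lef_pV2 ?posrE ?powR_gt0 //.
by apply: ler_powRl; rewrite ?oppr_ge0 ?(ltW x0).
Qed.

(** As r <= 2, the exponent r - 2 is nonpositive and the maximum of the path gives a lower bound of
    the second derivative valid at all times. *)
Lemma smooth_pow2_lower (R : realType) (e2 r u v : R) : 0 < e2 -> 1 < r -> r <= 2 -> `|u| <= `|v| ->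
  r * (r - 1) * smooth_abs e2 v `^ (r - 2) <= smooth_pow2 e2 r u.
Proof.
move=> e20 r1 r2 uv; have s0 := smooth_abs_gt0 e20 u; have v0 := smooth_abs_gt0 e20 v.
have r0 : 0 < r by exact: lt_trans ltr01 r1.
have sr : smooth_abs e2 u `^ r = smooth_abs e2 u ^+ 2 * smooth_abs e2 u `^ (r - 2).
  rewrite -powR_mulrn ?ltW // -powRD; first by congr powR; ring.
  by apply/implyP => _; exact: lt0r_neq0.
have wE : e2 = smooth_abs e2 u ^+ 2 - u ^+ 2 by rewrite smooth_abs_sqr // /smooth_sqr addrK.
have -> : smooth_pow2 e2 r u = r * (e2 + (r - 1) * u ^+ 2) / smooth_abs e2 u ^+ 2 * smooth_abs e2 u `^ (r - 2).
  rewrite /smooth_pow2 smooth_pow_abs sr -smooth_abs_sqr //.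
  by move: (smooth_abs e2 u `^ (r - 2)) (smooth_abs e2 u) s0 => y s s0; field; exact: lt0r_neq0.
apply: ler_pM; [|exact: powR_ge0| |].
- by rewrite mulr_ge0 ?subr_ge0 // ltW.
- rewrite -mulrA ler_pM2l // ler_pdivlMr ?exprn_gt0 // smooth_abs_sqr // /smooth_sqr.
  by have := sqr_ge0 u; nra.
- by apply: powR_npos_le; [exact: s0|exact: smooth_abs_le|rewrite subr_le0].
Qed.

(** Q is compared with a^2. The product of Q and the power p - 2 of a is what Ito's formula with r =
    p controls when Q is the energy and a the maximum. *)
Lemma powR_half_split (R : realType) (a Q p : R) : 0 < a -> 0 <= Q -> 1 < p -> p <= 2 ->
  Q `^ (p / 2) <= a `^ (p - 2) * Q + a `^ p.
Proof.
move=> a0 Q0 p1 p2; have p0 : 0 < p by exact: lt_trans ltr01 p1.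
have e : (a ^+ 2) `^ (p / 2) = a `^ p.
  by rewrite -powR_mulrn ?ltW // -powRrM; congr powR; field.
have [h|h] := leP Q (a ^+ 2).
  rewrite -e (le_trans (ler_powRl _ Q0 h)) ?divr_ge0 ?(ltW p0) //.
  by rewrite lerDr mulr_ge0 ?powR_ge0.
have Qp : 0 < Q by rewrite (lt_trans _ h) // exprn_gt0.
apply: (@le_trans _ _ (a `^ (p - 2) * Q)); last by rewrite lerDl powR_ge0.
rewrite -(mulr_powRB1 (ltW Qp)) ?divr_gt0 // mulrC ler_wpM2r ?(ltW Qp) //.
have -> : a `^ (p - 2) = (a ^+ 2) `^ (p / 2 - 1).
  by rewrite -powR_mulrn ?ltW // -powRrM; congr powR; field.
apply: powR_npos_le; [by rewrite exprn_gt0|exact: ltW|lra].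
Qed.

Lemma sup_absorb (R : realType) (C k t rr cq cr A B X Gm : R) : 0 <= C -> 0 <= A ->
  C * (k * t * rr) * cq <= 2^-1 -> A <= C * B ->
  B <= k * (t * (X + rr * (cq * A + cr * Gm))) ->
  A <= 2 * (C * (k * t)) * (X + rr * cr * Gm).
Proof.
move=> C0 A0 hc h h2; have a1 := ler_wpM2l C0 h2; have a2 := ler_wpM2r A0 hc.
have e : C * (k * (t * (X + rr * (cq * A + cr * Gm)))) =
  C * (k * t) * (X + rr * cr * Gm) + C * (k * t * rr) * cq * A by ring.
rewrite e in a1.
have -> : 2 * (C * (k * t)) * (X + rr * cr * Gm) = 2 * (C * (k * t) * (X + rr * cr * Gm)) by ring.
move: (C * (k * t) * _) (_ * A) a1 a2 => u v a1 a2; lra.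
Qed.

Lemma add_scaled (R : realType) (s A G y p : R) : s <= A -> p * y <= p * (A + G) -> 0 <= G ->
  s + p * y <= (1 + p) * (A + G).
Proof. lra. Qed.

Lemma energy_small_combine (R : realType) (c B k A G : R) : c * B <= c * (k * (A + G)) -> 0 <= G ->
  c * B + A <= (c * k + 1) * (A + G).
Proof. lra. Qed.

Section GapMoments.
Context (R : realType) (d : measure_display) (Omega : measurableType d)
  (P : probability Omega R).
Hypothesis P_complete : measure_is_complete P.
Context (T : R) (m : nat) (W : Omega -> R -> 'rV[R]_m).
Hypothesis W_bm : brownian_motion P T W.
Hypothesis T_gt0 : 0 < T.
Local Notation Ft t := (filtered P W t).
Local Notation mu := (@lebesgue_measure R).
Local Notation int g := (mu.-integrable `[0, T] (fun u => (g u)%:E)).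
Local Notation Int X := (P.-integrable setT (fun w => (X w)%:E)).
Context (be ga : R) (b q x g : Omega -> R -> R).
Hypothesis H : bsde_gap P T W be ga b q x g.
Context (e2 p : R).
Hypothesis e20 : 0 < e2.
Hypothesis p1 : 1 < p.
Local Notation a := (gap_abs T x e2).
Local Notation G := (gap_drift T g).
Hypothesis iA : Int (fun w => a w `^ p).
Hypothesis iG : Int (fun w => G w `^ p).
Let T0 : 0 <= T. Proof. exact: ltW. Qed.
Let p0 : 0 <= p. Proof. exact: le_trans ler01 (ltW p1). Qed.
Let PT : (P setT < +oo)%E. Proof. by rewrite (le_lt_trans (probability_le1 _ _)) ?ltry. Qed.
Let a_gt0 w : 0 < a w. Proof. exact: gap_abs_gt0. Qed.
Let G_ge0 w : 0 <= G w. Proof. by apply: Rintegral_ge0 => u _; exact: (gap_ge0 H). Qed.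
Let TT : 0 <= T <= T. Proof. by rewrite T0 lexx. Qed.
Let T00 : 0 <= (0 : R) <= T. Proof. by rewrite T0 lexx. Qed.

Definition gap_quad w := \int[mu]_(u in `[0, T]) q w u.
Local Notation Q := gap_quad.

Lemma gap_quad_ge0 w : 0 <= Q w.
Proof. by apply: Rintegral_ge0 => u _; exact: (ip_q0 (gap_ito H)). Qed.

Lemma measurable_gap_quad : measurable_fun setT Q.
Proof.
exact: (progressive_integral_measurable P_complete W_bm (ip_q (gap_ito H)) (lexx 0) T0 (lexx T)).
Qed.

Lemma state_abs_le w : smooth_abs e2 (x w T) <= a w.
Proof.
apply: smooth_abs_le => //; rewrite (ger0_norm (path_max_ge0 T_gt0 (gap_ito H) w)).
exact: (path_max_ge T_gt0 (gap_ito H)).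
Qed.

(** The condition on [c] gives the moment of [a] a coefficient at most 1/2 on the right of Doob's
    inequality, so that it can be moved to the left. *)
Lemma gap_sup_bound r qq c : 1 < r -> r <= 2 -> r < p -> qq = p / r -> 0 < c ->
  absorb_const (qq / (qq - 1)) qq * (expR (growth_rate r be ga * T) `^ qq * 2 `^ qq * r `^ qq) * c `^ qq <= 2^-1 ->
  \int[P]_w (a w `^ p) <= 2 * (absorb_const (qq / (qq - 1)) qq * (expR (growth_rate r be ga * T) `^ qq * 2 `^ qq)) *
    (\int[P]_w (smooth_abs e2 (x w T) `^ p) + r `^ qq * c `^ ((1 - r) * qq) * \int[P]_w (G w `^ p)).
Proof.
move=> r1 r2 rp qE c0 hc; have rp' := ltW rp.
have h := gap_doob P_complete W_bm T_gt0 H e20 p1 iA iG r1 r2 rp' qE rp.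
have iL := gap_terminal_powR_integrable P_complete W_bm T_gt0 H e20 p1 iA iG r1 rp' qE rp.
have ix : Int (fun w => smooth_abs e2 (x w T) `^ p).
  have [_ mx] := ip_x (gap_ito H).
  apply: (@integrable_leR _ _ _ P _ _ _ (fun w => a w `^ p)) => //.
    apply: measurable_powRf; apply: measurable_powRf; apply: measurable_addf => //.
    by apply: measurable_exprf; exact: (adapted_measurable P_complete W_bm (lexx T) (mx T TT)).
  move=> w _; rewrite (ger0_norm (powR_ge0 _ _)).
  exact: (ler_powRl p0 (powR_ge0 _ _) (state_abs_le w)).
set C := absorb_const _ _ in h hc *; set k := expR _ `^ qq in hc *.
have C0 : 0 <= C.
  have r0 : 0 < r by exact: lt_trans ltr01 r1.
  have q1 : 1 < qq by rewrite qE ltr_pdivlMr // mul1r.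
  rewrite /C /absorb_const mulr_ge0 ?powR_ge0 // mulr_ge0 // divr_ge0 ?subr_ge0 ?(ltW q1) //.
  exact: le_trans ler01 (ltW q1).
have i1 : Int (fun w => c `^ qq * a w `^ p) := integrableZR measurableT _ iA.
have i2 : Int (fun w => c `^ ((1 - r) * qq) * G w `^ p) := integrableZR measurableT _ iG.
have i3 := integrableDR measurableT i1 i2.
have i4 := integrableZR measurableT (r `^ qq) i3.
have i5 := integrableDR measurableT ix i4.
have i6 := integrableZR measurableT (2 `^ qq) i5.
have i7 := integrableZR measurableT k i6.
have h2 : \int[P]_w (gap_terminal T be ga x g e2 r w `^ qq) <= k * (2 `^ qq * (\int[P]_w (smooth_abs e2 (x w T) `^ p) +
    r `^ qq * (c `^ qq * \int[P]_w (a w `^ p) + c `^ ((1 - r) * qq) * \int[P]_w (G w `^ p)))).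
  rewrite -(RintegralZl _ _ iA) // -(RintegralZl _ _ iG) // -(RintegralD _ i1 i2) //.
  rewrite -(RintegralZl _ _ i3) // -(RintegralD _ ix i4) // -(RintegralZl _ _ i5) // -(RintegralZl _ _ i6) //.
  apply: le_Rintegral => // w _; exact: (gap_terminal_powR H e20 r1 qE rp _ c0).
have A0 : 0 <= \int[P]_w (a w `^ p) by apply: Rintegral_ge0 => w _; exact: powR_ge0.
exact: (sup_absorb C0 A0 hc h h2).
Qed.

(** The first factor inverts the lower bound p (p - 1) / 4 of the gain, the exponential with 1 + p
    bounds the terminal variable, and the last 1 is the second term of [powR_half_split]. *)
Definition energy_small_const := 4 / (p * (p - 1)) * (expR (growth_rate p be ga * T) * (1 + p)) + 1.

Lemma gap_energy_small : p <= 2 -> Int (fun w => Q w `^ (p / 2)) /\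
  \int[P]_w (Q w `^ (p / 2)) <= energy_small_const * (\int[P]_w (a w `^ p) + \int[P]_w (G w `^ p)).
Proof.
move=> p2; have pp := lexx p.
have m1 : @measurable_fun _ _ (Ft 0) R setT (fun _ : Omega => 1 : R) by exact: measurable_cst.
have [i1 h1] := gap_power_le P_complete W_bm T_gt0 H e20 iA iG p1 p2 pp T00 m1 (fun=> ler01) (fun=> lexx 1).
have iL := gap_terminal_integrable P_complete W_bm T_gt0 H e20 iA iG p1 pp.
set L := gap_terminal T be ga x g e2 p in h1 iL.
set B := (fun w : Omega => 1 * (_ + _)) in i1 h1.
have pp0 : 0 < p * (p - 1) by rewrite mulr_gt0 ?subr_gt0 // (lt_trans ltr01).
pose c1 := 4 / (p * (p - 1)); have c10 : 0 <= c1 by rewrite divr_ge0 // ltW.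
have hQ : \forall w \ae P, Q w `^ (p / 2) <= c1 * B w + a w `^ p.
  apply: filterS (ip_path (gap_ito H)) => w D.
  apply: (le_trans (powR_half_split (a_gt0 w) (gap_quad_ge0 w) p1 p2)); rewrite lerD2r.
  have [ib iq q0 mx] := D.
  have ig := gain_integrable ga e20 p1 p2 (gap_be0 H) D (fun u uT => path_max_ge T_gt0 (gap_ito H) w uT).
  have h2 : \int[mu]_(u in `[0, T]) (4^-1 * (p * (p - 1) * a w `^ (p - 2)) * q w u) <= \int[mu]_(u in `[0, T]) gain e2 p be ga q x w u.
    apply: le_Rintegral => //; first exact: integrableZR.
    move=> u; rewrite /= in_itv /= => uT; rewrite /gain.
    have qq := ip_q0 (gap_ito H) w u.
    apply: (@le_trans _ _ (1 * (4^-1 * smooth_pow2 e2 p (x w u) * q w u))).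
      rewrite mul1r ler_wpM2r // ler_wpM2l //; apply: smooth_pow2_lower => //.
      rewrite (ger0_norm (path_max_ge0 T_gt0 (gap_ito H) w)).
      exact: (path_max_ge T_gt0 (gap_ito H)).
    rewrite ler_wpM2r //.
      by rewrite mulr_ge0 // mulr_ge0 //; exact: smooth_pow2_ge0.
    rewrite -[leLHS]expR0 ler_expR mulr_ge0 ?growth_rate_ge0 //; [exact: gap_be0 H|by case/andP: uT].
  rewrite (RintegralZl _ _ iq) // in h2.
  have h3 : \int[mu]_(u in `[0, T]) gain e2 p be ga q x w u <= B w.
    rewrite /B mul1r lerDr mulr_ge0 ?expR_ge0 // ltW //; exact: smooth_pow_gt0.
  have h4 := ler_wpM2l c10 (le_trans h2 h3).
  move: h4; rewrite /c1 -/(Q w); move: (a w `^ _) (B w) (Q w) => y B' Q' h4.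
  rewrite (_ : y * Q' = 4 / (p * (p - 1)) * (4^-1 * (p * (p - 1) * y) * Q')) //.
  by field; have := lt0r_neq0 pp0; rewrite mulf_eq0 negb_or => /andP[-> ->].
have iB : Int (fun w => c1 * B w + a w `^ p).
  by apply: integrableDR => //; exact: integrableZR.
have iQ : Int (fun w => Q w `^ (p / 2)).
  apply: (ae_integrable_le _ _ iB); first by apply: measurable_powRf; exact: measurable_gap_quad.
  by apply: filterS hQ => w; rewrite (ger0_norm (powR_ge0 _ _)).
split => //; apply: (le_trans (ae_le_Rintegral iQ iB hQ)).
have i2 := integrableZR measurableT c1 i1.
rewrite RintegralD // (RintegralZl _ _ i1) //.
have hL : \int[P]_w (1 * L w) <= expR (growth_rate p be ga * T) * (1 + p) * (\int[P]_w (a w `^ p) + \int[P]_w (G w `^ p)).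
  have i3 := integrableDR measurableT iA iG.
  rewrite -(RintegralD _ iA iG) // -(RintegralZl _ _ i3) //.
  apply: (ae_le_Rintegral (integrableZR measurableT 1 iL) (integrableZR measurableT _ i3)).
  apply: aeW => w; rewrite mul1r /L /gap_terminal -mulrA ler_wpM2l ?expR_ge0 // smooth_pow_abs.
  have h5 := ler_powRl p0 (powR_ge0 _ _) (state_abs_le w).
  have h6 := powR_mul_split (q := 1) (ltW p1) ler01 (ltW (a_gt0 w)) (G_ge0 w) (ltr01 : (0 : R) < 1).
  rewrite !powR1 !mul1r !mulr1 powRr1 ?mulr_ge0 ?powR_ge0 // in h6.
  have h7 := ler_wpM2l p0 h6; have h8 := powR_ge0 (G w) p.
  move: h5 h7 h8; move: (_ `^ p) (a w `^ p) (G w `^ p) (_ * G w) => s A' G' y h5 h7 h8.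
  exact: (add_scaled h5 h7 h8).
have hL' := ler_wpM2l c10 (le_trans h1 hL).
have A0 : 0 <= \int[P]_w (G w `^ p) by apply: Rintegral_ge0 => w _; exact: powR_ge0.
rewrite /energy_small_const -/c1.
exact: (energy_small_combine hL' A0).
Qed.

End GapMoments.

Lemma Rintegral_cvg0 d (Om : measurableType d) (R : realType) (P : probability Om R)
    (f : nat -> Om -> R) (B : Om -> R) : (forall n, measurable_fun setT (f n)) ->
  (forall n w, 0 <= f n w) -> (forall n w, f n w <= B w) ->
  P.-integrable setT (fun w => (B w)%:E) -> (forall w, f n w @[n --> \oo] --> 0) ->
  \int[P]_w f n w @[n --> \oo] --> (0 : R).
Proof.
move=> mf f0 fB iB f_0.
have mfe n : measurable_fun setT (fun w => (f n w)%:E) by exact/measurable_EFinP.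
have cf : {ae P, forall w, setT w -> (f n w)%:E @[n --> \oo] --> (fun=> 0%E : \bar R) w}.
  by apply: aeW => w _; apply: cvg_EFin; [apply: nearW|exact: f_0].
have fg : {ae P, forall w n, setT w -> (`|(f n w)%:E| <= (B w)%:E)%E}.
  by apply: aeW => w n _; rewrite lee_fin ger0_norm.
have ml : measurable_fun setT (fun _ : Om => 0%E : \bar R) by [].
have [_ _ h] : [/\ P.-integrable setT (fun _ : Om => 0%E : \bar R), _ & _] := dominated_convergence measurableT mfe ml cf iB fg.
rewrite integral0 in h.
have i n : P.-integrable setT (fun w => (f n w)%:E).
  by apply: (integrable_leR _ (mf n) _ iB) => // w _; rewrite ger0_norm.
have e n : \int[P]_w f n w = fine (\int[P]_w (f n w)%:E)%E by rewrite integral_EFinR.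
by under eq_fun do rewrite e; exact: (fine_cvg h).
Qed.

Lemma add_multiple (R : realType) (s A G k : R) : s <= A -> 0 <= G ->
  s + k * (A + G) <= (1 + k) * (A + G).
Proof. lra. Qed.

Lemma min_increment_le (R : realType) (u v K e : R) : u <= v -> `|v - u| < e ->
  Num.min v K - Num.min u K <= e.
Proof.
by move=> uv; rewrite ger0_norm ?subr_ge0 // /Num.min; case: ifP; case: ifP; lra.
Qed.

Section GapEnergyLarge.
Context (R : realType) (d : measure_display) (Omega : measurableType d)
  (P : probability Omega R).
Hypothesis P_complete : measure_is_complete P.
Context (T : R) (m : nat) (W : Omega -> R -> 'rV[R]_m).
Hypothesis W_bm : brownian_motion P T W.
Hypothesis T_gt0 : 0 < T.
Local Notation Ft t := (filtered P W t).
Local Notation mu := (@lebesgue_measure R).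
Local Notation int g := (mu.-integrable `[0, T] (fun u => (g u)%:E)).
Local Notation Int X := (P.-integrable setT (fun w => (X w)%:E)).
Context (be ga : R) (b q x g : Omega -> R -> R).
Hypothesis H : bsde_gap P T W be ga b q x g.
Context (e2 p : R).
Hypothesis e20 : 0 < e2.
Hypothesis p2 : 2 < p.
Local Notation a := (gap_abs T x e2).
Local Notation G := (gap_drift T g).
Hypothesis iA : Int (fun w => a w `^ p).
Hypothesis iG : Int (fun w => G w `^ p).
Let T0 : 0 <= T. Proof. exact: ltW. Qed.
Let p1 : 1 < p. Proof. by apply: lt_trans p2; rewrite ltr1n. Qed.
Let p0 : 0 <= p. Proof. exact: le_trans ler01 (ltW p1). Qed.
Let two1 : 1 < 2 :> R. Proof. by rewrite ltr1n. Qed.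
Let al1 : 1 < p / 2. Proof. by rewrite ltr_pdivlMr // mul1r. Qed.
Let al0 : 0 <= p / 2. Proof. exact: le_trans ler01 (ltW al1). Qed.
Let PT : (P setT < +oo)%E. Proof. by rewrite (le_lt_trans (probability_le1 _ _)) ?ltry. Qed.
Local Notation Q := (gap_quad T q).
Local Notation L := (gap_terminal T be ga x g e2 2).

(* Off this set the integral of [q] is a junk value, and need not increase. *)
Let ind w : R := (w \in [set w | path_data T w b q x])%:R.
Definition gap_bracket t w := ind w * \int[mu]_(u in `[0, t]) q w u.
Local Notation A := gap_bracket.

Let ind_measurable t : @measurable_fun _ _ (Ft t) R setT ind.
Proof.
have mE : @measurable _ (Ft t) [set w | path_data T w b q x].
  rewrite -[X in measurable X]setCK; apply: measurableC; apply: filtered_negligible.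
  exact: (ip_path (gap_ito H)).
by rewrite (_ : ind = \1_[set w | path_data T w b q x]) //; exact: measurable_indic.
Qed.

Let indP w : ind w = 0 \/ ind w = 1 /\ path_data T w b q x.
Proof.
by rewrite /ind; case: (boolP (w \in _)) => [/set_mem D|_]; [right|left].
Qed.

Let A_adapted t : 0 <= t <= T -> @measurable_fun _ _ (Ft t) R setT (A t).
Proof.
move=> /andP[t0 tT]; apply: measurable_mulf; first exact: ind_measurable.
exact: (progressive_integral (ip_q (gap_ito H)) (lexx 0) t0 tT).
Qed.

Let A_0 w : A 0 w = 0.
Proof. by rewrite /A set_itv1 Rintegral_set1 mulr0. Qed.

Let A_cat s t w : 0 <= s -> s <= t -> t <= T -> A t w - A s w = ind w * \int[mu]_(u in `[s, t]) q w u.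
Proof.
move=> s0 st tT; rewrite /A; have [->|[-> D]] := indP w; first by rewrite !mul0r subrr.
by rewrite !mul1r (Rintegral_cat (pd_q D) (lexx 0) s0 st tT) addrAC subrr add0r.
Qed.

Let A_mono s t w : 0 <= s -> s <= t -> t <= T -> A s w <= A t w.
Proof.
move=> s0 st tT; rewrite -subr_ge0 A_cat // mulr_ge0 ?ler0n //.
by apply: Rintegral_ge0 => u _; exact: (ip_q0 (gap_ito H)).
Qed.

Let A_T : \forall w \ae P, A T w = Q w.
Proof.
by apply: filterS (ip_path (gap_ito H)) => w D; rewrite /A /ind mem_set // mul1r.
Qed.

Let A_continuous w : {within `[0, T], continuous (A^~ w)}.
Proof.
have [e|[e D]] := indP w.
  rewrite (_ : A^~ w = cst 0); first by apply: continuous_subspaceT => ?; exact: cvg_cst.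
  by apply/funext => t; rewrite /A e mul0r.
rewrite (_ : A^~ w = (fun t => \int[mu]_(u in `[0, t]) q w u)).
  exact: (Rintegral_continuous (pd_q D) T0).
by apply/funext => t; rewrite /A e mul1r.
Qed.

Let iL : Int L.
Proof. exact: (gap_terminal_integrable P_complete W_bm T_gt0 H e20 iA iG two1 (ltW p2)). Qed.

(** With r = 2 the gain dominates half of q, hence the factor 2 in front of [L]. This is the bound
    on the future increase that Garsia's inequality needs. *)
Let potential s (z : Omega -> R) Mz : 0 <= s <= T -> @measurable_fun _ _ (Ft s) R setT z ->
  (forall w, 0 <= z w) -> (forall w, z w <= Mz) ->
  Int (fun w => z w * (A T w - A s w)) /\
  \int[P]_w (z w * (A T w - A s w)) <= \int[P]_w (z w * (2 * L w)).
Proof.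
move=> sT mz z0 zM; have /andP[s0 sT'] := sT.
have [i1 h1] := gap_power_le P_complete W_bm T_gt0 H e20 iA iG two1 (lexx 2) (ltW p2) sT mz z0 zM.
set B := (fun w : Omega => z w * (_ + _)) in i1 h1.
have mz' : measurable_fun setT z by exact: (adapted_measurable P_complete W_bm sT').
have mA t : 0 <= t <= T -> measurable_fun setT (A t).
  by move=> tT; apply: (adapted_measurable P_complete W_bm _ (A_adapted tT)); case/andP: tT.
have hB : \forall w \ae P, z w * (A T w - A s w) <= 2 * B w.
  apply: filterS (ip_path (gap_ito H)) => w D.
  rewrite A_cat // /B (mulrCA 2) ler_wpM2l // /ind mem_set // mul1r.
  have iq := integrable_sub (pd_q D) s0 (lexx T).
  have ig := gain_integrable ga e20 two1 (lexx 2) (gap_be0 H) D (fun u uT => path_max_ge T_gt0 (gap_ito H) w uT).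
  have h2 : \int[mu]_(u in `[s, T]) (2^-1 * q w u) <= \int[mu]_(u in `[s, T]) gain e2 2 be ga q x w u.
    apply: le_Rintegral => //; [exact: integrableZR|exact: (integrable_sub ig s0 (lexx T))|].
    move=> u; rewrite /= in_itv /= => /andP[su uT].
    have qq := ip_q0 (gap_ito H) w u.
    (* For r = 2 the power is e2 + u^2, so the bound on the energy carries no negative power of the
       path. *)
    have e1 : smooth_pow2 e2 2 (x w u) = 2.
      rewrite /smooth_pow2 smooth_pow_abs powR_mulrn ?powR_ge0 // -smooth_abs_sqr //.
      rewrite (_ : 2 - 1 = 1); last by ring.
      have := smooth_abs_gt0 e20 (x w u); have : e2 = smooth_abs e2 (x w u) ^+ 2 - x w u ^+ 2.
        by rewrite smooth_abs_sqr // /smooth_sqr addrK.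
      by move: (smooth_abs e2 _) => y -> y0; field; exact: lt0r_neq0.
    rewrite /gain e1 (_ : 4^-1 * 2 = 2^-1); last by field.
    rewrite -[leLHS]mul1r ler_wpM2r ?mulr_ge0 //.
    by rewrite -[leLHS]expR0 ler_expR mulr_ge0 ?growth_rate_ge0 ?(gap_be0 H) // (le_trans s0).
  rewrite (RintegralZl _ _ iq) // in h2.
  have h3 : 0 <= expR (growth_rate 2 be ga * s) * smooth_pow e2 2 (x w s).
    by rewrite mulr_ge0 ?expR_ge0 // ltW //; exact: smooth_pow_gt0.
  by move: h2 h3; move: (Rintegral _ _ _) (Rintegral _ _ _) (_ * smooth_pow _ _ _) => I1 I2 y; lra.
have iB : Int (fun w => 2 * B w) by exact: integrableZR.
have iz : Int (fun w => z w * (A T w - A s w)).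
  apply: (ae_integrable_le _ _ iB).
    apply: measurable_mulf => //; apply: measurable_addf; [|apply: measurable_oppf]; apply: mA => //.
    by rewrite T0 lexx.
  apply: filterS hB => w; rewrite ger0_norm // mulr_ge0 // subr_ge0; exact: A_mono.
split => //; apply: (le_trans (ae_le_Rintegral iz iB hB)).
have izL : Int (fun w => z w * L w).
  by apply: (@integrableMbR _ _ _ P _ _ _ _ Mz) => // w _; rewrite ger0_norm.
have -> : \int[P]_w (z w * (2 * L w)) = 2 * \int[P]_w (z w * L w).
  by rewrite -(RintegralZl _ _ izL) //; apply: eq_Rintegral => w _; rewrite mulrCA.
by rewrite (RintegralZl _ _ i1) // ler_wpM2l.
Qed.

Let iAT : Int (A T).
Proof.
have m1 : @measurable_fun _ _ (Ft 0) R setT (fun _ : Omega => 1 : R) by exact: measurable_cst.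
have T00 : 0 <= (0 : R) <= T by rewrite lexx.
have [h _] := potential T00 m1 (fun=> ler01) (fun=> lexx 1).
by move: h; congr (P.-integrable _ _); apply/funext => w; rewrite mul1r A_0 subr0.
Qed.

Let L0 w : 0 <= 2 * L w.
Proof. by rewrite mulr_ge0 //; exact: (gap_terminal_ge0 H). Qed.

Let iLp : Int (fun w => (2 * L w) `^ (p / 2)).
Proof.
have h := gap_terminal_powR_integrable P_complete W_bm T_gt0 H e20 p1 iA iG two1 (ltW p2) erefl p2.
have := integrableZR measurableT (2 `^ (p / 2)) h; congr (P.-integrable _ _).
apply/funext => w; rewrite powRM //; exact: (gap_terminal_ge0 H).
Qed.

(** Garsia's inequality on finer and finer grids with the level [K] kept fixed: the continuity of
    the bracket makes the mean oscillation vanish, and [moment_absorb] applies because of the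
    truncation. *)
Lemma truncated_bracket K : 0 <= K -> \int[P]_w (Num.min (A T w) K `^ (p / 2)) <=
  absorb_const (p / 2) (p / 2) * \int[P]_w ((2 * L w) `^ (p / 2)).
Proof.
move=> K0.
have mA t : 0 <= t <= T -> measurable_fun setT (A t).
  by move=> tT; apply: (adapted_measurable P_complete W_bm _ (A_adapted tT)); case/andP: tT.
have A_ge0 t w : 0 <= t <= T -> 0 <= A t w by move=> /andP[? ?]; rewrite -(A_0 w) A_mono.
have TT : 0 <= T <= T by rewrite T0 lexx.
have mT : measurable_fun setT (fun w => Num.min (A T w) K) by apply: measurable_minf => //; exact: mA.
have mT0 w : 0 <= Num.min (A T w) K by rewrite le_min K0 A_ge0.
have iml (h : Omega -> R) : Int h -> Int (fun w => Num.min (A T w) K `^ (p / 2 - 1) * h w).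
  move=> ih; apply: (@integrableMbR _ _ _ P _ _ _ _ (K `^ (p / 2 - 1))) => //; first exact: measurable_powRf.
  move=> w _; rewrite ger0_norm ?powR_ge0 //; apply: ler_powRl => //; first by rewrite subr_ge0 ltW.
  by rewrite ge_min lexx orbT.
have i2L : Int (fun w => 2 * L w) by exact: integrableZR.
apply: moment_absorb => //; first by rewrite (lt_trans ltr01).
- apply: (@integrable_boundR _ _ _ P _ _ _ (K `^ (p / 2))) => //; first exact: measurable_powRf.
  move=> w _; rewrite ger0_norm ?powR_ge0 //; apply: ler_powRl => //.
  by rewrite ge_min lexx orbT.
- exact: iml.
pose tau n := grid 0 T n.
have tauT n i : (i <= n.+1)%N -> 0 <= tau n i <= T by move=> hi; exact: grid_itv.
have tauS n i : tau n i <= tau n i.+1 by exact: grid_le.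
pose mm n i w := Num.min (A (tau n i) w) K.
(* The largest step of the truncated bracket, which lies between 0 and [K] and tends to 0 on every
   path by uniform continuity. *)
pose dl n w := \big[Num.max/0]_(i < n.+1) (mm n i.+1 w - mm n i w).
have mdl n : measurable_fun setT (dl n).
  apply: measurable_bigmax => i; apply: measurable_addf; [|apply: measurable_oppf].
    by apply: measurable_minf => //; apply: mA; apply: tauT.
  by apply: measurable_minf => //; apply: mA; apply: tauT; exact: ltnW.
have dl0 n w : 0 <= dl n w by exact: bigmax_ge_id.
have dlK n w : dl n w <= K.
  apply: bigmax_le => // i _; rewrite lerBlDr (@le_trans _ _ K) ?ge_min ?lexx ?orbT //.
  by rewrite lerDl le_min K0 A_ge0 // tauT // ltnW.
have hG n : \int[P]_w (Num.min (A T w) K `^ (p / 2)) <=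
    p / 2 * \int[P]_w (Num.min (A T w) K `^ (p / 2 - 1) * (2 * L w)) + p / 2 * K `^ (p / 2 - 1) * \int[P]_w dl n w.
  have eT : tau n n.+1 = T by rewrite /tau gridS.
  have := @garsia_discrete _ _ _ P (fun i z => @measurable_fun _ _ (Ft (tau n i)) R setT z) n.+1
    (fun i => A (tau n i)) (fun w => 2 * L w) (dl n) K (p / 2) al1 K0; rewrite eT; apply => //.
  - by move=> w; rewrite /tau grid0.
  - move=> i w hi; have /andP[t0 _] := tauT n i (ltnW hi); have /andP[_ tT] := tauT n i.+1 hi.
    exact: A_mono.
  - by move=> i hi; apply: mA; exact: tauT.
  - by move=> i w hi; rewrite /dl (le_bigmax _ (fun i : 'I_n.+1 => mm n i.+1 w - mm n i w) (Ordinal hi)).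
  - move=> i z Mz hi mz mz' z0 zM; exact: (proj2 (potential (tauT n i hi) mz z0 zM)).
  - move=> i hi; have a1 : @measurable_fun _ _ (Ft (tau n i.+1)) R setT (A (tau n i)).
      by apply: (adapted_le (tauS n i)); apply: A_adapted; exact: tauT (ltnW hi).
    have a2 : @measurable_fun _ _ (Ft (tau n i.+1)) R setT (A (tau n i.+1)) by apply: A_adapted; exact: tauT.
    by apply: measurable_addf; [|apply: measurable_oppf]; apply: measurable_powRf; exact: measurable_minf.
have dcvg : \int[P]_w dl n w @[n --> \oo] --> (0 : R).
  apply: (Rintegral_cvg0 (B := fun=> K)) => //; first exact: integrable_cstR.
  move=> w; apply/cvgrPdist_le => e e0.
  have cA : {within `[0, T], continuous (A^~ w)} by exact: A_continuous.
  have [dt dt0 hu] := within_continuous_unif cA e0.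
  have Tdt : 0 < dt / T by rewrite divr_gt0.
  apply: filterS (natSinv_lt Tdt) => n hn; rewrite sub0r normrN ger0_norm //.
  apply: bigmax_le => [|i _]; first exact: ltW.
  have h1 := tauT n i (ltnW (ltn_ord i)); have h2 := tauT n i.+1 (ltn_ord i).
  have hs : `|tau n i.+1 - tau n i| < dt.
    rewrite /tau grid_step subr0 ger0_norm ?divr_ge0 // mulrC -ltr_pdivlMr //.
  have := hu _ _ h2 h1 hs; rewrite /mm; have := A_mono w (proj1 (andP h1)) (tauS n i) (proj2 (andP h2)).
  exact: min_increment_le.
have hc : p / 2 * \int[P]_w (Num.min (A T w) K `^ (p / 2 - 1) * (2 * L w)) + p / 2 * K `^ (p / 2 - 1) * \int[P]_w dl n w
    @[n --> \oo] --> p / 2 * \int[P]_w (Num.min (A T w) K `^ (p / 2 - 1) * (2 * L w)).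
  rewrite -[X in _ --> X]addr0; apply: cvgD; first exact: cvg_cst.
  by rewrite -(mulr0 (p / 2 * K `^ (p / 2 - 1))); exact: cvgMr.
rewrite -(cvg_lim _ hc) //; apply: limr_ge; first exact: cvgP hc.
exact: nearW.
Qed.

(** [absorb_const] is Garsia's constant and the first power of 2 comes from the factor 2 on [L]; the
    rest is [gap_terminal_powR] at r = 2 and c = 1, the terminal value being bounded by the
    maximum. *)
Definition energy_large_const := absorb_const (p / 2) (p / 2) *
  (2 `^ (p / 2) * (expR (growth_rate 2 be ga * T) `^ (p / 2) * (2 `^ (p / 2) * (1 + 2 `^ (p / 2))))).

Lemma gap_energy_large : Int (fun w => Q w `^ (p / 2)) /\
  \int[P]_w (Q w `^ (p / 2)) <= energy_large_const * (\int[P]_w (a w `^ p) + \int[P]_w (G w `^ p)).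
Proof.
pose C := absorb_const (p / 2) (p / 2) * \int[P]_w ((2 * L w) `^ (p / 2)).
have TT : 0 <= T <= T by rewrite T0 lexx.
have mAT : measurable_fun setT (A T) by exact: (adapted_measurable P_complete W_bm (lexx T) (A_adapted TT)).
have mm n : measurable_fun setT (fun w => Num.min (A T w) n%:R `^ (p / 2)).
  by apply: measurable_powRf; exact: measurable_minf.
have A_ge0 w : 0 <= A T w by rewrite -(A_0 w) A_mono.
have [iQ hQ] : Int (fun w => Q w `^ (p / 2)) /\ \int[P]_w (Q w `^ (p / 2)) <= C.
  apply: (@fatou_le _ _ _ P (fun n w => Num.min (A T w) n%:R `^ (p / 2)) (fun n w => Num.min (A T w) n%:R `^ (p / 2)) _ (fun=> C)).
  - exact: mm.
  - by move=> n w; exact: powR_ge0.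
  - move=> n; apply: (@integrable_boundR _ _ _ P _ _ _ (n%:R `^ (p / 2))) => //.
    move=> w _; rewrite ger0_norm ?powR_ge0 //; apply: ler_powRl => //; first by rewrite le_min ler0n A_ge0.
    by rewrite ge_min lexx orbT.
  - by move=> n; apply: aeW => w.
  - by move=> n; exact: truncated_bracket.
  - exact: cvg_cst.
  - by apply: measurable_powRf; exact: (measurable_gap_quad P_complete W_bm T_gt0 H).
  - apply: filterS A_T => w <-; apply: cvg_near_cst.
    near=> n; congr (_ `^ _); apply/min_idPl.
    by near: n; exact: nbhs_infty_ger.
split => //; apply: (le_trans hQ); rewrite /C /energy_large_const -mulrA.
have c0 : 0 <= absorb_const (p / 2) (p / 2).
  by rewrite /absorb_const mulr_ge0 ?powR_ge0 // mulr_ge0.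
rewrite ler_wpM2l // -mulrA.
have i3 := integrableDR measurableT iA iG.
rewrite -(RintegralD _ iA iG) // -!mulrA -(RintegralZl _ _ i3) //.
have i4 := integrableZR measurableT (1 + 2 `^ (p / 2)) i3.
have i5 := integrableZR measurableT (2 `^ (p / 2)) i4.
have i6 := integrableZR measurableT (expR (growth_rate 2 be ga * T) `^ (p / 2)) i5.
have i7 := integrableZR measurableT (2 `^ (p / 2)) i6.
rewrite -(RintegralZl _ _ i4) // -(RintegralZl _ _ i5) // -(RintegralZl _ _ i6) //.
apply: (ae_le_Rintegral iLp i7); apply: aeW => w.
have Lw : 0 <= L w by exact: (gap_terminal_ge0 H).
rewrite powRM // ler_wpM2l ?powR_ge0 //.
have h := gap_terminal_powR H e20 two1 erefl p2 w ltr01.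
apply: (le_trans h); rewrite ler_wpM2l ?powR_ge0 // ler_wpM2l ?powR_ge0 //.
rewrite !powR1 !mul1r.
have h5 : smooth_abs e2 (x w T) `^ p <= a w `^ p := ler_powRl p0 (powR_ge0 _ _) (state_abs_le T_gt0 H e20 w).
exact: (add_multiple _ h5 (powR_ge0 (G w) p)).
Unshelve. all: by end_near.
Qed.

End GapEnergyLarge.

Lemma sum_split (R : realType) (X G k : R) : 0 <= X -> 0 <= G -> 0 <= k -> X + k * G <= (1 + k) * (X + G).
Proof. by move=> X0 G0 k0; have := mulr_ge0 k0 X0; lra. Qed.

Section GapEstimate.
Context (R : realType) (d : measure_display) (Omega : measurableType d)
  (P : probability Omega R).
Hypothesis P_complete : measure_is_complete P.
Context (T : R) (m : nat) (W : Omega -> R -> 'rV[R]_m).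
Hypothesis W_bm : brownian_motion P T W.
Hypothesis T_gt0 : 0 < T.
Local Notation Int X := (P.-integrable setT (fun w => (X w)%:E)).

Lemma doob_exponent (p : R) : 1 < p -> exists r, [/\ 1 < r, r <= 2 & r < p].
Proof.
move=> p1; exists (Num.min 2 ((1 + p) / 2)); rewrite lt_min ge_min lexx gt_min; split => //.
  by rewrite ltr1n /=; lra.
by apply/orP; right; lra.
Qed.

Lemma estimate_combine (C1 E A X G S : R) : 0 <= C1 -> 0 <= X -> 0 <= G ->
  A <= C1 * (X + G) -> S <= E * (A + G) ->
  A <= (C1 + `|E| * (C1 + 1)) * (X + G) /\ (0 <= A -> S <= (C1 + `|E| * (C1 + 1)) * (X + G)).
Proof.
move=> c0 X0 G0 hA hS; have e0 := normr_ge0 E; have ee := ler_norm E.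
have x1 : 0 <= `|E| * (C1 + 1) * (X + G) by rewrite !mulr_ge0 ?addr_ge0.
have x2 : 0 <= C1 * (X + G) by rewrite mulr_ge0 ?addr_ge0.
split=> [|A0]; first by rewrite mulrDl; lra.
have h1 : E * (A + G) <= `|E| * ((C1 + 1) * (X + G)).
  apply: (@le_trans _ _ (`|E| * (A + G))); first by rewrite ler_wpM2r ?addr_ge0.
  by rewrite ler_wpM2l // mulrDl mul1r; lra.
by rewrite mulrDl; move: x2 h1 hS; rewrite -mulrA; lra.
Qed.

(** The exponent [r] and the parameter [c] are fixed before the processes and the regularization, so
    that one constant serves all of them. *)
Lemma gap_estimate (be ga p : R) : 1 < p -> exists2 C, 0 <= C &
  forall (b q x g : Omega -> R -> R) (e2 : R), bsde_gap P T W be ga b q x g -> 0 < e2 ->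
  Int (fun w => gap_abs T x e2 w `^ p) -> Int (fun w => gap_drift T g w `^ p) ->
  let B := C * (\int[P]_w (smooth_abs e2 (x w T) `^ p) + \int[P]_w (gap_drift T g w `^ p)) in
  [/\ \int[P]_w (gap_abs T x e2 w `^ p) <= B, Int (fun w => gap_quad T q w `^ (p / 2)) &
      \int[P]_w (gap_quad T q w `^ (p / 2)) <= B].
Proof.
move=> p1; have [r [r1 r2 rp]] := doob_exponent p1.
have r0 : 0 < r by exact: lt_trans ltr01 r1.
pose qq := p / r; have q1 : 1 < qq by rewrite /qq ltr_pdivlMr // mul1r.
have q0 : 0 < qq by exact: lt_trans ltr01 q1.
pose D := absorb_const (qq / (qq - 1)) qq.
have q10 : 0 < qq / (qq - 1) by rewrite divr_gt0 ?subr_gt0.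
have D0 : 0 <= D by rewrite /D /absorb_const mulr_ge0 ?powR_ge0 // mulr_ge0 // ltW.
pose k := expR (growth_rate r be ga * T) `^ qq.
have k0 : 0 <= k by exact: powR_ge0.
have c0 : 0 <= D * (k * 2 `^ qq * r `^ qq) by apply: mulr_ge0 => //; do 2 (apply: mulr_ge0; last exact: powR_ge0).
have [c cp hc] := powR_absorb_const q0 c0.
pose rc := r `^ qq * c `^ ((1 - r) * qq); have rc0 : 0 <= rc by rewrite mulr_ge0 ?powR_ge0.
pose B1 := 2 * (D * (k * 2 `^ qq)); have B10 : 0 <= B1 by apply: mulr_ge0 => //; apply: mulr_ge0 => //; apply: mulr_ge0 => //; exact: powR_ge0.
pose C1 := B1 * (1 + rc); have C10 : 0 <= C1 by rewrite mulr_ge0 ?addr_ge0.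
pose E := if p <= 2 then energy_small_const T be ga p else energy_large_const T be ga p.
exists (C1 + `|E| * (C1 + 1)); first by rewrite addr_ge0 // mulr_ge0 // addr_ge0.
move=> b q x g e2 H e20 iA iG /=.
pose X := \int[P]_w (smooth_abs e2 (x w T) `^ p); pose G := \int[P]_w (gap_drift T g w `^ p).
have X0 : 0 <= X by apply: Rintegral_ge0 => w _; exact: powR_ge0.
have G0 : 0 <= G by apply: Rintegral_ge0 => w _; exact: powR_ge0.
have A0 : 0 <= \int[P]_w (gap_abs T x e2 w `^ p) by apply: Rintegral_ge0 => w _; exact: powR_ge0.
have hA : \int[P]_w (gap_abs T x e2 w `^ p) <= C1 * (X + G).
  have h := gap_sup_bound P_complete W_bm T_gt0 H e20 p1 iA iG r1 r2 rp erefl cp hc.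
  have e : C1 * (X + G) = B1 * ((1 + rc) * (X + G)) by rewrite /C1 mulrA.
  by rewrite e; exact: (le_trans h (ler_wpM2l B10 (sum_split X0 G0 rc0))).
have [iQ hQ] : Int (fun w => gap_quad T q w `^ (p / 2)) /\
    \int[P]_w (gap_quad T q w `^ (p / 2)) <= E * (\int[P]_w (gap_abs T x e2 w `^ p) + G).
  rewrite /E; case: (leP p 2) => p2.
    exact: (gap_energy_small P_complete W_bm T_gt0 H e20 p1 iA iG p2).
  exact: (gap_energy_large P_complete W_bm T_gt0 H e20 p2 iA iG).
have [h1 h2] := estimate_combine C10 X0 G0 hA hQ.
split; [exact: h1|exact: iQ|exact: (h2 A0)].
Qed.

End GapEstimate.

(** * Differences of solutions *)

Lemma onesided_algebra (R : realType) (s a1 a2 c1 c2 d1 d2 u b1 b2 g1 g2 v e : R) : `|s| <= 1 ->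
  s * (a1 - c1) <= b1 * u -> s * (a2 - c2) <= b2 * u ->
  `|c1 - d1| <= g1 * v -> `|c2 - d2| <= g2 * v ->
  0 <= u -> - (s * (e - (a1 + a2))) <= (`|b1| + `|b2|) * u + (g1 + g2) * v + `|d1 + d2 - e|.
Proof.
move=> s1 m1 m2 l1 l2 u0.
have hs (y : R) : s * y <= `|y|.
  by rewrite (le_trans (ler_norm _)) // normrM ler_piMl.
have e1 := hs (c1 - d1); have e2 := hs (c2 - d2); have e3 := hs (d1 + d2 - e).
have n1 := ler_wpM2r u0 (ler_norm b1); have n2 := ler_wpM2r u0 (ler_norm b2).
have -> : - (s * (e - (a1 + a2))) = s * (a1 - c1) + s * (a2 - c2) + s * (c1 - d1) + s * (c2 - d2) + s * (d1 + d2 - e) by ring.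
rewrite !mulrDl; move: (s * _) (s * _) (s * _) (s * _) (s * _) (`|b1| * u) (`|b2| * u) m1 m2 e1 e2 e3 n1 n2 => *.
lra.
Qed.

Lemma reduction_algebra (R : realType) (x x' i1 i2 j1 j2 J J' Jt Jt' J0 J0' : R) :
  x + i2 - (J - Jt) - (x' + j2 - (J' - Jt')) =
  x + (i1 + i2) - (J - J0) - (x' + (j1 + j2) - (J' - J0')) + (j1 - i1) + (Jt - Jt') - (J0 - J0').
Proof. ring. Qed.

Section Reduction.
Context (R : realType) (d : measure_display) (Omega : measurableType d)
  (P : probability Omega R).
Hypothesis P_complete : measure_is_complete P.
Context (T : R) (m : nat) (W : Omega -> R -> 'rV[R]_m).
Hypothesis W_bm : brownian_motion P T W.
Hypothesis T_gt0 : 0 < T.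
Local Notation Ft t := (filtered P W t).
Local Notation mu := (@lebesgue_measure R).
Local Notation int g := (mu.-integrable `[0, T] (fun u => (g u)%:E)).
Context (p beta1 beta2 gamma1 gamma2 : R) (phi f : R -> R) (alpha : Omega -> R -> R)
  (F F1 F2 F' : generator_type R Omega m) (xi xi' : Omega -> R).
Hypothesis FB : assumption_B P T W p beta1 beta2 gamma1 gamma2 phi f alpha F F1 F2 xi.
Hypothesis gF' : is_generator P T W F'.
Context (Y Y' : Omega -> R -> R) (Z Z' : Omega -> R -> 'rV[R]_m).
Hypothesis sol : bsde_solution P T W F xi Y Z.
Hypothesis sol' : bsde_solution P T W F' xi' Y' Z'.
Definition generator_gap w u := `|F w u (Y' w u) (Z' w u) - F' w u (Y' w u) (Z' w u)|.
Definition drift_gap w u := F' w u (Y' w u) (Z' w u) - F w u (Y w u) (Z w u).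
Definition state_gap w u := Y w u - Y' w u.
Hypothesis gap_finite : \forall w \ae P,
  (\int[mu]_(s in `[0%R, T]) (generator_gap w s)%:E < +oo)%E.
Let T0 : 0 <= T. Proof. exact: ltW. Qed.

Let pY : progressive P T W Y.
Proof. by have [cY _ _ _ _] := sol; exact: continuous_adapted_progressive. Qed.

Let pY' : progressive P T W Y'.
Proof. by have [cY _ _ _ _] := sol'; exact: continuous_adapted_progressive. Qed.

Let pF : progressive P T W (fun w u => F w u (Y w u) (Z w u)).
Proof. by have [_ mZ _ _ _] := sol; exact: generator_progressive (B_generator FB) pY mZ. Qed.

Let pF' : progressive P T W (fun w u => F' w u (Y' w u) (Z' w u)).
Proof. by have [_ mZ _ _ _] := sol'; exact: generator_progressive gF' pY' mZ. Qed.

Let pb : progressive P T W drift_gap.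
Proof. by apply: progressiveD => //; exact: progressiveN. Qed.

Lemma generator_gap_progressive : progressive P T W generator_gap.
Proof.
have pG : progressive P T W (fun w u => F w u (Y' w u) (Z' w u) - F' w u (Y' w u) (Z' w u)).
  apply: progressiveD; last exact: progressiveN.
  by have [_ mZ _ _ _] := sol'; exact: generator_progressive (B_generator FB) pY' mZ.
apply: (progressive_comp (f := fun y => `|y|) _ pG); exact: measurable_normf.
Qed.

Let path_int (h : Omega -> R -> R) w : progressive P T W h ->
  (\int[mu]_(s in `[0%R, T]) `|h w s|%:E < +oo)%E -> int (h w).
Proof.
move=> ph hf; apply/integrableP; split => //; apply/measurable_EFinP.
exact: (progressive_path_measurable P_complete W_bm T0 w ph).
Qed.

Let iF : \forall w \ae P, int (fun u => F w u (Y w u) (Z w u)).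
Proof. by have [_ _ _ h _] := sol; apply: filterS h => w; exact: (path_int pF). Qed.

Let iF' : \forall w \ae P, int (fun u => F' w u (Y' w u) (Z' w u)).
Proof. by have [_ _ _ h _] := sol'; apply: filterS h => w; exact: (path_int pF'). Qed.

Let ib : \forall w \ae P, int (drift_gap w).
Proof. by apply: filterS2 iF iF' => w i1 i2; exact: integrableBR. Qed.

Lemma state_gap_adapted : continuous_adapted P T W state_gap.
Proof.
have [[cY mY] _ _ _ _] := sol; have [[cY' mY'] _ _ _ _] := sol'.
split=> [w|t tT]; first exact: within_continuousB.
by apply: measurable_addf; [exact: mY|apply: measurable_oppf; exact: mY'].
Qed.

Lemma generator_gap_integrable : \forall w \ae P, int (generator_gap w).
Proof.
apply: filterS gap_finite => w h; apply: path_int; first exact: generator_gap_progressive.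
by apply: le_lt_trans h; rewrite le_eqVlt; apply/orP; left; apply/eqP; apply: eq_integral => u _; rewrite normr_id.
Qed.

(** From (Y, Z) to (Y', Z') first y is changed at fixed Z, then z at fixed Y'; what is left is the
    difference of the generators at (Y', Z'). The absolute values cover negative [beta1] and
    [beta2]. *)
Lemma state_gap_onesided : \forall w \ae P, forall u, 0 <= u <= T ->
  - (Num.sg (state_gap w u) * drift_gap w u) <=
  (`|beta1| + `|beta2|) * `|state_gap w u| + (gamma1 + gamma2) * Num.sqrt (energy_density Z Z' w u) + generator_gap w u.
Proof.
apply: ae_impl4 (B_monotone FB) (B_lipschitz FB) (B_onesided FB) (B_convex FB) _ => w hm hl ho hc u uT.
have [h1 h2] := convex_onesided (B_gamma2 FB) (hc u uT) (B_f FB) (fun y z => ho u y z uT).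
have l1 := hl u (Y' w u) (Z w u) (Z' w u) uT.
have l2 : `|F2 w u (Y' w u) (Z w u) - F2 w u (Y' w u) (Z' w u)| <= gamma2 * euclid (Z w u - Z' w u).
  rewrite ler_norml h2 andbT lerNl opprB (le_trans (h2 _ _ _)) //.
  by rewrite -(euclidN (Z' w u - Z w u)) opprB.
have m1 := hm u (Y w u) (Y' w u) (Z w u) uT.
have m2 : Num.sg (Y w u - Y' w u) * (F2 w u (Y w u) (Z w u) - F2 w u (Y' w u) (Z w u)) <= beta2 * `|Y w u - Y' w u|.
  case: (ltrgtP (Y w u) (Y' w u)) => hy.
  - rewrite ltr0_sg ?subr_lt0 // mulN1r opprB; exact: h1.
  - rewrite gtr0_sg ?subr_gt0 // mul1r; exact: h1.
  - by rewrite hy !subrr !mulr0.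
rewrite /energy_density sqrtr_sqr (ger0_norm (euclid_ge0 _)) /drift_gap /generator_gap /state_gap.
have s1 : `|Num.sg (Y w u - Y' w u)| <= 1 by rewrite normr_sg; case: (_ != 0).
rewrite !(B_decomposition FB) //.
exact: (onesided_algebra _ s1 m1 m2 l1 l2 (normr_ge0 _)).
Qed.

Lemma state_gap_ito : ito_process P T W drift_gap (energy_density Z Z') state_gap.
Proof.
have [_ mZ eZ _ [J iJ hY]] := sol; have [_ mZ' eZ' _ [J' iJ' hY']] := sol'.
(* The backward equations at t and at 0 are subtracted, which gives the forward form with initial
   value at time 0. *)
have xE : \forall w \ae P, forall t, 0 <= t <= T -> state_gap w t =
    state_gap w 0 + \int[mu]_(u in `[0, t]) drift_gap w u + (J w t - J' w t) - (J w 0 - J' w 0).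
  apply: ae_impl4 iF iF' hY hY' _ => w i1 i2 h h' t tT; have /andP[t0 t1] := tT.
  have T00 : 0 <= (0 : R) <= T by rewrite lexx.
  rewrite /state_gap (h t tT) (h' t tT) (h 0 T00) (h' 0 T00).
  rewrite (Rintegral_cat i1 (lexx 0) t0 t1 (lexx T)) (Rintegral_cat i2 (lexx 0) t0 t1 (lexx T)).
  rewrite /drift_gap RintegralB //; [|exact: (integrable_sub i2 (lexx 0) t1)|exact: (integrable_sub i1 (lexx 0) t1)].
  exact: reduction_algebra.
have xc := state_gap_adapted.
split.
- exact: pb.
- exact: energy_density_progressive.
- by move=> w u; exact: sqr_ge0.
- exact: xc.
- exact: (energy_density_path P_complete W_bm T_gt0 ib xc mZ mZ' eZ eZ').
- move=> lam th l0 th0.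
  exact: (energy_density_budget P_complete W_bm T_gt0 pb ib xc mZ mZ' eZ eZ' iJ iJ' xE (smooth_bounded_one R) l0 th0).
- move=> lam th f0 f1 f2 L s t l0 th0 fS s0 st tT.
  exact: (ito_error_measurable_limit P_complete W_bm T_gt0 pb ib xc mZ mZ' eZ eZ' iJ iJ' xE fS l0 th0 s0 st tT).
- move=> lam th f0 f1 f2 L s t l0 th0 fS s0 st tT.
  exact: (ito_null_limit P_complete W_bm T_gt0 pb ib xc mZ mZ' eZ eZ' iJ iJ' xE fS l0 th0 s0 st tT).
Qed.

Lemma solution_gap : bsde_gap P T W (`|beta1| + `|beta2|) (gamma1 + gamma2) drift_gap
  (energy_density Z Z') state_gap generator_gap.
Proof.
split.
- by rewrite addr_ge0.
- by rewrite addr_ge0 ?(B_gamma1 FB) ?(B_gamma2 FB).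
- exact: state_gap_ito.
- exact: generator_gap_progressive.
- exact: generator_gap_integrable.
- by move=> w u; exact: normr_ge0.
- exact: state_gap_onesided.
Qed.

Lemma state_gap_terminal : \forall w \ae P, state_gap w T = xi w - xi' w.
Proof.
have [_ _ _ _ [J iJ hY]] := sol; have [_ _ _ _ [J' iJ' hY']] := sol'.
have TT : 0 <= T <= T by rewrite T0 lexx.
apply: filterS2 hY hY' => w h h'; rewrite /state_gap h // h' // set_itv1 !Rintegral_set1 !subrr !subr0 !addr0 //.
Qed.

End Reduction.

(** * Extended moments and the stability estimate *)

Section Moments.
Context (R : realType) (d : measure_display) (Omega : measurableType d)
  (P : probability Omega R).
Hypothesis P_complete : measure_is_complete P.
Local Notation Int X := (P.-integrable setT (fun w => (X w)%:E)).

(** The statement deals with extended moments, the estimates with real integrals; completeness makes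
    [V] measurable, so that the two can be identified. *)
Lemma moment_ae_EFin p (V : Omega -> \bar R) (X : Omega -> R) : measurable_fun setT X ->
  (\forall w \ae P, V w = (X w)%:E) -> moment P p V = (\int[P]_w (X w `^ p)%:E)%E.
Proof.
move=> mX VX.
have mXe : measurable_fun setT (fun w => (X w)%:E) by exact/measurable_EFinP.
have mV := ae_eq_measurable P_complete mXe VX.
apply: ge0_ae_eq_integral => //.
- exact: (measurableT_comp (measurable_poweR p)).
- by apply/measurable_EFinP; exact: measurable_powRf.
- by move=> w _; exact: poweR_ge0.
- by move=> w _; rewrite lee_fin powR_ge0.
- by apply: filterS VX => w -> _; rewrite poweR_EFin.
Qed.

Lemma moment_finite_integrable p (V : Omega -> \bar R) (X : Omega -> R) : measurable_fun setT X ->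
  (\forall w \ae P, V w = (X w)%:E) -> (moment P p V < +oo)%E ->
  Int (fun w => X w `^ p) /\ moment P p V = (\int[P]_w (X w `^ p))%:E.
Proof.
move=> mX VX; rewrite (moment_ae_EFin p mX VX) => fin.
have iX : Int (fun w => X w `^ p).
  apply/integrableP; split; first by apply/measurable_EFinP; exact: measurable_powRf.
  by under eq_integral do rewrite /= ger0_norm ?powR_ge0 //.
by rewrite integral_EFinR.
Qed.

Lemma moment_finite_ae p (V : Omega -> \bar R) : 0 < p -> measurable_fun setT V ->
  (forall w, (0 <= V w)%E) -> (moment P p V < +oo)%E -> \forall w \ae P, (V w < +oo)%E.
Proof.
move=> p0 mV V0 fin.
have iV : P.-integrable setT (fun w => (V w `^ p)%E).
  apply/integrableP; split; first exact: (measurableT_comp (measurable_poweR p)).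
  by apply: le_lt_trans fin; rewrite le_eqVlt; apply/orP; left; apply/eqP; apply: eq_integral => w _; rewrite gee0_abs ?poweR_ge0.
apply: filterS (integrable_ae measurableT iV) => w /(_ I).
by case: (V w) (V0 w) => // [r _ _|_]; [rewrite ltry|rewrite poweRyr ?lt0r_neq0].
Qed.

End Moments.

Lemma smooth_abs_powR_le (R : realType) (e2 p u : R) : 0 < e2 -> 0 <= p ->
  smooth_abs e2 u `^ p <= 2 `^ (p / 2) * (e2 `^ (p / 2) + `|u| `^ p).
Proof.
move=> e20 p0; rewrite /smooth_abs -powRrM (_ : 2^-1 * p = p / 2); last by rewrite mulrC.
apply: (le_trans (powRD_le _ _ _)); rewrite ?divr_ge0 ?sqr_ge0 ?(ltW e20) //.
rewrite -(real_normK (num_real u)) -powR_mulrn // -powRrM.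
by rewrite (_ : 2%:R * (p / 2) = p) // mulrCA divff ?mulr1.
Qed.

Lemma bound_combine (R : realType) (C k X G S e3 e : R) : 0 <= C -> 1 <= k -> 0 <= G ->
  S <= k * (e3 + X) -> C * k * e3 <= e -> C * (S + G) <= C * k * (X + G) + e.
Proof.
move=> C0 k1 G0 hS he; have h1 := ler_wpM2l C0 hS.
have h2 : C * G <= C * k * G by rewrite -mulrA ler_wpM2l // ler_peMl.
by move: h1 h2 he; rewrite !mulrDr !mulrA; lra.
Qed.

Section StabilityBound.
Context (R : realType) (d : measure_display) (Omega : measurableType d)
  (P : probability Omega R).
Hypothesis P_complete : measure_is_complete P.
Context (T : R) (m : nat) (W : Omega -> R -> 'rV[R]_m).
Hypothesis W_bm : brownian_motion P T W.
Hypothesis T_gt0 : 0 < T.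
Local Notation mu := (@lebesgue_measure R).
Local Notation Int X := (P.-integrable setT (fun w => (X w)%:E)).
Let T0 : 0 <= T. Proof. exact: ltW. Qed.
Let PT : (P setT < +oo)%E. Proof. by rewrite (le_lt_trans (probability_le1 _ _)) ?ltry. Qed.

Lemma sup_moment_integrable p (Y : Omega -> R -> R) : in_Sp P T W p Y ->
  [/\ measurable_fun setT (path_max T Y), (forall w, sup_path T Y w = (path_max T Y w)%:E) &
      Int (fun w => path_max T Y w `^ p)].
Proof.
move=> [[cY mY] fin].
have mY' t : 0 <= t <= T -> measurable_fun setT (fun w => Y w t).
  by move=> tT; apply: (adapted_measurable P_complete W_bm _ (mY t tT)); case/andP: tT.
have [mM eM] := sup_path_measurable T_gt0 cY mY'.
split => //; have VX : \forall w \ae P, sup_path T Y w = (path_max T Y w)%:E by apply: aeW.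
exact: (proj1 (moment_finite_integrable P_complete mM VX fin)).
Qed.

(** The quantifiers matter: the constant precedes the generators, the terminal values and the
    solutions, so it is uniform along a sequence sharing [beta1], [beta2], [gamma1] and [gamma2]. *)
Lemma stability_bound (p beta1 beta2 gamma1 gamma2 : R) : 1 < p -> exists2 C : R, 0 <= C &
  forall (phi f : R -> R) (alpha : Omega -> R -> R) (F F1 F2 F' : generator_type R Omega m)
    (xi xi' : Omega -> R) (Y Y' : Omega -> R -> R) (Z Z' : Omega -> R -> 'rV[R]_m),
  assumption_B P T W p beta1 beta2 gamma1 gamma2 phi f alpha F F1 F2 xi ->
  is_generator P T W F' -> bsde_solution P T W F xi Y Z -> bsde_solution P T W F' xi' Y' Z' ->
  in_Sp P T W p Y -> in_Sp P T W p Y' ->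
  let Mx := moment P p (fun w => `|xi w - xi' w|%:E) in
  let Mg := moment P p (fun w => \int[mu]_(s in `[0%R, T]) (generator_gap F F' Y' Z' w s)%:E)%E in
  (Mx < +oo)%E -> (Mg < +oo)%E ->
  (moment P p (sup_path T (fun w t => (Y w t - Y' w t)%R)) <= C%:E * (Mx + Mg))%E /\
  (moment P (p / 2) (energy T (fun w s => (Z w s - Z' w s)%R)) <= C%:E * (Mx + Mg))%E.
Proof.
move=> p1; have p0 : 0 < p by exact: lt_trans ltr01 p1.
have [C C0 hC] := gap_estimate P_complete W_bm T_gt0 (`|beta1| + `|beta2|) (gamma1 + gamma2) p1.
pose k : R := 2 `^ (p / 2); have k1 : 1 <= k by rewrite /k -[leLHS](powRr0 2) ler_powR ?ler1n // divr_ge0 // ltW.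
exists (C * k) => [|phi f alpha F F1 F2 F' xi xi' Y Y' Z Z' FB gF' sol sol' YS YS' Mx Mg fx fg].
  by rewrite mulr_ge0 // (le_trans ler01).
have pg := generator_gap_progressive FB gF' sol'.
have gfin : \forall w \ae P, (\int[mu]_(s in `[0%R, T]) (generator_gap F F' Y' Z' w s)%:E < +oo)%E.
  apply: (moment_finite_ae p0 _ _ fg).
    have mj := progressive_joint P_complete W_bm T0 pg.
    exact: (measurable_ge0_param_integral mj (fun w s _ => normr_ge0 _)).
  by move=> w; apply: integral_ge0 => u _; rewrite lee_fin; exact: normr_ge0.
have H := solution_gap P_complete W_bm T_gt0 FB gF' sol sol' gfin.
set x := state_gap Y Y' in H *; set q := energy_density Z Z' in H *; set g := generator_gap F F' Y' Z' in H pg gfin *.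
have xS : continuous_adapted P T W x := ip_x (gap_ito H).
have [cx mx] := xS.
have mx' t : 0 <= t <= T -> measurable_fun setT (fun w => x w t).
  by move=> tT; apply: (adapted_measurable P_complete W_bm _ (mx t tT)); case/andP: tT.
have TT : 0 <= T <= T by rewrite T0 lexx.
have [mM eM] := sup_path_measurable T_gt0 cx mx'.
have [m1 e1 i1] := sup_moment_integrable YS; have [m2 e2' i2] := sup_moment_integrable YS'.
have MD w : path_max T x w <= path_max T Y w + path_max T Y' w.
  have [t0 t0T [e _]] := sup_path_attained T_gt0 (cx w); rewrite /path_max e /= (le_trans (ler_normB _ _)) // lerD //.
    by rewrite -lee_fin -/(path_max T Y w) -e1; apply: ereal_sup_ubound; exists t0 => //=; rewrite in_itv.
  by rewrite -lee_fin -/(path_max T Y' w) -e2'; apply: ereal_sup_ubound; exists t0 => //=; rewrite in_itv.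
have M0 w : 0 <= path_max T x w by exact: (path_max_ge0 T_gt0 (gap_ito H)).
(* Membership of both solutions in S^p enters here; it makes finite the moment that the a priori
   estimate absorbs. *)
have iM : Int (fun w => path_max T x w `^ p).
  have i12 := integrableZR measurableT (2 `^ p) (integrableDR measurableT i1 i2).
  apply: (integrable_leR _ _ _ i12) => //; first exact: measurable_powRf.
  move=> w _; rewrite (ger0_norm (powR_ge0 _ _)).
  have a1 : 0 <= path_max T Y w by have [t0 _ [e _]] := sup_path_attained T_gt0 ((proj1 (proj1 YS)) w); rewrite /path_max e.
  have a2 : 0 <= path_max T Y' w by have [t0 _ [e _]] := sup_path_attained T_gt0 ((proj1 (proj1 YS')) w); rewrite /path_max e.
  apply: (le_trans (ler_powRl (ltW p0) (M0 w) (MD w))); exact: (powRD_le (ltW p0) a1 a2).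
have [iX eX] : Int (fun w => `|x w T| `^ p) /\ Mx = (\int[P]_w (`|x w T| `^ p))%:E.
  apply: (moment_finite_integrable P_complete _ _ fx); first by apply: measurable_normf; exact: mx'.
  by apply: filterS (state_gap_terminal T_gt0 sol sol') => w e; rewrite /x e.
have [iG eG] : Int (fun w => gap_drift T g w `^ p) /\ Mg = (\int[P]_w (gap_drift T g w `^ p))%:E.
  apply: (moment_finite_integrable P_complete _ _ fg).
    exact: (measurable_gap_drift P_complete W_bm T_gt0 H).
  by apply: filterS (gap_int H) => w iw; rewrite integral_EFinR.
have VM : \forall w \ae P, sup_path T (fun w t => Y w t - Y' w t) w = (path_max T x w)%:E by apply: aeW.
have VQ : \forall w \ae P, energy T (fun w s => Z w s - Z' w s) w = (gap_quad T q w)%:E.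
  by apply: filterS (ip_path (gap_ito H)) => w D; rewrite /energy (integral_EFinR _ (pd_q D)).
have mQ := measurable_gap_quad P_complete W_bm T_gt0 H.
rewrite (moment_ae_EFin P_complete _ mM VM) (moment_ae_EFin P_complete _ mQ VQ) eX eG.
rewrite (integral_EFinR measurableT iM) -EFinD -EFinM.
set X := \int[P]_w (`|x w T| `^ p); set G := \int[P]_w (gap_drift T g w `^ p).
have G0 : 0 <= G by apply: Rintegral_ge0 => w _; exact: powR_ge0.
have X0 : 0 <= X by apply: Rintegral_ge0 => w _; exact: powR_ge0.
have key e : 0 < e -> [/\ \int[P]_w (path_max T x w `^ p) <= C * k * (X + G) + e, Int (fun w => gap_quad T q w `^ (p / 2)) &
    \int[P]_w (gap_quad T q w `^ (p / 2)) <= C * k * (X + G) + e].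
  move=> e0; pose ck := C * k; have ck0 : 0 <= ck by rewrite mulr_ge0 // (le_trans ler01).
  (* The regularization contributes C k e3, at most e; [e2] is the value whose power p / 2 is
     [e3]. *)
  pose e3 := e / (ck + 1); have e30 : 0 < e3 by rewrite divr_gt0 // ltr_wpDl.
  pose e2 := e3 `^ (2 / p); have e20 : 0 < e2 by exact: powR_gt0.
  have e23 : e2 `^ (p / 2) = e3.
    by rewrite /e2 -powRrM (_ : 2 / p * (p / 2) = 1) ?powRr1 ?ltW //; field; exact: lt0r_neq0.
  have iA : Int (fun w => gap_abs T x e2 w `^ p).
    have i3 := integrableZR measurableT k (integrableDR measurableT (integrable_cstR measurableT (e2 `^ (p / 2)) PT) iM).
    apply: (integrable_leR _ _ _ i3) => //.
      apply: measurable_powRf; exact: (measurable_gap_abs P_complete W_bm T_gt0 H).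
    move=> w _; rewrite (ger0_norm (powR_ge0 _ _)).
    have := smooth_abs_powR_le (path_max T x w) e20 (ltW p0); by rewrite (ger0_norm (M0 w)).
  have [h1 iQ h2] := hC _ _ _ _ _ H e20 iA iG.
  have hX : \int[P]_w (smooth_abs e2 (x w T) `^ p) <= k * (e3 + X).
    have ie := integrable_cstR (mu := P) measurableT e3 PT.
    have i4 := integrableDR measurableT ie iX.
    have i5 := integrableZR measurableT k i4.
    have hp w : smooth_abs e2 (x w T) `^ p <= k * (e3 + `|x w T| `^ p).
      by have := smooth_abs_powR_le (x w T) e20 (ltW p0); rewrite e23.
    have iS : Int (fun w => smooth_abs e2 (x w T) `^ p).
      apply: (integrable_leR _ _ _ i5) => //; last by move=> w _; rewrite (ger0_norm (powR_ge0 _ _)).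
      apply: measurable_powRf; apply: measurable_powRf; apply: measurable_addf => //.
      by apply: measurable_exprf; exact: mx'.
    have e4 : \int[P]_w (k * (e3 + `|x w T| `^ p)) = k * (e3 + X).
      have PT1 : P setT = 1%E := probability_setT P.
      have c3 : \int[P]_w e3 = e3 by rewrite Rintegral_cst //; change (e3 * fine (P setT) = e3); rewrite PT1 mulr1.
      by rewrite (RintegralZl _ _ i4) // (RintegralD _ ie iX) // c3.
    rewrite -e4; apply: (ae_le_Rintegral iS i5); exact: aeW.
  have hM : \int[P]_w (path_max T x w `^ p) <= \int[P]_w (gap_abs T x e2 w `^ p).
    apply: (ae_le_Rintegral iM iA); apply: aeW => w; apply: (ler_powRl (ltW p0) (M0 w)).
    by have := normr_le_smooth_abs e20 (path_max T x w); rewrite (ger0_norm (M0 w)).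
  have hB : C * (\int[P]_w (smooth_abs e2 (x w T) `^ p) + G) <= C * k * (X + G) + e.
    apply: (bound_combine C0 k1 G0 hX); rewrite -/ck /e3 mulrCA ler_piMr ?(ltW e0) //.
    by rewrite ler_pdivrMr ?mul1r ?lerDl // ltr_wpDl.
  by split; [exact: le_trans hM (le_trans h1 hB)|exact: iQ|exact: le_trans h2 hB].
have [_ iQ _] := key 1 ltr01.
rewrite (integral_EFinR measurableT iQ) !lee_fin.
by split; apply/ler_addgt0Pr => e e0; have [h1 _ h2] := key e e0; [exact: h1|exact: h2].
Qed.

End StabilityBound.

Theorem proposition11 (R : realType) (d : measure_display)
  (Omega : measurableType d) (P : probability Omega R)
  (P_complete : measure_is_complete P)
  (T : R) (T_gt0 : 0 < T)
  (m : nat) (W : Omega -> R -> 'rV[R]_m) (W_bm : brownian_motion P T W)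
  (p : R) (p_gt1 : 1 < p)
  (beta1 beta2 gamma1 gamma2 : R) (phi f : R -> R)
  (alpha : nat -> Omega -> R -> R)
  (F F1 F2 : nat -> generator_type R Omega m)
  (xi : nat -> Omega -> R)
  (FB : forall n, assumption_B P T W p beta1 beta2 gamma1 gamma2 phi f
                    (alpha n) (F n) (F1 n) (F2 n) (xi n))
  (Y : nat -> Omega -> R -> R) (Z : nat -> Omega -> R -> 'rV[R]_m)
  (YZ_solution : forall n, bsde_solution P T W (F n) (xi n) (Y n) (Z n))
  (Y_Sp : forall n, in_Sp P T W p (Y n))
  (Z_Mp : forall n, in_Mp P T W p (Z n))
  (xi_cvg : moment P p (fun w => `|xi n w - xi 0%N w|%:E)
              @[n --> \oo] --> 0%E)
  (F_cvg : moment P p (fun w =>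
              \int[@lebesgue_measure R]_(s in `[0%R, T])
                `|F n w s (Y 0%N w s) (Z 0%N w s)
                  - F 0%N w s (Y 0%N w s) (Z 0%N w s)|%:E)%E
              @[n --> \oo] --> 0%E) :
  moment P p (sup_path T (fun w t => Y n w t - Y 0%N w t))
    @[n --> \oo] --> 0%E /\
  moment P (p / 2) (energy T (fun w s => Z n w s - Z 0%N w s))
    @[n --> \oo] --> 0%E.
Proof.
have [C C0 hC] := stability_bound P_complete W_bm T_gt0 beta1 beta2 gamma1 gamma2 p_gt1.
pose Mx n := moment P p (fun w => `|xi n w - xi 0%N w|%:E).
pose Mg n := moment P p (fun w => \int[@lebesgue_measure R]_(s in `[0%R, T])
  (generator_gap (F n) (F 0%N) (Y 0%N) (Z 0%N) w s)%:E)%E.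
have bound_cvg : (C%:E * (Mx n + Mg n))%E @[n --> \oo] --> 0%E.
  rewrite -(mule0 C%:E); apply: cvgeZl => //.
  by rewrite -[X in _ --> X]adde0; apply: cvgeD.
(* The moments of the data may be infinite for finitely many n; [stability_bound] is applied to the
   others. *)
have small (u : nat -> \bar R) : u n @[n --> \oo] --> 0%E -> \forall n \near \oo, (u n < +oo)%E.
  by move=> /fine_cvgP[h _]; apply: filterS h => n; rewrite fin_numElt => /andP[].
have near_bound : \forall n \near \oo,
    (moment P p (sup_path T (fun w t => (Y n w t - Y 0%N w t)%R)) <= C%:E * (Mx n + Mg n))%E /\
    (moment P (p / 2) (energy T (fun w s => (Z n w s - Z 0%N w s)%R)) <= C%:E * (Mx n + Mg n))%E.
  apply: filterS2 (small _ xi_cvg) (small _ F_cvg) => n fx fg.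
  exact: (hC _ _ _ _ _ _ _ _ _ _ _ _ _ (FB n) (B_generator (FB 0%N)) (YZ_solution n) (YZ_solution 0%N) (Y_Sp n) (Y_Sp 0%N)).
have moment_ge0 k (X : Omega -> \bar R) : (0 <= moment P k X)%E.
  by apply: integral_ge0 => w _; exact: poweR_ge0.
split; apply: (squeeze_cvge (f := fun=> 0%E) _ (cvg_cst _) bound_cvg).
- by apply: filterS near_bound => n [h _]; rewrite moment_ge0.
- by apply: filterS near_bound => n [_ h]; rewrite moment_ge0.
Qed.
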